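(* Let $K$ be an arbitrary field, let $C$ be a symmetrizable generalized Cartan matrix of Dynkin type, let $D$ be any symmetrizer of $C$, let $\Pi=\Pi(C,D)$ be the associated generalized preprojective algebra over $K$, and let $W=W(C)$ be the Weyl group of $C$. Then the following two maps are well defined and bijective: $$W\longrightarrow \mathsf{s}\tau^-\text{-}\mathsf{tilt}\,\Pi,\quad w\longmapsto \Pi/I_w,\qquad\qquad W\longrightarrow \mathsf{torf}\,\Pi,\quad w\longmapsto \mathsf{Sub}(\Pi/I_w).$$ Here $\mathsf{s}\tau^-\text{-}\mathsf{tilt}\,\Pi$ is the set of isomorphism classes of basic support $\tau^-$-tilting $\Pi$-modules and $\mathsf{torf}\,\Pi$ is the set of torsion-free classes in $\mathsf{rep}\,\Pi$.
   Context: Modules are left modules unless stated otherwise; $\mathsf{rep}\,\Lambda$ is the category of finite dimensional left $\Lambda$-modules. A generalized Cartan matrix (GCM) is $C=(c_{ij})\in M_n(\mathbb Z)$ with $c_{ii}=2$, $c_{ij}\le 0$ for $i\ne j$, and $c_{ij}\neq 0$ iff $c_{ji}\ne 0$. It is symmetrizable if there is a diagonal matrix $D=\mathrm{diag}(c_1,\dots,c_n)$ with integers $c_i\ge 1$ such that $DC$ is symmetric; such $D$ is called a symmetrizer. $C$ is of Dynkin type if the form $q_C=\sum_i c_iX_i^2-\sum_{i<j}c_i|c_{ij}|X_iX_j$ is positive definite. For $c_{ij}<0$ put $g_{ij}=\gcd(|c_{ij}|,|c_{ji}|)$ and $f_{ij}=|c_{ij}|/g_{ij}$. An orientation of $C$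 is a set $\Omega\subset\{1,\dots,n\}^2$ such that $\{(i,j),(j,i)\}\cap\Omega\ne\emptyset$ iff $c_{ij}<0$, and every sequence $((i_1,i_2),(i_2,i_3),\dots,(i_t,i_{t+1}))$, $t\ge1$, of elements of $\Omega$ satisfies $i_1\neq i_{t+1}$. Put $\Omega^*=\{(j,i)\mid (i,j)\in\Omega\}$, $\overline\Omega=\Omega\cup\Omega^*$, and $\mathrm{sgn}(i,j)=1$ if $(i,j)\in\Omega$, $-1$ if $(i,j)\in\Omega^*$. The generalized preprojective algebra $\Pi=\Pi(C,D)$ is $K\overline Q/\overline I$, where $\overline Q$ has vertex set $Q_0=\{1,\dots,n\}$, arrows $\alpha_{ij}^{(g)}:j\to i$ for $(i,j)\in\overline\Omega$, $1\le g\le g_{ij}$, and loops $\varepsilon_i:i\to i$; paths are composed from right to left; and $\overline I$ is generated by the relations: (P1) $\varepsilon_i^{c_i}=0$ for all $i$; (P2) $\varepsilon_i^{f_{ji}}\alpha_{ij}^{(g)}=\alpha_{ij}^{(g)}\varepsilon_j^{f_{ij}}$ for $(i,j)\in\overline\Omega$, $1\le g\le g_{ij}$; (P3) for each $i$, $\sum_{j:(j,i)\in\overline\Omega}\sum_{g=1}^{g_{ij}}\sum_{f=0}^{f_{ji}-1}\mathrm{sgn}(i,j)\,\varepsilon_i^f\alpha_{ij}^{(g)}\alpha_{ji}^{(g)}\varepsilon_i^{f_{ji}-1-f}=0$. Up to isomorphism it is independent of $\Omega$. In Dynkin type $\Pi$ is finite dimensional. Let $e_i$ be the primitive idempotent at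 vertex $i$. $W(C)$ is the Weyl group of the Kac-Moody Lie algebra of $C$, with simple reflections $s_1,\dots,s_n$. Put $I_i=\Pi(1-e_i)\Pi$, and for $w\in W(C)$ put $I_w=I_{i_1}I_{i_2}\cdots I_{i_k}$ for a reduced expression $w=s_{i_1}\cdots s_{i_k}$ (with $I_e=\Pi$); this is known to be independent of the reduced expression. For a finite dimensional algebra $\Lambda$, with inverse Auslander-Reiten translation $\tau^-$ and $|M|$ the number of non-isomorphic indecomposable direct summands of $M$: $M\in\mathsf{rep}\,\Lambda$ is $\tau^-$-rigid if $\mathrm{Hom}_\Lambda(\tau^-M,M)=0$; $\tau^-$-tilting if moreover $|M|=|\Lambda|$; support $\tau^-$-tilting if there is an idempotent $e\in\Lambda$ such that $M$ is a $\tau^-$-tilting $\Lambda/\langle e\rangle$-module, where $\langle e\rangle$ is the two-sided ideal generated by $e$. Basic means multiplicity free. A torsion-free class in $\mathsf{rep}\,\Lambda$ is a full subcategory closed under extensions and submodules. $\mathsf{Sub}\,M$ is the full subcategory of $\mathsf{rep}\,\Lambda$ of submodules of finite direct sums of copies of $M$. *)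

(* Defs.v *)
From HB Require Import structures.
From mathcomp Require Import all_boot all_algebra.
From mathcomp Require Import finmap monalg.
From mathcomp Require Import boolp classical_sets functions.

Set Implicit Arguments.
Unset Strict Implicit.
Unset Printing Implicit Defensive.

Import GRing.Theory.
Local Open Scope ring_scope.

(* K-algebras.  MathComp's algType requires 1 != 0, whereas A/<e> is the zero   *)
(* algebra when e = 1; so a K-algebra is here a possibly zero ring with a       *)
(* central ring morphism from K.                                                *)

HB.mixin Record isPzAlgebra (K : pzRingType) A of GRing.PzRing A := {
  pzscal : K -> A;
  pzscal_zmod : zmod_morphism pzscal;
  pzscal_monoid : monoid_morphism pzscal;
  pzscal_central : forall k (x : A), pzscal k * x = x * pzscal k }.

#[short(type="pzAlgType")]
HB.structure Definition PzAlgebra (K : pzRingType) :=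
  {A of isPzAlgebra K A & GRing.PzRing A}.

HB.instance Definition _ (K : pzRingType) (A : pzAlgType K) :=
  GRing.isZmodMorphism.Build K A pzscal pzscal_zmod.
HB.instance Definition _ (K : pzRingType) (A : pzAlgType K) :=
  GRing.isMonoidMorphism.Build K A pzscal pzscal_monoid.

Section ConverseAlgebra.
Variables (K : comPzRingType) (A : pzAlgType K).

Let scalc (k : K) : A^c := (pzscal k : A).

Fact scalc_zmod : zmod_morphism scalc.
Proof. exact: pzscal_zmod. Qed.

Fact scalc_monoid : monoid_morphism scalc.
Proof.
split=> [|k l]; first exact: (@pzscal_monoid K A).1.
by rewrite mulrC; exact: (@pzscal_monoid K A).2.
Qed.

Fact scalc_central k (x : A^c) : scalc k * x = x * scalc k.
Proof. exact/esym/(@pzscal_central K A). Qed.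

HB.instance Definition _ :=
  isPzAlgebra.Build K (A^c)%type scalc_zmod scalc_monoid scalc_central.
End ConverseAlgebra.

Record submodule (R : pzRingType) (V : lmodType R) := Submodule {
  submod_pred :> {pred V};
  submod_predP : submod_closed submod_pred }.

HB.instance Definition _ (R : pzRingType) (V : lmodType R) (S : submodule V) :=
  GRing.isZmodClosed.Build V (submod_pred S)
    (GRing.submod_closedB (submod_predP S)).

Section QuotientModule.
Variables (R : pzRingType) (V : lmodType R) (S : submodule V).

Definition quot_mod : Type := Quotient.quot (submod_pred S).
HB.instance Definition _ := GRing.Zmodule.on quot_mod.

Definition mod_proj (x : V) : quot_mod :=
  \pi_(Quotient.quot (submod_pred S))%qT x.

Lemma mod_proj_eq x y : (mod_proj x == mod_proj y) = (x - y \in S).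
Proof. by rewrite /mod_proj -Quotient.idealrBE. Qed.

Fact mod_proj_zmod : zmod_morphism mod_proj.
Proof. by move=> x y; rewrite /mod_proj raddfB. Qed.
HB.instance Definition _ :=
  GRing.isZmodMorphism.Build V quot_mod mod_proj mod_proj_zmod.

Definition mod_repr (u : quot_mod) : V :=
  @repr _ (Quotient.quot (submod_pred S)) u.

Lemma mod_reprK : cancel mod_repr mod_proj.
Proof. by move=> u; rewrite /mod_proj reprK. Qed.

Definition quot_scale (a : R) (u : quot_mod) := mod_proj (a *: mod_repr u).

Lemma quot_scaleE a x : quot_scale a (mod_proj x) = mod_proj (a *: x).
Proof.
apply/eqP; rewrite mod_proj_eq -scalerBr.
have [S0 SZ] := submod_predP S; rewrite -[_ *: _]addr0 SZ //.
by rewrite -mod_proj_eq mod_reprK.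
Qed.

Fact quot_scaleA a b u : quot_scale a (quot_scale b u) = quot_scale (a * b) u.
Proof. by rewrite -(mod_reprK u) !quot_scaleE scalerA. Qed.
Fact quot_scale1 : left_id 1 quot_scale.
Proof. by move=> u; rewrite -(mod_reprK u) quot_scaleE scale1r. Qed.
Fact quot_scaleDr : right_distributive quot_scale +%R.
Proof.
move=> a u v; rewrite -(mod_reprK u) -(mod_reprK v) !quot_scaleE.
by rewrite -(raddfD mod_proj) quot_scaleE scalerDr raddfD.
Qed.
Fact quot_scaleDl u : {morph quot_scale^~ u : a b / a + b}.
Proof.
by move=> a b /=; rewrite -(mod_reprK u) !quot_scaleE -raddfD scalerDl.
Qed.

HB.instance Definition _ := GRing.Zmodule_isLmodule.Build R quot_mod
  quot_scaleA quot_scale1 quot_scaleDr quot_scaleDl.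
End QuotientModule.

Record ideal (R : pzRingType) := Ideal {
  ideal_pred :> {pred R};
  ideal_zmod : zmod_closed ideal_pred;
  ideal_mull : forall a x, x \in ideal_pred -> a * x \in ideal_pred;
  ideal_mulr : forall a x, x \in ideal_pred -> x * a \in ideal_pred }.

HB.instance Definition _ (R : pzRingType) (I : ideal R) :=
  GRing.isZmodClosed.Build R (ideal_pred I) (ideal_zmod I).

Section GeneratedIdeal.
Variables (R : pzRingType) (X : set R).

Definition gen_pred : {pred R} := fun x => `[< exists t : seq (R * R * R),
  (forall p, p \in t -> X p.1.2) /\ x = \sum_(p <- t) p.1.1 * p.1.2 * p.2 >].

Fact gen_zmod : zmod_closed gen_pred.
Proof.
split=> [|x y]; first by apply/asboolP; exists [::]; rewrite big_nil.
move=> /asboolP[t [tX ->]] /asboolP[u [uX ->]]; apply/asboolP.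
exists (t ++ [seq (- p.1.1, p.1.2, p.2) | p <- u]); split=> [p|].
  by rewrite mem_cat => /orP[/tX//|/mapP[q /uX qX ->]].
rewrite big_cat big_map /= -sumrN; congr (_ + _).
by apply: eq_bigr => p _; rewrite !mulNr.
Qed.

Fact gen_mull a x : x \in gen_pred -> a * x \in gen_pred.
Proof.
move=> /asboolP[t [tX ->]]; apply/asboolP.
exists [seq (a * p.1.1, p.1.2, p.2) | p <- t]; split=> [p|].
  by move=> /mapP[q /tX qX ->].
by rewrite big_map mulr_sumr; apply: eq_bigr => p _; rewrite !mulrA.
Qed.

Fact gen_mulr a x : x \in gen_pred -> x * a \in gen_pred.
Proof.
move=> /asboolP[t [tX ->]]; apply/asboolP.
exists [seq (p.1.1, p.1.2, p.2 * a) | p <- t]; split=> [p|].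
  by move=> /mapP[q /tX qX ->].
by rewrite big_map mulr_suml; apply: eq_bigr => p _; rewrite !mulrA.
Qed.

Definition gen_ideal : ideal R := Ideal gen_zmod gen_mull gen_mulr.
End GeneratedIdeal.

Section IdealProduct.
Variables (R : pzRingType) (I J : ideal R).

Definition prod_pred : {pred R} := fun x => `[< exists t : seq (R * R),
  (forall p, p \in t -> p.1 \in I /\ p.2 \in J) /\
  x = \sum_(p <- t) p.1 * p.2 >].

Fact prod_zmod : zmod_closed prod_pred.
Proof.
split=> [|x y]; first by apply/asboolP; exists [::]; rewrite big_nil.
move=> /asboolP[t [tIJ ->]] /asboolP[u [uIJ ->]]; apply/asboolP.
exists (t ++ [seq (- p.1, p.2) | p <- u]); split=> [p|].
  rewrite mem_cat => /orP[/tIJ//|/mapP[q /uIJ[qI qJ] ->]].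
  by rewrite /= rpredN.
rewrite big_cat big_map /= -sumrN; congr (_ + _).
by apply: eq_bigr => p _; rewrite !mulNr.
Qed.

Fact prod_mull a x : x \in prod_pred -> a * x \in prod_pred.
Proof.
move=> /asboolP[t [tIJ ->]]; apply/asboolP.
exists [seq (a * p.1, p.2) | p <- t]; split=> [p|].
  by move=> /mapP[q /tIJ[qI qJ] ->]; rewrite /= ideal_mull.
by rewrite big_map mulr_sumr; apply: eq_bigr => p _; rewrite !mulrA.
Qed.

Fact prod_mulr a x : x \in prod_pred -> x * a \in prod_pred.
Proof.
move=> /asboolP[t [tIJ ->]]; apply/asboolP.
exists [seq (p.1, p.2 * a) | p <- t]; split=> [p|].
  by move=> /mapP[q /tIJ[qI qJ] ->]; rewrite /= ideal_mulr.
by rewrite big_map mulr_suml; apply: eq_bigr => p _; rewrite !mulrA.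
Qed.

Definition ideal_mul : ideal R := Ideal prod_zmod prod_mull prod_mulr.
End IdealProduct.

Section TrivialIdeals.
Variable R : pzRingType.

Fact predT_zmod : zmod_closed (predT : {pred R}). Proof. by []. Qed.

Definition unit_ideal : ideal R :=
  Ideal predT_zmod (fun _ _ _ => isT) (fun _ _ _ => isT).

Variable I : ideal R.

Fact ideal_submod : submod_closed (ideal_pred I : {pred R^o}).
Proof.
split=> [|a x y xI yI]; first exact: rpred0.
by apply: (@rpredD _ (ideal_pred I)) => //; apply: ideal_mull.
Qed.

Definition lsubmod_of_ideal : submodule (R^o)%type := Submodule ideal_submod.
End TrivialIdeals.

Section QuotientRing.
Variables (R : pzRingType) (I : ideal R).

Definition quot_alg : Type := Quotient.quot (ideal_pred I).
HB.instance Definition _ := GRing.Zmodule.on quot_alg.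

Definition alg_proj (x : R) : quot_alg :=
  \pi_(Quotient.quot (ideal_pred I))%qT x.

Lemma alg_proj_eq x y : (alg_proj x == alg_proj y) = (x - y \in I).
Proof. by rewrite /alg_proj -Quotient.idealrBE. Qed.

Fact alg_proj_zmod : zmod_morphism alg_proj.
Proof. by move=> x y; rewrite /alg_proj raddfB. Qed.
HB.instance Definition _ :=
  GRing.isZmodMorphism.Build R quot_alg alg_proj alg_proj_zmod.

Definition alg_repr (u : quot_alg) : R :=
  @repr _ (Quotient.quot (ideal_pred I)) u.

Lemma alg_reprK : cancel alg_repr alg_proj.
Proof. by move=> u; rewrite /alg_proj reprK. Qed.

Definition quot_mul (u v : quot_alg) := alg_proj (alg_repr u * alg_repr v).

Lemma quot_mulE x y : quot_mul (alg_proj x) (alg_proj y) = alg_proj (x * y).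
Proof.
apply/eqP; rewrite alg_proj_eq.
set x' := alg_repr _; set y' := alg_repr _.
have -> : x' * y' - x * y = (x' - x) * y' + x * (y' - y).
  by rewrite mulrBl mulrBr addrA subrK.
apply: rpredD; [apply: ideal_mulr | apply: ideal_mull];
  by rewrite -alg_proj_eq alg_reprK.
Qed.

Fact quot_mulA : associative quot_mul.
Proof.
move=> u v w; rewrite -(alg_reprK u) -(alg_reprK v) -(alg_reprK w).
by rewrite !quot_mulE mulrA.
Qed.
Fact quot_mul1l : left_id (alg_proj 1) quot_mul.
Proof. by move=> u; rewrite -(alg_reprK u) quot_mulE mul1r. Qed.
Fact quot_mul1r : right_id (alg_proj 1) quot_mul.
Proof. by move=> u; rewrite -(alg_reprK u) quot_mulE mulr1. Qed.
Fact quot_mulDl : left_distributive quot_mul +%R.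
Proof.
move=> u v w; rewrite -(alg_reprK u) -(alg_reprK v) -(alg_reprK w).
by rewrite -raddfD !quot_mulE -raddfD mulrDl.
Qed.
Fact quot_mulDr : right_distributive quot_mul +%R.
Proof.
move=> u v w; rewrite -(alg_reprK u) -(alg_reprK v) -(alg_reprK w).
by rewrite -raddfD !quot_mulE -raddfD mulrDr.
Qed.

HB.instance Definition _ := GRing.Zmodule_isPzRing.Build quot_alg
  quot_mulA quot_mul1l quot_mul1r quot_mulDl quot_mulDr.

Fact alg_proj_monoid : monoid_morphism alg_proj.
Proof. by split=> // x y; rewrite -quot_mulE. Qed.
HB.instance Definition _ :=
  GRing.isMonoidMorphism.Build R quot_alg alg_proj alg_proj_monoid.
End QuotientRing.

Section QuotientAlgebra.
Variables (K : pzRingType) (A : pzAlgType K) (I : ideal A).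

Let scalq (k : K) : quot_alg I := alg_proj I (pzscal k).

Fact scalq_zmod : zmod_morphism scalq.
Proof. by move=> k l; rewrite /scalq !raddfB. Qed.
Fact scalq_monoid : monoid_morphism scalq.
Proof. by split=> [|k l]; rewrite /scalq ?rmorph1 ?rmorphM. Qed.
Fact scalq_central k (u : quot_alg I) : scalq k * u = u * scalq k.
Proof. by rewrite -(alg_reprK u) -!rmorphM pzscal_central. Qed.

HB.instance Definition _ :=
  isPzAlgebra.Build K (quot_alg I) scalq_zmod scalq_monoid scalq_central.
End QuotientAlgebra.

Record quiver := Quiver {
  vertex : finType;
  arrow : choiceType;
  asource : arrow -> vertex;
  atarget : arrow -> vertex }.

Section PathAlgebra.
Variable Q : quiver.
Implicit Types (i : vertex Q) (s t : seq (arrow Q)).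

(* The path a_1 a_2 ... a_l, composed from right to left (a_l comes first), is  *)
(* encoded as (i, [:: a_1; ...; a_l]) where i is its target; it is the trivial  *)
(* path at i if l = 0.                                                          *)
Fixpoint composable i s : bool :=
  if s is a :: s' then (atarget a == i) && composable (asource a) s' else true.

Definition seq_source i s : vertex Q := last i [seq asource a | a <- s].

Record qpath := QPath {
  path_val : vertex Q * seq (arrow Q);
  path_valP : composable path_val.1 path_val.2 }.

HB.instance Definition _ := [isSub for path_val].
HB.instance Definition _ := [Choice of qpath by <:].

Definition ptarget (p : qpath) : vertex Q := (path_val p).1.
Definition parrows (p : qpath) : seq (arrow Q) := (path_val p).2.
Definition psource (p : qpath) : vertex Q := seq_source (ptarget p) (parrows p).

Definition trivial_path i : qpath := @QPath (i, [::]) isT.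

Fact arrow_path_subproof (a : arrow Q) : composable (atarget a) [:: a].
Proof. by rewrite /= eqxx. Qed.
Definition arrow_path (a : arrow Q) : qpath :=
  @QPath (atarget a, [:: a]) (arrow_path_subproof a).

(* [None] stands for the zero product of non-composable paths *)
Definition path_comp (p q : qpath) : option qpath :=
  if psource p == ptarget q then insub (ptarget p, parrows p ++ parrows q)
  else None.

Lemma composable_cat i s t :
  composable i (s ++ t) = composable i s && composable (seq_source i s) t.
Proof. by elim: s i => [|a s IHs] i //=; rewrite IHs andbA. Qed.

Lemma seq_source_cat i s t :
  seq_source i (s ++ t) = seq_source (seq_source i s) t.
Proof. by rewrite /seq_source map_cat last_cat. Qed.

Variant path_comp_spec (p q : qpath) : option qpath -> Prop :=
| PathComp r of psource p = ptarget q & ptarget r = ptarget p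
    & psource r = psource q & parrows r = parrows p ++ parrows q :
    path_comp_spec p q (Some r)
| PathNoComp of psource p != ptarget q : path_comp_spec p q None.

Lemma path_compP p q : path_comp_spec p q (path_comp p q).
Proof.
rewrite /path_comp; case: eqVneq => [pq|]; last by constructor.
have v : composable (ptarget p) (parrows p ++ parrows q).
  by rewrite composable_cat (path_valP p) -/(psource p) pq (path_valP q).
rewrite (@insubT _ _ qpath (ptarget p, parrows p ++ parrows q) v).
by constructor=> //; rewrite {1}/psource seq_source_cat -/(psource p) pq.
Qed.

Lemma qpath_eq (p q : qpath) :
  ptarget p = ptarget q -> parrows p = parrows q -> p = q.
Proof.
case: p q => [[i s] sP] [[j t] tP]; rewrite /ptarget /parrows /= => ij st.
by apply: val_inj; rewrite /= ij st.
Qed.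

Lemma path_compA p q r :
  obind (path_comp p) (path_comp q r) =
  obind (fun x => path_comp x r) (path_comp p q).
Proof.
case: path_compP => [qr q_r tqr sqr aqr|q_r]; case: path_compP => //=.
- move=> pq p_q tpq spq apq; case: path_compP => [x _ tx _ ax|].
    case: path_compP => [y _ ty _ ay|]; last by rewrite spq q_r eqxx.
    congr Some; apply: qpath_eq; first by rewrite tx ty.
    by rewrite ax ay aqr apq catA.
  by rewrite tqr p_q eqxx.
- move=> p_q; case: path_compP => // x; rewrite tqr => p_q'.
  by rewrite p_q' eqxx in p_q.
- move=> pq _ _ spq _; case: path_compP => // x; rewrite spq => q_r'.
  by rewrite q_r' eqxx in q_r.
Qed.

Lemma path_comp1p i p :
  path_comp (trivial_path i) p = if i == ptarget p then Some p else None.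
Proof.
case: path_compP => [r|]; last by move/negbTE=> /= ->.
move=> /= ip tr _ ar; rewrite -ip eqxx; congr Some; apply: qpath_eq => //.
by rewrite tr.
Qed.

Lemma path_compp1 i p :
  path_comp p (trivial_path i) = if psource p == i then Some p else None.
Proof.
case: path_compP => [r|]; last by move/negbTE=> /= ->.
move=> /= -> tr _ ar; rewrite eqxx; congr Some; apply: qpath_eq => //.
by rewrite ar cats0.
Qed.

Variable K : fieldType.

Definition pathalg : Type := {malg K[qpath]}.
HB.instance Definition _ := GRing.Lmodule.on pathalg.

Definition pathb (p : qpath) : pathalg := << p >>.
Definition opathb (o : option qpath) : pathalg := oapp pathb 0 o.

Definition pathalg_one : pathalg := \sum_(i : vertex Q) pathb (trivial_path i).
Definition pathalg_mul (x y : pathalg) : pathalg :=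
  \sum_(p <- msupp x) \sum_(q <- msupp y)
    (x@_p * y@_q) *: opathb (path_comp p q).

Lemma pathalg_sum (x : pathalg) (d : {fset qpath}) : (msupp x `<=` d)%fset ->
  x = \sum_(p <- d) x@_p *: pathb p.
Proof.
move=> /monalgEw {1}->; apply: eq_bigr => p _.
apply/malgP=> q; rewrite mcoeffZ !mcoeffU.
by case: eqP => _; rewrite ?mulr1 ?mulr0.
Qed.

Lemma pathalg_mulw (x y : pathalg) (d e : {fset qpath}) :
  (msupp x `<=` d)%fset -> (msupp y `<=` e)%fset ->
  pathalg_mul x y = \sum_(p <- d) \sum_(q <- e)
    (x@_p * y@_q) *: opathb (path_comp p q).
Proof.
move=> xd ye; rewrite /pathalg_mul (big_fset_incl _ xd) /=.
  apply: eq_bigr => p _; apply: big_fset_incl => // q _ /mcoeff_outdom ->.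
  by rewrite mulr0 scale0r.
move=> p _ /mcoeff_outdom x0; rewrite big1 // => q _.
by rewrite x0 mul0r scale0r.
Qed.

Fact pathalg_mulDl : left_distributive pathalg_mul +%R.
Proof.
move=> x y z; set d := (msupp x `|` msupp y)%fset.
have xd : (msupp x `<=` d)%fset by apply: fsubsetUl.
have yd : (msupp y `<=` d)%fset by apply: fsubsetUr.
have le_z := fsubset_refl (msupp z).
rewrite (pathalg_mulw (msuppD_le x y) le_z) (pathalg_mulw xd le_z).
rewrite (pathalg_mulw yd le_z) -big_split; apply: eq_bigr => p _ /=.
rewrite -big_split; apply: eq_bigr => q _ /=.
by rewrite mcoeffD mulrDl scalerDl.
Qed.

Fact pathalg_mulDr : right_distributive pathalg_mul +%R.
Proof.
move=> x y z; set d := (msupp y `|` msupp z)%fset.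
have yd : (msupp y `<=` d)%fset by apply: fsubsetUl.
have zd : (msupp z `<=` d)%fset by apply: fsubsetUr.
have le_x := fsubset_refl (msupp x).
rewrite (pathalg_mulw le_x (msuppD_le y z)) (pathalg_mulw le_x yd).
rewrite (pathalg_mulw le_x zd) -big_split; apply: eq_bigr => p _ /=.
rewrite -big_split; apply: eq_bigr => q _ /=.
by rewrite mcoeffD mulrDr scalerDl.
Qed.

Fact pathalg_mulZl k x y : pathalg_mul (k *: x) y = k *: pathalg_mul x y.
Proof.
rewrite (pathalg_mulw (msuppZ_le k x) (fsubset_refl (msupp y))) scaler_sumr.
apply: eq_bigr => p _; rewrite scaler_sumr; apply: eq_bigr => q _.
by rewrite mcoeffZ scalerA mulrA.
Qed.

Fact pathalg_mulZr k x y : pathalg_mul x (k *: y) = k *: pathalg_mul x y.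
Proof.
rewrite (pathalg_mulw (fsubset_refl (msupp x)) (msuppZ_le k y)) scaler_sumr.
apply: eq_bigr => p _; rewrite scaler_sumr; apply: eq_bigr => q _.
by rewrite mcoeffZ scalerA mulrCA.
Qed.

Fact pathalg_mul0l x : pathalg_mul 0 x = 0.
Proof. by rewrite /pathalg_mul msupp0 big_seq_fset0. Qed.
Fact pathalg_mul0r x : pathalg_mul x 0 = 0.
Proof.
by rewrite /pathalg_mul big1 // => p _; rewrite msupp0 big_seq_fset0.
Qed.

Lemma pathalg_mul_suml I (r : seq I) (F : I -> pathalg) x :
  pathalg_mul (\sum_(i <- r) F i) x = \sum_(i <- r) pathalg_mul (F i) x.
Proof.
elim: r => [|i r IHr]; first by rewrite !big_nil pathalg_mul0l.
by rewrite !big_cons pathalg_mulDl IHr.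
Qed.

Lemma pathalg_mul_sumr I (r : seq I) (F : I -> pathalg) x :
  pathalg_mul x (\sum_(i <- r) F i) = \sum_(i <- r) pathalg_mul x (F i).
Proof.
elim: r => [|i r IHr]; first by rewrite !big_nil pathalg_mul0r.
by rewrite !big_cons pathalg_mulDr IHr.
Qed.

Lemma pathalg_mulbb p q :
  pathalg_mul (pathb p) (pathb q) = opathb (path_comp p q).
Proof.
rewrite (pathalg_mulw (msuppU_le) (msuppU_le)) !big_seq_fset1 !mcoeffUU.
by rewrite mulr1 scale1r.
Qed.

Lemma pathalg_ind (P : pathalg -> Prop) :
    P 0 -> (forall x y, P x -> P y -> P (x + y)) ->
    (forall k p, P (k *: pathb p)) -> forall x, P x.
Proof.
move=> P0 PD Pb x; rewrite (pathalg_sum (fsubset_refl (msupp x))).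
by apply: (big_ind P) => // p _; apply: Pb.
Qed.

Fact pathalg_mulA : associative pathalg_mul.
Proof.
move=> x y z; elim/pathalg_ind: x => [|x x' IHx IHx'|k p].
- by rewrite !pathalg_mul0l.
- by rewrite !pathalg_mulDl IHx IHx'.
rewrite !pathalg_mulZl; congr (_ *: _).
elim/pathalg_ind: y => [|y y' IHy IHy'|l q].
- by rewrite !(pathalg_mul0l, pathalg_mul0r).
- by rewrite !(pathalg_mulDl, pathalg_mulDr) IHy IHy'.
rewrite !(pathalg_mulZl, pathalg_mulZr); congr (_ *: _).
elim/pathalg_ind: z => [|z z' IHz IHz'|m r].
- by rewrite !pathalg_mul0r.
- by rewrite !pathalg_mulDr IHz IHz'.
rewrite !pathalg_mulZr; congr (_ *: _); rewrite !pathalg_mulbb.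
have := path_compA p q r.
case: (path_comp q r) => [qr|]; case: (path_comp p q) => [pq|] /=;
  rewrite ?pathalg_mulbb ?pathalg_mul0l ?pathalg_mul0r.
- by move=> ->.
- by move=> ->.
- by move=> <-.
- by [].
Qed.

Fact pathalg_mul1l : left_id pathalg_one pathalg_mul.
Proof.
elim/pathalg_ind => [|x y IHx IHy|k p]; first by rewrite pathalg_mul0r.
  by rewrite pathalg_mulDr IHx IHy.
rewrite pathalg_mulZr pathalg_mul_suml; congr (_ *: _).
rewrite (bigD1_seq (ptarget p)) ?mem_index_enum ?index_enum_uniq //=.
rewrite pathalg_mulbb path_comp1p eqxx big1 ?addr0 // => i /negbTE ip.
by rewrite pathalg_mulbb path_comp1p ip.
Qed.

Fact pathalg_mul1r : right_id pathalg_one pathalg_mul.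
Proof.
elim/pathalg_ind => [|x y IHx IHy|k p]; first by rewrite pathalg_mul0l.
  by rewrite pathalg_mulDl IHx IHy.
rewrite pathalg_mulZl pathalg_mul_sumr; congr (_ *: _).
rewrite (bigD1_seq (psource p)) ?mem_index_enum ?index_enum_uniq //=.
rewrite pathalg_mulbb path_compp1 eqxx big1 ?addr0 // => i /negbTE ip.
by rewrite pathalg_mulbb path_compp1 eq_sym ip.
Qed.

HB.instance Definition _ := GRing.Zmodule_isPzRing.Build pathalg
  pathalg_mulA pathalg_mul1l pathalg_mul1r pathalg_mulDl pathalg_mulDr.

Let scalp (k : K) : pathalg := k *: pathalg_one.

Fact scalp_zmod : zmod_morphism scalp.
Proof. by move=> k l; rewrite /scalp scalerBl. Qed.
Fact scalp_monoid : monoid_morphism scalp.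
Proof.
split=> [|k l]; first by rewrite /scalp scale1r.
rewrite /scalp [RHS]pathalg_mulZl; rewrite -scalerA; congr (_ *: _).
by rewrite pathalg_mul1l.
Qed.
Fact scalp_central k (x : pathalg) : scalp k * x = x * scalp k.
Proof.
rewrite [LHS]pathalg_mulZl [RHS]pathalg_mulZr.
by rewrite pathalg_mul1l pathalg_mul1r.
Qed.

HB.instance Definition _ :=
  isPzAlgebra.Build K pathalg scalp_zmod scalp_monoid scalp_central.
End PathAlgebra.

Arguments pathb {Q} K p.

Definition restr_mod (R S : pzRingType) (f : {rmorphism R -> S})
  (N : lmodType S) : Type := N.

Section Restriction.
Variables (R S : pzRingType) (f : {rmorphism R -> S}) (N : lmodType S).
Local Notation restr_mod := (restr_mod f N).

HB.instance Definition _ := GRing.Zmodule.on restr_mod.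

Definition restr_scale (a : R) (x : restr_mod) : restr_mod := f a *: (x : N).

Fact restr_scaleA a b x :
  restr_scale a (restr_scale b x) = restr_scale (a * b) x.
Proof. by rewrite /restr_scale scalerA rmorphM. Qed.
Fact restr_scale1 : left_id 1 restr_scale.
Proof. by move=> x; rewrite /restr_scale rmorph1 scale1r. Qed.
Fact restr_scaleDr : right_distributive restr_scale +%R.
Proof. by move=> a x y; apply: scalerDr. Qed.
Fact restr_scaleDl x : {morph restr_scale^~ x : a b / a + b}.
Proof. by move=> a b; rewrite /restr_scale rmorphD; apply: scalerDl. Qed.

HB.instance Definition _ := GRing.Zmodule_isLmodule.Build R restr_mod
  restr_scaleA restr_scale1 restr_scaleDr restr_scaleDl.
End Restriction.

(* The K-dual D M = Hom_K(M, K) of a left A-module M, as a right A-module, that *)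
(* is, a left module over the opposite algebra A^c: (phi a)(x) = phi (a x).     *)
Section Dual.
Variables (K : fieldType) (A : pzAlgType K) (M : lmodType A).

Definition Klinear_pred : {pred M -> K^o} := fun phi =>
  `[< forall (k : K) x y, phi ((pzscal k : A) *: x + y) = k * phi x + phi y >].

Fact Klinear_zmod : zmod_closed Klinear_pred.
Proof.
split=> [|phi psi /asboolP phiL /asboolP psiL]; apply/asboolP => k x y.
  by rewrite /= mulr0 addr0.
by rewrite /= !fctE phiL psiL mulrBr opprD addrACA.
Qed.
HB.instance Definition _ :=
  GRing.isZmodClosed.Build (M -> K^o)%type Klinear_pred Klinear_zmod.

Record dual_mod := DualMod {
  dual_fun :> M -> K^o;
  dual_funP : dual_fun \in Klinear_pred }.
HB.instance Definition _ := [isSub for dual_fun].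
HB.instance Definition _ := [Choice of dual_mod by <:].
HB.instance Definition _ := [SubChoice_isSubZmodule of dual_mod by <:].

Fact dual_scale_subproof (a : A) (phi : dual_mod) :
  (fun x => phi (a *: x)) \in Klinear_pred.
Proof.
have /asboolP phiL := dual_funP phi; apply/asboolP => k x y /=.
by rewrite scalerDr scalerA -pzscal_central -scalerA phiL.
Qed.
Definition dual_scale (a : A^c) (phi : dual_mod) : dual_mod :=
  DualMod (dual_scale_subproof a phi).

Fact dual_scaleA a b phi :
  dual_scale a (dual_scale b phi) = dual_scale (a * b) phi.
Proof. by apply/val_inj/funext => x /=; rewrite scalerA. Qed.
Fact dual_scale1 : left_id 1 dual_scale.
Proof. by move=> phi; apply/val_inj/funext => x /=; rewrite scale1r. Qed.
Fact dual_scaleDr : right_distributive dual_scale +%R.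
Proof. by move=> a phi psi; apply/val_inj/funext. Qed.
Fact dual_scaleDl phi : {morph dual_scale^~ phi : a b / a + b}.
Proof.
move=> a b; apply/val_inj/funext => x /=.
have /asboolP phiL := dual_funP phi; rewrite !fctE /= scalerDl.
by have := phiL 1 ((a : A) *: x) ((b : A) *: x); rewrite rmorph1 scale1r mul1r.
Qed.
HB.instance Definition _ := GRing.Zmodule_isLmodule.Build A^c dual_mod
  dual_scaleA dual_scale1 dual_scaleDr dual_scaleDl.
End Dual.

(* The R-dual Hom_R(P, R) of a right R-module P (a left module over R^c), as a  *)
(* left R-module: (a f)(x) = a f(x).                                            *)
Section RingDual.
Variables (R : pzRingType) (P : lmodType R^c).

Definition rlinear_pred : {pred P -> R^o} := fun f =>
  `[< forall (a : R) x y, f ((a : R^c) *: x + y) = (f x : R) * a + f y >].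

Fact rlinear_submod : submod_closed rlinear_pred.
Proof.
split=> [|b f g /asboolP fL /asboolP gL]; apply/asboolP => a x y.
  by rewrite /= mul0r addr0.
rewrite !fctE fL gL /= scalerDr mulrDl addrACA; congr (_ + _ + _).
by rewrite /GRing.scale /= mulrA.
Qed.
HB.instance Definition _ :=
  GRing.isSubmodClosed.Build R (P -> R^o)%type rlinear_pred rlinear_submod.

Record ring_dual := RingDual {
  ring_dual_fun :> P -> R^o;
  ring_dual_funP : ring_dual_fun \in rlinear_pred }.
HB.instance Definition _ := [isSub for ring_dual_fun].
HB.instance Definition _ := [Choice of ring_dual by <:].
HB.instance Definition _ := [SubChoice_isSubLmodule of ring_dual by <:].
End RingDual.

Section Modules.
Variables (K : fieldType) (A : pzAlgType K).
Implicit Types M N X Y P : lmodType A.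

Definition fin_dim M : Prop := exists b : seq M, forall x : M,
  exists c : nat -> K, x = \sum_(i < size b) (pzscal (c i) : A) *: b`_i.

Definition surjective_fun (U V : Type) (f : U -> V) : Prop :=
  forall y, exists x, f x = y.

Definition iso_mod M N : Prop := exists f : {linear M -> N}, bijective f.

Definition zero_mod M : Prop := forall x : M, x = 0.

Definition summand X M : Prop := exists Y, iso_mod M (X * Y)%type.

Definition indecomposable M : Prop :=
  ~ zero_mod M /\
  (forall X Y, iso_mod M (X * Y)%type -> zero_mod X \/ zero_mod Y).

(* |M| = m *)
Definition num_indec_summands M (m : nat) : Prop :=
  exists X : 'I_m -> lmodType A,
  [/\ forall i, indecomposable (X i) /\ summand (X i) M,
      forall i j, iso_mod (X i) (X j) -> i = j
    & forall Y, indecomposable Y -> summand Y M -> exists i, iso_mod Y (X i)].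

(* multiplicity free *)
Definition basic M : Prop :=
  forall X, indecomposable X -> ~ summand (X * X)%type M.

Definition projective P : Prop :=
  forall M N (g : {linear M -> N}) (f : {linear P -> N}),
    fin_dim M -> fin_dim N -> surjective_fun g ->
    exists h : {linear P -> M}, forall x, g (h x) = f x.

(* the kernel of f is a superfluous submodule: S + ker f = M forces S = M *)
Definition superfluous_ker M N (f : {linear M -> N}) : Prop :=
  forall S : submodule M,
    (forall x, exists2 y, y \in S & f (x - y) = 0) -> forall x, x \in S.

Definition exact_at M N P (f : {linear M -> N}) (g : {linear N -> P}) : Prop :=
  forall y, g y = 0 <-> exists x, f x = y.

(* P1 --p1--> P0 --p0--> M --> 0 *)
Definition min_proj_presentation P1 P0 M
    (p1 : {linear P1 -> P0}) (p0 : {linear P0 -> M}) : Prop :=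
  [/\ fin_dim P1 /\ fin_dim P0, projective P1 /\ projective P0,
      exact_at p1 p0 /\ surjective_fun p0
    & superfluous_ker p1 /\ superfluous_ker p0].
End Modules.

Section AuslanderReiten.
Variables (K : fieldType) (A : pzAlgType K).
Implicit Types M N T : lmodType A.

(* T = Tr X, the cokernel of Hom(P0, A) -> Hom(P1, A), f |-> f \o p1 *)
Definition is_transpose (X : lmodType A^c) T : Prop :=
  exists (P1 P0 : lmodType A^c)
         (p1 : {linear P1 -> P0}) (p0 : {linear P0 -> X}),
  min_proj_presentation p1 p0 /\
  exists q : {linear ring_dual P1 -> T},
    surjective_fun q /\
    forall g : ring_dual P1,
      q g = 0 <-> exists f : ring_dual P0, forall x, g x = f (p1 x).

(* tau^- = Tr D, which is determined up to isomorphism *)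
Definition is_tau_inv M T : Prop := is_transpose (dual_mod M) T.

Definition tau_inv_rigid M : Prop :=
  exists T, is_tau_inv M T /\ forall (f : {linear T -> M}) x, f x = 0.

Definition tau_inv_tilting M : Prop :=
  [/\ fin_dim M, tau_inv_rigid M
    & exists m, num_indec_summands M m /\ num_indec_summands (A^o)%type m].
End AuslanderReiten.

Section Classes.
Variables (K : fieldType) (A : pzAlgType K).
Implicit Types M N E : lmodType A.

Definition support_tau_inv_tilting M : Prop :=
  exists e : A, e * e = e /\
  exists N : lmodType (quot_alg (gen_ideal [set e]%classic)),
    tau_inv_tilting N /\
    iso_mod M (restr_mod (alg_proj (gen_ideal [set e]%classic)) N).

Definition basic_support_tau_inv_tilting M : Prop :=
  basic M /\ support_tau_inv_tilting M.

(* A full subcategory of rep A, given by its class of objects. The class is not *)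
(* empty, and is closed under isomorphisms since it is under injections.        *)
Definition torsion_free_class (F : lmodType A -> Prop) : Prop :=
  [/\ forall M, F M -> fin_dim M,
      exists M, F M,
      forall M N (f : {linear M -> N}), injective f -> F N -> F M
    & forall M E N (f : {linear M -> E}) (g : {linear E -> N}),
        fin_dim E -> injective f -> exact_at f g -> surjective_fun g ->
        F M -> F N -> F E].

Definition same_class (F G : lmodType A -> Prop) : Prop :=
  forall M, F M <-> G M.

Definition Sub_class M : lmodType A -> Prop := fun N =>
  fin_dim N /\
  exists (k : nat) (f : {linear N -> {ffun 'I_k -> M}}), injective f.
End Classes.

Section Cartan.
Variables (n : nat) (C : 'M[int]_n).

Definition is_GCM : Prop :=
  [/\ forall i, C i i = 2,
      forall i j, i != j -> C i j <= 0
    & forall i j, (C i j != 0) = (C j i != 0)].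

Definition is_symmetrizer (D : 'I_n -> nat) : Prop :=
  (forall i, 1 <= D i)%N /\
  let DC := diag_mx (\row_i (D i)%:Z) *m C in DC^T = DC.

Definition Cartan_form (D : 'I_n -> nat) (x : 'I_n -> int) : int :=
  \sum_(i < n) (D i)%:Z * x i ^+ 2
  - \sum_(i < n) \sum_(j < n | (i < j)%N) (D i)%:Z * `|C i j| * x i * x j.

(* positivity on nonzero integral vectors, equivalently on nonzero real ones *)
Definition is_Dynkin (D : 'I_n -> nat) : Prop :=
  forall x : 'I_n -> int, (exists i, x i != 0) -> 0 < Cartan_form D x.

Definition Cartan_g (i j : 'I_n) : nat := gcdn `|C i j|%N `|C j i|%N.
Definition Cartan_f (i j : 'I_n) : nat := (`|C i j| %/ Cartan_g i j)%N.

Definition is_orientation (Om : {set 'I_n * 'I_n}) : Prop :=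
  (forall i j, ((i, j) \in Om) || ((j, i) \in Om) = (C i j < 0)) /\
  (forall i p, p != [::] -> path (fun a b => (a, b) \in Om) i p ->
    i != last i p).

(* W(C) acts faithfully on the root lattice with basis the simple roots a_j by  *)
(* s_i(a_j) = a_j - c_ij a_i; it is realized by matrices of this action on      *)
(* column vectors.  The s_i being involutions, their products form a group.     *)
Definition simple_refl (i : 'I_n) : 'M[int]_n := 1%:M - delta_mx i i *m C.

Definition refl_word (s : seq 'I_n) : 'M[int]_n :=
  foldr (fun i w => simple_refl i *m w) 1%:M s.

Definition Weyl_group : set 'M[int]_n := fun w => exists s, refl_word s = w.

Definition reduced (s : seq 'I_n) : Prop :=
  forall t, refl_word t = refl_word s -> (size s <= size t)%N.

(* a reduced expression of w; its value is irrelevant for w outside W(C) *)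
Definition reduced_expr (w : 'M[int]_n) : seq 'I_n :=
  xget [::] (fun s => refl_word s = w /\ reduced s).
End Cartan.

Section Preprojective.
Variables (K : fieldType) (n : nat) (C : 'M[int]_n) (D : 'I_n -> nat).
Variable Om : {set 'I_n * 'I_n}.

Definition Om_bar (i j : 'I_n) : bool := ((i, j) \in Om) || ((j, i) \in Om).

(* (i, j, g) is the arrow alpha_ij^(g+1) : j -> i *)
Definition is_alpha (a : 'I_n * 'I_n * nat) : bool :=
  Om_bar a.1.1 a.1.2 && (a.2 < Cartan_g C a.1.1 a.1.2)%N.

Definition pp_arrow : choiceType := ('I_n + {a | is_alpha a})%type.

Definition pp_source (a : pp_arrow) : 'I_n :=
  match a with inl i => i | inr a => (val a).1.2 end.
Definition pp_target (a : pp_arrow) : 'I_n :=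
  match a with inl i => i | inr a => (val a).1.1 end.

Definition pp_quiver : quiver := @Quiver 'I_n pp_arrow pp_source pp_target.

Local Notation KQ := (pathalg pp_quiver K).

Definition eps (i : 'I_n) : KQ :=
  pathb K (arrow_path (inl i : arrow pp_quiver)).

(* zero when there is no such arrow *)
Definition alpha (i j : 'I_n) (g : nat) : KQ :=
  if insub (i, j, g) is Some a
  then pathb K (arrow_path (inr a : arrow pp_quiver)) else 0.

Definition Om_sgn (i j : 'I_n) : KQ := if (i, j) \in Om then 1 else -1.

Local Notation f := (Cartan_f C).

Inductive pp_relation : KQ -> Prop :=
| pp_nilpotent i : pp_relation (eps i ^+ D i)
| pp_commute i j g of Om_bar i j & (g < Cartan_g C i j)%N :
    pp_relation (eps i ^+ f j i * alpha i j g - alpha i j g * eps j ^+ f i j)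
| pp_mesh i :
    pp_relation (\sum_(j | Om_bar j i) \sum_(g < Cartan_g C i j)
      \sum_(k < f j i) Om_sgn i j *
        (eps i ^+ k * alpha i j g * alpha j i g * eps i ^+ (f j i - 1 - k))).

Definition preproj : pzAlgType K := quot_alg (gen_ideal pp_relation).

Definition pp_idem (i : 'I_n) : preproj :=
  alg_proj (gen_ideal pp_relation)
    (pathb K (trivial_path (i : vertex pp_quiver))).

Definition pp_ideal (i : 'I_n) : ideal preproj :=
  gen_ideal [set 1 - pp_idem i]%classic.

Definition pp_ideal_word (s : seq 'I_n) : ideal preproj :=
  foldr (fun i J => ideal_mul (pp_ideal i) J) (unit_ideal preproj) s.

Definition pp_ideal_w (w : 'M[int]_n) : ideal preproj :=
  pp_ideal_word (reduced_expr C w).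

Definition pp_mod (w : 'M[int]_n) : lmodType preproj :=
  quot_mod (lsubmod_of_ideal (pp_ideal_w w)).
End Preprojective.

(* f maps X bijectively onto the set of classes of elements of Y modulo the     *)
(* equivalence relation R (set_bij is not usable with U := lmodType A, which    *)
(* does not fit in the universe of set)                                         *)
Definition bij_onto_classes (T U : Type) (R : U -> U -> Prop)
    (X : T -> Prop) (Y : U -> Prop) (f : T -> U) : Prop :=
  [/\ forall x, X x -> Y (f x),
      forall x y, X x -> X y -> R (f x) (f y) -> x = y
    & forall u, Y u -> exists2 x, X x & R (f x) u].

(* Main.v *)
(* Reflection at a vertex i, built by replacing the part of a module at i by a subquotient of the sum of
the neighbouring parts, relates the torsion-free classes containing the simple module S_i to those that do
not. Iterating it from the zero class turns a word into a torsion-free class with Ext-projective generator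
Pi/I_w; since the form of C is positive definite, such words have bounded length, so every torsion-free
class is reached. A module M is tau^- -rigid iff it is Ext-injective in Sub M. The trace form makes Ext^1
symmetric as soon as one argument is locally free; Pi/I_w is locally free, hence Ext-injective in
Sub(Pi/I_w) as well, and its summands are counted by the vertices j with e_j not in I_w. *)

From HB Require Import structures.
From mathcomp Require Import all_boot all_order all_algebra.
From mathcomp Require Import finmap monalg.
From mathcomp Require Import boolp classical_sets functions.
From mathcomp Require Import zify ring.
Require Import Defs.

Set Implicit Arguments.
Unset Strict Implicit.
Unset Printing Implicit Defensive.
Import Order.TTheory GRing.Theory Num.Theory.
Local Open Scope ring_scope.

(** * Submodules as modules; bijective linear maps *)

Section SubModule.
Variables (R : pzRingType) (V : lmodType R) (S : submodule V).

(** Reflections are therefore run on finite dimensional nilpotent modules, with [torf0] as the local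
    notion of torsion-free class. Once a word is found whose class contains all of these modules, a
    grading shows that they separate the elements of Pi; so Pi is one of them, and from then on
    [torf0] and [torsion_free_class] agree. The path algebra is used only through a [presentation]:
    the relations, induction on generators, and the property that operators satisfying the relations
    form a module. Dimension vectors tie words to W: the matrix X of dimensions of Pi/I_w satisfies
    X C = D (1 - w), so I_w determines w, while a class determines I_w as its annihilator. Sign
    coherence of roots is itself read off from modules. Of the symmetry of Ext^1 only vanishing is
    used: if all extensions of M by N split and M or N is locally free, then all extensions of N by
    M split. Ext-injectivity over Pi/<e> passes to Pi because e is idempotent: an extension of
    modules killed by e is killed by e. *)

Record sub_mod := SubMod { sub_val :> V; sub_valP : sub_val \in S }.
HB.instance Definition _ := [isSub for sub_val].
HB.instance Definition _ := [Choice of sub_mod by <:].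
HB.instance Definition _ := GRing.isSubmodClosed.Build R V (submod_pred S) (submod_predP S).
HB.instance Definition _ := [SubChoice_isSubLmodule of sub_mod by <:].

Definition sub_incl : sub_mod -> V := val.
Fact sub_incl_linear : linear sub_incl. by []. Qed.
HB.instance Definition _ := GRing.isLinear.Build R sub_mod V *:%R sub_incl sub_incl_linear.
End SubModule.

Definition mkL (R : pzRingType) (U V : lmodType R) (f : U -> V) (h : linear f) :
  {linear U -> V} :=
 HB.pack f (GRing.isLinear.Build R U V *:%R f h).

Lemma linear_inv (R : pzRingType) (U V : lmodType R) (f : {linear U -> V}) :
 bijective f -> exists g : {linear V -> U}, cancel f g /\ cancel g f.
case=> g fK gK; have gL : linear g.
 by move=> a x y; apply: (can_inj fK); rewrite linearP !gK.
by exists (mkL gL).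
Qed.

Lemma bijP (U V : Type) (f : U -> V) :
 injective f -> surjective_fun f -> bijective f.
move=> fI fS; have [g gP] := choice fS.
by exists g => // x; apply: fI; rewrite gP.
Qed.

Lemma bij_surj (U V : Type) (f : U -> V) : bijective f -> surjective_fun f.
by case=> g _ gK y; exists (g y). Qed.

(** * Finite dimensional vector spaces over K *)

Section LinAlg.
Variable K : fieldType.
Implicit Types (U V W : lmodType K) (m d : nat).

Definition hasdim V d := exists f : {linear V -> 'rV[K]_d}, bijective f.
Definition fd V := exists d, hasdim V d.

(** Take a matrix of maximal rank among those whose row space lies in [S]; a vector of [S] outside
    that row space could be adjoined and would raise the rank. *)
Lemma rowspace_pred d (S : submodule 'rV[K]_d) :
 exists A : 'M[K]_d, forall x, (x \in S) = (x <= A)%MS.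
pose P r := `[< exists A : 'M[K]_d, (forall x : 'rV_d, (x <= A)%MS -> x \in S) /\ \rank A = r >].
have exP : exists r, P r.
 exists 0%N; apply/asboolP; exists 0; split; last exact: mxrank0. by move=> x; rewrite submx0 => /eqP->; case: (submod_predP S).
have ubP r : P r -> (r <= d)%N by move=> /asboolP[A [_ <-]]; apply: rank_leq_row.
case: (ex_maxnP exP ubP) => r /asboolP[A [AS rA]] rmax; exists A => x.
apply/idP/idP => [xS|/AS//]; apply/negPn/negP => xA.
have : P (\rank (A + <<x>>)%MS).
 apply/asboolP; exists (A + <<x>>)%MS; split=> // y. rewrite (adds_eqmx (eqmx_refl A) (genmxE x)) => /sub_addsmxP[[u v] /= ->].
 have [_ SZ] := submod_predP S; rewrite addrC. have -> : v *m x = v 0 0 *: x by rewrite [v]mx11_scalar mul_scalar_mx mxE eqxx.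
 by apply: SZ => //; apply: AS; apply: submxMl.
move/rmax; rewrite -rA leqNgt => /negP; apply.
suff : (A < A + <<x>>)%MS by rewrite ltmxErank => /andP[].
rewrite ltmxE addsmxSl /=; apply: contra xA => h.
apply: submx_trans h; apply: submx_trans (addsmxSr _ _).
by rewrite genmxE.
Qed.

Lemma hasdim_bij V d (f : {linear 'rV[K]_d -> V}) : bijective f -> hasdim V d.
by move=> /linear_inv[g [fK gK]]; exists g; exists f. Qed.

Lemma hasdim_iso V W d (f : {linear V -> W}) : bijective f -> hasdim V d -> hasdim W d.
move=> /linear_inv[g [fK gK]] [h hB]; exists (h \o g : {linear _ -> _}).
by apply: bij_comp => //; exists f.
Qed.

Lemma hasdim_le V W d e (f : {linear V -> W}) : injective f ->
 hasdim V d -> hasdim W e -> (d <= e)%N.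
move=> fI [g /linear_inv[g' [gK g'K]]] [h /bij_inj hI].
pose k : {linear 'rV_d -> 'rV_e} := h \o (f \o g').
suff /eqP <- : row_free (lin1_mx k) by apply: rank_leq_col.
apply: inj_row_free => v; rewrite mul_rV_lin1 /= => e0.
apply: (can_inj g'K); apply: fI; apply: hI; rewrite e0.
by rewrite !linear0.
Qed.

Lemma hasdim_uniq V d e : hasdim V d -> hasdim V e -> d = e.
move=> hd he; apply/eqP; rewrite eqn_leq.
by rewrite (hasdim_le (f := idfun : {linear V -> V}) _ hd he) //
 (hasdim_le (f := idfun : {linear V -> V}) _ he hd).
Qed.

(** The kernel of [f] is the row space of a matrix A. Multiplication by a column base of the
    cokernel matrix of A has exactly this kernel and full rank, so it descends to coordinates on
    V. *)
Lemma fd_quot_rV m V (f : {linear 'rV[K]_m -> V}) : surjective_fun f -> fd V.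
move=> fS; have kP : submod_closed (fun x => f x == 0).
 split=> [|a x y]; rewrite /in_mem /= ?linear0 // => /eqP x0 /eqP y0. by rewrite linearP x0 y0 scaler0 addr0.
have [A AP] := rowspace_pred (Submodule kP).
have [s sP] := choice fS.
pose B := col_base (cokermx A); pose g v := s v *m B.
have BP x : (f x == 0) = (x *m B == 0).
 have -> : (f x == 0) = (x \in Submodule kP) by []. rewrite AP submxE -[X in x *m X]mulmx_base mulmxA.
 rewrite -[X in _ == X](mul0mx _ (row_base (cokermx A))). by apply: (inj_eq (row_free_inj (row_base_free _))).
have BE x y : f x = f y -> x *m B = y *m B.
 by move=> e; apply/eqP; rewrite -subr_eq0 -mulmxBl -BP linearB /= e subrr.
have gL : linear g.
 move=> a x y; rewrite /g scalemxAl -mulmxDl; apply: BE. by rewrite linearP !sP.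
exists (\rank (cokermx A)), (mkL gL); apply: bijP => [x y /=|y].
 rewrite /g => /eqP; rewrite -subr_eq0 -mulmxBl -BP linearB /= !sP subr_eq0. by move/eqP.
have /row_fullP[C CB] := col_base_full (cokermx A).
by exists (f (y *m C)) => /=; rewrite /g (BE _ (y *m C)) ?sP // -mulmxA CB mulmx1.
Qed.

Lemma fd_span V m (b : 'I_m -> V) :
 (forall x, exists c : 'I_m -> K, x = \sum_i c i *: b i) -> fd V.
move=> bP; pose f (x : 'rV[K]_m) := \sum_i x 0 i *: b i.
have fL : linear f.
 move=> a x y; rewrite /f scaler_sumr -big_split; apply: eq_bigr => i _ /=. by rewrite !mxE scalerDl scalerA.
apply: (@fd_quot_rV m V (mkL fL)) => x; have [c ->] := bP x.
by exists (\row_i c i); apply: eq_bigr => i _; rewrite mxE.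
Qed.

Lemma fd_surj V W (f : {linear V -> W}) : surjective_fun f -> fd V -> fd W.
move=> fS [d [g /linear_inv[h [gK hK]]]].
apply: (@fd_quot_rV d W (f \o h : {linear _ -> _})) => y.
by have [x <-] := fS y; exists (g x) => /=; rewrite gK.
Qed.

Lemma fd_inj V W (f : {linear V -> W}) : injective f -> fd W -> fd V.
move=> fI [d [g gB]].
have kP : submod_closed (fun x : 'rV[K]_d => `[< exists v, g (f v) = x >]).
 split=> [|a x y /asboolP[v <-] /asboolP[w <-]]; apply/asboolP.
  by exists 0; rewrite !linear0.
 by exists (a *: v + w); rewrite !linearP.
have [A AP] := rowspace_pred (Submodule kP).
have AP' x : `[< exists v, g (f v) = x >] = (x <= A)%MS by exact: AP.
pose h (x : 'rV[K]_d) := x *m A.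
have hP x : exists v, g (f v) = h x.
 by apply/asboolP; rewrite AP' submxMl.
have [s sP] := choice hP; have I : injective (g \o f).
 by apply: inj_comp => //; apply: bij_inj.
have sL : linear s.
 move=> a x y; apply: I; rewrite /= !linearP /= !sP /h mulmxDl scalemxAl //.
apply: (@fd_quot_rV d V (mkL sL)) => v.
have /submxP[x xP] : (g (f v) <= A)%MS by rewrite -AP'; apply/asboolP; exists v.
by exists x; apply: I; rewrite /= sP /h -xP.
Qed.

Lemma fd_sub V (S : submodule V) : fd V -> fd (sub_mod S).
by apply: (@fd_inj _ _ (@sub_incl _ V S)); apply: val_inj. Qed.

Lemma dim_ses U V W (f : {linear U -> V}) (g : {linear V -> W}) a c :
 injective f -> surjective_fun g -> (forall y, g y = 0 <-> exists x, f x = y) -> hasdim U a -> hasdim W c -> hasdim V (a + c).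
move=> fI gS ex [u /linear_inv[u' [uK u'K]]] [w /linear_inv[w' [wK w'K]]].
have [s sP] := choice gS.
(* The set-theoretic section [s] need not be linear; only its values on basis vectors are kept and
   extended linearly. *)
pose t (z : 'rV[K]_c) : V := \sum_j z 0 j *: s (w' (delta_mx 0 j)).
have tL : linear t.
 move=> k x y; rewrite /t scaler_sumr -big_split; apply: eq_bigr => j _ /=. by rewrite !mxE scalerDl scalerA.
have gt z : g (t z) = w' z.
 rewrite {2}(row_sum_delta z) /t !linear_sum; apply: eq_bigr => j _ /=. by rewrite !linearZ /= sP.
have hL : linear (fun z : 'rV[K]_(a + c) => f (u' (lsubmx z)) + t (rsubmx z)).
 by move=> k x y /=; rewrite !linearP tL scalerDr addrACA.
apply: (@hasdim_bij _ _ (mkL hL)); apply: bijP.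
 suff I z : f (u' (lsubmx z)) + t (rsubmx z) = 0 -> z = 0.
  move=> x y /= e; apply/eqP; rewrite -subr_eq0; apply/eqP/I. by have := linearB (mkL hL) x y => /= ->; rewrite e subrr.
 move=> e; have r0 : rsubmx z = 0.
  apply: (can_inj w'K); rewrite linear0 -gt. have : g (f (u' (lsubmx z)) + t (rsubmx z)) = 0 by rewrite e linear0.
  have g0 : g (f (u' (lsubmx z))) = 0 by apply/ex; exists (u' (lsubmx z)). by rewrite linearD /= g0 add0r.
 move: e; rewrite r0 (_ : t 0 = 0); last by have := linear0 (mkL tL). rewrite addr0 => e; rewrite -[z]hsubmxK r0 (_ : lsubmx z = 0) ?row_mx0 //.
 by apply: (can_inj u'K); apply: fI; rewrite e !linear0.
move=> y; have [x xP] : exists x, f x = y - t (w (g y)).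
 by apply/ex; rewrite linearB /= gt wK subrr.
exists (row_mx (u x) (w (g y))); rewrite /= row_mxKl row_mxKr uK xP.
by rewrite subrK.
Qed.

Lemma fd_ses U V W (f : {linear U -> V}) (g : {linear V -> W}) :
 injective f -> surjective_fun g -> (forall y, g y = 0 <-> exists x, f x = y) -> fd U -> fd W -> fd V.
by move=> fI gS ex [a ha] [c hc]; exists (a + c)%N; apply: (dim_ses fI gS ex ha hc). Qed.

Definition dimV V : nat := xget 0%N (hasdim V).

Lemma dimP V : fd V -> hasdim V (dimV V).
by move=> hV; exact: (@xgetPex _ 0%N (hasdim V)). Qed.

Lemma dimE V d : hasdim V d -> dimV V = d.
by move=> hd; apply: (@hasdim_uniq V) => //; apply: dimP; exists d. Qed.

Lemma dim_exact U V W (f : {linear U -> V}) (g : {linear V -> W}) :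
 injective f -> surjective_fun g -> (forall y, g y = 0 <-> exists x, f x = y) -> fd V -> dimV V = (dimV U + dimV W)%N.
move=> fI gS ex fV; apply: dimE.
apply: (dim_ses fI gS ex); apply: dimP; first exact: (fd_inj fI).
exact: (fd_surj gS).
Qed.

Lemma dim_iso V W (f : {linear V -> W}) : bijective f -> fd V -> dimV V = dimV W.
by move=> fB /dimP h; apply/esym/dimE; exact: (hasdim_iso fB h). Qed.

Lemma dim_le V W (f : {linear V -> W}) : injective f -> fd W -> (dimV V <= dimV W)%N.
by move=> fI fW; apply: (hasdim_le fI (dimP (fd_inj fI fW)) (dimP fW)). Qed.

Lemma dim0P V : fd V -> (dimV V = 0%N <-> forall x : V, x = 0).
move=> fV; split=> [|V0].
 have [f /bij_inj fI] := dimP fV; move=> d0 x; apply: fI; apply/rowP. by move=> j; have := leq_trans (ltn_ord j) (eq_leq d0).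
have zL : linear ((fun=> 0) : 'rV[K]_0 -> V) by move=> a x y; rewrite scaler0 addr0.
apply: dimE; apply: (@hasdim_bij _ _ (mkL zL)); exists (fun=> 0) => x /=.
 by rewrite [x]thinmx0.
by rewrite (V0 x).
Qed.

Lemma inj_dim_bij V W (f : {linear V -> W}) :
 fd W -> injective f -> (dimV W <= dimV V)%N -> bijective f.
move=> fW fI le; apply: bijP => // y.
have fV := fd_inj fI fW.
have [g /linear_inv[g' [gK g'K]]] := dimP fV; have [h hB] := dimP fW.
pose k : {linear 'rV_(dimV V) -> 'rV_(dimV W)} := h \o (f \o g').
have rf : row_free (lin1_mx k).
 apply: inj_row_free => v; rewrite mul_rV_lin1 /= => e0. apply: (can_inj g'K); apply: fI; apply: (bij_inj hB); rewrite e0. by rewrite !linear0.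
have : row_full (lin1_mx k).
 rewrite /row_full eqn_leq rank_leq_col; apply: leq_trans le _. by rewrite row_leq_rank.
move/(submx_full (h y))/submxP => [x xP]; exists (g' x).
by apply: (bij_inj hB); rewrite xP mul_rV_lin1.
Qed.

Lemma inj_endo_bij V (f : {linear V -> V}) : fd V -> injective f -> bijective f.
by move=> fV fI; apply: inj_dim_bij. Qed.

Lemma fd_rV d : fd 'rV[K]_d.
by exists d, (idfun : {linear _ -> _}); exists id. Qed.

(** A pseudo-inverse, f s f = f: a K-linear retraction when [f] is injective and a K-linear section
    when it is surjective. Extensions are first split over K in this way, and the splitting is
    improved later by averaging. *)
Lemma gen_inv V W (f : {linear V -> W}) : fd V -> fd W ->
 exists s : {linear W -> V}, forall x, f (s (f x)) = f x.
move=> [a [u /linear_inv[u' [uK u'K]]]] [b [w /linear_inv[w' [wK w'K]]]].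
pose k : {linear 'rV_a -> 'rV_b} := w \o (f \o u').
exists (u' \o (mulmxr (pinvmx (lin1_mx k)) \o w) : {linear _ -> _}) => x /=.
apply: (can_inj wK).
have kE z : w (f (u' z)) = z *m lin1_mx k by rewrite mul_rV_lin1.
by rewrite kE mulmxKpV // -[x]uK kE submxMl.
Qed.

Lemma sub_proj V (S : submodule V) : fd V ->
 exists p : {linear V -> V}, (forall x, p x \in S) /\ (forall x, x \in S -> p x = x).
move=> fV; have [s sP] := gen_inv (@sub_incl _ V S) (fd_sub S fV) fV.
exists (@sub_incl _ V S \o s : {linear _ -> _}); split=> x /=; first exact: valP.
by move=> xS; have := sP (SubMod xS).
Qed.

Lemma sep_functional V (S : submodule V) x : fd V -> x \notin S ->
 exists phi : {linear V -> K^o}, (forall y, y \in S -> phi y = 0) /\ phi x != 0.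
move=> fV xS; have [p [p1 p2]] := sub_proj S fV.
have [d [f fB]] := fV.
have : f (x - p x) != 0.
 rewrite -(linear0 f) (inj_eq (bij_inj fB)) subr_eq0; apply: contra xS => /eqP->. exact: p1.
case/matrix0Pn => i [j h].
have phiL : linear ((fun y => f (y - p y) i j) : V -> K^o).
 move=> k y z; have -> : k *: y + z - p (k *: y + z) = k *: (y - p y) + (z - p z).
  by rewrite linearP opprD addrACA -scalerBr.
 by rewrite linearP !mxE.
exists (mkL phiL); split=> //= y yS.
by rewrite p2 // subrr linear0 mxE.
Qed.
End LinAlg.

(** * Kernels, images, factorization of linear maps, finite sums *)

Section KernelImage.
Variables (R : pzRingType) (U V : lmodType R) (f : {linear U -> V}).

Fact ker_submod : submod_closed (fun x => f x == 0).
split=> [|a x y]; rewrite /in_mem /= ?linear0 // => /eqP x0 /eqP y0.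
by rewrite linearP x0 y0 scaler0 addr0.
Qed.
Definition kerS := Submodule ker_submod.
Lemma kerSP x : reflect (f x = 0) (x \in kerS).
exact: eqP. Qed.

Fact im_submod : submod_closed (fun y => `[< exists x, f x = y >]).
split=> [|a x y /asboolP[v <-] /asboolP[w <-]]; apply/asboolP.
 by exists 0; rewrite linear0.
by exists (a *: v + w); rewrite linearP.
Qed.
Definition imS := Submodule im_submod.
Lemma imSP y : reflect (exists x, f x = y) (y \in imS).
exact: asboolP. Qed.

Lemma inj_ker : injective f <-> forall x, f x = 0 -> x = 0.
split=> [fI x x0|h x y e]; first by apply: fI; rewrite x0 linear0.
by apply/eqP; rewrite -subr_eq0; apply/eqP/h; rewrite linearB /= e subrr.
Qed.
End KernelImage.

Section SubQuot.
Variables (R : pzRingType) (V : lmodType R) (S : submodule V).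

Fact mod_proj_linear : linear (@mod_proj R V S).
by move=> a x y; rewrite raddfD /=; congr (_ + _); rewrite -quot_scaleE. Qed.
Definition projL : {linear V -> quot_mod S} := mkL mod_proj_linear.
Lemma projL_surj : surjective_fun projL.
by move=> u; exists (mod_repr u); rewrite /= mod_reprK. Qed.
Lemma projL0 x : projL x = 0 <-> x \in S.
have <- : projL 0 = 0 by rewrite linear0.
rewrite -[x in x \in S]subr0; split; first by move/eqP; rewrite /= mod_proj_eq.
by move=> h; apply/eqP; rewrite /= mod_proj_eq.
Qed.

Definition inclL : {linear sub_mod S -> V} := @sub_incl R V S.
Lemma inclL_inj : injective inclL. exact: val_inj. Qed.
Lemma inclLP x : x \in S -> exists y, inclL y = x.
by move=> xS; exists (SubMod xS). Qed.
Lemma inclL_in y : inclL y \in S. exact: valP. Qed.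

Lemma corestr (U : lmodType R) (f : {linear U -> V}) : (forall x, f x \in S) ->
 exists g : {linear U -> sub_mod S}, forall x, inclL (g x) = f x.
move=> fS; have gL : linear (fun x => SubMod (fS x)).
 by move=> a x y; apply: val_inj; rewrite /= linearP.
by exists (mkL gL).
Qed.

Lemma fact_surj (U W : lmodType R) (f : {linear U -> V}) (g : {linear U -> W}) :
 surjective_fun f -> (forall x, f x = 0 -> g x = 0) -> exists h : {linear V -> W}, forall x, h (f x) = g x.
move=> /choice[s sP] fg; have E x y : f x = f y -> g x = g y.
 move=> e; apply/eqP; rewrite -subr_eq0 -linearB; apply/eqP/fg. by rewrite linearB /= e subrr.
have hL : linear (g \o s).
 by move=> a x y /=; rewrite -linearP; apply: E; rewrite linearP !sP.
by exists (mkL hL) => x; apply: E; rewrite sP.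
Qed.

Lemma fact_inj (U W : lmodType R) (f : {linear U -> V}) (g : {linear W -> V}) :
 injective f -> (forall y, exists x, f x = g y) -> exists h : {linear W -> U}, forall y, f (h y) = g y.
move=> fI /choice[s sP]; have sL : linear s.
 by move=> a x y; apply: fI; rewrite linearP !sP linearP.
by exists (mkL sL).
Qed.
End SubQuot.

Section Fun.
Variables (R : pzRingType) (I : finType).
Implicit Types V W : lmodType R.

Fact evalL_linear V (i : I) : linear (fun x : {ffun I -> V} => x i).
by move=> a x y; rewrite !ffunE. Qed.
Definition evalL V i : {linear {ffun I -> V} -> V} := mkL (@evalL_linear V i).
Fact singL_linear V (i : I) : linear (fun x : V => [ffun j => if j == i then x else 0]).
by move=> a x y; apply/ffunP => j; rewrite !ffunE; case: eqP; rewrite ?scaler0 ?addr0. Qed.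
Definition singL V i : {linear V -> {ffun I -> V}} := mkL (@singL_linear V i).
Lemma ffun_sum V (x : {ffun I -> V}) : x = \sum_i singL V i (evalL V i x).
apply/ffunP => j; rewrite sum_ffunE (bigD1 j) //= ffunE eqxx big1 ?addr0 // => i.
by rewrite ffunE eq_sym => /negbTE->.
Qed.
Fact pairfL_linear V W (f : I -> {linear V -> W}) : linear (fun x => [ffun i => f i x]).
by move=> a x y; apply/ffunP => j; rewrite !ffunE linearP. Qed.
Definition pairfL V W (f : I -> {linear V -> W}) : {linear V -> {ffun I -> W}} :=
 mkL (@pairfL_linear V W f).
Fact sumfL_linear V W (f : I -> {linear V -> W}) :
 linear (fun x : {ffun I -> V} => \sum_i f i (x i)).
move=> a x y; rewrite scaler_sumr -big_split; apply: eq_bigr => i _ /=.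
by rewrite !ffunE linearP.
Qed.
Definition sumfL V W (f : I -> {linear V -> W}) : {linear {ffun I -> V} -> W} :=
 mkL (@sumfL_linear V W f).
End Fun.

Section Pairs.
Variables (R : pzRingType) (U V : lmodType R).
Fact inlL_linear : linear (fun x : U => (x, 0) : U * V).
by move=> a x y; apply: injective_projections; rewrite /= ?scaler0 ?addr0. Qed.
Definition inlL : {linear U -> (U * V)%type} := mkL inlL_linear.
Fact inrL_linear : linear (fun x : V => (0, x) : U * V).
by move=> a x y; apply: injective_projections; rewrite /= ?scaler0 ?addr0. Qed.
Definition inrL : {linear V -> (U * V)%type} := mkL inrL_linear.
Fact fstL_linear : linear (@fst U V). by []. Qed.
Definition fstL : {linear (U * V)%type -> U} := mkL fstL_linear.
Fact sndL_linear : linear (@snd U V). by []. Qed.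
Definition sndL : {linear (U * V)%type -> V} := mkL sndL_linear.
Lemma pair_sum (z : U * V) : z = inlL z.1 + inrL z.2.
by case: z => x y; congr pair; rewrite /= ?addr0 ?add0r. Qed.
End Pairs.

(** * Finite dimensional modules and their K-dimension *)

Section KMod.
Variables (K : fieldType) (A : pzAlgType K).
Implicit Types (M N P X Y : lmodType A).

Definition kmod M : lmodType K := restr_mod (@pzscal K A : {rmorphism K -> A}) M.

Lemma kscaleE M (k : K) (x : kmod M) : k *: x = (pzscal k : A) *: (x : M).
by []. Qed.

Fact kmap_linear M N (f : {linear M -> N}) : linear (f : kmod M -> kmod N).
by move=> k x y; apply: linearP. Qed.
Definition kmap M N (f : {linear M -> N}) : {linear kmod M -> kmod N} := mkL (kmap_linear f).

Lemma fin_dimP M : fin_dim M <-> fd (kmod M).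
split=> [[b bP]|[d [f /linear_inv[g [fK gK]]]]].
 apply: (@fd_span _ (kmod M) (size b) (fun i => b`_i)) => x. by have [c cP] := bP x; exists (fun i => c i).
exists [seq g (delta_mx 0 i) | i <- enum 'I_d] => x.
exists (fun i => if insub i is Some j then f x 0 j else 0).
rewrite size_map size_enum_ord -[LHS]fK {1}(row_sum_delta (f x)) linear_sum.
apply: eq_bigr => i _ /=; rewrite valK linearZ /= (nth_map i) ?size_enum_ord //.
by rewrite nth_ord_enum.
Qed.

Lemma fin_dim_inj M N (f : {linear M -> N}) : injective f -> fin_dim N -> fin_dim M.
by rewrite !fin_dimP => fI; apply: (@fd_inj _ _ _ (kmap f)). Qed.
Lemma fin_dim_surj M N (f : {linear M -> N}) : surjective_fun f -> fin_dim M -> fin_dim N.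
by rewrite !fin_dimP => fI; apply: (@fd_surj _ _ _ (kmap f)). Qed.
Lemma fin_dim_ses M N P (f : {linear M -> N}) (g : {linear N -> P}) :
 injective f -> surjective_fun g -> exact_at f g -> fin_dim M -> fin_dim P -> fin_dim N.
by rewrite !fin_dimP => fI gS ex; apply: (@fd_ses _ _ _ _ (kmap f) (kmap g)). Qed.
Lemma fin_dim_prod M N : fin_dim M -> fin_dim N -> fin_dim (M * N)%type.
apply: (@fin_dim_ses _ _ _ (inlL M N) (sndL M N)) => [x y []//|y|[x y]].
 by exists (0, y).
by split=> [/= ->|[z [_ <-]]//]; exists x.
Qed.
Lemma fin_dim0 M : zero_mod M -> fin_dim M.
by move=> M0; exists [::] => x; exists (fun=> 0); rewrite big_ord0. Qed.
Lemma fin_dim_ffun (I : finType) M : fin_dim M -> fin_dim {ffun I -> M}.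
rewrite !fin_dimP => -[d [f /bij_inj fI]].
have hL : linear (fun x : kmod {ffun I -> M} => mxvec (\matrix_(i < #|I|) f (x (enum_val i)))).
 move=> a x y; rewrite -linearP; congr mxvec; apply/matrixP => i j. by rewrite !mxE !ffunE linearP !mxE.
apply: (@fd_inj _ _ _ (mkL hL) _ (fd_rV _ _)) => x y /= /(can_inj mxvecK) /row_matrixP e.
apply/ffunP => i; apply: fI; have := e (enum_rank i).
by rewrite !rowK enum_rankK.
Qed.

Definition dimK M := dimV (kmod M).
Lemma dimK_le M N (f : {linear M -> N}) : injective f -> fin_dim N -> (dimK M <= dimK N)%N.
by rewrite fin_dimP => fI; apply: (@dim_le _ _ _ (kmap f)). Qed.
Lemma dimK_exact M N P (f : {linear M -> N}) (g : {linear N -> P}) :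
 injective f -> surjective_fun g -> exact_at f g -> fin_dim N -> dimK N = (dimK M + dimK P)%N.
by rewrite fin_dimP => fI gS ex; apply: (@dim_exact _ _ _ _ (kmap f) (kmap g)). Qed.
Lemma dimK0 M : fin_dim M -> (dimK M = 0%N <-> zero_mod M).
by rewrite fin_dimP => /dim0P. Qed.
Lemma inj_dimK_bij M N (f : {linear M -> N}) :
 fin_dim N -> injective f -> (dimK N <= dimK M)%N -> bijective f.
by rewrite fin_dimP => fN fI h; apply: (@inj_dim_bij _ _ _ (kmap f)). Qed.
Lemma endo_bij M (f : {linear M -> M}) : fin_dim M -> injective f -> bijective f.
by move=> fM fI; apply: inj_dimK_bij. Qed.
Lemma fin_dim_sub M (S : submodule M) : fin_dim M -> fin_dim (sub_mod S).
exact: (fin_dim_inj (@inclL_inj _ _ S)). Qed.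
Lemma fin_dim_quot M (S : submodule M) : fin_dim M -> fin_dim (quot_mod S).
exact: (fin_dim_surj (@projL_surj _ _ S)). Qed.
Lemma sub_exact M (S : submodule M) : exact_at (inclL S) (projL S).
move=> y; rewrite projL0; split=> [/inclLP//|[x <-]]; exact: inclL_in.
Qed.
Lemma dimK_sub_quot M (S : submodule M) : fin_dim M ->
 dimK M = (dimK (sub_mod S) + dimK (quot_mod S))%N.
apply: (dimK_exact (@inclL_inj _ _ S) (@projL_surj _ _ S)); exact: sub_exact.
Qed.
Lemma dimK_sub_lt M (S : submodule M) : fin_dim M ->
 (exists x, x \notin S) -> (dimK (sub_mod S) < dimK M)%N.
move=> fM [x xS]; rewrite (dimK_sub_quot S fM) -[X in (X < _)%N]addn0 ltn_add2l lt0n.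
apply/eqP => /(dimK0 (fin_dim_quot S fM)) z; case/negP: xS.
by apply/projL0; apply: z.
Qed.
End KMod.

(** * Fitting decomposition and Krull-Schmidt *)

Section KrullSchmidt.
Variables (K : fieldType) (A : pzAlgType K).
Implicit Types (M N P X Y Z : lmodType A).

Definition retract X M := exists (i : {linear X -> M}) (p : {linear M -> X}), cancel i p.

Fixpoint powL M (f : {linear M -> M}) n : {linear M -> M} :=
 if n is m.+1 then f \o powL f m else idfun.
Lemma powLE M (f : {linear M -> M}) n x : powL f n x = iter n f x.
by elim: n => //= n ->. Qed.

(** Choose n > 0 with ker f^n of maximal dimension. Then ker f^(2n) = ker f^n, so f^n is injective
    on its own image, and by dimension it is also onto there. *)
Lemma fitting M (f : {linear M -> M}) : fin_dim M -> exists n,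
 [/\ (0 < n)%N, forall x, iter n f (iter n f x) = 0 -> iter n f x = 0
  & forall x, exists y, iter n f x = iter n f (iter n f y)].
move=> fM; pose k n := dimK (sub_mod (kerS (powL f n))).
pose Q d := `[< exists2 n, (0 < n)%N & k n = d >].
have exQ : exists d, Q d by exists (k 1%N); apply/asboolP; exists 1%N.
have ubQ d : Q d -> (d <= dimK M)%N.
 by move=> /asboolP[n _ <-]; apply: dimK_le (@inclL_inj _ _ _) fM.
case: (ex_maxnP exQ ubQ) => d /asboolP[n n0 kn] dmax.
have le : (k (n + n)%N <= k n)%N.
 by rewrite kn; apply: dmax; apply/asboolP; exists (n + n)%N; rewrite ?addn_gt0 ?n0.
have gS (x : sub_mod (kerS (powL f n))) : inclL _ x \in kerS (powL f (n + n)).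
 have /kerSP := inclL_in x; rewrite powLE => e. by apply/kerSP; rewrite powLE iterD e -powLE linear0.
have [g gP] := corestr gS.
have gI : injective g.
 by move=> x y e; apply: (@inclL_inj _ _ (kerS (powL f n))); rewrite -!gP e.
have fS := fin_dim_sub (kerS (powL f (n + n))) fM.
have gB := inj_dimK_bij fS gI le.
have inj x : iter n f (iter n f x) = 0 -> iter n f x = 0.
 rewrite -iterD -powLE => /kerSP /inclLP[y yx]; rewrite -yx. have [z <-] := bij_surj gB y; rewrite gP -powLE; apply/kerSP; exact: inclL_in.
exists n; split=> // x.
have hS y : (powL f n \o inclL (imS (powL f n)) : {linear _ -> _}) y \in imS (powL f n).
 by apply/imSP; exists (inclL _ y).
have [h hP] := corestr hS.
have hI : injective h.
 apply/inj_ker => y y0; have : inclL (imS (powL f n)) (h y) = 0 by rewrite y0 linear0. rewrite hP /= powLE; have /imSP[z <-] := inclL_in y.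
 rewrite powLE => /inj e; apply: (@inclL_inj _ _ (imS (powL f n))). rewrite linear0; have /imSP[z' z'P] := inclL_in y.
 have := hP y; rewrite y0 linear0 /= -z'P !powLE => /esym /inj //.
have /inclLP[u uP] : powL f n x \in imS (powL f n) by apply/imSP; exists x.
have hB : bijective h by apply: endo_bij hI; apply: fin_dim_sub.
have [v vP] := bij_surj hB u.
have /imSP[w wP] := inclL_in v.
by exists w; rewrite -!powLE wP -[RHS]hP vP uP.
Qed.

Lemma iso_retract M N : iso_mod M N -> retract M N.
by move=> [f /linear_inv[g [fK gK]]]; exists f, g. Qed.
Lemma iso_sym M N : iso_mod M N -> iso_mod N M.
by move=> [f /linear_inv[g [fK gK]]]; exists g; exists f. Qed.
Lemma iso_trans M N P : iso_mod M N -> iso_mod N P -> iso_mod M P.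
move=> [f fB] [g gB]; exists (g \o f : {linear _ -> _}); exact: bij_comp.
Qed.
Lemma retract_trans X M N : retract X M -> retract M N -> retract X N.
move=> [i [p ip]] [j [q jq]]; exists (j \o i : {linear _ -> _}), (p \o q : {linear _ -> _}).
by move=> x /=; rewrite jq ip.
Qed.
Lemma iso_fin_dim M N : iso_mod M N -> fin_dim M -> fin_dim N.
by move=> [f fB]; apply: fin_dim_surj (bij_surj fB). Qed.
Lemma retract_fin_dim X M : retract X M -> fin_dim M -> fin_dim X.
by move=> [i [p ip]]; apply: fin_dim_inj (can_inj ip). Qed.

Lemma idem_iso M (e : {linear M -> M}) : (forall x, e (e x) = e x) ->
 iso_mod M (sub_mod (imS e) * sub_mod (kerS e))%type.
move=> ee; have fS x : e x \in imS e by apply/imSP; exists x.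
have [f fP] := corestr fS.
have dP x : (idfun \- e : {linear _ -> _}) x \in kerS e.
 by apply/kerSP; rewrite /= linearB /= ee subrr.
have [g gP] := corestr dP.
have hL : linear (fun x => (f x, g x)) by move=> a x y; rewrite !linearP.
exists (mkL hL); apply: bijP => [x y [/(congr1 (inclL _)) + /(congr1 (inclL _))]|[u v]].
 by rewrite !fP !gP /= => -> /addIr.
have /imSP[x xu] := inclL_in u; have /kerSP v0 := inclL_in v.
exists (inclL _ u + inclL _ v); congr pair; apply: (@inclL_inj).
 by rewrite fP linearD /= v0 addr0 -{1}xu ee.
by rewrite gP /= linearD /= v0 addr0 -{2}xu ee xu addrAC subrr add0r.
Qed.

Lemma retract_iso X M : retract X M -> summand X M.
move=> [i [p ip]]; pose e : {linear M -> M} := i \o p.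
have ee x : e (e x) = e x by rewrite /= ip.
exists (sub_mod (kerS e)); apply: iso_trans (idem_iso ee) _.
have xP x : i x \in imS e by apply/imSP; exists (i x); rewrite /= ip.
have [f fP] := corestr xP.
have fB : bijective f.
 apply: bijP => [x y /(congr1 (inclL _))|u]; first by rewrite !fP => /(can_inj ip). have /imSP[x xu] := inclL_in u; exists (p x); apply: (@inclL_inj).
 by rewrite fP -xu.
have [g [fK gK]] := linear_inv fB.
have hL : linear (fun z : sub_mod (imS e) * sub_mod (kerS e) => (g z.1, z.2)).
 by move=> a x y; rewrite linearP.
exists (mkL hL); exists (fun z => (f z.1, z.2)) => -[x y] /=; first by rewrite gK.
by rewrite fK.
Qed.

Lemma summand_retract X M : summand X M -> retract X M.
move=> [Y /iso_sym/iso_retract h]; apply: retract_trans h.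
by exists (inlL X Y), (fstL X Y).
Qed.

Lemma indec_retract X Y : indecomposable Y -> ~ zero_mod X ->
 forall (i : {linear X -> Y}) (p : {linear Y -> X}), cancel i p -> bijective i.
move=> [_ Yi] X0 i p ip; pose e : {linear Y -> Y} := i \o p.
have ee x : e (e x) = e x by rewrite /= ip.
have [Z0|Z0] := Yi _ _ (idem_iso ee).
 case: X0 => x; apply: (can_inj ip); rewrite linear0. have /inclLP[u <-] : i x \in imS e by apply/imSP; exists (i x); rewrite /= ip.
 by rewrite (Z0 u) linear0.
exists p => // y; apply/eqP; rewrite -subr_eq0 -oppr_eq0 opprB.
have /inclLP[u uP] : y - i (p y) \in kerS e by apply/kerSP; rewrite /= !linearB /= ip subrr.
by rewrite -uP (Z0 u) linear0.
Qed.

(** Fitting splits X into ker f^n and im f^n, and one of the two summands has to vanish. *)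
Lemma indec_endo X (f : {linear X -> X}) : indecomposable X -> fin_dim X ->
 bijective f \/ exists n, forall x, iter n f x = 0.
move=> [X0 Xi] fX; have [n [n0 nI nS]] := fitting f fX.
pose g := powL f n.
have fK x := erefl (iter n f x).
have hL : linear (fun z : sub_mod (kerS g) * sub_mod (imS g) => inclL _ z.1 + inclL _ z.2).
 by move=> a x y; rewrite !linearP scalerDr addrACA.
have hB : bijective (mkL hL).
 apply: bijP.
  apply/inj_ker => -[x y] /= e. have /kerSP x0 := inclL_in x; have /imSP[z yz] := inclL_in y. have y0 : inclL _ y = 0.
   have : g (inclL _ x + inclL _ y) = 0 by rewrite e linear0. by rewrite linearD x0 add0r /= -yz /g !powLE; apply: nI.
  move: e; rewrite y0 addr0 => e. by congr pair; apply: (@inclL_inj); rewrite ?e ?y0 linear0.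
 move=> x; have [y yP] := nS x. have /inclLP[u uP] : x - g y \in kerS g by apply/kerSP; rewrite linearB /= /g !powLE -yP subrr.
 have /inclLP[v vP] : g y \in imS g by apply/imSP; exists y. by exists (u, v); rewrite /= uP vP subrK.
have [|Z0|Z0] := Xi (sub_mod (kerS g)) (sub_mod (imS g)).
- by apply: iso_sym; exists (mkL hL).
- left; apply: endo_bij => //; apply/inj_ker => x fx.
 have /inclLP[u <-] : x \in kerS g; last by rewrite (Z0 u) linear0. apply/kerSP; rewrite /g powLE; case: {hL hB g nI nS fK Z0} n n0 => // n _.
 by rewrite iterSr fx -powLE linear0.
right; exists n => x; rewrite -powLE.
by have /inclLP[u <-] : g x \in imS g; [apply/imSP; exists x | rewrite (Z0 u) linear0].
Qed.

(* the non-invertible endomorphisms are closed under sums: End X is local *)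
Lemma indec_local X (I : Type) (r : seq I) (f : I -> {linear X -> X}) (h : {linear X -> X}) :
 indecomposable X -> fin_dim X -> bijective h -> (forall x, h x = \sum_(i <- r) f i x) -> exists i, bijective (f i).
move=> iX fX; elim: r h => [|i r IHr] h hB hE.
 case: iX => -[] x; apply: (bij_inj hB); by rewrite !hE !big_nil.
have [h' [hK h'K]] := linear_inv hB.
pose u : {linear X -> X} := h' \o f i.
have [uB|[n un]] := indec_endo u iX fX.
 exists i; have -> : f i = h \o u :> (X -> X) by apply/funext => x /=; rewrite h'K. exact: bij_comp.
apply: (IHr (h \- f i : {linear _ -> _})); last by move=> x /=; rewrite hE big_cons addrAC subrr add0r.
apply: endo_bij => //; apply/inj_ker => x /= /eqP; rewrite subr_eq0 => /eqP e.
have ux : u x = x by rewrite /= -e hK.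
by rewrite -(un x); elim: n {un} => //= n <-; rewrite [h' _]ux.
Qed.

(** A direct sum decomposition given by its inclusions and projections, which avoids building the
    direct sum of a dependent family of modules. *)
Definition decomp M (J : finType) (Y : J -> lmodType A) :=
 exists (i : forall j, {linear Y j -> M}) (p : forall j, {linear M -> Y j}), [/\ forall x, x = \sum_j i j (p j x), forall j x, p j (i j x) = x
  & forall j l x, j != l -> p j (i l x) = 0].

Lemma decomp_retract M (J : finType) (Y : J -> lmodType A) j : decomp M Y -> retract (Y j) M.
by move=> [i [p [_ pi _]]]; exists (i j), (p j); exact: pi. Qed.

Lemma decomp_iso M N (J : finType) (Y : J -> lmodType A) (Z : J -> lmodType A) :
 decomp M Y -> decomp N Z -> (forall j, iso_mod (Y j) (Z j)) -> iso_mod M N.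
move=> [i [p [s pi pi0]]] [k [q [t qk qk0]]] YZ.
pose f j := projT1 (cid (YZ j)); have fB j : bijective (f j) := projT2 (cid (YZ j)).
pose g j := projT1 (cid (linear_inv (fB j))).
have gP j : cancel (f j) (g j) /\ cancel (g j) (f j) := projT2 (cid (linear_inv (fB j))).
have aL : linear (fun x => \sum_j k j (f j (p j x))).
 move=> a x y; rewrite scaler_sumr -big_split; apply: eq_bigr => j _ /=. by rewrite !linearP.
exists (mkL aL); exists (fun y => \sum_j i j (g j (q j y))) => x /=.
 rewrite [RHS]s; apply: eq_bigr => j _; rewrite linear_sum (bigD1 j) //= qk. by rewrite big1 ?addr0 ?(gP j).1 // => l lj; rewrite qk0 // eq_sym.
rewrite [RHS]t; apply: eq_bigr => j _; rewrite linear_sum (bigD1 j) //= pi.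
by rewrite big1 ?addr0 ?(gP j).2 // => l lj; rewrite pi0 // eq_sym.
Qed.

Lemma decomp_fin_dim M (J : finType) (Y : J -> lmodType A) : decomp M Y -> fin_dim M ->
 forall j, fin_dim (Y j).
by move=> dM fM j; apply: retract_fin_dim (decomp_retract j dM) fM. Qed.

(** Exchange: inserting the identity of M as the sum of the i_j p_j writes the bijection b a as a
    sum of endomorphisms of X, and End X is local, so some summand is bijective. *)
Lemma krull_schmidt X M (J : finType) (Y : J -> lmodType A)
  (a : {linear X -> M}) (b : {linear M -> X}) (i : forall j, {linear Y j -> M}) (p : forall j, {linear M -> Y j}) :
 indecomposable X -> fin_dim X -> bijective (b \o a) -> (forall x, x = \sum_j i j (p j x)) -> exists j, bijective (b \o (i j \o (p j \o a))).
move=> iX fX bB s.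
apply: (@indec_local X J (enum J) (fun j => b \o (i j \o (p j \o a))) (b \o a) iX fX bB) => x.
by rewrite /= {1}[a x]s linear_sum big_enum.
Qed.

Lemma bij_retract X Y (a : {linear X -> Y}) (b : {linear Y -> X}) :
 indecomposable Y -> ~ zero_mod X -> bijective (b \o a) -> bijective a /\ bijective b.
move=> iY X0 bB; have [h [hK h'K]] := linear_inv (f := b \o a : {linear _ -> _}) bB.
have aB : bijective a by apply: (@indec_retract _ _ iY X0 a (h \o b)) => x; apply: hK.
split=> //; have [a' aK a'K] := aB.
by exists (a \o h) => y /=; [rewrite -[y]a'K; congr (a _); apply: hK | apply: h'K].
Qed.

Lemma krull_schmidt_iso X M (J : finType) (Y : J -> lmodType A) :
 indecomposable X -> fin_dim X -> retract X M -> decomp M Y -> (forall j, indecomposable (Y j)) -> exists j, iso_mod X (Y j).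
move=> iX fX [a [b ab]] [i [p [s _ _]]] iY.
have ba : bijective (b \o a) by exists id => x /=; rewrite ab.
have [j jB] := krull_schmidt iX fX ba s; exists j, (p j \o a : {linear _ -> _}).
have [] // := @bij_retract X (Y j) (p j \o a) (b \o i j) (iY j) iX.1.
Qed.

Lemma indec_iso X Y : iso_mod X Y -> indecomposable X -> indecomposable Y.
move=> XY [X0 Xi]; split=> [Y0|Z T /(iso_trans XY)/Xi//].
by have [f [g fK gK]] := XY; case: X0 => x; rewrite -[x]fK (Y0 (f x)) -(fK 0) (Y0 (f 0)).
Qed.

Lemma decomp_num M (J : finType) (Y : J -> lmodType A) : fin_dim M -> decomp M Y ->
 (forall j, indecomposable (Y j)) -> (forall i j, iso_mod (Y i) (Y j) -> i = j) -> num_indec_summands M #|J|.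
move=> fM dM iY Yij; exists (fun i => Y (enum_val i)); split=> [i|i j|X iX /summand_retract rX].
- by split=> //; apply: retract_iso; apply: decomp_retract.
- by move/Yij/enum_val_inj.
have [j jP] := krull_schmidt_iso iX (retract_fin_dim rX fM) rX dM iY.
by exists (enum_rank j); rewrite enum_rankK.
Qed.

(** If X x X were a summand, exchange would place both copies of X at the same index j, since the Y
    j are pairwise non-isomorphic; the map between the two copies through Y j is then bijective,
    although they are independent in M. *)
Lemma decomp_basic M (J : finType) (Y : J -> lmodType A) : fin_dim M -> decomp M Y ->
 (forall j, indecomposable (Y j)) -> (forall i j, iso_mod (Y i) (Y j) -> i = j) -> basic M.
move=> fM [i [p [s pi pi0]]] iY Yij X iX /summand_retract [a [b ab]].
have rX : retract X (X * X)%type by exists (inlL X X), (fstL X X).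
have fX : fin_dim X.
 by apply: (retract_fin_dim _ fM); apply: retract_trans rX _; exists a, b.
pose a1 : {linear X -> M} := a \o inlL X X; pose a2 : {linear X -> M} := a \o inrL X X.
pose b1 : {linear M -> X} := fstL X X \o b; pose b2 : {linear M -> X} := sndL X X \o b.
have B1 : bijective (b1 \o a1) by exists id => x /=; rewrite ab.
have B2 : bijective (b2 \o a2) by exists id => x /=; rewrite ab.
have [j jB] := krull_schmidt iX fX B1 s; have [l lB] := krull_schmidt iX fX B2 s.
have [P1 I1] := @bij_retract X (Y j) (p j \o a1) (b1 \o i j) (iY j) iX.1 jB.
have [P2 I2] := @bij_retract X (Y l) (p l \o a2) (b2 \o i l) (iY l) iX.1 lB.
have X1 : iso_mod X (Y j) by exists (p j \o a1 : {linear _ -> _}).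
have X2 : iso_mod X (Y l) by exists (p l \o a2 : {linear _ -> _}).
have lj : l = j by apply: Yij; apply: iso_trans (iso_sym X2) X1.
move: lj P2 I2 {X2} lB => -> P2 I2 _.
pose h : {linear X -> X} := (b1 \o i j) \o (p j \o a2).
have hB : bijective h by apply: bij_comp.
have zL : linear ((fun=> 0) : X -> X) by move=> k x y; rewrite scaler0 addr0.
(* Since b1 a2 = 0, the bijection [h] through Y j is minus the sum of the other terms. By locality
   one of these is bijective, which gives Y k isomorphic to Y j for some k other than j. *)
pose g k : {linear X -> X} := if k == j then mkL zL else (b1 \o i k) \o ((\- p k) \o a2).
have [|k] := @indec_local X J (enum J) g h iX fX hB.
 move=> x; rewrite big_enum (bigD1 j) //= /g eqxx add0r. have : b1 (\sum_j i j (p j (a2 x))) = 0 by rewrite -s /= ab.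
 rewrite linear_sum (bigD1 j) //= => /eqP; rewrite addr_eq0 => /eqP->. by rewrite -sumrN; apply: eq_bigr => k /negbTE -> /=; rewrite !linearN.
rewrite /g; case: eqP => [_ zB|kj gB].
 by case: iX.1 => x; apply: (bij_inj zB).
have [_ J1] := @bij_retract X (Y k) ((\- p k) \o a2) (b1 \o i k) (iY k) iX.1 gB.
case: kj; apply: Yij; apply: iso_trans _ X1.
by exists (b1 \o i k : {linear _ -> _}).
Qed.

Lemma decomp_isoM M N (J : finType) (Y : J -> lmodType A) : iso_mod M N -> decomp N Y -> decomp M Y.
move=> [f /linear_inv[g [fK gK]]] [i [p [s pi pi0]]].
exists (fun j => g \o i j), (fun j => p j \o f); split=> [x|j x|j l x jl] /=.
- by rewrite -[LHS]fK [f x in LHS]s linear_sum.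
- by rewrite gK pi.
by rewrite gK pi0.
Qed.

Definition sum_family (J L : Type) (Y : J -> lmodType A) (Z : L -> lmodType A) (j : J + L) :
 lmodType A := match j with inl a => Y a | inr b => Z b end.

Lemma decomp_prod M N (J L : finType) (Y : J -> lmodType A) (Z : L -> lmodType A) :
 decomp M Y -> decomp N Z -> decomp (M * N)%type (sum_family Y Z).
move=> [i [p [s pi pi0]]] [k [q [t qk qk0]]].
pose a (j : J + L) : {linear sum_family Y Z j -> (M * N)%type} :=
 match j with inl x => inlL M N \o i x | inr y => inrL M N \o k y end.
pose b (j : J + L) : {linear (M * N)%type -> sum_family Y Z j} :=
 match j with inl x => p x \o fstL M N | inr y => q y \o sndL M N end.
exists a, b; split=> [x|[x|x] y|[x|x] [y|y] z] /=.
- rewrite big_sumType /= {1}[x]pair_sum [x.1 in LHS]s [x.2 in LHS]t !linear_sum.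
 by congr (_ + _).
- exact: pi.
- exact: qk.
- by move=> xy; apply: pi0.
- by rewrite linear0.
- by rewrite linear0.
by move=> xy; apply: qk0.
Qed.

Lemma dimK_prod M N : fin_dim M -> fin_dim N -> dimK (M * N)%type = (dimK M + dimK N)%N.
move=> fM fN; apply: (@dimK_exact _ _ _ _ _ (inlL M N) (sndL M N)).
- by move=> x y [].
- by move=> y; exists (0, y).
- by case=> x y; split=> [/= ->|[z [_ <-]]//]; exists x.
exact: fin_dim_prod.
Qed.

Lemma indec_decomp M : fin_dim M -> exists (J : finType) (Y : J -> lmodType A),
 (forall j, indecomposable (Y j)) /\ decomp M Y.
have [n] := ubnP (dimK M); elim: n M => // n IHn M ltMn fM.
have [M0|M0] := pselect (zero_mod M).
 exists void, (fun=> M); split=> [[]//|]. exists (fun=> idfun), (fun=> idfun); split=> [x|[]|[]] //. by rewrite (M0 x) big1 // => -[].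
have [iM|iM] := pselect (indecomposable M).
 exists unit, (fun=> M); split=> [//|]. exists (fun=> idfun), (fun=> idfun); split=> [x|[]|[] []] //. by rewrite (big_pred1 tt) // => -[].
have [X [Z [XZ X0 Z0]]] : exists X Z, [/\ iso_mod M (X * Z)%type, ~ zero_mod X & ~ zero_mod Z].
 apply: contrapT => h; apply: iM; split=> // X Z XZ; apply: contrapT => /not_orP[X0 Z0]. by apply: h; exists X, Z.
have fXZ := iso_fin_dim XZ fM.
have fX : fin_dim X by apply: fin_dim_surj (fstL X Z) _ fXZ => x; exists (x, 0).
have fZ : fin_dim Z by apply: fin_dim_surj (sndL X Z) _ fXZ => x; exists (0, x).
have dM : dimK M = (dimK X + dimK Z)%N.
 rewrite -dimK_prod //; have [f /bij_inj fI] := XZ; have [g /bij_inj gI] := iso_sym XZ. by apply/eqP; rewrite eqn_leq (dimK_le fI) // (dimK_le gI).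
have dX : (0 < dimK X)%N by rewrite lt0n; apply/eqP => /(dimK0 fX).
have dZ : (0 < dimK Z)%N by rewrite lt0n; apply/eqP => /(dimK0 fZ).
have [|J [Y [iY dY]]] := IHn X _ fX.
 by apply: leq_trans (_ : dimK M <= n)%N; rewrite // dM -addn1 leq_add2l.
have [|L [T [iT dT]]] := IHn Z _ fZ.
 by apply: leq_trans (_ : dimK M <= n)%N; rewrite // dM -add1n leq_add2r.
exists (J + L)%type, (sum_family Y T).
by split=> [[]//|]; apply: decomp_isoM XZ _; apply: decomp_prod.
Qed.

(** Two isomorphic summands Y i, Y j of a decomposition would give a summand Y i x Y i, against
    basicness; Krull-Schmidt then matches the summands with the m classes that are counted. *)
Lemma basic_num M m : fin_dim M -> basic M -> num_indec_summands M m ->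
 exists (J : finType) (Y : J -> lmodType A), [/\ forall j, indecomposable (Y j), decomp M Y,
  forall i j, iso_mod (Y i) (Y j) -> i = j & #|J| = m].
move=> fM bM [X [iX Xij Xall]]; have [J [Y [iY dY]]] := indec_decomp fM.
have Yij i j : iso_mod (Y i) (Y j) -> i = j.
 move=> [f /linear_inv[g [fK gK]]]; apply/eqP/negPn/negP => ij. apply: (bM (Y i)) => //; apply: retract_iso. have [a [b [_ ba ba0]]] := dY.
 have cL : linear (fun z : Y i * Y i => a i z.1 + a j (f z.2)).
  by move=> k x y; rewrite !linearP scalerDr addrACA.
 have dL : linear (fun z : M => (b i z, g (b j z))) by move=> k x y; rewrite !linearP.
 exists (mkL cL), (mkL dL) => -[x y]; congr pair; rewrite /= linearD /= ba.
  by rewrite ba0 ?addr0.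
 by rewrite ba0 ?add0r ?fK // eq_sym.
exists J, Y; split=> //.
have fYj := decomp_fin_dim dY fM.
have uP i : exists j, iso_mod (X i) (Y j).
 have [iXi /summand_retract rX] := iX i. by apply: krull_schmidt_iso iXi (retract_fin_dim rX fM) rX dY iY.
have vP j : exists i, iso_mod (Y j) (X i).
 by apply: Xall => //; apply: retract_iso; apply: decomp_retract.
have [u {}uP] := choice uP; have [v {}vP] := choice vP.
apply/eqP; rewrite eqn_leq -{2}(card_ord m) -{1}(card_ord m).
rewrite (leq_card v) ?(leq_card u) // => [i j e|i j e].
 by apply: Xij; apply: iso_trans (uP i) _; rewrite e; apply: iso_sym.
by apply: Yij; apply: iso_trans (vP i) _; rewrite e; apply: iso_sym.
Qed.
End KrullSchmidt.

(** * K-duality of finite dimensional modules *)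

Section Dual.
Variables (K : fieldType) (A : pzAlgType K).
Implicit Types (M N : lmodType A).

Definition dualm M : lmodType (A^c)%type := dual_mod M.

Lemma dualP M (phi : dual_mod M) k x y :
 phi ((pzscal k : A) *: x + y) = k * phi x + phi y.
by have /asboolP := dual_funP phi; apply. Qed.
Lemma dualL M (phi : dual_mod M) : linear (phi : kmod M -> K^o).
by move=> k x y; apply: dualP. Qed.
Definition dual_lin M (phi : dual_mod M) : {linear kmod M -> K^o} := mkL (@dualL M phi).
Lemma dual0 M (phi : dual_mod M) : phi 0 = 0. exact: (linear0 (dual_lin phi)). Qed.
Lemma dualD M (phi : dual_mod M) x y : phi (x + y) = phi x + phi y.
exact: (linearD (dual_lin phi)). Qed.
Lemma dualB M (phi : dual_mod M) x y : phi (x - y) = phi x - phi y.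
exact: (linearB (dual_lin phi)). Qed.
Lemma dual_sum M (phi : dual_mod M) (I : Type) (r : seq I) (x : I -> M) :
 phi (\sum_(i <- r) x i) = \sum_(i <- r) phi (x i).
exact: (linear_sum (dual_lin phi)). Qed.

Lemma dualZ M (phi : dual_mod M) k x : phi ((pzscal k : A) *: x) = k * phi x.
by rewrite -[_ *: _]addr0 dualP dual0 addr0. Qed.
Lemma dual_coord M (phi : dual_mod M) d (g : {linear 'rV[K]_d -> kmod M}) v :
 phi (g v) = \sum_j v 0 j * phi (g (delta_mx 0 j)).
rewrite {1}(row_sum_delta v) linear_sum dual_sum; apply: eq_bigr => j _.
by rewrite linearZ; apply: dualZ.
Qed.

Lemma transp_subproof M N (f : {linear M -> N}) (phi : dual_mod N) :
 linear ((fun x => phi (f x)) : kmod M -> K^o).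
by move=> k x y; rewrite kscaleE linearP dualP. Qed.

Fact mkdual_subproof M (f : {linear kmod M -> K^o}) : (f : M -> K^o) \in @Klinear_pred K A M.
by apply/asboolP => k x y; apply: (linearP f). Qed.
Definition mkdual M (f : {linear kmod M -> K^o}) : dual_mod M := DualMod (mkdual_subproof f).

Lemma dual_eq M (phi psi : dual_mod M) : (forall x, phi x = psi x) -> phi = psi.
by move=> e; apply/val_inj/funext. Qed.
Lemma dual_addE M (phi psi : dual_mod M) x : (phi + psi) x = phi x + psi x. by []. Qed.
Lemma dual_subE M (phi psi : dual_mod M) x : (phi - psi) x = phi x - psi x. by []. Qed.
Lemma dual_scaleE M (a : A) (phi : dual_mod M) x : ((a : A^c) *: phi) x = phi (a *: x).
by []. Qed.
Lemma dual_zeroE M x : (0 : dual_mod M) x = 0. by []. Qed.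

Fact transp_linear M N (f : {linear M -> N}) :
 linear (fun phi : dualm N => mkdual (mkL (transp_subproof f phi)) : dualm M).
by move=> a phi psi; apply: dual_eq => x; rewrite dual_addE dual_scaleE /= linearZ. Qed.
Definition transp M N (f : {linear M -> N}) : {linear dualm N -> dualm M} := mkL (transp_linear f).
Lemma transpE M N (f : {linear M -> N}) (phi : dual_mod N) x : (transp f phi : dual_mod M) x = phi (f x).
by []. Qed.

Lemma dual_sep M x : fin_dim M -> (forall phi : dual_mod M, phi x = 0) -> x = 0.
move=> /fin_dimP fM h; apply/eqP/negPn/negP => x0.
have S0 : submod_closed (fun y : kmod M => y == 0).
 by split=> [|a y z]; rewrite /in_mem /= ?eqxx // => /eqP-> /eqP->; rewrite scaler0 addr0.
have [phi [_]] := @sep_functional _ (kmod M) (Submodule S0) x fM x0.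
by rewrite (_ : phi x = 0) ?eqxx //; apply: (h (mkdual phi)).
Qed.

Lemma dual_dual M (Phi : {linear kmod (dualm M) -> K^o}) : fin_dim M ->
 exists m, forall phi, Phi phi = phi m.
move=> /fin_dimP[d [f /linear_inv[g [fK gK]]]].
have cL j : linear ((fun x => f x 0 j) : kmod M -> K^o) by move=> a x y; rewrite linearP !mxE.
pose c j := mkdual (mkL (cL j)).
exists (\sum_j (pzscal (Phi (c j)) : A) *: g (delta_mx 0 j)) => phi.
have -> : phi = \sum_j (pzscal (phi (g (delta_mx 0 j))) : A^c) *: c j.
 apply: dual_eq => x; rewrite -{1}[x]fK dual_coord. have -> : (\sum_j (pzscal (phi (g (delta_mx 0 j))) : A^c) *: c j) x =
  \sum_j ((pzscal (phi (g (delta_mx 0 j))) : A^c) *: c j) x. by elim/big_rec2: _ => // j y z _ <-.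
 by apply: eq_bigr => j _; rewrite dual_scaleE dualZ mulrC.
rewrite (linear_sum Phi) dual_sum; apply: eq_bigr => j _.
rewrite dualZ -[X in Phi X]/(phi (g (delta_mx 0 j)) *: (c j : kmod (dualm M))) linearZ /=.
rewrite [LHS]mulrC; congr (_ * _).
have -> : (\sum_i (pzscal (phi (g (delta_mx 0 i))) : A^c) *: c i) (g (delta_mx 0 j)) =
  \sum_i ((pzscal (phi (g (delta_mx 0 i))) : A^c) *: c i) (g (delta_mx 0 j)).
 by elim/big_rec2: _ => // i y z _ <-.
rewrite (bigD1 j) //= big1 ?addr0 => [|i /negbTE ij].
 rewrite -[X in f X]/(phi (g (delta_mx 0 j)) *: (g (delta_mx 0 j) : kmod M)). by rewrite linearZ gK !mxE !eqxx mulr1.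
rewrite -[X in f X]/(phi (g (delta_mx 0 i)) *: (g (delta_mx 0 j) : kmod M)).
by rewrite linearZ gK !mxE eqxx ij mulr0.
Qed.

Lemma fin_dim_dual M : fin_dim M -> fin_dim (dualm M).
move=> /fin_dimP[d [f /linear_inv[g [fK gK]]]]; apply/fin_dimP.
have hL : linear (fun phi : kmod (dualm M) => \row_j phi (g (delta_mx 0 j))).
 move=> a phi psi; apply/rowP => j; rewrite !mxE dual_addE; congr (_ + _). by rewrite dual_scaleE dualZ.
apply: (@fd_inj _ _ _ (mkL hL) _ (fd_rV _ _)) => phi psi /rowP e; apply: dual_eq => x.
rewrite -[x]fK !dual_coord; apply: eq_bigr => j _; congr (_ * _).
by have := e j; rewrite !mxE.
Qed.

(** Otherwise some functional on the dual space separates [phi] from [S]; by biduality it is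
    evaluation at an element m, which contradicts the hypothesis at m. *)
Lemma dual_perp M (S : submodule (kmod (dualm M))) (phi : dual_mod M) : fin_dim M ->
 (forall m, (forall psi : dual_mod M, psi \in S -> psi m = 0) -> phi m = 0) -> phi \in S.
move=> fM h; apply/negPn/negP => phiS.
have /fin_dimP fD := fin_dim_dual fM.
have [Phi [PhiS /negP[]]] := sep_functional fD phiS.
have [m mP] := dual_dual Phi fM; rewrite mP h // => psi psiS.
by rewrite -mP PhiS.
Qed.

Lemma transp_surj M N (f : {linear M -> N}) : fin_dim N -> injective f -> surjective_fun (transp f).
move=> fN fI phi; have fM := fin_dim_inj fI fN.
have [s sP] := gen_inv (kmap f) (proj1 (fin_dimP _) fM) (proj1 (fin_dimP _) fN).
exists (mkdual (dual_lin phi \o s)); apply: dual_eq => x; rewrite transpE /=; congr (phi _).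
exact/fI/sP.
Qed.

Lemma transp_inj M N (f : {linear M -> N}) : surjective_fun f -> injective (transp f).
move=> fS phi psi e; apply: dual_eq => y; have [x <-] := fS y.
by rewrite -!transpE e.
Qed.

End Dual.

(** * Projective covers and minimal presentations *)

Section Projective.
Variables (K : fieldType) (A : pzAlgType K).
Hypothesis fA : fin_dim (A^o)%type.
Implicit Types (M N P : lmodType A).

Definition freem r : lmodType A := {ffun 'I_r -> A^o}.

Fact free_map_linear r N (v : 'I_r -> N) : linear (fun x : freem r => \sum_i (x i : A) *: v i).
move=> a x y; rewrite scaler_sumr -big_split; apply: eq_bigr => i _ /=.
by rewrite !ffunE scalerDl scalerA.
Qed.
Definition free_map r N (v : 'I_r -> N) : {linear freem r -> N} := mkL (free_map_linear v).
Definition free_unit r (i : 'I_r) : freem r := [ffun j => if j == i then 1 else 0].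
Lemma free_mapE r N (v : 'I_r -> N) i : free_map v (free_unit i) = v i.
rewrite /= (bigD1 i) //= ffunE eqxx scale1r big1 ?addr0 // => j /negbTE h.
by rewrite ffunE h scale0r.
Qed.
Lemma free_ext r N (f g : {linear freem r -> N}) :
 (forall i, f (free_unit i) = g (free_unit i)) -> f =1 g.
move=> e x; have -> : x = \sum_i (x i : A) *: free_unit i.
 apply/ffunP => j; rewrite sum_ffunE (bigD1 j) //= !ffunE eqxx big1 ?addr0 ?[_ *: _]mulr1 //.
 by move=> i; rewrite !ffunE eq_sym => /negbTE->; rewrite [_ *: _]mulr0.
by rewrite !linear_sum; apply: eq_bigr => i _; rewrite !linearZ /= e.
Qed.

Lemma free_projective r : projective (freem r).
move=> M N g f _ _ gS; have [s sP] := choice gS.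
exists (free_map (fun i => s (f (free_unit i)))).
apply: (@free_ext _ _ (g \o free_map (fun i => s (f (free_unit i))))) => i.
by rewrite /= -[X in g X]/(free_map _ _) free_mapE sP.
Qed.

Lemma free_surj M : fin_dim M -> exists r (f : {linear freem r -> M}), surjective_fun f.
move=> [b bP]; exists (size b), (free_map (fun i => b`_i)) => x; have [c cP] := bP x.
by exists [ffun i : 'I_(size b) => pzscal (c i)]; rewrite cP; apply: eq_bigr => i _; rewrite ffunE.
Qed.

Lemma retract_projective P M : retract P M -> projective M -> projective P.
move=> [i [p ip]] pM N Q g f fN fQ gS.
by have [h hP] := pM _ _ g (f \o p) fN fQ gS; exists (h \o i) => x /=; rewrite hP /= ip.
Qed.

Lemma projective_retract P : fin_dim P -> projective P -> exists r, retract P (freem r).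
move=> fP pP; have [r [f fS]] := free_surj fP; exists r.
by have [h hP] := pP _ _ f idfun (fin_dim_ffun _ fA) fP fS; exists h, f.
Qed.

(** Take a projective P of minimal dimension mapping onto M. If S + ker p = P, then p lifts to an
    endomorphism g of P over M with image in S. By Fitting, the image of a power of g is a retract
    of P still mapping onto M, so minimality makes it P, and S = P. *)
Lemma projective_cover M : fin_dim M -> exists (P : lmodType A) (p : {linear P -> M}),
 [/\ fin_dim P, projective P, surjective_fun p & superfluous_ker p].
move=> fM; pose Q d := `[< exists (P : lmodType A) (p : {linear P -> M}),
 [/\ fin_dim P, projective P, surjective_fun p & dimK P = d] >].
have exQ : exists d, Q d.
 have [r [f fS]] := free_surj fM; exists (dimK (freem r)); apply/asboolP. by exists (freem r), f; split=> //; [apply: fin_dim_ffun | apply: free_projective].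
case: (ex_minnP exQ) => d /asboolP[P [p [fP pP pS dP]]] dmin.
exists P, p; split=> // S SP.
have pSS : surjective_fun (p \o inclL S).
 move=> y; have [x xy] := pS y; have [z zS /eqP] := SP x. have [z' <-] := inclLP zS; rewrite linearB subr_eq0 => /eqP e; exists z'. by rewrite /= -e.
have [h hP] := pP _ _ (p \o inclL S) p (fin_dim_sub S fP) fM pSS.
pose g : {linear P -> P} := inclL S \o h.
have [n [n0 nI nS]] := fitting g fP.
have pg k x : p (iter k g x) = p x by elim: k => //= k <-; rewrite -[RHS]hP.
pose G := powL g n; pose T := sub_mod (imS G).
have rT : retract T P.
 have GS (x : P) : G x \in imS G by apply/imSP; exists x. have [u uP] := corestr GS. have uI : injective (u \o inclL (imS G)).
  apply/inj_ker => x /= /(congr1 (inclL _)); rewrite uP linear0 => e. apply: (@inclL_inj _ _ (imS G)); rewrite linear0. have /imSP[y yx] := inclL_in x.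
  by move: e; rewrite -[sub_incl x]/(inclL (imS G) x) -yx /G !powLE => /nI.
 have fT : fin_dim T by apply: fin_dim_sub. have [v [uvK vuK]] := linear_inv (endo_bij fT uI).
 by exists (inclL (imS G)), (v \o u) => x /=; rewrite -[RHS]uvK.
have [//|xS] := pselect (forall x, x \in S).
have fT := fin_dim_sub (imS G) fP.
have TS : surjective_fun (p \o inclL (imS G)).
 move=> y; have [x xy] := pS y. have /inclLP[z zP] : G x \in imS G by apply/imSP; exists x. by exists z; rewrite /= zP /G powLE pg.
have : Q (dimK T).
 by apply/asboolP; exists T, (p \o inclL (imS G)); split=> //; apply: retract_projective rT pP.
move=> /dmin; rewrite leqNgt -dP => /negP[]; apply: dimK_sub_lt => //.
have [x xN] : exists x, x \notin S.
 by apply: contrapT => /forallNP xSN; case: xS => x; apply/negPn/negP/xSN.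
exists x; apply: contra xN => /imSP[y <-]; rewrite /G powLE.
by case: (n) n0 => // m _ /=; apply: inclL_in.
Qed.

Lemma min_presentation M : fin_dim M -> exists (P1 P0 : lmodType A)
 (p1 : {linear P1 -> P0}) (p0 : {linear P0 -> M}), min_proj_presentation p1 p0.
move=> fM; have [P0 [p0 [f0 q0 s0 k0]]] := projective_cover fM.
have [P1 [p1 [f1 q1 s1 k1]]] := projective_cover (fin_dim_sub (kerS p0) f0).
exists P1, P0, (inclL (kerS p0) \o p1), p0; split=> //; last first.
 split=> // S SP; apply: k1 => x; have [y yS /= e] := SP x; exists y => //. by apply: (@inclL_inj _ _ (kerS p0)); rewrite linear0 -[RHS]e.
split=> // y; split=> [/kerSP/inclLP[z <-]|[x <-]].
 by have [x <-] := s1 z; exists x.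
by apply/kerSP; apply: inclL_in.
Qed.

(** The lifting form of Ext^1(X, M) = 0 for all X in [F]: maps to M extend along every monomorphism
    into a finite dimensional module whose cokernel is in [F]. *)
Definition ext_inj (F : lmodType A -> Prop) M := forall (Z1 Z Z2 : lmodType A)
 (i : {linear Z1 -> Z}) (p : {linear Z -> Z2}) (f : {linear Z1 -> M}), fin_dim Z -> injective i -> surjective_fun p -> exact_at i p -> F Z2 ->
 exists g : {linear Z -> M}, forall x, g (i x) = f x.
End Projective.

(** * tau^- -rigidity and Ext-injectivity *)

Section RightDual.
Variables (K : fieldType) (A : pzAlgType K).
Hypothesis fA : fin_dim ((A^c)^o)%type.
Implicit Types (M N : lmodType A) (P : lmodType (A^c)%type).

Lemma rdualP P (q : ring_dual P) (a : A) x y :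
 q ((a : A^c) *: x + y) = (q x : A) * a + q y.
by have /asboolP := ring_dual_funP q; apply. Qed.
Lemma rdual0 P (q : ring_dual P) : q 0 = 0.
by have := rdualP q 1 0 0; rewrite scale1r addr0 mulr1 => /eqP; rewrite addrC -subr_eq subrr eq_sym => /eqP. Qed.
Lemma rdualZ P (q : ring_dual P) (a : A) x : q ((a : A^c) *: x) = (q x : A) * a.
by rewrite -[_ *: x]addr0 rdualP rdual0 addr0. Qed.
Lemma rdualD P (q : ring_dual P) x y : q (x + y) = q x + q y.
by have := rdualP q 1 x y; rewrite scale1r mulr1. Qed.
Lemma rdual_sum P (q : ring_dual P) (I : Type) (r : seq I) (x : I -> P) :
 q (\sum_(i <- r) x i) = \sum_(i <- r) q (x i).
by elim/big_rec2: _ => [|i y z _ <-]; rewrite ?rdual0 ?rdualD. Qed.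
Lemma rdual_eq P (q r : ring_dual P) : (forall x, q x = r x) -> q = r.
by move=> e; apply/val_inj/funext. Qed.

Lemma dual_basis P : fin_dim P -> projective P ->
 exists (r : nat) (x : 'I_r -> P) (f : 'I_r -> ring_dual P),
  forall y, y = \sum_i (f i y : A^c) *: x i.
move=> fP pP; have [r [j [p jp]]] := projective_retract fA fP pP.
have fL i : (fun y : P => j y i : A^o) \in @rlinear_pred A P.
 by apply/asboolP => a x y; rewrite linearP !ffunE.
exists r, (fun i => p (@free_unit _ (A^c)%type r i)), (fun i => RingDual (fL i)) => y.
rewrite -{1}[y]jp; have -> : j y = \sum_i (j y i : A^c) *: @free_unit _ (A^c)%type r i.
 apply/ffunP => l; rewrite sum_ffunE (bigD1 l) //= !ffunE eqxx big1 ?addr0 ?[_ *: _]mulr1 //.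
 by move=> i; rewrite !ffunE eq_sym => /negbTE->; rewrite [_ *: _]mulr0.
by rewrite linear_sum; apply: eq_bigr => i _; rewrite linearZ.
Qed.

Fact pull_subproof (P Q : lmodType (A^c)%type) (u : {linear P -> Q}) (q : ring_dual Q) :
 (fun x : P => q (u x)) \in @rlinear_pred A P.
by apply/asboolP => a x y; rewrite linearP rdualP. Qed.
Definition pull0 P (Q : lmodType (A^c)%type) (u : {linear P -> Q}) q := RingDual (pull_subproof u q).
Fact pull_linear P (Q : lmodType (A^c)%type) (u : {linear P -> Q}) : linear (pull0 u).
by move=> a x y; apply: rdual_eq. Qed.
Definition pull P (Q : lmodType (A^c)%type) (u : {linear P -> Q}) : {linear ring_dual Q -> ring_dual P} :=
 mkL (pull_linear u).

(* [phi q] as a homomorphism from [P] to the dual of [M] *)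
Fact prod_linear P M (phi : dual_mod M) (q : ring_dual P) :
 linear (fun x => ((q x : A^c) *: phi : dualm M)).
move=> a x y; rewrite rdualP scalerDl; congr (_ + _).
by apply: dual_eq => m; rewrite !dual_scaleE scalerA.
Qed.
Definition prodL P M (phi : dual_mod M) (q : ring_dual P) : {linear P -> dualm M} :=
 mkL (prod_linear phi q).

(* Hom(P^*, M) and Hom(P, DM) are dual to each other *)
Lemma pairing_sep M (P1 P0 : lmodType (A^c)%type) (p1 : {linear P1 -> P0}) (h : {linear ring_dual P1 -> M}) :
 fin_dim M -> fin_dim P1 -> projective P1 -> fin_dim P0 -> projective P0 ->
 (forall psi : {linear P1 -> dualm M}, exists th : {linear P0 -> dualm M}, forall x, psi x = th (p1 x)) ->
 (forall q, h (pull p1 q) = 0) -> forall q, h q = 0.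
move=> fM f1 pp1 f0 pp0 psiP h0 q; apply: dual_sep => // phi.
have [r [x [f xf]]] := dual_basis f1 pp1; have [s [y [g yg]]] := dual_basis f0 pp0.
have [th thP] := psiP (prodL phi q).
have -> : q = \sum_i (q (x i) : A) *: f i.
 apply: rdual_eq => z; rewrite {1}(xf z) rdual_sum. have -> : (\sum_i (q (x i) : A) *: f i) z = \sum_i ((q (x i) : A) *: f i) z.
  by elim/big_rec2: _ => // i u v _ <-.
 by apply: eq_bigr => i _; rewrite rdualZ.
rewrite linear_sum dual_sum.
have E i : phi (h ((q (x i) : A) *: f i)) = \sum_l th (y l) ((g l (p1 (x i)) : A) *: h (f i)).
 rewrite linearZ -[LHS]/((prodL phi q (x i)) (h (f i))) thP {1}(yg (p1 (x i))) linear_sum. have -> : (\sum_l th ((g l (p1 (x i)) : A^c) *: y l)) (h (f i)) =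
   \sum_l (th ((g l (p1 (x i)) : A^c) *: y l)) (h (f i)).
  by elim/big_rec2: _ => // l u v _ <-.
 by apply: eq_bigr => l _; rewrite linearZ.
under eq_bigr do rewrite E.
rewrite exchange_big big1 // => l _; rewrite -dual_sum.
have -> : \sum_i (g l (p1 (x i)) : A) *: h (f i) = h (pull p1 (g l)).
 have -> : pull p1 (g l) = \sum_i (g l (p1 (x i)) : A) *: f i.
  apply: rdual_eq => z /=; rewrite {1}(xf z) linear_sum rdual_sum.
  have -> : (\sum_i (g l (p1 (x i)) : A) *: f i) z = \sum_i ((g l (p1 (x i)) : A) *: f i) z.
   by elim/big_rec2: _ => // i u v _ <-.
  by apply: eq_bigr => i _; rewrite linearZ rdualZ.
 by rewrite linear_sum; apply: eq_bigr => i _; rewrite linearZ.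
by rewrite h0 dual0.
Qed.

(** The double opposite of A is A only up to conversion; an explicit identity morphism allows the
    dual of a right module to be restricted to a left A-module. *)
Definition ldual_id : A -> (A^c)^c := id.
Fact ldual_id_zmod : zmod_morphism ldual_id. by []. Qed.
Fact ldual_id_monoid : monoid_morphism ldual_id. by []. Qed.
HB.instance Definition _ := GRing.isZmodMorphism.Build A ((A^c)^c)%type ldual_id ldual_id_zmod.
HB.instance Definition _ := GRing.isMonoidMorphism.Build A ((A^c)^c)%type ldual_id ldual_id_monoid.

Definition ldual P : lmodType A := restr_mod (ldual_id : {rmorphism A -> (A^c)^c}) (dualm P).

Definition lev P (x : P) (phi : ldual P) : K := (phi : dual_mod P) x.
Lemma levP P (x : P) (a : A) (phi psi : ldual P) :
 lev x (a *: phi + psi) = lev ((a : A^c) *: x) phi + lev x psi.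
by []. Qed.
Lemma levZ P (x : P) (a : A) (phi : ldual P) : lev ((a : A^c) *: x) phi = lev x (a *: phi).
by []. Qed.
Lemma levD P (x y : P) (phi : ldual P) : lev (x + y) phi = lev x phi + lev y phi.
exact: dualD. Qed.
Lemma lev0 P (x : P) : lev x 0 = 0. by []. Qed.
Lemma levB P (x : P) (phi psi : ldual P) : lev x (phi - psi) = lev x phi - lev x psi.
by []. Qed.
Lemma lev_lin P (phi : ldual P) : linear ((fun x => @lev P x phi) : kmod P -> K^o).
exact: dualL. Qed.
Lemma lev_eq P (phi psi : ldual P) : (forall x, lev x phi = lev x psi) -> phi = psi.
exact: dual_eq. Qed.
Definition mklev P (f : {linear kmod P -> K^o}) : ldual P := mkdual f.
Lemma mklevE P (f : {linear kmod P -> K^o}) x : lev x (mklev f) = f x.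
by []. Qed.

Definition Sub_ext_inj M := ext_inj (Sub_class M) M.

Lemma Sub_class_self M : fin_dim M -> Sub_class M M.
move=> fM; split=> //; exists 1%N, (singL M ord0) => x y /ffunP/(_ ord0).
by rewrite !ffunE eqxx.
Qed.

(** By [pairing_sep], surjectivity of Hom(P0, DM) -> Hom(P1, DM) is what makes Hom(tau^- M, M)
    vanish. Ext-injectivity corrects a given [psi] up to an error vanishing on a submodule of M, and
    minimality of the presentation removes that error. *)
Lemma ext_inj_lift M (P1 P0 : lmodType (A^c)%type) (p1 : {linear P1 -> P0})
  (p0 : {linear P0 -> dualm M}) :
 fin_dim M -> Sub_ext_inj M -> min_proj_presentation p1 p0 ->
 forall psi : {linear P1 -> dualm M}, exists th : {linear P0 -> dualm M}, forall x, psi x = th (p1 x).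
move=> fM eM [[f1 f0] [pp1 pp0] [ex s0] [k1 _]] psi.
(* Z is the pullback of D P0 and M over D P1, along the duals of [p1] and [psi]. Its projection to M
   has image in Sub M, and the kernel Z1 of that projection maps to M, since D P0 contains M through
   [j], the dual of [p0]. *)
have ZP : submod_closed (fun z : (ldual P0 * M)%type =>
  `[< forall x, lev (p1 x) z.1 = psi x z.2 >]).
 split=> [|a z w /asboolP zP /asboolP wP]; apply/asboolP => x.
  by rewrite lev0 dual0.
 rewrite [in LHS](_ : (a *: z + w).1 = a *: z.1 + w.1) // levP wP. by rewrite -linearZ zP linearZ [in RHS](_ : (a *: z + w).2 = a *: z.2 + w.2) // dualD.
pose ZS := Submodule ZP; pose Z : lmodType A := sub_mod ZS.
pose pr1 : {linear Z -> ldual P0} := fstL _ _ \o inclL ZS.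
pose pr2 : {linear Z -> M} := sndL _ _ \o inclL ZS.
have prP (z : Z) x : lev (p1 x) (pr1 z) = psi x (pr2 z).
 by have /asboolP := inclL_in z; apply.
have mL m : linear ((fun y => (p0 y : dual_mod M) m) : kmod P0 -> K^o).
 by move=> k x y; rewrite kscaleE linearP dual_addE dual_scaleE dualZ.
have jL : linear (fun m : M => mklev (mkL (mL m))).
 by move=> a x y; apply: lev_eq => u; rewrite levP !mklevE /= dualD linearZ.
pose j := mkL jL.
have jE m u : lev u (j m) = (p0 u : dual_mod M) m by [].
have jI : injective j.
 apply/inj_ker => m m0; apply: dual_sep => // phi; have [u <-] := s0 phi. by rewrite -jE m0 lev0.
pose Z1 : lmodType A := sub_mod (kerS pr2).
pose i1 : {linear Z1 -> Z} := inclL (kerS pr2).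
have i1P z : pr2 (i1 z) = 0 by apply/kerSP; apply: inclL_in.
have [f fP] : exists f : {linear Z1 -> M}, forall z, j (f z) = pr1 (i1 z).
 apply: (@fact_inj _ _ _ _ j (pr1 \o i1) jI) => z. have [Phi PhiP] : exists Phi : {linear kmod (dualm M) -> K^o}, forall u, Phi (p0 u) = lev u (pr1 (i1 z)).
  apply: (@fact_surj _ _ _ _ (kmap p0) (mkL (lev_lin (pr1 (i1 z))))) => // x /ex[v <-] /=. by rewrite prP i1P dual0.
 have [m mP] := dual_dual Phi fM; exists m; apply: lev_eq => u. by rewrite jE -mP PhiP.
have fL : fin_dim (ldual P0).
 have /fin_dimP[d [h hB]] := fin_dim_dual f0; apply/fin_dimP; exists d.
 have hL : linear ((fun x => h x) : kmod (ldual P0) -> 'rV_d) by move=> k x y; apply: (linearP h). by exists (mkL hL).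
have fZ : fin_dim Z by apply: (fin_dim_sub ZS); apply: fin_dim_prod.
pose I2 : lmodType A := sub_mod (imS pr2).
pose i2 : {linear I2 -> M} := inclL (imS pr2).
have i2I : injective i2 by apply: inclL_inj.
have [r rP] : exists r : {linear Z -> I2}, forall z, i2 (r z) = pr2 z.
 by apply: corestr => z; apply/imSP; exists z.
have rS : surjective_fun r.
 move=> u; have /imSP[z zu] := inclL_in u; exists z. by apply: i2I; rewrite rP.
have rex : exact_at i1 r.
 move=> z; split=> [e|[z1 <-]].
  by apply: inclLP; apply/kerSP; rewrite -rP e linear0.
 by apply: i2I; rewrite rP linear0.
have F2 : Sub_class M I2.
 have [_ [k [e eI]]] := Sub_class_self fM; split; first exact: fin_dim_sub. by exists k, (e \o i2); apply: inj_comp eI _.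
have [g gP] := eM _ _ _ i1 r f fZ (@inclL_inj _ _ _) rS rex F2.
have [h hP] : exists h : {linear I2 -> ldual P0},
  forall z, h (r z) = (pr1 \- (j \o g)) z.
 apply: fact_surj => // z /rex[z1 <-]. by rewrite -[LHS]/(pr1 (i1 z1) - j (g (i1 z1))) gP fP subrr.
have tL (u : P0) : linear ((fun m => lev u (h m)) : kmod I2 -> K^o).
 by move=> k x y; rewrite kscaleE linearP levP; congr (_ + _); apply: (@dualZ _ _ _ (h x : dual_mod P0)).
have tmL : linear (fun u : P0 => mkdual (mkL (tL u)) : dualm I2).
 move=> a u v; apply: dual_eq => m; rewrite dual_addE dual_scaleE /= levD levZ. by rewrite linearZ.
have fI2 := F2.1.
have [th thP] := pp0 _ _ (transp i2) (mkL tmL) (fin_dim_dual fM) (fin_dim_dual fI2) (transp_surj fM i2I).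
exists th; pose de : {linear P1 -> dualm M} := psi \- (th \o p1).
have deE x : de x = psi x - th (p1 x) by [].
have de0 x z : (de x : dual_mod M) (pr2 z) = 0.
 rewrite deE dual_subE -rP -[(th (p1 x) : dual_mod M) _]transpE thP /= hP. rewrite -[X in lev _ X]/(pr1 z - j (g z)) levB prP jE.
 have -> : p0 (p1 x) = 0 by apply/ex; exists x. by rewrite rP dual_zeroE subr0 subrr.
(* The error [de] takes values in psi(ker p1): if m is killed by psi(ker p1), then y |-> psi(y)(m)
   factors through [p1] and extends to P0, so m comes from Z, where [de] vanishes. *)
pose S := imS (kmap (psi \o inclL (kerS p1))).
have deS x : (de x : kmod (dualm M)) \in S.
 apply: dual_perp => // m mP. have [s sP] := gen_inv (kmap p1) (proj1 (fin_dimP _) f1) (proj1 (fin_dimP _) f0).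
 have vL : linear ((fun y => (psi (s y) : dual_mod M) m) : kmod P0 -> K^o).
  by move=> k y z; rewrite linearP kscaleE linearP dual_addE dual_scaleE dualZ.
 have zP : ((mklev (mkL vL), m) : (ldual P0 * M)%type) \in ZS.
  apply/asboolP => y; rewrite mklevE /=; apply/eqP; rewrite -subr_eq0 -dual_subE -linearB. have /inclLP[k <-] : s (p1 y) - y \in kerS p1.
   by apply/kerSP; rewrite linearB [p1 (s _)]sP subrr.
  by apply/eqP/mP/imSP; exists k.
 exact: (de0 x (SubMod zP)).
have ker x : de x = 0.
 apply/(kerSP de)/k1 => {}x; have /imSP[k kx] := deS x. have k0 : p1 (inclL _ k) = 0 by apply/kerSP; apply: inclL_in.
 exists (x - inclL _ k); last by rewrite opprB addrC subrK. apply/kerSP; rewrite linearB -kx deE k0 linear0 subr0. exact: subrr.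
by move=> x; apply/eqP; rewrite -subr_eq0 -deE ker.
Qed.

Lemma Sub_ext_inj_rigid M : fin_dim M -> Sub_ext_inj M -> tau_inv_rigid M.
move=> fM eM; have [P1 [P0 [p1 [p0 mp]]]] := min_presentation fA (fin_dim_dual fM).
have [[f1 f0] [pp1 pp0] _ _] := mp.
exists (quot_mod (imS (pull p1))); split=> [|f x].
 exists P1, P0, p1, p0; split=> //; exists (projL (imS (pull p1))). split; first exact: projL_surj.
 move=> g; rewrite projL0; split=> [/imSP[q <-]|[q qP]]; first by exists q. by apply/imSP; exists q; apply: rdual_eq => x; rewrite qP.
have [g <-] := projL_surj x.
apply: (@pairing_sep M P1 P0 p1 (f \o projL (imS (pull p1)))) => //.
 exact: ext_inj_lift mp.
move=> q; rewrite -[LHS]/(f (projL (imS (pull p1)) (pull p1 q))).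
by rewrite (proj2 (projL0 _ _)) ?linear0 //; apply/imSP; exists q.
Qed.

(** A dual basis of P1 encodes maps P1 -> DM as functionals on M^r. A tuple annihilated by all maps
    that factor through [p1] defines a homomorphism from the ring dual of P1 to M vanishing on the
    image of the ring dual of P0, hence factoring through T, hence zero. Double annihilation
    concludes. *)
Lemma rigid_lift M (T : lmodType A) (P1 P0 : lmodType (A^c)%type) (p1 : {linear P1 -> P0})
  (q : {linear ring_dual P1 -> T}) :
 fin_dim M -> fin_dim P1 -> projective P1 -> surjective_fun q -> (forall g, q g = 0 <-> exists f : ring_dual P0, forall x, g x = f (p1 x)) ->
 (forall (f : {linear T -> M}) x, f x = 0) -> forall psi : {linear P1 -> dualm M}, exists th : {linear P0 -> dualm M}, forall x, psi x = th (p1 x).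
move=> fM f1 pp1 qS qK T0 psi; have [r [x [f xf]]] := dual_basis f1 pp1.
pose Mr : lmodType A := {ffun 'I_r -> M}.
have vL (u : {linear P1 -> dualm M}) :
  linear ((fun m : Mr => \sum_i (u (x i) : dual_mod M) (m i)) : kmod Mr -> K^o).
 move=> k m m'; rewrite scaler_sumr -big_split; apply: eq_bigr => i _ /=. by rewrite !ffunE dualP.
pose v u := mkdual (mkL (vL u)).
have SP : submod_closed (fun F : kmod (dualm Mr) => `[< exists th : {linear P0 -> dualm M}, F = v (th \o p1) >]).
 split=> [|a F G /asboolP[t ->] /asboolP[t' ->]]; apply/asboolP.
  exists (\0 : {linear P0 -> dualm M}); apply: dual_eq => m /=. by rewrite big1.
 have tL : linear (fun y => (pzscal a : A^c) *: t y + t' y).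
  move=> b y z; rewrite !linearP !scalerDr !scalerA. by rewrite (@pzscal_central K (A^c)%type) addrACA.
 exists (mkL tL); apply: dual_eq => m. rewrite [LHS](_ : _ = v (t \o p1) ((pzscal a : A) *: m) + v (t' \o p1) m) //.
 by rewrite /= -big_split; apply: eq_bigr => i _ /=; rewrite !ffunE.
have /asboolP[th thP] : (v psi : kmod (dualm Mr)) \in Submodule SP.
 apply: dual_perp; first exact: fin_dim_ffun. move=> m mP; have hL : linear (fun g : ring_dual P1 => \sum_i (g (x i) : A) *: m i).
  move=> a g g'; rewrite scaler_sumr -big_split; apply: eq_bigr => i _ /=. by rewrite scalerA -scalerDl.
 have h0 q0 : mkL hL (pull p1 q0) = 0.
  apply: dual_sep => // phi; rewrite dual_sum. have := mP (v (prodL phi q0 \o p1)) _; apply. by apply/asboolP; exists (prodL phi q0).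
 have [hT hTP] : exists hT : {linear T -> M}, forall g, hT (q g) = mkL hL g.
  apply: fact_surj => // g /qK[q0 q0P]; rewrite -[RHS](h0 q0). by apply: eq_bigr => i _; rewrite q0P.
 rewrite -[LHS]/(\sum_i (psi (x i) : dual_mod M) (m i)). under eq_bigr => i _.
  rewrite {1}(xf (x i)) linear_sum. have -> : (\sum_l psi ((f l (x i) : A^c) *: x l)) (m i) =
    \sum_l (psi ((f l (x i) : A^c) *: x l)) (m i).
   by elim/big_rec2: _ => // l y z _ <-.
  under eq_bigr do rewrite linearZ dual_scaleE. over.
 rewrite exchange_big big1 // => l _; rewrite -dual_sum. by have := hTP (f l); rewrite T0 => /= <-; rewrite dual0.
exists th => y.
have E i : psi (x i) = th (p1 (x i)).
 apply: dual_eq => m; have := congr1 (fun F : dual_mod Mr => F (singL M i m)) thP.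
 rewrite /= (bigD1 i) //= ffunE eqxx big1 => [|l /negbTE li]; last by rewrite ffunE li dual0.
 rewrite addr0 => ->; rewrite (bigD1 i) //= ffunE eqxx big1 ?addr0 // => l /negbTE li. by rewrite ffunE li dual0.
rewrite [y in LHS]xf [y in RHS]xf !linear_sum; apply: eq_bigr => i _.
by rewrite !linearZ /= E.
Qed.

(** The extension problem is dualized: a lift u : P0 -> DZ of the dual of [f] exists by
    projectivity, and its obstruction to descending to DM is u p1, which lands in D Z2. Embedding Z2
    in M^k and lifting to D(M^k), this obstruction factors through [p1] by [rigid_lift]. *)
Lemma rigid_Sub_ext_inj M : fin_dim M -> tau_inv_rigid M -> Sub_ext_inj M.
move=> fM [T [[P1 [P0 [p1 [p0 [mp [q [qS qK]]]]]]] T0]].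
have [[f1 f0] [pp1 pp0] [ex s0] _] := mp.
have lft := rigid_lift fM f1 pp1 qS qK T0.
move=> Z1 Z Z2 i p f fZ iI pS ip [f2 [k [e eI]]].
have fZ1 := fin_dim_inj iI fZ.
have [u uP] := pp0 _ _ (transp i) (transp f \o p0) (fin_dim_dual fZ) (fin_dim_dual fZ1) (transp_surj fZ iI).
have pI := transp_inj pS.
have [v vP] : exists v : {linear P1 -> dualm Z2}, forall x, transp p (v x) = (u \o p1) x.
 apply: fact_inj => // x. have [F FP] : exists F : {linear kmod Z2 -> K^o}, forall z, F (p z) = (u (p1 x) : dual_mod Z) z.
  apply: (@fact_surj _ _ _ _ (kmap p) (dual_lin (u (p1 x)))) => // z /ip[z1 <-] /=. rewrite -transpE uP /=; have -> : p0 (p1 x) = 0 by apply/ex; exists x.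
  by [].
 by exists (mkdual F); apply: dual_eq => z; rewrite transpE -FP.
pose Mk : lmodType A := {ffun 'I_k -> M}.
have fMk : fin_dim Mk by apply: fin_dim_ffun.
have [w wP] := pp1 _ _ (transp e) v (fin_dim_dual fMk) (fin_dim_dual f2) (transp_surj fMk eI).
have /choice[t tP] a := lft (transp (@singL _ _ M a) \o w).
have thL : linear (fun y => \sum_a transp (@evalL _ _ M a) (t a y) : dualm Mk).
 move=> b y z; rewrite scaler_sumr -big_split; apply: eq_bigr => a _. by rewrite linearP linearP.
have wt x : w x = mkL thL (p1 x).
 apply: dual_eq => m /=. have -> : (\sum_a transp (@evalL _ _ M a) (t a (p1 x)) : dual_mod Mk) m =
  \sum_a (transp (@evalL _ _ M a) (t a (p1 x)) : dual_mod Mk) m. by elim/big_rec2: _ => // l y z _ <-.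
 rewrite {1}[m]ffun_sum dual_sum; apply: eq_bigr => a _. by rewrite -tP.
(* The corrected lift kills the image of [p1], so it descends to DM -> DZ; the correction comes from
   D Z2 and does not change the restriction to Z1. *)
pose u' : {linear P0 -> dualm Z} := u \- (transp p \o (transp e \o mkL thL)).
have u'E y : u' y = u y - transp p (transp e (mkL thL y)) by [].
have [f' f'P] : exists f' : {linear dualm M -> dualm Z}, forall y, f' (p0 y) = u' y.
 apply: fact_surj => // y /ex[x <-]; rewrite u'E -wt wP vP; exact: subrr.
have f'i phi x : (f' phi : dual_mod Z) (i x) = phi (f x).
 have [y <-] := s0 phi; rewrite f'P u'E dual_subE -[(u y : dual_mod Z) _]transpE uP /=. have -> : p (i x) = 0 by apply/ip; exists x.
 by rewrite linear0 dual0 subr0.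
have FL z : linear ((fun phi => (f' phi : dual_mod Z) z) : kmod (dualm M) -> K^o).
 move=> b phi psi; rewrite kscaleE linearP dual_addE dual_scaleE; congr (_ + _). exact: dualZ.
have /choice[g gP] z := dual_dual (mkL (FL z)) fM.
have gL : linear g.
 move=> b x y; apply/eqP; rewrite -subr_eq0; apply/eqP/dual_sep => // phi. rewrite dualB dualD -gP -dual_scaleE -!gP /= dualD linearZ dual_scaleE.
 exact: subrr.
exists (mkL gL) => x; apply/eqP; rewrite -subr_eq0; apply/eqP/dual_sep => // phi.
by rewrite dualB /= -gP /= f'i subrr.
Qed.
End RightDual.

(** * Quiver representations as modules over a quotient of the path algebra *)

Section PathAlg.
Variables (Q : quiver) (K : fieldType).
Notation KQ := (pathalg Q K).

Lemma pathb_arrow (a : arrow Q) (p : qpath Q) : asource a = ptarget p ->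
 exists r, [/\ pathb K (arrow_path a) * pathb K p = pathb K r :> KQ,
  ptarget r = atarget a & parrows r = a :: parrows p].
move=> ap; have := pathalg_mulbb K (arrow_path a) p; case: path_compP => [r _ tr sr ar e|].
 by exists r; split.
by rewrite {1}/psource /seq_source /= ap eqxx.
Qed.

Lemma pathb_scale k (x : KQ) : k *: x = pzscal k * x.
by rewrite -[pzscal k]/(k *: (1 : KQ)) [RHS]pathalg_mulZl [pathalg_mul 1 x]pathalg_mul1l. Qed.

Lemma path_ind (P : qpath Q -> Prop) :
 (forall i, P (trivial_path i)) -> (forall a p q, asource a = ptarget p -> ptarget q = atarget a -> parrows q = a :: parrows p ->
   P p -> P q) -> forall p, P p.
move=> P0 Pa [[i s] c]; elim: s i c => [|a s IHs] i c.
 by rewrite (_ : QPath c = trivial_path i) //; apply: val_inj.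
have /andP[/eqP ti cs] := c.
by apply: (Pa a (@QPath Q (asource a, s) cs)).
Qed.

Lemma pathalg_genind (P : KQ -> Prop) :
 P 0 -> (forall x y, P x -> P y -> P (x + y)) -> (forall k x, P x -> P (pzscal k * x)) -> (forall i, P (pathb K (trivial_path i))) ->
 (forall a x, P x -> P (pathb K (arrow_path a) * x)) -> forall x, P x.
move=> P0 PD PZ Pi Pa; apply: pathalg_ind => // k p; rewrite pathb_scale; apply: PZ.
elim/path_ind: p => [i|a p q ap tq aq Pp]; first exact: Pi.
have [r [e tr ar]] := pathb_arrow ap; rewrite (_ : q = r) -?e; first exact: Pa.
by apply: qpath_eq; rewrite ?tq ?tr ?aq ?ar.
Qed.

Variables (V : lmodType K) (E : vertex Q -> {linear V -> V}) (X : arrow Q -> {linear V -> V}).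
Hypothesis EE : forall i j v, E i (E j v) = if i == j then E j v else 0.
Hypothesis E1 : forall v, \sum_i E i v = v.
Hypothesis XE : forall a v, X a (E (asource a) v) = X a v.
Hypothesis EX : forall a v, E (atarget a) (X a v) = X a v.

Definition pact (p : qpath Q) : {linear V -> V} :=
 foldr (fun a (f : {linear V -> V}) => (X a \o f : {linear V -> V})) (E (psource p)) (parrows p).

Lemma pact_source p v : pact p (E (psource p) v) = pact p v.
by rewrite /pact; elim: (parrows p) => [|a s IHs] /=; rewrite ?EE ?eqxx // IHs. Qed.

Lemma pact_target p v : E (ptarget p) (pact p v) = pact p v.
elim/path_ind: p => [i|a p q _ tq aq _]; first by rewrite /pact /= EE eqxx.
by rewrite /pact tq aq /= EX.
Qed.

Lemma pact_comp p q v : pact p (pact q v) = oapp (fun r => pact r v) 0 (path_comp p q).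
case: path_compP => [r pq tr sr ar|pq] /=.
 rewrite -(pact_target q) -pq pact_source /pact sr ar foldr_cat. have hq := pact_target q v; move: hq; rewrite /pact; move: (foldr _ _ (parrows q)) => h hq.
 elim: (parrows p) => [|a s IHs] /=; first by rewrite pq hq. by rewrite IHs.
rewrite -[pact q v]pact_target -pact_source EE.
by rewrite (negbTE pq) linear0.
Qed.

Definition act (x : KQ) (v : V) : V := \sum_(p <- msupp x) x@_p *: pact p v.

Lemma act_w (x : KQ) (d : {fset qpath Q}) v : (msupp x `<=` d)%fset ->
 act x v = \sum_(p <- d) x@_p *: pact p v.
by move=> xd; apply: big_fset_incl => // p _ /mcoeff_outdom ->; rewrite scale0r.
Qed.

Lemma actDl x y v : act (x + y) v = act x v + act y v.
set d := (msupp x `|` msupp y)%fset.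
rewrite (@act_w x d) ?fsubsetUl // (@act_w y d) ?fsubsetUr // (act_w _ (msuppD_le x y)).
by rewrite -big_split; apply: eq_bigr => p _ /=; rewrite mcoeffD scalerDl.
Qed.
Lemma actZl k x v : act (k *: x) v = k *: act x v.
rewrite (act_w _ (msuppZ_le k x)) scaler_sumr; apply: eq_bigr => p _.
by rewrite mcoeffZ scalerA.
Qed.
Lemma actN x v : act (- x) v = - act x v.
by rewrite -[- x]scaleN1r actZl scaleN1r. Qed.
Lemma act0l v : act 0 v = 0. by rewrite /act msupp0 big_seq_fset0. Qed.
Lemma act_linear x : linear (act x).
move=> k u v; rewrite /act scaler_sumr -big_split; apply: eq_bigr => p _ /=.
by rewrite linearP scalerDr !scalerA mulrC.
Qed.
Lemma actb p v : act (pathb K p) v = pact p v.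
by rewrite (act_w _ (msuppU_le)) big_seq_fset1 mcoeffUU scale1r. Qed.
Definition actL x : {linear V -> V} := mkL (act_linear x).
Lemma actM x y v : act (x * y) v = act x (act y v).
rewrite -[x * y]/(pathalg_mul x y).
elim/pathalg_ind: x => [|x x' IHx IHx'|k p].
- by rewrite pathalg_mul0l [LHS]act0l [RHS]act0l.
- rewrite pathalg_mulDl (actDl (pathalg_mul x y)) actDl.
 by congr (_ + _); [apply: IHx | apply: IHx'].
rewrite pathalg_mulZl [LHS]actZl [RHS]actZl; congr (_ *: _).
elim/pathalg_ind: y => [|y y' IHy IHy'|l q].
- by rewrite pathalg_mul0r act0l actb linear0.
- rewrite pathalg_mulDr (actDl (pathalg_mul _ y)) (actDl y) actb linearD.
 by rewrite -!actb; congr (_ + _); [apply: IHy | apply: IHy'].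
rewrite pathalg_mulZr [LHS]actZl [act (l *: pathb K q) v]actZl !actb linearZ; congr (_ *: _).
rewrite pathalg_mulbb pact_comp; case: (path_comp p q) => [r|] /=; first exact: actb.
exact: act0l.
Qed.
Lemma act_com x y z u v : act (x * y - z * u) v = act x (act y v) - act z (act u v).
by rewrite (actDl (x * y)) actN (actM x) (actM z). Qed.
Lemma act_mesh c x y z u v :
 act (c * (x * y * z * u)) v = act c (act x (act y (act z (act u v)))).
by rewrite (actM c) (actM _ u) (actM _ z) (actM x). Qed.
Lemma act1 v : act 1 v = v.
rewrite -[RHS]E1 -[1]/(pathalg_one Q K) /pathalg_one.
rewrite (big_morph (act^~ v) (fun x y => actDl x y v) (act0l v)).
by apply: eq_bigr => i _; rewrite actb.
Qed.
Lemma act_pzscal k v : act (pzscal k) v = k *: v.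
by have -> : pzscal k = k *: (1 : KQ) by []; rewrite actZl act1. Qed.
Lemma act_trivial i v : act (pathb K (trivial_path i)) v = E i v.
by rewrite actb. Qed.
Lemma act_arrow a v : act (pathb K (arrow_path a)) v = X a v.
by rewrite actb /pact /= XE. Qed.
Lemma actXn x k v : act (x ^+ k) v = iter k (act x) v.
by elim: k => [|k IHk]; rewrite ?expr0 ?act1 // exprS actM IHk. Qed.

Lemma act_iter u (U : V -> V) k v : (forall v, act u v = U v) -> act (u ^+ k) v = iter k U v.
by move=> h; rewrite actXn; elim: k => //= k ->. Qed.
Lemma act_com_iter u a w (U B W : V -> V) p q v : (forall v, act u v = U v) ->
 (forall v, act a v = B v) -> (forall v, act w v = W v) -> act (u ^+ p * a - a * w ^+ q) v = iter p U (B v) - B (iter q W v).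
move=> hu ha hw; rewrite act_com (act_iter p _ hu) (act_iter q _ hw).
by congr (iter p U _ - _); exact: ha.
Qed.
Lemma act_mesh_iter c u a b (U B L : V -> V) p q v : (forall v, act u v = U v) ->
 (forall v, act a v = B v) -> (forall v, act b v = L v) -> act (c * (u ^+ p * a * b * u ^+ q)) v = act c (iter p U (B (L (iter q U v)))).
move=> hu ha hb; rewrite act_mesh (act_iter q _ hu) (act_iter p _ hu).
by congr (act c (iter p U _)); rewrite -hb -ha.
Qed.

Variables (Rel : set KQ).
Hypothesis RelP : forall x v, Rel x -> act x v = 0.

Lemma act_ideal x v : x \in gen_ideal Rel -> act x v = 0.
move=> /asboolP[t [tR ->]]; elim: t tR => [|p t IHt] tR; first by rewrite big_nil act0l.
rewrite big_cons actDl IHt ?addr0 => [|q qt]; last by apply: tR; rewrite inE qt orbT.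
have := tR p; rewrite inE eqxx => /(_ isT) pR.
by rewrite !actM (RelP _ pR) -[act p.1.1 0]/(actL p.1.1 0) linear0.
Qed.

Definition repmod : Type := V.
HB.instance Definition _ := GRing.Zmodule.on repmod.
Notation Pi := (quot_alg (gen_ideal Rel)).
Definition rep_scale (a : Pi) (v : repmod) : repmod := act (alg_repr a) v.
Lemma rep_scaleE x v : rep_scale (alg_proj (gen_ideal Rel) x) v = act x v.
apply/eqP; rewrite -subr_eq0 /rep_scale; set y := alg_repr _.
have <- : act (y - x) v = act y v - act x v.
 by rewrite actDl actN.
by rewrite act_ideal // -alg_proj_eq alg_reprK.
Qed.
Fact rep_scaleA a b v : rep_scale a (rep_scale b v) = rep_scale (a * b) v.
by rewrite -(alg_reprK a) -(alg_reprK b) -rmorphM !rep_scaleE actM. Qed.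
Fact rep_scale1 : left_id 1 rep_scale.
by move=> v; rewrite -(rmorph1 (alg_proj (gen_ideal Rel))) rep_scaleE act1. Qed.
Fact rep_scaleDr : right_distributive rep_scale +%R.
by move=> a u v; apply: (linearD (actL (alg_repr a))). Qed.
Fact rep_scaleDl v : {morph rep_scale^~ v : a b / a + b}.
by move=> a b /=; rewrite -(alg_reprK a) -(alg_reprK b) -rmorphD !rep_scaleE actDl. Qed.
HB.instance Definition _ := GRing.Zmodule_isLmodule.Build Pi repmod
 rep_scaleA rep_scale1 rep_scaleDr rep_scaleDl.

Lemma rep_exists0 : exists (M : lmodType Pi) (f : V -> M), [/\ bijective f,
 forall k x y, f (k *: x + y) = (pzscal k : Pi) *: f x + f y & forall x v, f (act x v) = alg_proj (gen_ideal Rel) x *: f v].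
exists repmod, id; split=> [|k x y|x v]; first by exists id.
 by congr (_ + _); rewrite -[LHS]act_pzscal -[LHS]rep_scaleE.
by rewrite -rep_scaleE.
Qed.
End PathAlg.

Section QuotRing.
Variables (R : pzRingType) (I : ideal R).
Implicit Types u v w : R.
Notation pj := (alg_proj I).
Lemma pj0 : pj 0 = 0. exact: rmorph0. Qed.
Lemma pj1 : pj 1 = 1. exact: rmorph1. Qed.
Lemma pjD u v : pj (u + v) = pj u + pj v. exact: rmorphD. Qed.
Lemma pjN u : pj (- u) = - pj u. exact: rmorphN. Qed.
Lemma pjM u v : pj (u * v) = pj u * pj v. exact: rmorphM. Qed.
Lemma pjX u k : pj (u ^+ k) = pj u ^+ k. exact: rmorphXn. Qed.
Lemma pj_sum (T : Type) (r : seq T) (P : pred T) (F : T -> R) :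
 pj (\sum_(t <- r | P t) F t) = \sum_(t <- r | P t) pj (F t).
exact: rmorph_sum. Qed.
Lemma pj_eqM u v w : u * v = w -> pj u * pj v = pj w. by move<-; rewrite pjM. Qed.
Lemma pj_com u v w z k l : pj (u ^+ k * v - w * z ^+ l) = pj u ^+ k * pj v - pj w * pj z ^+ l.
by rewrite rmorphB !rmorphM !rmorphXn. Qed.
Lemma pj_mesh c u v w k l : pj (c * (u ^+ k * v * w * u ^+ l)) =
 pj c * (pj u ^+ k * pj v * pj w * pj u ^+ l).
by rewrite !rmorphM !rmorphXn. Qed.
Lemma pj_rel (X : set R) y : X y -> alg_proj (gen_ideal X) y = 0.
move=> yR; apply/eqP; rewrite -(raddf0 (alg_proj (gen_ideal X))) alg_proj_eq subr0.
by apply/asboolP; exists [:: (1, y, 1)]; split=> [p|]; rewrite ?big_seq1 ?mul1r ?mulr1 // inE => /eqP->.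
Qed.
End QuotRing.

(** * Generators, relations and the universal property of Pi *)

Section Interface.
Variables (K : fieldType) (n : nat) (C : 'M[int]_n) (D : 'I_n -> nat).
Variable Om : {set 'I_n * 'I_n}.
Notation f := (Cartan_f C).
Notation G := (Cartan_g C).

Definition sg (i j : 'I_n) : K := if (i, j) \in Om then 1 else -1.
Definition valid_arrow (i j : 'I_n) (g : nat) := Om_bar Om i j && (g < G i j)%N.

(* [sg i j] times the summand of index (j, g, k) of the mesh relation at i *)
Definition mesh_term (A : pzAlgType K) (x : 'I_n -> A) (a : 'I_n -> 'I_n -> nat -> A) i j g k :=
 pzscal (sg i j) * (x i ^+ k * a i j g * a j i g * x i ^+ (f j i - 1 - k)).

(* A presentation of [preproj] by its generators, independent of its construction *)
Record presentation (A : pzAlgType K) (e x : 'I_n -> A) (a : 'I_n -> 'I_n -> nat -> A) : Prop := {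
 pr_ee : forall i j, e i * e j = if i == j then e j else 0; pr_e1 : \sum_i e i = 1; pr_ex : forall i, e i * x i = x i; pr_xe : forall i, x i * e i = x i;
 pr_ea : forall i j g, e i * a i j g = a i j g; pr_ae : forall i j g, a i j g * e j = a i j g; pr_a0 : forall i j g, ~~ valid_arrow i j g -> a i j g = 0;
 pr_nil : forall i, x i ^+ D i = 0; pr_com : forall i j g, valid_arrow i j g -> x i ^+ f j i * a i j g = a i j g * x j ^+ f i j;
 pr_mesh : forall i, \sum_(j | Om_bar Om j i) \sum_(g < G i j) \sum_(k < f j i)
  mesh_term x a i j g k = 0;
 pr_ind : forall P : A -> Prop, P 0 -> (forall y z, P y -> P z -> P (y + z)) ->
  (forall k y, P y -> P (pzscal k * y)) -> (forall i, P (e i)) -> (forall i y, P y -> P (x i * y)) -> (forall i j g y, P y -> P (a i j g * y)) ->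
  forall y, P y;
 pr_univ : forall (V : lmodType K) (E X : 'I_n -> {linear V -> V})
  (L : 'I_n -> 'I_n -> nat -> {linear V -> V}), (forall i j v, E i (E j v) = if i == j then E j v else 0) -> (forall v, \sum_i E i v = v) ->
  (forall i v, E i (X i v) = X i v) -> (forall i v, X i (E i v) = X i v) -> (forall i j g v, valid_arrow i j g -> E i (L i j g v) = L i j g v) ->
  (forall i j g v, valid_arrow i j g -> L i j g (E j v) = L i j g v) -> (forall i v, iter (D i) (X i) v = 0) -> (forall i j g v, valid_arrow i j g ->
    iter (f j i) (X i) (L i j g v) = L i j g (iter (f i j) (X j) v)) ->
  (forall i v, \sum_(j | Om_bar Om j i) \sum_(g < G i j) \sum_(k < f j i)
    sg i j *: iter k (X i) (L i j g (L j i g (iter (f j i - 1 - k) (X i) v))) = 0) ->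
  exists (M : lmodType A) (h : V -> M), [/\ bijective h,
   forall k u v, h (k *: u + v) = (pzscal k : A) *: h u + h v, forall i v, h (E i v) = e i *: h v, forall i v, h (X i v) = x i *: h v
  & forall i j g v, valid_arrow i j g -> h (L i j g v) = a i j g *: h v] }.

Notation Q := (pp_quiver C Om).
Notation KQ := (pathalg Q K).
Notation Rel := (@pp_relation K n C D Om).
Notation I := (gen_ideal Rel).

Definition pp_eps i : preproj K C D Om := alg_proj I (eps K C Om i).
Definition pp_al i j g : preproj K C D Om := alg_proj I (alpha K C Om i j g).

Lemma Cartan_gC i j : G i j = G j i. exact: gcdnC. Qed.
Lemma Om_barC i j : Om_bar Om i j = Om_bar Om j i. exact: orbC. Qed.
Lemma validC i j g : valid_arrow i j g = valid_arrow j i g.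
by rewrite /valid_arrow Om_barC Cartan_gC. Qed.

Lemma alphaE i j g (v : valid_arrow i j g) :
 alpha K C Om i j g = pathb K (arrow_path (inr (exist _ (i, j, g) v) : arrow Q)).
rewrite /alpha; case: insubP => [u _ uE|]; last by rewrite [is_alpha _ _ _]v.
by rewrite (_ : u = exist _ (i, j, g) v) //; apply: val_inj.
Qed.
Lemma alpha0 i j g : ~~ valid_arrow i j g -> alpha K C Om i j g = 0.
by move=> h; rewrite /alpha insubN. Qed.

Lemma pathb_target (p : qpath Q) : pathb K (trivial_path (ptarget p)) * pathb K p = pathb K p :> KQ.
by rewrite [LHS]pathalg_mulbb path_comp1p eqxx. Qed.
Lemma pathb_source (p : qpath Q) : pathb K p * pathb K (trivial_path (psource p)) = pathb K p :> KQ.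
by rewrite [LHS]pathalg_mulbb path_compp1 eqxx. Qed.

Lemma alpha_target (i j : vertex Q) g :
 pathb K (trivial_path i) * alpha K C Om i j g = alpha K C Om i j g :> KQ.
have [v|v] := boolP (valid_arrow i j g).
 by rewrite (alphaE v); apply: (pathb_target (arrow_path (inr (exist _ (i, j, g) v) : arrow Q))).
by rewrite (alpha0 v); apply: pathalg_mul0r.
Qed.
Lemma alpha_source (i j : vertex Q) g :
 alpha K C Om i j g * pathb K (trivial_path j) = alpha K C Om i j g :> KQ.
have [v|v] := boolP (valid_arrow i j g).
 by rewrite (alphaE v); apply: (pathb_source (arrow_path (inr (exist _ (i, j, g) v) : arrow Q))).
by rewrite (alpha0 v); apply: pathalg_mul0l.
Qed.

Lemma pp_relE : [/\ forall i, pp_eps i ^+ D i = 0,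
 forall i j g, valid_arrow i j g -> pp_eps i ^+ f j i * pp_al i j g = pp_al i j g * pp_eps j ^+ f i j &
 forall i, \sum_(j | Om_bar Om j i) \sum_(g < G i j) \sum_(k < f j i)
  mesh_term pp_eps pp_al i j g k = 0].
split=> [i|i j g /andP[v1 v2]|i].
- by have := pj_rel (@pp_nilpotent K n C D Om i); rewrite pjX.
- by have := pj_rel (@pp_commute K n C D Om i j g v1 v2); rewrite pj_com => /eqP; rewrite subr_eq0 => /eqP.
rewrite -[RHS](pj_rel (pp_mesh K C D Om i)) pj_sum; apply: eq_bigr => j _.
rewrite pj_sum; apply: eq_bigr => g _; rewrite pj_sum; apply: eq_bigr => k _.
rewrite /mesh_term pj_mesh; congr (_ * _).
rewrite /sg /Om_sgn; case: ifP => _; first by rewrite rmorph1 pj1.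
by rewrite rmorphN1 pjN pj1.
Qed.

Lemma epsE i : eps K C Om i = pathb K (arrow_path (inl i : arrow Q)). by []. Qed.
Local Opaque eps alpha act pathalg_mul.

(** For the universal property the given operators act along paths; the three families of relations
    act by zero, so the action descends to the quotient by the ideal they generate. *)
Lemma pp_presentation : presentation (pp_idem K C D Om) pp_eps pp_al.
have [r1 r2 r3] := pp_relE.
have tt (i j : vertex Q) : pathb K (trivial_path i) * pathb K (trivial_path j) =
  if i == j then pathb K (trivial_path j) else 0 :> KQ.
 by rewrite [LHS]pathalg_mulbb path_comp1p /ptarget /=; case: ifP.
have epE i : pp_eps i = alg_proj I (pathb K (arrow_path (inl i : arrow Q))) by [].
split=> //.
- move=> i j; have := pj_eqM I (tt i j); case: ifP => // _ e; rewrite -[RHS](pj0 I); exact: e.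
- rewrite /pp_idem -pj_sum; exact: pj1.
- move=> i; exact: (pj_eqM I (pathb_target (arrow_path (inl i : arrow Q)))).
- move=> i; exact: (pj_eqM I (pathb_source (arrow_path (inl i : arrow Q)))).
- move=> i j g; exact: (pj_eqM I (alpha_target i j g)).
- move=> i j g; exact: (pj_eqM I (alpha_source i j g)).
- by move=> i j g v; rewrite /pp_al alpha0 // pj0.
- move=> P P0 PD PZ Pe Px Pa y; rewrite -(alg_reprK y).
 elim/pathalg_genind: (alg_repr y) => [|u v Pu Pv|k u Pu|i|[i|[[[i j] g] v]] u Pu].
 + by rewrite pj0.
 + by rewrite pjD; apply: PD.
 + by rewrite pjM; apply: PZ.
 + exact: Pe.
 + by rewrite pjM -epE; apply: Px. by rewrite pjM -(alphaE v); apply: Pa.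
move=> V E X L hEE hE1 hEX hXE hEL hLE hnil hcom hmesh.
pose Y (b : arrow Q) : {linear V -> V} := match b with inl i => X i
 | inr u => L (val u).1.1 (val u).1.2 (val u).2 end.
pose E' : vertex Q -> {linear V -> V} := E.
have hEE' (i j : vertex Q) v : E' i (E' j v) = if i == j then E' j v else 0 := hEE i j v.
have hE1' v : \sum_(i : vertex Q) E' i v = v := hE1 v.
have YE (b : arrow Q) v : Y b (E' (@asource Q b) v) = Y b v.
 case: b => [i|[[[i j] g] u]] /=; [exact: hXE | exact: hLE].
have EY (b : arrow Q) v : E' (@atarget Q b) (Y b v) = Y b v.
 case: b => [i|[[[i j] g] u]] /=; [exact: hEX | exact: hEL].
have aM := actM hEE' EY.
have ax i v : act E' Y (eps K C Om i) v = X i v by rewrite epsE act_arrow.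
have aX i k v : act E' Y (eps K C Om i ^+ k) v = iter k (X i) v.
 by rewrite actXn //; elim: k => //= k ->; rewrite ax.
have al i j g v (h : valid_arrow i j g) : act E' Y (alpha K C Om i j g) v = L i j g v.
 by rewrite (alphaE h) act_arrow.
have aS (T : Type) (r : seq T) (P : pred T) (F : T -> KQ) v :
  act E' Y (\sum_(t <- r | P t) F t) v = \sum_(t <- r | P t) act E' Y (F t) v.
 apply: (big_morph (fun x => act E' Y x v)) => [x y|]; [exact: actDl | exact: act0l].
have aN x v : act E' Y (- x) v = - act E' Y x v by apply: actN.
have a1 v : act E' Y 1 v = v by apply: (act1 Y hE1').
have RelP x v : Rel x -> act E' Y x v = 0.
 case=> [i|i j g v1 v2|i]; first by rewrite aX hnil.
  have h : valid_arrow i j g by apply/andP. apply: etrans (act_com_iter hEE' hE1' EY _ _ v (ax i) (al i j g ^~ h) (ax j)) _. by rewrite hcom // subrr.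
 rewrite -[RHS](hmesh i v); apply: etrans (aS _ _ _ _ _) _; apply: eq_bigr => j ij. apply: etrans (aS _ _ _ _ _) _; apply: eq_bigr => g _.
 have h : valid_arrow i j g by rewrite /valid_arrow Om_barC ij /=. apply: etrans (aS _ _ _ _ _) _; apply: eq_bigr => k _.
 have h' : valid_arrow j i g by rewrite validC. apply: etrans (act_mesh_iter hEE' hE1' EY _ _ _ v (ax i) (al i j g ^~ h) (al j i g ^~ h')) _.
 rewrite /Om_sgn /sg; case: ifP => _; first by rewrite a1 scale1r. by rewrite aN a1 scaleN1r.
have [M [h [hB hL hA]]] := rep_exists0 hEE' hE1' EY RelP.
exists M, h; split=> // [i v|i v|i j g v u].
- by rewrite -[RHS]hA act_trivial.
- by rewrite -[RHS]hA ax.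
by rewrite -[RHS]hA al.
Qed.
End Interface.

(** * Arithmetic of a symmetrizable Cartan matrix *)

Section CartanFacts.
Variables (K : fieldType) (n : nat) (C : 'M[int]_n) (D : 'I_n -> nat).
Variable Om : {set 'I_n * 'I_n}.
Hypotheses (hC : is_GCM C) (hD : is_symmetrizer C D) (hO : is_orientation C Om).
Notation f := (Cartan_f C).
Notation G := (Cartan_g C).

Lemma Om_bar_lt i j : Om_bar Om i j = (C i j < 0).
by have [h _] := hO; apply: h. Qed.
Lemma Om_bar_neq i j : Om_bar Om i j -> i != j.
rewrite Om_bar_lt => ij; apply/eqP => e; move: ij; rewrite e.
by have [-> _ _] := hC.
Qed.
Lemma absC_gt0 i j : Om_bar Om i j -> (0 < `|C i j|)%N.
by rewrite Om_bar_lt absz_gt0 => /ltr0_neq0. Qed.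
Lemma Cartan_g_gt0 i j : Om_bar Om i j -> (0 < G i j)%N.
by move=> ij; rewrite gcdn_gt0 absC_gt0. Qed.
Lemma Cartan_fg i j : (`|C i j| = f i j * G i j)%N.
by rewrite /Cartan_f divnK // dvdn_gcdl. Qed.
Lemma Cartan_f_gt0 i j : Om_bar Om i j -> (0 < f i j)%N.
by move=> /absC_gt0; rewrite Cartan_fg muln_gt0 => /andP[]. Qed.
Lemma D_gt0 i : (0 < D i)%N. by have [h _] := hD. Qed.
Lemma D_sym i j : (D i)%:Z * C i j = (D j)%:Z * C j i.
have [_ h] := hD; have := congr1 (fun M : 'M_n => M i j) h.
by rewrite mxE !mul_diag_mx !mxE => ->.
Qed.
Lemma D_abs i j : (D i * `|C i j| = D j * `|C j i|)%N.
by have := congr1 absz (D_sym i j); rewrite !abszM. Qed.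
Lemma D_f i j : Om_bar Om i j -> (D i * f i j = D j * f j i)%N.
move=> ij; apply/eqP; rewrite -(eqn_pmul2r (Cartan_g_gt0 ij)) -!mulnA -Cartan_fg.
by rewrite Cartan_gC -Cartan_fg D_abs.
Qed.
Lemma coprime_f i j : Om_bar Om i j -> coprime (f i j) (f j i).
move=> ij; have g0 := Cartan_g_gt0 ij.
rewrite /coprime -(eqn_pmul2r g0) mul1n muln_gcdl -Cartan_fg Cartan_gC -Cartan_fg.
by rewrite /Cartan_g gcdnC.
Qed.
(** The integer k_ij = c_i / f_ji = c_j / f_ij, which is gcd(c_i, c_j). Both x_i^(f_ji) and
    x_j^(f_ij) have k_ij-th power zero, which makes averaging between neighbouring vertices
    possible. *)
Definition Ck i j := (D i %/ f j i)%N.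
Lemma CkE i j : Om_bar Om i j -> (f j i * Ck i j = D i)%N.
move=> ij; rewrite mulnC divnK //.
have : (f j i %| D i * f i j)%N by rewrite D_f // dvdn_mull.
by rewrite Gauss_dvdl // coprime_sym coprime_f.
Qed.
Lemma CkC i j : Om_bar Om i j -> Ck i j = Ck j i.
move=> ij; have ji : Om_bar Om j i by rewrite Om_barC.
apply/eqP; rewrite -(eqn_pmul2l (Cartan_f_gt0 ij)) -(eqn_pmul2l (Cartan_f_gt0 ji)).
by rewrite mulnCA CkE // CkE // mulnC D_f // mulnC.
Qed.
Lemma CkE' i j : Om_bar Om i j -> (f i j * Ck i j = D j)%N.
by move=> ij; rewrite CkC // CkE // Om_barC. Qed.
Lemma Ck_gt0 i j : Om_bar Om i j -> (0 < Ck i j)%N.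
by move=> ij; have := D_gt0 i; rewrite -(CkE ij) muln_gt0 => /andP[]. Qed.
Lemma sgC i j : Om_bar Om i j -> sg K Om i j = - sg K Om j i.
move=> ij; rewrite /sg; have [_ h] := hO.
have [ji|/negbTE ji] := boolP ((j, i) \in Om).
 case: ifP => [ij'|//]; have := h i [:: j; i] isT. by rewrite /= ij' ji eqxx => /(_ isT).
have : (i, j) \in Om by move: ij; rewrite /Om_bar ji orbF.
by move=> ->; rewrite opprK.
Qed.
Lemma sg2 i j : sg K Om i j * sg K Om i j = 1.
by rewrite /sg; case: ifP => _; rewrite ?mulrNN mulr1. Qed.
End CartanFacts.

(** * Modules as subquotients; replacing the part at one vertex *)

Section Modules.
Variables (K : fieldType) (n : nat) (C : 'M[int]_n) (D : 'I_n -> nat).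
Variable Om : {set 'I_n * 'I_n}.
Hypotheses (hC : is_GCM C) (hD : is_symmetrizer C D) (hO : is_orientation C Om).
Notation f := (Cartan_f C).
Notation G := (Cartan_g C).
Notation valid := (valid_arrow C Om).
Notation sg := (sg K Om).
Variables (A : pzAlgType K) (e x : 'I_n -> A) (a : 'I_n -> 'I_n -> nat -> A).
Hypothesis P : presentation C D Om e x a.
Implicit Types M N : lmodType A.

Lemma pzscale_comm M k (b : A) (m : M) : (pzscal k : A) *: (b *: m) = b *: ((pzscal k : A) *: m).
by rewrite !scalerA pzscal_central. Qed.

Fact opL_linear M (b : A) : linear (fun m : kmod M => b *: (m : M) : kmod M).
by move=> k u v; rewrite !kscaleE scalerDr pzscale_comm. Qed.
Definition opL M (b : A) : {linear kmod M -> kmod M} := mkL (@opL_linear M b).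

Lemma gen_linear M N (h : {linear kmod M -> kmod N}) :
 (forall i m, h (e i *: (m : M)) = e i *: (h m : N)) -> (forall i m, h (x i *: (m : M)) = x i *: (h m : N)) ->
 (forall i j g m, valid i j g -> h (a i j g *: (m : M)) = a i j g *: (h m : N)) -> exists h' : {linear M -> N}, forall m, h' m = h m.
move=> he hx ha; have hL : linear (h : M -> N).
 move=> b u v; rewrite -[LHS]/(h ((b *: u : kmod M) + v)) linearD; congr (_ + _).
 move: u {v}; elim/(pr_ind P): b => [|b c Hb Hc|k b Hb|i|i b Hb|i j g b Hb] u.
 - by rewrite !scale0r linear0.
 - by rewrite !scalerDl -Hb -Hc; apply: (linearD h).
 - by rewrite -!scalerA -[RHS]/(k *: (b *: (h u : N) : kmod N)) -Hb -linearZ.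
 - exact: he.
 - by rewrite -!scalerA hx Hb. rewrite -!scalerA; have [v|v] := boolP (valid i j g); first by rewrite ha // Hb. by rewrite (pr_a0 P v) !scale0r linear0.
by exists (mkL hL).
Qed.

Section SubQuot.
Variables (V : lmodType K) (S R : submodule V).
Definition stable (h : V -> V) := (forall v, v \in S -> h v \in S) /\ (forall v, v \in R -> h v \in R).

Let R' : submodule (sub_mod S).
exists (fun u => inclL S u \in R); split=> [|k u v]; rewrite /in_mem /= ?linear0 ?linearP.
 exact: rpred0.
by move=> uR vR; apply: rpredD => //; apply: rpredZ.
Defined.
Let V' := quot_mod R'.
Let pi : {linear sub_mod S -> V'} := projL R'.

Let piE u v : inclL S u - inclL S v \in R -> pi u = pi v.
move=> h; apply/eqP; rewrite -subr_eq0 -linearB; apply/eqP/projL0.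
by rewrite -[_ \in _]/(inclL S (u - v) \in R) linearB.
Qed.

(** A total version of the class map S -> S/R, with default value 0 outside [S]. *)
Let cl v : V' := match pselect (v \in S) with left vS => pi (SubMod vS) | right _ => 0 end.
Let clE u : cl (inclL S u) = pi u.
rewrite /cl; case: pselect => [uS|[]]; last exact: inclL_in.
by congr (pi _); apply: (@inclL_inj _ _ S).
Qed.
Let cl_lin k u v : u \in S -> v \in S -> cl (k *: u + v) = k *: cl u + cl v.
by move=> /inclLP[u' <-] /inclLP[v' <-]; rewrite -linearP !clE linearP. Qed.
Let cl0P v : v \in S -> cl v = 0 <-> v \in R.
by move=> /inclLP[u <-]; rewrite clE; apply: projL0. Qed.
Let cl_surj q : exists2 v, v \in S & cl v = q.
have [u <-] := projL_surj q; exists (inclL S u); [exact: inclL_in | exact: clE].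
Qed.
Let cl0 : cl 0 = 0. by apply/cl0P; apply: rpred0. Qed.
Let clD u v : u \in S -> v \in S -> cl (u + v) = cl u + cl v.
by move=> uS vS; rewrite -[u]scale1r cl_lin // !scale1r. Qed.
Let clZ k u : u \in S -> cl (k *: u) = k *: cl u.
by move=> uS; rewrite -[k *: u]addr0 cl_lin ?rpred0 // cl0 addr0. Qed.
Let cl_eq u v : u \in S -> v \in S -> u - v \in R -> cl u = cl v.
move=> uS vS /cl0P h; apply/eqP; rewrite -subr_eq0 -scaleN1r -clZ // -clD ?rpredZ //.
by rewrite scaleN1r h // rpredB.
Qed.
Let cl_sum (T : Type) (r : seq T) (Q : pred T) (F : T -> V) : (forall t, Q t -> F t \in S) ->
 cl (\sum_(t <- r | Q t) F t) = \sum_(t <- r | Q t) cl (F t).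
move=> FS; elim: r => [|t r IHr]; first by rewrite !big_nil cl0.
rewrite !big_cons; case: ifP => // Qt; rewrite clD ?IHr //; first exact: FS.
exact: rpred_sum.
Qed.

Let induced (h : {linear V -> V}) : stable h ->
 exists h' : {linear V' -> V'}, forall v, v \in S -> h' (cl v) = cl (h v).
move=> [hS hR].
have [h1 h1P] := @corestr _ _ S _ (h \o inclL S) (fun u => hS _ (inclL_in u)).
have [|h2 h2P] := @fact_surj _ V' _ _ pi (pi \o h1) (@projL_surj _ _ R').
 move=> u /projL0 uR; apply/projL0; rewrite -[_ \in _]/(inclL S (h1 u) \in R) h1P. exact: hR.
exists h2 => v /inclLP[u <-]; rewrite clE h2P /= -[h _]h1P clE //.
Qed.

Variables (E X : 'I_n -> {linear V -> V}) (L : 'I_n -> 'I_n -> nat -> {linear V -> V}).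
Hypotheses (sE : forall i, stable (E i)) (sX : forall i, stable (X i))
 (sL : forall i j g, valid i j g -> stable (L i j g)).
Hypothesis hEE : forall i j v, v \in S -> E i (E j v) - (if i == j then E j v else 0) \in R.
Hypothesis hE1 : forall v, v \in S -> \sum_i E i v - v \in R.
Hypothesis hEX : forall i v, v \in S -> E i (X i v) - X i v \in R.
Hypothesis hXE : forall i v, v \in S -> X i (E i v) - X i v \in R.
Hypothesis hEL : forall i j g v, valid i j g -> v \in S -> E i (L i j g v) - L i j g v \in R.
Hypothesis hLE : forall i j g v, valid i j g -> v \in S -> L i j g (E j v) - L i j g v \in R.
Hypothesis hnil : forall i v, v \in S -> iter (D i) (X i) v \in R.
Hypothesis hcom : forall i j g v, valid i j g -> v \in S ->
 iter (f j i) (X i) (L i j g v) - L i j g (iter (f i j) (X j) v) \in R.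
Hypothesis hmesh : forall i v, v \in S ->
 \sum_(j | Om_bar Om j i) \sum_(g < G i j) \sum_(k < f j i)
    sg i j *: iter k (X i) (L i j g (L j i g (iter (f j i - 1 - k) (X i) v))) \in R.

(** The relations are required only on S and modulo R; on the quotient S/R the induced operators
    satisfy them exactly, and the universal property applies there. *)
Lemma rep_subquot : exists (M : lmodType A) (pr : V -> M), [/\ forall m, exists2 v, v \in S & pr v = m,
 forall k u v, u \in S -> v \in S -> pr (k *: u + v) = (pzscal k : A) *: pr u + pr v, forall v, v \in S -> pr v = 0 <-> v \in R &
 [/\ forall i v, v \in S -> e i *: pr v = pr (E i v), forall i v, v \in S -> x i *: pr v = pr (X i v)
  & forall i j g v, valid i j g -> v \in S -> a i j g *: pr v = pr (L i j g v)]].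
pose E' i := projT1 (cid (induced (sE i))).
have EP i v : v \in S -> E' i (cl v) = cl (E i v) := projT2 (cid (induced (sE i))) v.
pose X' i := projT1 (cid (induced (sX i))).
have XP i v : v \in S -> X' i (cl v) = cl (X i v) := projT2 (cid (induced (sX i))) v.
(* Triples that are not arrows get the zero operator, as stability is available for arrows only. *)
pose L0 i j g := match pselect (valid i j g) with
 | left v => projT1 (cid (induced (sL v))) | right _ => mkL (f := fun=> 0) (fun k u v => esym (etrans (addr0 _) (scaler0 _ k))) end.
have LP i j g v : valid i j g -> v \in S -> L0 i j g (cl v) = cl (L i j g v).
 rewrite /L0; case: pselect => [w _ vS|//]; exact: (projT2 (cid (induced (sL w))) v vS).
have ES i v : v \in S -> E i v \in S by apply: (sE i).1.
have XS i v : v \in S -> X i v \in S by apply: (sX i).1.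
have LS i j g v : valid i j g -> v \in S -> L i j g v \in S by move=> /sL[h _]; apply: h.
have XiS i k v : v \in S -> iter k (X i) v \in S by move=> vS; elim: k => //= k; apply: XS.
have Xi i k v : v \in S -> iter k (X' i) (cl v) = cl (iter k (X i) v).
 by move=> vS; elim: k => //= k ->; rewrite XP // XiS.
have [|||||||||M [h [hB hL he hx ha]]] := @pr_univ _ _ _ _ _ _ _ _ _ P V' E' X' L0.
- move=> i j q; have [v vS <-] := cl_surj q; rewrite !(EP, ES) //.
 by case: ifP (hEE i j vS) => _ h; [|rewrite -cl0]; apply: cl_eq => //; rewrite ?rpred0 ?ES.
- move=> q; have [v vS <-] := cl_surj q.
 rewrite (eq_bigr (fun i => cl (E i v))) => [|i _]; last exact: EP.
 by rewrite -cl_sum => [|i _]; [apply: cl_eq => //; [apply: rpred_sum => i _; apply: ES | apply: hE1] | apply: ES].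
- by move=> i q; have [v vS <-] := cl_surj q; rewrite !(XP, EP, XS) //; apply: cl_eq; rewrite ?ES ?XS ?hEX.
- by move=> i q; have [v vS <-] := cl_surj q; rewrite !(EP, XP, ES) //; apply: cl_eq; rewrite ?XS ?ES ?hXE.
- move=> i j g q w; have [v vS <-] := cl_surj q; rewrite LP // EP ?LS //.
 by apply: cl_eq; rewrite ?ES ?LS ?hEL.
- move=> i j g q w; have [v vS <-] := cl_surj q; rewrite EP // !LP ?ES //.
 by apply: cl_eq; rewrite ?LS ?ES ?hLE.
- by move=> i q; have [v vS <-] := cl_surj q; rewrite Xi //; apply/cl0P; [apply: XiS | apply: hnil].
- move=> i j g q w; have [v vS <-] := cl_surj q; rewrite Xi // !LP ?XiS // Xi ?LS //.
 by apply: cl_eq; rewrite ?XiS ?LS ?XiS ?hcom.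
- move=> i q; have [v vS <-] := cl_surj q.
 have tS j g k : Om_bar Om j i -> (g < G i j)%N ->
   iter k (X i) (L i j g (L j i g (iter (f j i - 1 - k) (X i) v))) \in S.
  move=> ij gj; have w : valid i j g by rewrite /valid_arrow Om_barC ij. by apply/XiS/LS => //; apply/LS; rewrite 1?validC //; apply: XiS.
 rewrite -[RHS](proj2 (cl0P _) (hmesh i vS)); last first.
  by apply: rpred_sum => j ij; apply: rpred_sum => g _; apply: rpred_sum => k _; apply: rpredZ; apply: tS.
 rewrite cl_sum => [|j ij]; last first.
  by apply: rpred_sum => g _; apply: rpred_sum => k _; apply: rpredZ; apply: tS.
 apply: eq_bigr => j ij; rewrite cl_sum => [|g _]; last first.
  by apply: rpred_sum => k _; apply: rpredZ; apply: tS.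
 apply: eq_bigr => g _; rewrite cl_sum => [|k _]; last by apply: rpredZ; apply: tS. have w : valid i j g by rewrite /valid_arrow Om_barC ij /=.
 have w' : valid j i g by rewrite validC. apply: eq_bigr => k _; rewrite clZ; last by apply: tS.
 by rewrite Xi // LP ?XiS // LP ?LS ?XiS // Xi // LS // LS // XiS.
exists M, (h \o cl); split=> [m|k u v uS vS|v vS|] /=.
- have [q <-] := bij_surj hB m; have [v vS <-] := cl_surj q; by exists v.
- by rewrite cl_lin // hL.
- have h0 : h 0 = 0.
  by have := hL 1 0 0; rewrite rmorph1 !scale1r addr0 => /eqP; rewrite addrC -subr_eq subrr eq_sym => /eqP.
 by rewrite -cl0P //; split=> [|->//]; rewrite -{1}h0 => /(bij_inj hB).
split=> [i v vS|i v vS|i j g v w vS] /=; first by rewrite -EP // he.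
 by rewrite -XP // hx.
by rewrite -LP // ha.
Qed.
End SubQuot.

Lemma sum_kscale M (T : Type) (r : seq T) (Q : pred T) (F : T -> A) (m : M) :
 \sum_(t <- r | Q t) (F t *: m : kmod M) = (\sum_(t <- r | Q t) F t) *: m.
elim: r => [|t r IHr]; first by rewrite !big_nil scale0r.
by rewrite !big_cons; case: ifP => // _; rewrite IHr scalerDl.
Qed.

(* A module obtained from [M] by replacing [e i M] by the subquotient [S0 / R0] of [V0] *)
Section Glue.
Variables (i : 'I_n) (M : lmodType A) (V0 : lmodType K) (S0 R0 : submodule V0).
Variables (ep : {linear V0 -> V0}) (ain : 'I_n -> nat -> {linear kmod M -> V0})
 (bout : 'I_n -> nat -> {linear V0 -> kmod M}).
Hypothesis RS0 : forall v, v \in R0 -> v \in S0.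
Hypotheses (epS : forall v, v \in S0 -> ep v \in S0) (epR : forall v, v \in R0 -> ep v \in R0).
Hypothesis ainS : forall j g w, valid i j g -> ain j g w \in S0.
Hypothesis boutR : forall j g v, valid i j g -> v \in R0 -> bout j g v = 0.
Hypothesis aine : forall j g (w : M), valid i j g -> ain j g (e j *: w) = ain j g w.
Hypothesis boute : forall j g v, valid i j g -> v \in S0 -> e j *: (bout j g v : M) = bout j g v.
Hypothesis epnil : forall v, v \in S0 -> iter (D i) ep v \in R0.
Hypothesis ainC : forall j g (w : M), valid i j g ->
 iter (f j i) ep (ain j g w) - ain j g (x j ^+ f i j *: w) \in R0.
Hypothesis boutC : forall j g v, valid i j g -> v \in S0 ->
 x j ^+ f i j *: (bout j g v : M) = bout j g (iter (f j i) ep v).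
Hypothesis meshi : forall v, v \in S0 ->
 \sum_(j | Om_bar Om j i) \sum_(g < G i j) \sum_(k < f j i)
  sg i j *: iter k ep (ain j g (bout j g (iter (f j i - 1 - k) ep v))) \in R0.
(** Passing through the replaced vertex acts on M as before, so the mesh relations at the neighbours
    of [i] are inherited from M; the one at [i] itself is [meshi]. *)
Hypothesis ab : forall j g (w : M), valid i j g -> bout j g (ain j g w) = a j i g *: (a i j g *: w).

Let V : lmodType K := (kmod M * V0)%type.
Let ev (b : A) : {linear V -> V} := inlL (kmod M) V0 \o (opL M b \o fstL (kmod M) V0).
Let gEi : {linear V -> V} := inrL (kmod M) V0 \o sndL (kmod M) V0.
Let gXi : {linear V -> V} := inrL (kmod M) V0 \o (ep \o sndL (kmod M) V0).
Let gLi k g : {linear V -> V} := inrL (kmod M) V0 \o (ain k g \o fstL (kmod M) V0).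
Let gLo l g : {linear V -> V} := inlL (kmod M) V0 \o (bout l g \o sndL (kmod M) V0).
Let gE l : {linear V -> V} := if l == i then gEi else ev (e l).
Let gX l : {linear V -> V} := if l == i then gXi else ev (x l).
Let gL l k g : {linear V -> V} := if l == i then gLi k g
 else if k == i then gLo l g else ev (a l k g).

Definition glue_dom (w : M) (v : V0) : Prop := e i *: w = 0 /\ v \in S0.

Fact glueS_submod : submod_closed (fun v : V => (e i *: (v.1 : M) == 0) && (v.2 \in S0)).
split=> [|k u v]; rewrite /in_mem /= ?scaler0 ?eqxx; first exact: (rpred0 S0).
move=> /andP[/eqP u1 u2] /andP[/eqP v1 v2]; apply/andP; split.
 by rewrite scalerDr v1 addr0 kscaleE -pzscale_comm u1 scaler0.
exact: ((submod_predP S0).2 k u.2 v.2).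
Qed.
Fact glueR_submod : submod_closed (fun v : V => (v.1 == 0) && (v.2 \in R0)).
split=> [|k u v]; rewrite /in_mem /= ?eqxx; first exact: (rpred0 R0).
move=> /andP[/eqP u1 u2] /andP[/eqP v1 v2]; apply/andP; split.
 by rewrite v1 u1 scaler0 addr0.
exact: ((submod_predP R0).2 k u.2 v.2).
Qed.
Let S : submodule V := Submodule glueS_submod.
Let R : submodule V := Submodule glueR_submod.
Let inS w v : ((w, v) \in S) = (e i *: w == 0) && (v \in S0). by []. Qed.
Let inR w v : ((w, v) \in R) = (w == 0) && (v \in R0). by []. Qed.
Let inS0 v : ((0, v) \in S) = (v \in S0). by rewrite inS scaler0 eqxx. Qed.
Let inSl (w : M) l : l != i -> e l *: w = w -> (w, 0) \in S.
by rewrite eq_sym => /negbTE li ew; rewrite inS rpred0 andbT -ew scalerA (pr_ee P) li scale0r. Qed.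
Let inR0 v : ((0, v) \in R) = (v \in R0). by rewrite inR eqxx. Qed.

Let itXi k v : iter k (gX i) (0, v) = (0, iter k ep v).
by elim: k => //= k ->; rewrite /gX eqxx. Qed.
Let itXi2 k (v : V) : (iter k (gX i) v).2 = iter k ep v.2.
by elim: k => //= k <-; rewrite {1}/gX eqxx. Qed.
Let itXl k l w : l != i -> iter k (gX l) (w, 0) = (x l ^+ k *: w, 0).
move=> /negbTE li; elim: k => [|k IHk]; first by rewrite expr0 scale1r.
by rewrite iterS IHk /gX li /= exprS scalerA.
Qed.
Let itXl1 k l (v : V) : l != i -> (iter k (gX l) v).1 = x l ^+ k *: (v.1 : M).
move=> /negbTE li; elim: k => [|k IHk]; first by rewrite expr0 scale1r.
by rewrite iterS {1}/gX li /= IHk exprS scalerA.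
Qed.

Lemma glue : exists (Q : lmodType A) (pr : M -> V0 -> Q),
 [/\ forall q, exists w v, glue_dom w v /\ pr w v = q,
  forall k w v w' v', glue_dom w v -> glue_dom w' v' ->
   pr ((pzscal k : A) *: w + w') (k *: v + v') = (pzscal k : A) *: pr w v + pr w' v',
  forall w v, glue_dom w v -> pr w v = 0 <-> w = 0 /\ v \in R0, [/\ forall w v, glue_dom w v -> e i *: pr w v = pr 0 v,
    forall w v, glue_dom w v -> x i *: pr w v = pr 0 (ep v), forall l w v, l != i -> glue_dom w v -> e l *: pr w v = pr (e l *: w) 0
   & forall l w v, l != i -> glue_dom w v -> x l *: pr w v = pr (x l *: w) 0] &
  [/\ forall j g w v, valid i j g -> glue_dom w v -> a i j g *: pr w v = pr 0 (ain j g w),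
    forall j g w v, valid i j g -> glue_dom w v -> a j i g *: pr w v = pr (bout j g v) 0
   & forall l k g w v, valid l k g -> l != i -> k != i -> glue_dom w v ->
     a l k g *: pr w v = pr (a l k g *: w) 0]].
have vi k g : valid i k g -> k != i by move=> /andP[/(Om_bar_neq hC hO)]; rewrite eq_sym.
have evS l (b : A) w (v : V) : l != i -> e l * b = b -> ev b (w, v.2) \in S.
 by move=> li lb; apply: (inSl li); rewrite /= scalerA lb.
have evR (b : A) v : v \in R -> ev b v \in R.
 by case: v => w v; rewrite inR => /andP[/eqP-> _]; rewrite inR /= scaler0 eqxx rpred0.
have sE l : stable S R (gE l).
 rewrite /gE; case: eqP => [_|/eqP li]; split=> [] [w v].
 - by rewrite inS => /andP[_ vS]; rewrite inS0.
 - by rewrite inR => /andP[_ vS]; rewrite inR0.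
 - by move=> _; apply: (@evS l _ w (w, v)) => //; rewrite (pr_ee P) eqxx. exact: evR.
have sX l : stable S R (gX l).
 rewrite /gX; case: eqP => [_|/eqP li]; split=> [] [w v].
 - by rewrite inS => /andP[_ vS]; rewrite inS0 epS.
 - by rewrite inR => /andP[_ vS]; rewrite inR0 epR.
 - by move=> _; apply: (@evS l _ w (w, v)) => //; rewrite (pr_ex P). exact: evR.
have sL l k g : valid l k g -> stable S R (gL l k g).
 rewrite /gL; case: eqP => [->|/eqP li] vl; last (case: eqP vl => [->|/eqP ki] vl); split=> [] [w v].
 - by move=> _; rewrite inS0 ainS.
 - by rewrite inR => /andP[/eqP-> _]; rewrite inR0 /= linear0 rpred0.
 - rewrite inS => /andP[_ vS]; rewrite validC in vl; apply: (inSl li) => /=.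
  by rewrite boute.
 - rewrite inR => /andP[_ vR]; rewrite validC in vl; rewrite inR /=.
  by rewrite boutR // eqxx rpred0.
 - by move=> _; apply: (@evS l _ w (w, v)) => //; rewrite (pr_ea P). exact: evR.
have eqR (u v : V) : u = v -> u - v \in R by move=> ->; rewrite subrr rpred0.
have [| | | | | | | | |Q [pr [prS prL pr0 [pre prx pra]]]] := rep_subquot sE sX sL.
- move=> l k [w v] _; apply: eqR; rewrite /gE.
 have [lk|lk] := eqVneq l k.
  rewrite lk; case: eqP => //= _. by rewrite scalerA (pr_ee P) eqxx.
 case: eqP => [li|_]; case: eqP => [ki|_] /=; rewrite ?scaler0 //.
  by case/eqP: lk; rewrite li ki.
 by rewrite scalerA (pr_ee P) (negbTE lk) scale0r.
- move=> [w v] /[!inS] /andP[/eqP ew vS]; apply: eqR.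
 rewrite (bigD1 i) //= (eq_bigr (fun l => inlL (kmod M) V0 (e l *: w))) => [|l /negbTE li]; last first.
  by rewrite /gE li.
 rewrite -linear_sum /gE eqxx. have -> : \sum_(l | l != i) (e l *: (w : M) : kmod M) = w.
  rewrite sum_kscale; have -> : \sum_(l | l != i) e l = 1 - e i by rewrite -(pr_e1 P) [in RHS](bigD1 i) //= addrAC subrr add0r.
  by rewrite scalerBl ew scale1r subr0.
 by apply: injective_projections; rewrite /= ?add0r ?addr0.
- move=> l [w v] _; apply: eqR; rewrite /gE /gX; case: eqP => //= _.
 by rewrite scalerA (pr_ex P).
- move=> l [w v] _; apply: eqR; rewrite /gE /gX; case: eqP => //= _.
 by rewrite scalerA (pr_xe P).
- move=> l k g [w v] vl /[!inS] /andP[_ vS]; apply: eqR; rewrite /gE /gL.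
 have [//|li] := eqVneq l i; have [ki|ki] := eqVneq k i => /=.
  by rewrite ki validC in vl; rewrite boute.
 by rewrite scalerA (pr_ea P).
- move=> l k g [w v] vl _; apply: eqR; rewrite /gE /gL.
 have [li|li] := eqVneq l i; have [ki|ki] := eqVneq k i => //=.
 + by rewrite li ki in vl; have := vi _ _ vl; rewrite eqxx.
 + by rewrite li in vl; rewrite aine. by rewrite scalerA (pr_ae P).
- move=> l [w v] /[!inS] /andP[/eqP ew vS].
 have [->|li] := eqVneq l i.
  have -> : iter (D i) (gX i) (w, v) = (0, iter (D i) ep v).
   have := D_gt0 hD i; case: (D i) => // d _; rewrite iterSr {2}/gX eqxx /= itXi. by rewrite -iterSr.
  by rewrite inR0 epnil.
 have -> : iter (D l) (gX l) (w, v) = (x l ^+ D l *: w, 0).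
  have := D_gt0 hD l; case: (D l) => // d _; rewrite iterSr {2}/gX (negbTE li) /= itXl //. by rewrite scalerA -exprSr.
 by rewrite (pr_nil P) scale0r inR eqxx rpred0.
- move=> l k g [w v] vl /[!inS] /andP[_ vS].
 have [li|li] := eqVneq l i; have [ki|ki] := eqVneq k i.
 + by rewrite li ki in vl; have := vi _ _ vl; rewrite eqxx.
 + rewrite li in vl *; rewrite /gL eqxx /= itXi itXl1 //=.
  by rewrite -[_ - _]/(0 - 0, _) subrr inR0 ainC.
 + rewrite ki /gL eqxx (negbTE li) /= itXl // itXi2 /=.
  rewrite ki validC in vl; rewrite boutC //. by apply: eqR.
 apply: eqR; rewrite /gL (negbTE li) (negbTE ki) /= itXl // itXl1 //=. by rewrite !scalerA (pr_com P vl).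
- move=> l [w v] /[!inS] /andP[/eqP ew vS].
 have [->|li] := eqVneq l i.
  rewrite (eq_bigr (fun j => inrL (kmod M) V0 (\sum_(g < G i j) \sum_(k < f j i)
   sg i j *: iter k ep (ain j g (bout j g (iter (f j i - 1 - k) ep v)))))) => [|j ij]. by rewrite -linear_sum inR0 meshi.
  rewrite !linear_sum; apply: eq_bigr => g _; rewrite linear_sum; apply: eq_bigr => k _. rewrite linearZ; congr (_ *: _).
  have /negbTE ji : j != i by apply: (Om_bar_neq hC hO). by rewrite /gL !eqxx ji /= itXi2 itXi.
 rewrite (eq_bigr (fun j => inlL (kmod M) V0 (\sum_(g < G l j) \sum_(k < f j l)
   (mesh_term C Om x a l j g k : A) *: w))) => [|j ij].
  rewrite -linear_sum; under eq_bigr => j ij.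
   under eq_bigr do rewrite sum_kscale. rewrite sum_kscale; over.
  by rewrite sum_kscale (pr_mesh P) scale0r linear0 rpred0.
 rewrite !linear_sum; apply: eq_bigr => g _; rewrite linear_sum; apply: eq_bigr => k _. pose b := x l ^+ k * a l j g * a j l g * x l ^+ (f j l - 1 - k).
 have -> : mesh_term C Om x a l j g k *: w = sg l j *: (b *: (w : M) : kmod M).
  by rewrite /mesh_term -scalerA.
 rewrite linearZ; congr (_ *: _); rewrite {}/b. have lj : valid l j g by rewrite /valid_arrow Om_barC ij /=. have jl : valid j l g by rewrite validC.
 move: (nat_of_ord g) (nat_of_ord k) lj jl => {}g {}k lj jl. rewrite /gL (negbTE li); have [ji|ji] := eqVneq j i.
  rewrite ji in jl lj *; rewrite /= itXl // itXl1 //= ab //. by rewrite !scalerA.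
 by rewrite /= itXl1 // itXl //= !scalerA.
exists Q, (fun w v => pr (w, v)); split.
- move=> q; have [[w v] h <-] := prS q; exists w, v; split=> //.
 by move: h; rewrite inS => /andP[/eqP].
- move=> k w v w' v' [w0 vS] [w0' vS']; rewrite -prL ?inS ?w0 ?w0' ?vS ?vS' ?eqxx //.
- move=> w v [w0 vS]; rewrite pr0 ?inS ?w0 ?vS ?eqxx // inR.
 by split=> [/andP[/eqP]|[-> ->]]; rewrite ?eqxx.
- split=> [w v|w v|l w v li|l w v li] [w0 vS].
 + by rewrite pre ?inS ?w0 ?vS ?eqxx // /gE eqxx.
 + by rewrite prx ?inS ?w0 ?vS ?eqxx // /gX eqxx.
 + by rewrite pre ?inS ?w0 ?vS ?eqxx // /gE (negbTE li). by rewrite prx ?inS ?w0 ?vS ?eqxx // /gX (negbTE li).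
split=> [j g w v vl|j g w v vl|l k g w v vl li ki] [w0 vS].
- by rewrite pra ?inS ?w0 ?vS ?eqxx // /gL eqxx.
- by rewrite pra 1?validC ?inS ?w0 ?vS ?eqxx // /gL eqxx (negbTE (vi _ _ vl)).
by rewrite pra ?inS ?w0 ?vS ?eqxx // /gL (negbTE li) (negbTE ki).
Qed.
End Glue.
End Modules.

(** * The neighbour space at a vertex, with its outgoing and incoming maps *)

Section Coinduced.
Variables (K : fieldType) (n : nat) (C : 'M[int]_n) (D : 'I_n -> nat).
Variable Om : {set 'I_n * 'I_n}.
Hypotheses (hC : is_GCM C) (hD : is_symmetrizer C D) (hO : is_orientation C Om).
Notation f := (Cartan_f C).
Notation G := (Cartan_g C).
Notation valid := (valid_arrow C Om).
Notation sg := (sg K Om).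
Variables (A : pzAlgType K) (e x : 'I_n -> A) (a : 'I_n -> 'I_n -> nat -> A).
Hypothesis P : presentation C D Om e x a.
Variable i : 'I_n.
Implicit Types M N : lmodType A.

Definition TM M : lmodType K := (('I_n * nat * nat) -> kmod M)%type.

(** With H_j = K[x_j]/(x_j^(c_j)), this is the sum over the neighbours j of the H_i-modules induced
    from the e_j M. An element is stored as an infinite sequence in b whose first f_ji entries are
    free and which then repeats up to x_j^(f_ij); the loop x_i acts by the shift [sh]. *)
Definition tl_cond M (y : TM M) := forall j g b,
 [/\ valid i j g -> e j *: (y (j, g, b) : M) = y (j, g, b),
   valid i j g -> y (j, g, (b + f j i)%N) = x j ^+ f i j *: (y (j, g, b) : M)
  & ~~ valid i j g -> y (j, g, b) = 0].
Fact tl_submod M : submod_closed (fun y : TM M => `[< tl_cond y >]).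
split=> [|k u v /asboolP uP /asboolP vP]; apply/asboolP => j g b.
 by split=> // _; rewrite scaler0.
have [u1 u2 u3] := uP j g b; have [v1 v2 v3] := vP j g b; rewrite !fctE !kscaleE.
split=> h; last by rewrite u3 // v3 // scaler0 addr0.
 by rewrite scalerDr -pzscale_comm u1 // v1.
by rewrite scalerDr -pzscale_comm u2 // v2.
Qed.
Definition tl M := Submodule (@tl_submod M).
Lemma tlP M (y : TM M) : reflect (tl_cond y) (y \in tl M).
exact: asboolP. Qed.
Lemma tl_e M (y : TM M) j g b : y \in tl M -> e j *: (y (j, g, b) : M) = y (j, g, b).
move=> /tlP/(_ j g b)[h1 _ h3]; have [/h1//|/h3 ->] := boolP (valid i j g).
by rewrite scaler0.
Qed.
Lemma tl_shift M (y : TM M) j g b k : y \in tl M ->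
 y (j, g, (b + f j i * k)%N) = x j ^+ (f i j * k) *: (y (j, g, b) : M).
move=> yt; elim: k => [|k IHk]; first by rewrite !muln0 addn0 expr0 scale1r.
have /tlP/(_ j g (b + f j i * k)%N)[_ h2 h3] := yt.
have [v|v] := boolP (valid i j g).
 by rewrite mulnSr addnA h2 // IHk scalerA -exprD -mulnS.
have /tlP/(_ j g b)[_ _ h4] := yt; have /tlP/(_ j g (b + f j i * k.+1)%N)[_ _ h5] := yt.
by rewrite h4 // h5 // scaler0.
Qed.
Lemma tl_inv M (y : TM M) j g b : y \in tl M -> ~~ valid i j g -> y (j, g, b) = 0.
by move=> /tlP/(_ j g b)[]. Qed.
Lemma tl_eq M (y z : TM M) : y \in tl M -> z \in tl M ->
 (forall j g b, valid i j g -> (b < f j i)%N -> y (j, g, b) = z (j, g, b)) -> y = z.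
move=> yt zt yz; apply/funext => -[[j g] b].
have [v|v] := boolP (valid i j g); last by rewrite !tl_inv.
have f0 : (0 < f j i)%N by apply: (Cartan_f_gt0 hO); have /andP[] := v; rewrite Om_barC.
by rewrite (divn_eq b (f j i)) addnC mulnC !tl_shift // yz // ltn_mod.
Qed.

Fact sh_linear M : linear ((fun y p => y (p.1, p.2.+1)) : TM M -> TM M).
by []. Qed.
Definition sh M : {linear TM M -> TM M} := locked (mkL (@sh_linear M)).
Lemma shE M (y : TM M) j g b : sh M y (j, g, b) = y (j, g, b.+1). by rewrite /sh -lock. Qed.
Lemma iter_sh M (y : TM M) k j g b : iter k (sh M) y (j, g, b) = y (j, g, (b + k)%N).
by elim: k b => [|k IHk] b; rewrite ?addn0 // iterS shE IHk addSnnS. Qed.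
Lemma sh_tl M (y : TM M) : y \in tl M -> sh M y \in tl M.
move=> yt; apply/tlP => j g b; split=> v; rewrite !shE.
- exact: tl_e.
- by rewrite -[(b + _).+1]addSn -[f j i]muln1 tl_shift // muln1.
exact: tl_inv.
Qed.
Lemma iter_sh_tl M (y : TM M) k : y \in tl M -> iter k (sh M) y \in tl M.
by move=> yt; elim: k => //= k; apply: sh_tl. Qed.
(** Since D i = f_ji k_ij, shifting D i times multiplies the entries at j by x_j^(f_ij k_ij) =
    x_j^(D j) = 0. *)
Lemma sh_nil M (y : TM M) : y \in tl M -> iter (D i) (sh M) y = 0.
move=> yt; apply: tl_eq; [exact: iter_sh_tl | exact: rpred0 |] => j g b v _.
have /andP[ij _] := v; rewrite iter_sh -(CkE hD hO ij) tl_shift // (CkE' hD hO ij).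
by rewrite (pr_nil P) scale0r.
Qed.

Fact out_linear M : linear ((fun m p => a p.1.1 i p.1.2 *: (x i ^+ p.2 *: (m : M))) : kmod M -> TM M).
move=> k u v; apply/funext => -[[j g] b] /=; rewrite -[RHS]/((pzscal k : A) *: _ + _) !scalerDr.
by rewrite !(pzscale_comm k).
Qed.
Definition outL M : {linear kmod M -> TM M} := locked (mkL (@out_linear M)).
Lemma outE M (m : M) j g b : outL M m (j, g, b) = a j i g *: (x i ^+ b *: m). by rewrite /outL -lock. Qed.
Lemma out_tl M m : outL M m \in tl M.
apply/tlP => j g b; rewrite !outE; split=> v; first by rewrite scalerA (pr_ea P).
 by rewrite validC in v; rewrite addnC exprD !scalerA (pr_com P v) !mulrA.
by rewrite validC in v; rewrite (pr_a0 P v) scale0r.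
Qed.
Lemma out_e M m : outL M (e i *: (m : M)) = outL M m.
apply/funext => -[[j g] b]; rewrite !outE; case: b => [|b].
 by rewrite expr0 !scale1r scalerA (pr_ae P).
by rewrite exprSr -!scalerA [x i *: (e i *: m)]scalerA (pr_xe P).
Qed.
Lemma sh_out M m : sh M (outL M m) = outL M (x i *: (m : M)).
by apply/funext => -[[j g] b]; rewrite shE !outE exprSr -scalerA. Qed.
Lemma iter_sh_out M m k : iter k (sh M) (outL M m) = outL M (x i ^+ k *: (m : M)).
by elim: k => [|k IHk]; rewrite ?expr0 ?scale1r // iterS IHk sh_out exprS -scalerA. Qed.

(** The entry of index f_ji - 1 - k is paired with x_i^k, so that the composite with [outL] is
    literally the mesh sum at [i]. *)
Definition in_sum M (y : TM M) : M := \sum_(j | Om_bar Om j i) \sum_(g < G i j) \sum_(k < f j i)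
 (pzscal (sg i j) : A) *: (x i ^+ k *: (a i j g *: (y (j, nat_of_ord g, (f j i - 1 - k)%N) : M))).
Fact in_linear M : linear (@in_sum M : TM M -> kmod M).
move=> k u v; rewrite /= kscaleE /in_sum scaler_sumr -big_split; apply: eq_bigr => j _ /=.
rewrite scaler_sumr -big_split; apply: eq_bigr => g _ /=.
rewrite scaler_sumr -big_split; apply: eq_bigr => l _ /=.
rewrite -[(k *: u + v) _]/((pzscal k : A) *: (u _ : M) + v _ : M).
by rewrite !scalerDr; congr (_ + _); rewrite !(pzscale_comm k).
Qed.
Definition inL M : {linear TM M -> kmod M} := locked (mkL (@in_linear M)).
Lemma inE_ M (y : TM M) : inL M y = in_sum y. by rewrite /inL -lock. Qed.
Lemma in_e M (y : TM M) : e i *: (inL M y : M) = inL M y.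
rewrite inE_ /in_sum scaler_sumr; apply: eq_bigr => j _.
rewrite scaler_sumr; apply: eq_bigr => g _; rewrite scaler_sumr; apply: eq_bigr => k _.
rewrite -pzscale_comm; congr (_ *: _); case: (nat_of_ord k) => [|k'].
 by rewrite expr0 scale1r scalerA (pr_ea P).
by rewrite exprS -scalerA scalerA (pr_ex P).
Qed.
(** Shifting moves the term of index k to index k - 1. The term that leaves the range is recovered
    from y(f_ji) = x_j^(f_ij) y(0) and the commutation relation of x_i^(f_ji) with a_ij. *)
Lemma in_sh M (y : TM M) : y \in tl M -> inL M (sh M y) = x i *: (inL M y : M).
move=> yt; rewrite !inE_ /in_sum scaler_sumr; apply: eq_bigr => j ij.
rewrite scaler_sumr; apply: eq_bigr => g _; rewrite -!scaler_sumr -pzscale_comm.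
congr (_ *: _); have v : valid i j g by rewrite /valid_arrow Om_barC ij /=.
have f0 : (0 < f j i)%N by apply: (Cartan_f_gt0 hO ij).
have := pr_com P v; have := @tl_shift _ y j g 0 1 yt; rewrite !muln1 add0n.
case: (f j i) f0 => // q _ s1 c1; rewrite scaler_sumr big_ord_recl [RHS]big_ord_recr /=.
rewrite [LHS]addrC; congr (_ + _).
 apply: eq_bigr => k _; rewrite (_ : bump 0 k = k.+1) // exprS -scalerA subn1 /= shE subnSK //.
rewrite expr0 scale1r subn1 /= subn0 subnn shE s1.
by rewrite !scalerA -exprS c1.
Qed.
Lemma in_out M m : inL M (outL M m) = 0.
rewrite inE_ -[RHS](scale0r (m : M)) -(pr_mesh P i) scaler_suml; apply: eq_bigr => j _.
rewrite scaler_suml; apply: eq_bigr => g _; rewrite scaler_suml; apply: eq_bigr => k _.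
by rewrite outE /mesh_term -!scalerA.
Qed.

(** The element of [tl] that [inL] sends to a_ij m. In the range b < f_ji its only nonzero entry is
    the last one, b = f_ji - 1, which [inL] pairs with x_i^0; later entries are forced by
    periodicity, and the sign cancels that of [in_sum]. *)
Fact dl_linear M j g : linear ((fun m p => if [&& p.1.1 == j, p.1.2 == g & (f j i %| p.2.+1)%N] then
 (pzscal (sg i j) : A) *: (x j ^+ (f i j * (p.2.+1 %/ f j i)%N.-1) *: (e j *: (m : M))) else 0) : kmod M -> TM M).
move=> k u v; apply/funext => -[[l h] b]; rewrite -[RHS]/((pzscal k : A) *: _ + _) /=; case: ifP => _; last by rewrite scaler0 addr0.
by rewrite -[k *: u + v]/((pzscal k : A) *: (u : M) + v : M) !scalerDr !(pzscale_comm k).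
Qed.
Definition dlL M j g : {linear kmod M -> TM M} := locked (mkL (@dl_linear M j g)).
Lemma dlE M j g m l h b : dlL M j g m (l, h, b) = if [&& l == j, h == g & (f j i %| b.+1)%N] then
 (pzscal (sg i j) : A) *: (x j ^+ (f i j * (b.+1 %/ f j i)%N.-1) *: (e j *: (m : M))) else 0.
by rewrite /dlL -lock. Qed.
Lemma exj k j : (0 < k)%N -> e j * x j ^+ k = x j ^+ k.
by case: k => // k _; rewrite exprS mulrA (pr_ex P). Qed.
Lemma ex_comm k j : e j * x j ^+ k = x j ^+ k * e j.
case: k => [|k]; first by rewrite expr0 mulr1 mul1r.
by rewrite exj // exprSr -mulrA (pr_xe P).
Qed.
Lemma dl_tl M j g m : valid i j g -> dlL M j g m \in tl M.
move=> v; have f0 : (0 < f j i)%N by apply: (Cartan_f_gt0 hO); have /andP[] := v; rewrite Om_barC.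
apply/tlP => l h b; rewrite !dlE; split=> vl.
- case: ifP => [/and3P[/eqP-> _ _]|_]; last by rewrite scaler0.
 rewrite -pzscale_comm; congr (_ *: _). by rewrite [e j *: (_ *: _)]scalerA ex_comm -scalerA [e j *: (e j *: m)]scalerA (pr_ee P) eqxx.
- case: (boolP ((l == j) && (h == g))) => [/andP[/eqP lj /eqP hg]|/negbTE lh]; last first.
  by rewrite !andbA lh scaler0.
 rewrite lj hg !eqxx /= -addSn dvdn_addl // ; case: ifP => [/dvdnP[q qb]|_]; last by rewrite scaler0.
 rewrite -pzscale_comm; congr (_ *: _); rewrite [x j ^+ f i j *: (_ *: _)]scalerA -exprD; congr (x j ^+ _ *: _).
 rewrite divnDr // divnn f0 addn1 /= qb mulnK //. by case: q qb => [//|q _]; rewrite mulnS.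
by case: ifP => // /and3P[/eqP lj /eqP hg _]; case/negP: vl; rewrite lj hg.
Qed.
Lemma dl_e M j g m : dlL M j g (e j *: (m : M)) = dlL M j g m.
apply/funext => -[[l h] b]; rewrite !dlE; case: ifP => // _.
by rewrite [e j *: (e j *: m)]scalerA (pr_ee P) eqxx.
Qed.
Lemma sh_dl M j g m : valid i j g ->
 iter (f j i) (sh M) (dlL M j g m) = dlL M j g (x j ^+ f i j *: (m : M)).
move=> v; apply: tl_eq; [exact/iter_sh_tl/dl_tl | exact: dl_tl |] => l h b vl lb.
rewrite iter_sh.
case: (eqVneq l j) lb vl => [->|lj] lb vl; last by rewrite !dlE (negbTE lj).
have := tl_shift j h b 1%N (dl_tl m v); rewrite !muln1 => ->.
rewrite !dlE; case: ifP => [_|]; last by rewrite scaler0.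
rewrite -pzscale_comm; congr (_ *: _); rewrite [e j *: (x j ^+ f i j *: _)]scalerA ex_comm -scalerA !scalerA -!exprD.
by rewrite addnC.
Qed.
Lemma in_dl M j g m : valid i j g -> inL M (dlL M j g m) = a i j g *: (m : M).
move=> v; have /andP[ij gG] := v; have ji : Om_bar Om j i by rewrite Om_barC.
have f0 : (0 < f j i)%N by apply: (Cartan_f_gt0 hO ji).
rewrite inE_ /in_sum (bigD1 j) //= [X in _ + X]big1 ?addr0 => [|l /andP[_ lj]]; last first.
 by rewrite big1 // => h _; rewrite big1 // => k _; rewrite dlE (negbTE lj) !scaler0.
rewrite (bigD1 (Ordinal gG)) //= [X in _ + X]big1 ?addr0 => [|h hg]; last first.
 rewrite big1 // => k _; rewrite dlE eqxx /=; case: eqP => [hg'|_]; last by rewrite !scaler0. by case/eqP: hg; apply: val_inj.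
rewrite (bigD1 (Ordinal f0)) //= [X in _ + X]big1 ?addr0 => [|k k0]; last first.
 rewrite dlE !eqxx /= -subnDA add1n subnSK //. rewrite [(_ %| _)%N](_ : _ = false) ?scaler0 //; apply/negbTE/negP. have k1 : (0 < k)%N by rewrite lt0n.
 have lt : (f j i - k < f j i)%N by rewrite ltn_subrL k1. by rewrite gtnNdvd // subn_gt0.
rewrite dlE !eqxx /= subn0 subn1 prednK // dvdnn divnn f0 /= muln0 expr0 !scale1r.
by rewrite -pzscale_comm [_ *: (_ *: (a _ _ _ *: _))]scalerA -rmorphM sg2 rmorph1 scale1r scalerA (pr_ae P).
Qed.
(** The element of [tl] whose entries with b < f_ji are the e_j-parts of those of y. It has the
    shape of [in_sum] with a_ij replaced by [dlL] and x_i by the shift, so identities for [in_sum]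
    lift to [tl]. *)
Definition tl_ext M (y : TM M) : TM M := \sum_(j | Om_bar Om j i) \sum_(g < G i j) \sum_(k < f j i)
  sg i j *: iter k (sh M) (dlL M j g (y (j, nat_of_ord g, (f j i - 1 - k)%N))).
Lemma tl_ext_tl M (y : TM M) : tl_ext y \in tl M.
apply: rpred_sum => j ij; apply: rpred_sum => g _; apply: rpred_sum => k _.
by apply/rpredZ/iter_sh_tl/dl_tl; rewrite /valid_arrow Om_barC ij /=.
Qed.
Lemma tl_extE M (y : TM M) l h b : valid i l h -> (b < f l i)%N ->
 tl_ext y (l, h, b) = e l *: (y (l, h, b) : M).
move=> v lb; have /andP[il hG] := v; have li : Om_bar Om l i by rewrite Om_barC.
have E (T : Type) (r : seq T) (Q : pred T) (F : T -> TM M) p :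
  (\sum_(t <- r | Q t) F t) p = \sum_(t <- r | Q t) F t p.
 by elim/big_rec2: _ => // t u w _ <-.
rewrite /tl_ext E (bigD1 l) //= [X in _ + X]big1 ?addr0 => [|j /andP[_ lj]]; last first.
 rewrite E big1 // => g _; rewrite E big1 // => k _. by rewrite fctE iter_sh dlE eq_sym (negbTE lj) scaler0.
rewrite E (bigD1 (Ordinal hG)) //= [X in _ + X]big1 ?addr0 => [|g gh]; last first.
 rewrite E big1 // => k _; rewrite fctE iter_sh dlE eqxx /=. case: eqP => [hg'|_]; last by rewrite scaler0. by case/eqP: gh; apply: val_inj.
have bk : (f l i - 1 - b < f l i)%N by rewrite -subnDA ltn_subrL (leq_ltn_trans _ lb).
rewrite E (bigD1 (Ordinal bk)) //= [X in _ + X]big1 ?addr0 => [|k kb]; last first.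
 rewrite fctE iter_sh dlE !eqxx /=. rewrite [(_ %| _)%N](_ : _ = false) ?scaler0 //; apply/negbTE/negP => /dvdnP[q qE]. have : (q < 2)%N.
  rewrite -(ltn_pmul2r (leq_ltn_trans (leq0n b) lb)) -qE mul2n -addnn. by rewrite -addnS -addSn leq_add // ltn_ord.
 case: q qE => [//|[|//]]; rewrite mul1n => qE _; case/eqP: kb; apply: val_inj => /=. by rewrite subn1 -[X in X.-1]qE /= addKn.
have bE : ((b + (f l i - 1 - b)).+1 = f l i)%N.
 by rewrite subnKC ?subn1 ?prednK ?(leq_ltn_trans _ lb) // -ltnS prednK // (leq_ltn_trans _ lb).
have bE' : (f l i - 1 - (f l i - 1 - b) = b)%N.
 by rewrite subKn // -ltnS subn1 prednK // (leq_ltn_trans _ lb).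
rewrite fctE iter_sh dlE !eqxx bE bE' dvdnn divnn (leq_ltn_trans _ lb) //= muln0 expr0 !scale1r.
by rewrite kscaleE scalerA -rmorphM sg2 rmorph1 scale1r.
Qed.
Lemma tl_decomp M (y : TM M) : y \in tl M -> y = tl_ext y.
move=> yt; apply: tl_eq (tl_ext_tl y) _ => // l h b v lb.
by rewrite tl_extE // tl_e.
Qed.
End Coinduced.

(** * The two reflections at a vertex *)

Section Glued.
Variables (K : fieldType) (n : nat) (C : 'M[int]_n) (D : 'I_n -> nat).
Variable Om : {set 'I_n * 'I_n}.
Hypotheses (hC : is_GCM C) (hD : is_symmetrizer C D) (hO : is_orientation C Om).
Notation f := (Cartan_f C).
Notation G := (Cartan_g C).
Notation valid := (valid_arrow C Om).
Notation sg := (sg K Om).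
Variables (A : pzAlgType K) (e x : 'I_n -> A) (a : 'I_n -> 'I_n -> nat -> A).
Hypothesis P : presentation C D Om e x a.
Variable i : 'I_n.
Implicit Types M N : lmodType A.
Notation TM := (@TM K n A).
Notation tl M := (tl C Om e x i M).
Notation sh := (@sh K n A).
Notation out := (outL x a i).
Notation inn := (inL C Om x a i).
Notation dl := (dlL C Om e x i).

Lemma ee l j (M : lmodType A) (m : M) : e l *: (e j *: m) = if l == j then e j *: m else 0.
by rewrite scalerA (pr_ee P); case: ifP => // _; rewrite scale0r. Qed.
Lemma sum_e M (m : M) : \sum_l e l *: m = m.
by rewrite -scaler_suml (pr_e1 P) scale1r. Qed.
Lemma valid_neq j g : valid i j g -> j != i.
by move=> /andP[/(Om_bar_neq hC hO)]; rewrite eq_sym. Qed.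
Lemma opLE M (b : A) (m : M) : opL M b m = b *: m. by []. Qed.

(* A module whose part outside the vertex [i] is that of [M] (embedded by [gw]), and whose part *)
(* at [i] is the subquotient S0/R0 of V0 (by [gv]), with loop [ep] and arrows [ain], [bout] *)
Record glued M (V0 : lmodType K) (S0 R0 : submodule V0) (ep : V0 -> V0)
 (ain : 'I_n -> nat -> M -> V0) (bout : 'I_n -> nat -> V0 -> M) (Q : lmodType A) (gw : {linear kmod M -> kmod Q}) (gv : V0 -> Q) : Prop := {
 g_dec : forall q, exists w v, v \in S0 /\ q = gw w + gv v; g_vlin : forall k u v, u \in S0 -> v \in S0 -> gv (k *: u + v) = (pzscal k : A) *: gv u + gv v;
 g_w0 : forall w, gw w = 0 <-> e i *: (w : M) = w; g_v0 : forall v, v \in S0 -> gv v = 0 <-> v \in R0;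
 g_we : forall l (w : M), e l *: (gw w : Q) = gw (e l *: w); g_ve : forall v, v \in S0 -> e i *: gv v = gv v;
 g_wx : forall l (w : M), x l *: (gw w : Q) = gw (x l *: w); g_vx : forall v, v \in S0 -> x i *: gv v = gv (ep v);
 g_ain : forall j g (w : M), valid i j g -> a i j g *: (gw w : Q) = gv (ain j g w);
 g_bout : forall j g v, valid i j g -> v \in S0 -> a j i g *: gv v = gw (bout j g v); g_a : forall l k g (w : M), valid l k g -> l != i -> k != i ->
  a l k g *: (gw w : Q) = gw (a l k g *: w) }.

Section GluedEx.
Variables (M : lmodType A) (V0 : lmodType K) (S0 R0 : submodule V0).
Variables (ep : {linear V0 -> V0}) (ain : 'I_n -> nat -> {linear kmod M -> V0})
 (bout : 'I_n -> nat -> {linear V0 -> kmod M}).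
Hypotheses (epS : forall v, v \in S0 -> ep v \in S0) (epR : forall v, v \in R0 -> ep v \in R0).
Hypothesis ainS : forall j g w, valid i j g -> ain j g w \in S0.
Hypothesis boutR : forall j g v, valid i j g -> v \in R0 -> bout j g v = 0.
Hypothesis aine : forall j g (w : M), valid i j g -> ain j g (e j *: w) = ain j g w.
Hypothesis boute : forall j g v, valid i j g -> v \in S0 -> e j *: (bout j g v : M) = bout j g v.
Hypothesis epnil : forall v, v \in S0 -> iter (D i) ep v \in R0.
Hypothesis ainC : forall j g (w : M), valid i j g ->
 iter (f j i) ep (ain j g w) - ain j g (x j ^+ f i j *: w) \in R0.
Hypothesis boutC : forall j g v, valid i j g -> v \in S0 ->
 x j ^+ f i j *: (bout j g v : M) = bout j g (iter (f j i) ep v).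
Hypothesis meshi : forall v, v \in S0 ->
 \sum_(j | Om_bar Om j i) \sum_(g < G i j) \sum_(k < f j i)
  sg i j *: iter k ep (ain j g (bout j g (iter (f j i - 1 - k) ep v))) \in R0.
Hypothesis ab : forall j g (w : M), valid i j g -> bout j g (ain j g w) = a j i g *: (a i j g *: w).

Lemma glued_ex : exists (Q : lmodType A) (gw : {linear kmod M -> kmod Q}) (gv : V0 -> Q),
 glued S0 R0 ep (fun j g => ain j g) (fun j g => bout j g) gw gv.
have [Q [pr [prS prL pr0 [pre prx prel prxl] [pra pro prlk]]]] :=
 glue hC hD hO P epS epR ainS boutR aine boute epnil ainC boutC meshi ab.
have c0 (w : M) : e i *: ((1 - e i) *: w) = 0.
 by rewrite scalerBl scale1r scalerBr ee eqxx subrr.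
have dw w v : v \in S0 -> glue_dom e i S0 ((1 - e i) *: w : M) v by [].
have dw0 w : glue_dom e i S0 ((1 - e i) *: w : M) 0 by split; rewrite ?rpred0.
have dv v : v \in S0 -> glue_dom e i S0 (0 : M) v by split; rewrite ?scaler0.
have gwL : linear (fun w : kmod M => pr ((1 - e i) *: w) 0 : kmod Q).
 move=> k u v; rewrite kscaleE -prL //; congr pr; last by rewrite scaler0 addr0. by rewrite pzscale_comm -scalerDr.
have ce l (w : M) : l != i -> (1 - e i) *: (e l *: w) = e l *: w.
 by rewrite eq_sym => /negbTE li; rewrite scalerBl scale1r ee li subr0.
have ci (w : M) : (1 - e i) *: (e i *: w) = 0 by rewrite scalerBl scale1r ee eqxx subrr.
have ec l (w : M) : l != i -> e l *: ((1 - e i) *: w) = e l *: w.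
 by move=> /negbTE li; rewrite scalerBl scale1r scalerBr ee li subr0.
have p00 : pr 0 0 = 0 by apply/pr0; rewrite ?rpred0 //; apply: dv; rewrite rpred0.
have xe (b : A) l (w : M) : l != i -> b * e l = b -> b *: ((1 - e i) *: w) = b *: w.
 by move=> li be; rewrite -be -!scalerA ec.
have ex (b : A) l (w : M) : l != i -> e l * b = b -> (1 - e i) *: (b *: w) = b *: w.
 by move=> li be; rewrite -be -!scalerA ce.
exists Q, (mkL gwL), (pr 0); split=> /=.
- move=> q; have [w [v [[w0 vS] <-]]] := prS q; exists w, v; split=> //.
 rewrite scalerBl w0 subr0 scale1r. have /= := prL 1 w 0 0 v (conj w0 (rpred0 S0)) (dv _ vS). by rewrite rmorph1 !scale1r addr0 add0r => ->.
- by move=> k u v uS vS; rewrite -prL ?scaler0 ?addr0 //; apply: dv.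
- move=> w; rewrite pr0 ?rpred0 //; split=> [[h _]|h].
  by apply/esym/eqP; rewrite -subr_eq0; move: h; rewrite scalerBl scale1r => ->.
 by rewrite scalerBl scale1r h subrr.
- by move=> v vS; rewrite pr0; [split=> [[]|] | exact: dv].
- move=> l w; have [->|li] := eqVneq l i.
  by rewrite pre // ci.
 by rewrite prel // ec // ce.
- by move=> v vS; rewrite pre //; apply: dv.
- move=> l w; have [->|li] := eqVneq l i.
  rewrite prx // linear0; rewrite -[x i](pr_ex P) -scalerA ci. by rewrite p00.
 by rewrite prxl // (xe _ l) ?(pr_xe P) // (ex _ l) ?(pr_ex P).
- by move=> v vS; rewrite prx //; apply: dv.
- move=> j g w v; rewrite pra //; congr pr.
 by rewrite -(aine _ v) ec ?(valid_neq v) // aine.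
- move=> j g v vl vS; rewrite pro //; last exact: dv.
 by rewrite -(boute vl vS) ce ?(valid_neq vl).
move=> l k g w v li ki; rewrite prlk // (xe _ k) ?(pr_ae P) // (ex _ l) //.
exact: (pr_ea P).
Qed.
End GluedEx.

Section GluedFacts.
Variables (M : lmodType A) (V0 : lmodType K) (S0 R0 : submodule V0) (ep : V0 -> V0)
 (ain : 'I_n -> nat -> M -> V0) (bout : 'I_n -> nat -> V0 -> M) (Q : lmodType A) (gw : {linear kmod M -> kmod Q}) (gv : V0 -> Q).
Hypothesis gQ : glued S0 R0 ep ain bout gw gv.

Lemma gv0 : gv 0 = 0.
have := g_vlin gQ 1 (rpred0 S0) (rpred0 S0); rewrite rmorph1 !scale1r addr0.
by move/eqP; rewrite -subr_eq0 opprD addNKr oppr_eq0 => /eqP.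
Qed.
Lemma gvD u v : u \in S0 -> v \in S0 -> gv (u + v) = gv u + gv v.
by move=> uS vS; rewrite -[u]scale1r (g_vlin gQ) // rmorph1 !scale1r. Qed.
Lemma gvZ k u : u \in S0 -> gv (k *: u) = (pzscal k : A) *: gv u.
by move=> uS; rewrite -[k *: u]addr0 (g_vlin gQ) ?rpred0 // gv0 addr0. Qed.
Lemma gv_eq u v : u \in S0 -> v \in S0 -> gv u = gv v <-> u - v \in R0.
move=> uS vS; have dS : u - v \in S0 by rewrite rpredB.
rewrite -(g_v0 gQ) // -scaleN1r gvD ?rpredZ // gvZ // rmorphN1 scaleN1r.
by split=> [->|/eqP]; rewrite ?subrr // subr_eq0 => /eqP.
Qed.
Lemma gwi (w : M) : gw (e i *: w) = 0.
by apply/(g_w0 gQ); rewrite ee eqxx. Qed.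
Lemma gwei (w : M) : e i *: (gw w : Q) = 0.
by rewrite (g_we gQ) gwi. Qed.
Lemma gvel l v : v \in S0 -> l != i -> e l *: gv v = 0.
by move=> vS /negbTE li; rewrite -(g_ve gQ vS) ee li. Qed.
Lemma g_sum0 w v : v \in S0 -> gw w + gv v = 0 <-> gw w = 0 /\ gv v = 0.
move=> vS; split=> [h|[-> ->]]; last by rewrite addr0.
have v0 : gv v = 0.
 by have := scaler0 Q (e i); rewrite -{1}h scalerDr gwei add0r (g_ve gQ).
by split=> //; rewrite -h v0 addr0.
Qed.
Lemma g_el l w v : v \in S0 -> l != i -> e l *: ((gw w : Q) + gv v) = gw (e l *: (w : M)).
by move=> vS li; rewrite scalerDr gvel // addr0 (g_we gQ). Qed.
Lemma g_ei w v : v \in S0 -> e i *: ((gw w : Q) + gv v) = gv v.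
by move=> vS; rewrite scalerDr gwei add0r (g_ve gQ). Qed.
Lemma gw_inj (w w' : M) : e i *: w = 0 -> e i *: w' = 0 -> gw w = gw w' -> w = w'.
move=> w0 w0' /eqP; rewrite -subr_eq0 -linearB => /eqP/(g_w0 gQ).
rewrite -[_ - _]/((w : M) - w') scalerBr w0 w0' subrr => /esym/eqP.
by rewrite subr_eq0 => /eqP.
Qed.
Lemma g_part (q : Q) : e i *: q = 0 -> exists w, e i *: (w : M) = 0 /\ q = gw w.
move=> q0; have [w [v [vS qE]]] := g_dec gQ q.
move: q0; rewrite qE g_ei // => v0; exists (w - e i *: (w : M)); split.
 by rewrite scalerBr ee eqxx subrr.
by rewrite v0 addr0 (linearB gw) gwi subr0.
Qed.
Lemma g_partl (q : Q) l : l != i -> e l *: q = q -> exists w, e l *: (w : M) = w /\ q = gw w.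
move=> li ql; have [w [v [vS qE]]] := g_dec gQ q.
by exists (e l *: (w : M)); rewrite ee eqxx; split=> //; rewrite -ql qE g_el.
Qed.
Lemma g_parti (q : Q) : e i *: q = q -> exists2 v, v \in S0 & q = gv v.
move=> qi; have [w [v [vS qE]]] := g_dec gQ q.
by exists v => //; rewrite -qi qE g_ei.
Qed.

Lemma glue_hom N (al : {linear kmod M -> kmod N}) (be : V0 -> N) :
 (forall k u v, u \in S0 -> v \in S0 -> be (k *: u + v) = (pzscal k : A) *: be u + be v) -> (forall v, v \in R0 -> be v = 0) ->
 (forall w : M, al (e i *: w) = 0) -> (forall l (w : M), l != i -> al (e l *: w) = e l *: (al w : N)) ->
 (forall l (w : M), l != i -> al (x l *: w) = x l *: (al w : N)) -> (forall l k g (w : M), valid l k g -> l != i -> k != i ->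
   al (a l k g *: w) = a l k g *: (al w : N)) ->
 (forall v, v \in S0 -> e i *: be v = be v) -> (forall v, v \in S0 -> x i *: be v = be (ep v)) ->
 (forall j g w, valid i j g -> a i j g *: (al w : N) = be (ain j g w)) -> (forall j g v, valid i j g -> v \in S0 -> a j i g *: be v = al (bout j g v)) ->
 (forall v, v \in S0 -> ep v \in S0) -> (forall j g w, valid i j g -> ain j g w \in S0) ->
 exists h : {linear Q -> N}, (forall w, h (gw w) = al w) /\ (forall v, v \in S0 -> h (gv v) = be v).
move=> beL beR ali ale alx ala bee bex alain albout epS ainS.
have bE v : v \in S0 -> be v = e i *: be v by move=> vS; rewrite bee.
have be0 : be 0 = 0 by apply: beR; rewrite rpred0.
have al0 w : gw w = 0 -> al w = 0 by move=> /(g_w0 gQ) <-.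
have [pw pwP] := choice (g_dec gQ); have [pv pvP] := choice pwP.
have uniq w v w' v' : v \in S0 -> v' \in S0 -> gw w + gv v = gw w' + gv v' -> al w + be v = al w' + be v'.
 move=> vS vS' h; have [h1 h2] : gw (w - w') = 0 /\ gv (v - v') = 0.
  have dS : v - v' \in S0 by rewrite rpredB. apply/g_sum0 => //; rewrite linearB -[v - v']addrC -scaleN1r (g_vlin gQ) // rmorphN1 scaleN1r.
  by rewrite [- _ + gv v]addrC addrACA -opprD h subrr.
 have b0 : be v = be v'.
  apply/eqP; rewrite -subr_eq0 addrC -scaleN1r -[-1](rmorphN1 (@pzscal K A)) -beL // scaleN1r addrC. by apply/eqP/beR; rewrite -(g_v0 gQ) // rpredB.
 have := al0 _ h1; rewrite linearB => /eqP; rewrite subr_eq0 => /eqP ->. by rewrite b0.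
pose h q := al (pw q) + be (pv q).
have hE w v : v \in S0 -> h (gw w + gv v) = al w + be v.
 by move=> vS; have [vS' E] := pvP (gw w + gv v); apply: uniq.
have hw w : h (gw w) = al w by have := hE w 0 (rpred0 S0); rewrite gv0 be0 !addr0.
have hv v : v \in S0 -> h (gv v) = be v by move=> vS; have := hE 0 v vS; rewrite !linear0 !add0r.
have hL : linear (h : kmod Q -> kmod N).
 move=> k u v; have [w1 [v1 [vS1 ->]]] := g_dec gQ u; have [w2 [v2 [vS2 ->]]] := g_dec gQ v.
 rewrite !hE // kscaleE scalerDr addrACA -kscaleE -linearP -(g_vlin gQ) //.
 rewrite hE ?rpredD ?rpredZ // linearP beL // kscaleE scalerDr -!addrA; congr (_ + _). by rewrite addrCA.
have ali0 w : e i *: (al w : N) = 0.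
 rewrite -[w in al w](sum_e (w : M)) (linear_sum al) scaler_sumr big1 // => l _.
 by have [->|li] := eqVneq l i; rewrite ?ali ?scaler0 // ale // ee eq_sym (negbTE li).
have beel v l : v \in S0 -> l != i -> e l *: be v = 0.
 by move=> vS /negbTE li; rewrite bE // ee li.
have [|||h' h'E] := gen_linear P (h := mkL hL).
- move=> l q /=; have [w [v [vS ->]]] := g_dec gQ q; rewrite hE //.
 have [->|li] := eqVneq l i.
  by rewrite g_ei // hv // scalerDr ali0 add0r bee.
 by rewrite g_el // hw scalerDr beel // addr0 ale.
- move=> l q /=; have [w [v [vS ->]]] := g_dec gQ q; rewrite hE // !scalerDr (g_wx gQ).
 have [->|li] := eqVneq l i.
  rewrite (g_vx gQ) // hE ?epS // bex //; congr (_ + _). by rewrite -{1}(pr_ex P) -scalerA ali -(pr_xe P) -scalerA ali0 scaler0.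
 have -> : x l *: gv v = 0 by rewrite -(pr_xe P) -scalerA gvel // scaler0. rewrite addr0 hw.
 have -> : x l *: be v = 0 by rewrite -(pr_xe P) -scalerA beel // scaler0. by rewrite addr0 alx.
- move=> l k g q v /=; have [w [u [uS ->]]] := g_dec gQ q; rewrite hE // !scalerDr.
 have [ki|ki] := eqVneq k i.
  rewrite ki in v *. have -> : a l i g *: (gw w : Q) = 0 by rewrite -(pr_ae P) -scalerA gwei scaler0.
  have -> : a l i g *: (al w : N) = 0 by rewrite -(pr_ae P) -scalerA ali0 scaler0. by rewrite validC in v; rewrite !add0r (g_bout gQ) // hw albout.
 have -> : a l k g *: gv u = 0 by rewrite -(pr_ae P) -scalerA gvel // scaler0. have -> : a l k g *: be u = 0 by rewrite -(pr_ae P) -scalerA beel // scaler0.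
 rewrite !addr0; have [li|li] := eqVneq l i.
  by rewrite li in v *; rewrite (g_ain gQ) // hv ?ainS // alain.
 by rewrite (g_a gQ) // hw ala.
by exists h'; split=> [w|v vS]; rewrite h'E /= ?hw ?hv.
Qed.
End GluedFacts.

Definition conc M := forall m : M, e i *: m = m.

Section SpEx.
Variable N : lmodType A.
Fact kin_submod : submod_closed (fun y : TM N => (y \in tl N) && (inn N y == 0)).
split=> [|k u v]; rewrite /in_mem /= ?linear0 ?eqxx ?andbT; first exact: (rpred0 (tl N)).
move=> /andP[u1 /eqP u2] /andP[v1 /eqP v2]; rewrite linearP u2 v2 scaler0 addr0 eqxx andbT.
exact: ((submod_predP (tl N)).2 k u v u1 v1).
Qed.
Definition kin := Submodule kin_submod.
Fact zero_submod (V : lmodType K) : submod_closed (fun y : V => y == 0).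
by split=> [|k u v]; rewrite /in_mem //= => /eqP-> /eqP->; rewrite scaler0 addr0. Qed.
Definition zS (V : lmodType K) := Submodule (@zero_submod V).
Lemma kinP y : y \in kin <-> y \in tl N /\ inn N y = 0.
by split=> [/andP[? /eqP]|[? /eqP h]] //; apply/andP. Qed.
Lemma zSP (V : lmodType K) (y : V) : y \in zS V <-> y = 0.
by split=> [/eqP|->]; rewrite // /in_mem /=. Qed.

Definition Sp_ain j g : {linear kmod N -> TM N} := out N \o opL N (a i j g).
Fact Sp_bout_linear j g : linear (fun y : TM N => y (j, g, 0%N) : kmod N). by []. Qed.
Definition Sp_bout j g : {linear TM N -> kmod N} := mkL (Sp_bout_linear j g).

(** The reflection whose part at [i] is the kernel of [in]: an arrow into [i] acts by a_ij followed
    by [out], an arrow out of [i] reads off the entry b = 0. The mesh sum at [i] of y becomes out(in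
    y), which is zero. *)
Lemma Sp_ex : exists (Q : lmodType A) (gw : {linear kmod N -> kmod Q}) (gv : TM N -> Q),
 glued kin (zS _) (sh N) (fun j g => Sp_ain j g) (fun j g => Sp_bout j g) gw gv.
apply: glued_ex.
- by move=> v /kinP[vt v0]; apply/kinP; rewrite sh_tl // (in_sh hO P) // v0 scaler0.
- by move=> v /zSP->; rewrite linear0; apply/zSP.
- by move=> j g w v; apply/kinP; rewrite /= (out_tl P) (in_out P).
- by move=> j g v vl /zSP->; rewrite linear0.
- by move=> j g w v; rewrite /= scalerA (pr_ae P).
- by move=> j g v vl /kinP[vt _]; rewrite /= (tl_e _ _ _ vt).
- by move=> v /kinP[vt _]; rewrite (sh_nil hD hO P) //; apply/zSP.
- move=> j g w v; apply/zSP; rewrite /= iter_sh_out; apply/eqP; rewrite subr_eq0; apply/eqP.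
 by congr (out N _); rewrite !scalerA (pr_com P v).
- move=> j g v vl /kinP[vt _] /=; rewrite iter_sh add0n.
 by have := tl_shift j g 0 1 vt; rewrite !muln1 add0n => ->.
- move=> v /kinP[vt v0]; apply/zSP; rewrite -[RHS](linear0 (out N)) -v0 inE_ /in_sum.
 rewrite linear_sum; apply: eq_bigr => j ij; rewrite linear_sum; apply: eq_bigr => g _.
 rewrite linear_sum; apply: eq_bigr => k _; rewrite -kscaleE linearZ; congr (_ *: _). by rewrite /= iter_sh_out iter_sh add0n.
by move=> j g w v; rewrite /= outE expr0 scale1r.
Qed.
End SpEx.

Section ZEx.
Variables (M : lmodType A) (m0 : M) (d : nat).
Hypotheses (dD : (d <= D i)%N) (em0 : e i *: m0 = m0) (xm0 : x i ^+ d *: m0 = 0).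
Let H : lmodType K := (nat -> K^o)%type.
Let V0 : lmodType K := (TM M * H)%type.
(** For d = 0 the quotient ZS/ZR is the cokernel of [out], the part at [i] of the opposite
    reflection [Sm]. For d = D i a free K[x_i]/(x_i^(D i))-module of rank one is added, with
    generator lying over m0; this variant produces the projective module at [i]. *)
Fact ZS_submod : submod_closed (fun v : V0 => (v.1 \in tl M) && `[< forall k, (d <= k)%N -> v.2 k = 0 >]).
split=> [|k u v]; rewrite /in_mem /=; first by apply/andP; split; [exact: (rpred0 (tl M)) | apply/asboolP].
move=> /andP[u1 /asboolP u2] /andP[v1 /asboolP v2]; apply/andP; split.
 exact: ((submod_predP (tl M)).2 k u.1 v.1 u1 v1).
by apply/asboolP => l dl; rewrite !fctE u2 // v2 // scaler0 addr0.
Qed.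
Definition ZS := Submodule ZS_submod.
Fact ZR_submod : submod_closed (fun v : V0 => `[< exists m, out M m = v.1 /\ v.2 = 0 >]).
split=> [|k u v /asboolP[m [m1 m2]] /asboolP[m' [m1' m2']]]; apply/asboolP.
 by exists 0; rewrite linear0.
by exists (k *: m + m'); rewrite linearP m1 m1' /= m2 m2' scaler0 addr0.
Qed.
Definition ZR := Submodule ZR_submod.
Lemma ZSP y h : (y, h) \in ZS <-> y \in tl M /\ forall k, (d <= k)%N -> h k = 0.
by split=> [/andP[? /asboolP]|[? ?]] //; apply/andP; split=> //; apply/asboolP. Qed.
Lemma ZRP y h : (y, h) \in ZR <-> exists m, out M m = y /\ h = 0.
by split=> [/asboolP|?] //; apply/asboolP. Qed.

Definition hsh (h : H) : H := fun k => if k is k'.+1 then (if (k < d)%N then h k' else 0) else 0.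
Fact Zep_linear : linear (fun v : V0 => (sh M v.1, hsh v.2) : V0).
move=> k u v; apply: injective_projections; rewrite /= ?linearP //.
by apply/funext => -[|l]; rewrite !fctE /= ?scaler0 ?addr0 //; case: ifP; rewrite ?scaler0 ?addr0.
Qed.
Definition Zep := locked (mkL Zep_linear).
Lemma ZepE y h : Zep (y, h) = (sh M y, hsh h). by rewrite /Zep -lock. Qed.
Definition Zain j g : {linear kmod M -> V0} := inlL _ _ \o dl M j g.
Lemma ZainE j g m : Zain j g m = (dl M j g m, 0). by []. Qed.
Definition Zval (v : V0) : M := inn M v.1 + \sum_(k < d) (pzscal (v.2 k : K) : A) *: (x i ^+ k *: m0).
Fact Zval_linear : linear (Zval : V0 -> kmod M).
move=> k u v; rewrite /Zval /= linearP -[RHS]/((pzscal k : A) *: (_ + _ : M) + _).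
rewrite scalerDr [RHS]addrACA scaler_sumr -big_split; congr (_ + _).
apply: eq_bigr => l _ /=; rewrite -[(_ + _) _]/(k * u.2 l + v.2 l) rmorphD rmorphM scalerDl -scalerA.
by [].
Qed.
Definition ZvalL := locked (mkL Zval_linear).
Lemma ZvalE y h : ZvalL (y, h) = inn M y + \sum_(k < d) (pzscal (h k : K) : A) *: (x i ^+ k *: m0).
by rewrite /ZvalL -lock. Qed.
Definition Zbout j g : {linear V0 -> kmod M} := opL M (a j i g) \o ZvalL.

Lemma Zval_ep v : v \in ZS -> ZvalL (Zep v) = x i *: (ZvalL v : M).
case: v => y h /ZSP[yt h0]; rewrite ZepE !ZvalE (in_sh hO P) // scalerDr; congr (_ + _).
rewrite scaler_sumr; have key d' : d' = d -> \sum_(k < d') pzscal (hsh h k : K) *: (x i ^+ k *: m0) =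
  \sum_(k < d') x i *: ((pzscal (h k : K) : A) *: (x i ^+ k *: m0)); last exact: key.
case: d' => [|d'] dE; first by rewrite !big_ord0.
rewrite big_ord_recl big_ord_recr /= rmorph0 scale0r add0r.
rewrite -pzscale_comm [x i *: (x i ^+ d' *: m0)]scalerA -exprS dE xm0 scaler0 addr0.
apply: eq_bigr => k _; rewrite (_ : bump 0 k = k.+1) // -dE ltnS ltn_ord.
by rewrite -(pzscale_comm (h k)) [x i *: (x i ^+ k *: m0)]scalerA -exprS.
Qed.
Lemma Zep_S v : v \in ZS -> Zep v \in ZS.
case: v => y h /ZSP[yt h0]; rewrite ZepE; apply/ZSP; split; first exact: sh_tl.
by case=> [|k] //= dk; rewrite ltnNge dk.
Qed.
Lemma Zep_iter v k : v \in ZS -> iter k Zep v \in ZS /\ ZvalL (iter k Zep v) = x i ^+ k *: (ZvalL v : M).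
move=> vS; elim: k => [|k [IH1 IH2]]; first by rewrite expr0 scale1r.
by rewrite iterS Zep_S // Zval_ep // IH2 scalerA -exprS.
Qed.
Lemma Zep_iterE y h k : exists h', iter k Zep (y, h) = (iter k (sh M) y, h') /\
 (forall l, (l < k)%N -> h' l = 0) /\ (h = 0 -> h' = 0).
elim: k => [|k [h' [IH1 [IH2 IH3]]]]; first by exists h.
exists (hsh h'); rewrite iterS IH1 ZepE; split=> //; split=> [[|l] //= lk|/IH3->].
 by rewrite IH2 //; case: ifP.
by apply/funext => -[|l] //=; case: ifP.
Qed.
Lemma Z_ex : exists (Q : lmodType A) (gw : {linear kmod M -> kmod Q}) (gv : V0 -> Q),
 glued ZS ZR Zep (fun j g => Zain j g) (fun j g => Zbout j g) gw gv.
have dlS j g w : valid i j g -> Zain j g w \in ZS.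
 by move=> v; rewrite ZainE; apply/ZSP; split=> //; apply: (dl_tl hO P).
have R0 v : v = 0 -> v \in ZR by move=> ->; apply: rpred0.
apply: glued_ex => //.
- exact: Zep_S.
- move=> [y h] /ZRP[m [<- ->]]; rewrite ZepE; apply/ZRP; exists (x i *: (m : M)).
 by rewrite sh_out; split=> //; apply/funext => -[|l] //=; case: ifP.
- move=> j g [y h] v /ZRP[m [<- ->]]; rewrite /= ZvalE (in_out P) add0r big1 ?scaler0 // => k _.
 by rewrite rmorph0 scale0r.
- by move=> j g w v; rewrite !ZainE (dl_e P).
- by move=> j g v vl vS; rewrite /= scalerA (pr_ea P).
- move=> [y h] vS; have [h' [E [h1 _]]] := Zep_iterE y h (D i).
 have /ZSP[yt h0] := vS; have [+ _] := Zep_iter (D i) vS; rewrite E => /ZSP[_ h2]. apply: R0; congr pair; first by rewrite (sh_nil hD hO P).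
 apply/funext => k; have [kd|dk] := ltnP k d; last exact: h2. by apply: h1; apply: leq_trans kd dD.
- move=> j g w v; apply: R0; have [h' [E [_ h0]]] := Zep_iterE (dl M j g w) 0 (f j i).
 rewrite !ZainE E h0 // (sh_dl hO P) //. by rewrite -[_ - _]/(_ - _, 0 - 0) !subrr.
- move=> j g v vl vS; rewrite /= (Zep_iter (f j i) vS).2 !scalerA (pr_com P) // validC //.
(* Reassembling the entries by [tl_decomp], the mesh sum of v is (out(val v), 0), an element of
   ZR. *)
- move=> v vS; have -> : \sum_(j | Om_bar Om j i) \sum_(g < G i j) \sum_(k < f j i)
   sg i j *: iter k Zep (Zain j g (Zbout j g (iter (f j i - 1 - k) Zep v))) = (out M (ZvalL v), 0).
  rewrite {1}(tl_decomp hO P (out_tl P i (ZvalL v))) -[RHS]/(inlL _ H _) linear_sum. apply: eq_bigr => j ij; rewrite linear_sum; apply: eq_bigr => g _.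
  rewrite linear_sum; apply: eq_bigr => k _; rewrite linearZ; congr (_ *: _). rewrite /= (Zep_iter _ vS).2 outE; set m := a j i g *: _.
  have [h' [E [_ h0]]] := Zep_iterE (dl M j g m) 0 k. by rewrite E h0.
 by apply/ZRP; exists (ZvalL v).
move=> j g w v; rewrite /= ZvalE (in_dl hO P) // big1 ?addr0 // => k _.
by rewrite rmorph0 scale0r.
Qed.
End ZEx.
End Glued.

(** * Functoriality of the reflections, unit and counit *)

Section Functors.
Variables (K : fieldType) (n : nat) (C : 'M[int]_n) (D : 'I_n -> nat).
Variable Om : {set 'I_n * 'I_n}.
Hypotheses (hC : is_GCM C) (hD : is_symmetrizer C D) (hO : is_orientation C Om).
Notation f := (Cartan_f C).
Notation G := (Cartan_g C).
Notation valid := (valid_arrow C Om).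
Variables (A : pzAlgType K) (e x : 'I_n -> A) (a : 'I_n -> 'I_n -> nat -> A).
Hypothesis P : presentation C D Om e x a.
Implicit Types M N : lmodType A.
Notation TM := (@TM K n A).
Variable i : 'I_n.
Notation tl M := (tl C Om e x i M).
Notation sh := (@sh K n A).
Notation out := (outL x a i).
Notation inn := (inL C Om x a i).
Notation dl := (dlL C Om e x i).
Notation kin := (kin C Om e x a i).
Notation ee := (ee P).

Definition isSp N Q (gw : {linear kmod N -> kmod Q}) (gv : TM N -> Q) :=
 glued C Om e x a i (kin N) (zS (TM N)) (sh N) (fun j g => Sp_ain x a i N j g)
  (fun j g => Sp_bout N j g) gw gv.
Definition isZ M (m0 : M) d Q (gw : {linear kmod M -> kmod Q}) (gv : TM M * (nat -> K^o) -> Q) :=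
 glued C Om e x a i (ZS C Om e x i M d) (ZR x a i M) (Zep n M d) (fun j g => Zain C Om e x i M j g)
  (fun j g => Zbout C Om x a i m0 d j g) gw gv.

Fact fT_linear M N (h : {linear M -> N}) : linear ((fun y p => h (y p)) : TM M -> TM N).
by move=> k u v; apply/funext => p; rewrite !fctE /= (linearP (kmap h)). Qed.
Definition fT M N (h : {linear M -> N}) : {linear TM M -> TM N} := locked (mkL (fT_linear h)).
Lemma fTE M N (h : {linear M -> N}) y p : fT h y p = h (y p). by rewrite /fT -lock. Qed.
Lemma fT_tl M N (h : {linear M -> N}) y : y \in tl M -> fT h y \in tl N.
move=> yt; apply/tlP => j g b; split=> v; rewrite !fTE.
- by rewrite -linearZ /= (tl_e _ _ _ yt).
- by have := tl_shift j g b 1 yt; rewrite !muln1 => ->; rewrite linearZ.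
by rewrite (tl_inv _ yt v) linear0.
Qed.
Lemma fT_tl_inv M N (h : {linear M -> N}) y : injective h -> fT h y \in tl N -> y \in tl M.
move=> hI yt; apply/tlP => j g b; split=> v; apply: hI.
- by rewrite linearZ /=; have := tl_e j g b yt; rewrite fTE.
- by rewrite linearZ /=; have := tl_shift j g b 1 yt; rewrite !muln1 !fTE.
by have := tl_inv b yt v; rewrite fTE linear0.
Qed.
Lemma fT_sh M N (h : {linear M -> N}) y : fT h (sh M y) = sh N (fT h y).
by apply/funext => -[[j g] b]; rewrite fTE !shE fTE. Qed.
Lemma fT_out M N (h : {linear M -> N}) m : fT h (out M m) = out N (h m).
by apply/funext => -[[j g] b]; rewrite fTE !outE !linearZ. Qed.
Lemma fT_dl M N (h : {linear M -> N}) j g m : fT h (dl M j g m) = dl N j g (h m).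
by apply/funext => -[[l k] b]; rewrite fTE !dlE; case: ifP; rewrite ?linear0 ?linearZ //= !linearZ.
Qed.
Lemma fT_in M N (h : {linear M -> N}) y : inn N (fT h y) = h (inn M y).
rewrite !inE_ /in_sum linear_sum; apply: eq_bigr => j _; rewrite linear_sum; apply: eq_bigr => g _.
by rewrite linear_sum; apply: eq_bigr => k _; rewrite fTE !linearZ.
Qed.
Lemma fT_inj M N (h : {linear M -> N}) : injective h -> injective (fT h).
by move=> hI y z E; apply/funext => p; apply: hI; rewrite -!fTE E. Qed.
Lemma fT_kin M N (h : {linear M -> N}) y : y \in kin M -> fT h y \in kin N.
by move=> /kinP[yt y0]; apply/kinP; rewrite fT_tl // fT_in y0 linear0. Qed.

Section SpFacts.
Variables (N Q : lmodType A) (gw : {linear kmod N -> kmod Q}) (gv : TM N -> Q).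
Hypothesis sQ : isSp gw gv.

Lemma Sp_gv_inj y : y \in kin N -> gv y = 0 -> y = 0.
by move=> yk /(g_v0 sQ yk)/zSP. Qed.

Lemma Sp_map N' Q' (gw' : {linear kmod N' -> kmod Q'}) gv' (h : {linear N -> N'}) :
 isSp gw' gv' -> exists H : {linear Q -> Q'}, (forall w, H (gw w) = gw' (h w)) /\
  (forall y, y \in kin N -> H (gv y) = gv' (fT h y)).
move=> sQ'; apply: (glue_hom P sQ (al := gw' \o kmap h) (be := fun y => gv' (fT h y))).
- by move=> k u v uk vk; rewrite linearP (g_vlin sQ') // fT_kin.
- by move=> v /zSP->; rewrite linear0 (gv0 sQ').
- by move=> w /=; rewrite linearZ (gwi P sQ').
- by move=> l w li /=; rewrite linearZ (g_we sQ').
- by move=> l w li /=; rewrite linearZ (g_wx sQ').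
- by move=> l k g w v li ki /=; rewrite linearZ (g_a sQ').
- by move=> v vk; rewrite (g_ve sQ') // fT_kin.
- by move=> v vk; rewrite (g_vx sQ') ?fT_kin // fT_sh.
- by move=> j g w v /=; rewrite (g_ain sQ') //= fT_out linearZ.
- by move=> j g v vl vk; rewrite (g_bout sQ') ?fT_kin //= fTE.
- by move=> v /kinP[vt v0]; apply/kinP; rewrite sh_tl // (in_sh hO P) // v0 scaler0.
by move=> j g w v; apply/kinP; rewrite /= (out_tl P) (in_out P).
Qed.

Lemma Sp_conc : conc e i N -> zero_mod Q.
move=> cN q; have [w [v [/[dup] vk /kinP[vt _] ->]]] := g_dec sQ q.
have -> : v = 0.
 apply/funext => -[[j g] b]; have [vl|vl] := boolP (valid i j g); last by rewrite (tl_inv _ vt).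
 by rewrite -(tl_e j g b vt) -[v (j, g, b)]cN ee (negbTE (valid_neq hC hO vl)).
by rewrite (gv0 sQ) addr0; apply/(g_w0 sQ).
Qed.

(** The unit N -> Sp N is the identity away from [i] and [out] at [i]; it is injective unless N has
    a submodule concentrated at [i]. *)
Lemma Sp_unit : exists c : {linear N -> Q}, (forall m, c m = gw m + gv (out N m)) /\
 (forall m, c m = 0 -> e i *: m = m /\ out N m = 0).
have ok m : out N m \in kin N by apply/kinP; rewrite (out_tl P) (in_out P).
have cL : linear (fun m : kmod N => gw m + gv (out N m) : kmod Q).
 move=> k u v; rewrite !linearP (g_vlin sQ) // kscaleE scalerDr addrACA; congr (_ + _).
have [|||c cE] := gen_linear P (h := mkL cL).
- move=> l m /=; have [->|li] := eqVneq l i.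
  by rewrite (g_ei P sQ) // (gwi P sQ) add0r (out_e P).
 rewrite (g_el P sQ) //. have -> : out N (e l *: (m : N)) = 0.
  by rewrite -(out_e P) ee eq_sym (negbTE li) linear0.
 by rewrite (gv0 sQ) addr0.
- move=> l m /=; rewrite scalerDr (g_wx sQ); congr (_ + _); have [->|li] := eqVneq l i.
  by rewrite (g_vx sQ) // sh_out.
 have -> : out N (x l *: (m : N)) = 0.
  by rewrite -(out_e P) -(pr_ex P l) -scalerA ee eq_sym (negbTE li) linear0.
 by rewrite (gv0 sQ) -(pr_xe P) -scalerA (gvel P sQ) // scaler0.
- move=> l k g m vl /=; rewrite scalerDr.
 have [li|li] := eqVneq l i.
  rewrite li in vl *; rewrite (g_ain sQ) //= -{1}(pr_ea P) -scalerA (gwi P sQ) add0r.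
  by rewrite -(pr_ae P i k) -[X in _ + X]scalerA (gvel P sQ) ?(valid_neq hC hO vl) // scaler0 addr0.
 have -> : out N (a l k g *: (m : N)) = 0.
  by rewrite -(out_e P) -(pr_ea P l) -scalerA ee eq_sym (negbTE li) linear0.
 rewrite (gv0 sQ) addr0; have [ki|ki] := eqVneq k i.
  rewrite ki in vl *; rewrite (g_bout sQ) 1?validC //= outE expr0 scale1r.
  have -> : a l i g *: (gw m : Q) = 0 by rewrite -(pr_ae P) -scalerA (gwei P sQ) scaler0. by rewrite add0r.
 rewrite (g_a sQ) //; rewrite -(pr_ae P l k) -[X in _ + X]scalerA (gvel P sQ) //. by rewrite scaler0 addr0.
exists c; split=> m; first by rewrite cE.
rewrite cE => /(g_sum0 P sQ _ (ok m))[/(g_w0 sQ) h1 h2]; split=> //.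
by apply: Sp_gv_inj.
Qed.
End SpFacts.

Lemma Sp_map_inj N Q (gw : {linear kmod N -> kmod Q}) gv N' Q' (gw' : {linear kmod N' -> kmod Q'}) gv'
  (h : {linear N -> N'}) (H : {linear Q -> Q'}) : isSp gw gv -> isSp gw' gv' ->
 (forall w, H (gw w) = gw' (h w)) -> (forall y, y \in kin N -> H (gv y) = gv' (fT h y)) -> injective h -> injective H.
move=> sQ sQ' Hw Hv hI; apply/inj_ker => q; have [w [v [vk ->]]] := g_dec sQ q.
rewrite linearD Hw Hv // => /(g_sum0 P sQ' _ (fT_kin h vk))[h1 h2].
have /(g_w0 sQ)-> : e i *: (w : N) = w.
 by apply: hI; rewrite linearZ; apply/(g_w0 sQ').
have /(Sp_gv_inj sQ' (fT_kin h vk)) := h2; rewrite -[X in _ = X](linear0 (fT h)) => /(fT_inj hI)->.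
by rewrite (gv0 sQ) addr0.
Qed.

Lemma Sp_map_exact N Q (gw : {linear kmod N -> kmod Q}) gv N' Q' (gw' : {linear kmod N' -> kmod Q'}) gv'
  N'' Q'' (gw'' : {linear kmod N'' -> kmod Q''}) gv'' (h : {linear N -> N'}) (H : {linear Q -> Q'}) (k : {linear N' -> N''}) (L : {linear Q' -> Q''}) :
 isSp gw gv -> isSp gw' gv' -> isSp gw'' gv'' -> (forall w, H (gw w) = gw' (h w)) -> (forall y, y \in kin N -> H (gv y) = gv' (fT h y)) ->
 (forall w, L (gw' w) = gw'' (k w)) -> (forall y, y \in kin N' -> L (gv' y) = gv'' (fT k y)) -> injective h -> exact_at h k -> exact_at H L.
move=> sQ sQ' sQ'' Hw Hv Lw Lv hI ex q; split.
 have [w [v [vk ->]]] := g_dec sQ' q. rewrite linearD Lw Lv // => /(g_sum0 P sQ'' _ (fT_kin k vk))[/(g_w0 sQ'') h1 h2].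
 have [w0 w0E] : exists w0, h w0 = (w : N') - e i *: (w : N').
  by apply/ex; rewrite linearB linearZ; apply/eqP; rewrite subr_eq0; apply/eqP/esym/h1.
 have /choice[u uP] : forall p, exists m, h m = v p.
  move=> p; apply/ex; have /(Sp_gv_inj sQ'' (fT_kin k vk)) := h2. by rewrite -fTE => ->.
 have vE : v = fT h (u : TM N) by apply/funext => p; rewrite fTE uP. have uk : (u : TM N) \in kin N.
  have /kinP[vt v0] := vk; apply/kinP; split; first by apply: (fT_tl_inv hI); rewrite -vE. by apply: hI; rewrite -fT_in -vE v0 linear0.
 exists (gw w0 + gv u); rewrite linearD Hw Hv // -vE w0E linearB (gwi P sQ') subr0. by [].
move=> [r <-]; have [w [v [vk ->]]] := g_dec sQ r.
have kh z : k (h z) = 0 by apply/ex; exists z.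
rewrite !linearD Hw Hv // Lw Lv ?fT_kin // kh linear0 add0r.
suff -> : fT k (fT h v) = 0 by rewrite (gv0 sQ'').
by apply/funext => p; rewrite !fTE kh.
Qed.

Section ZFacts.
Variables (M : lmodType A) (m0 : M) (d : nat) (Q : lmodType A).
Variables (gw : {linear kmod M -> kmod Q}) (gv : TM M * (nat -> K^o) -> Q).
Hypotheses (em0 : e i *: m0 = m0) (xm0 : x i ^+ d *: m0 = 0) (sQ : isZ m0 d gw gv).
Notation V0 := (TM M * (nat -> K^o))%type.
Notation val := (ZvalL C Om x a i m0 d).

Lemma tlZ (y : TM M) : y \in tl M -> ((y, 0) : V0) \in ZS C Om e x i M d.
by move=> yt; apply/ZSP. Qed.

Lemma Zval_e v : e i *: (val v : M) = val v.
case: v => y h; rewrite ZvalE scalerDr (in_e P); congr (_ + _).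
rewrite scaler_sumr; apply: eq_bigr => k _; rewrite -(pzscale_comm (h k)).
by rewrite [e i *: (x i ^+ _ *: _)]scalerA (ex_comm P) -scalerA em0.
Qed.

(** The counit is the identity away from [i] and evaluation [Zval] at [i], so its kernel is
    concentrated at [i]. *)
Lemma Z_counit : exists c : {linear Q -> M}, [/\ forall w, c (gw w) = (w : M) - e i *: (w : M),
 forall v, v \in ZS C Om e x i M d -> c (gv v) = val v & forall q, c q = 0 -> e i *: q = q].
have beL k u v : val (k *: u + v) = (pzscal k : A) *: (val u : M) + val v by rewrite linearP.
pose al := opL M (1 - e i); have alE w : al w = (w : M) - e i *: (w : M).
 by rewrite opLE scalerBl scale1r.
have elS l (b : A) (w : M) : l != i -> e l * b = b -> (1 - e i) *: (b *: w) = b *: w.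
 move=> li be; rewrite scalerBl scale1r -{2}be -!scalerA ee eq_sym (negbTE li). by rewrite subr0.
have erS l (b : A) (w : M) : l != i -> b * e l = b -> b *: ((1 - e i) *: w) = b *: w.
 move=> li be; rewrite scalerBl scale1r scalerBr -{2}be -!scalerA ee (negbTE li). by rewrite scaler0 subr0.
have [| | | | | | | | | | | |c [cw cv]] := glue_hom P sQ (al := al) (be := val).
- by move=> k u v _ _; apply: beL.
- move=> [y h] /ZRP[m [<- ->]]; rewrite ZvalE (in_out P) add0r big1 // => k _.
 by rewrite rmorph0 scale0r.
- by move=> w; rewrite alE ee eqxx subrr.
- move=> l w li; rewrite !opLE (elS l) ?(erS l) // (pr_ee P) eqxx //.
- move=> l w li; rewrite !opLE (elS l) ?(erS l) // ?(pr_xe P) ?(pr_ex P) //.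
- move=> l k g w v li ki; rewrite !opLE (elS l) ?(erS k) // ?(pr_ae P) ?(pr_ea P) //.
- by move=> v _; apply: Zval_e.
- by move=> v vS; rewrite (Zval_ep hO P).
- move=> j g w v; rewrite ZainE ZvalE (in_dl hO P) // opLE (erS j) ?(pr_ae P) ?(valid_neq hC hO v) //.
 by rewrite big1 ?addr0 // => k _; rewrite rmorph0 scale0r.
- move=> j g v vl vS; rewrite [RHS](elS j) ?(valid_neq hC hO vl) //.
 exact: (pr_ea P).
- exact: Zep_S.
- by move=> j g w v; rewrite ZainE; apply/ZSP; split=> //; apply: (dl_tl hO P).
exists c; split=> [w|//|q]; first by rewrite cw alE.
have [w [v [vS ->]]] := g_dec sQ q; rewrite linearD cw cv // alE => h.
have w0 : e i *: (w : M) = w.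
 have : (w : M) - e i *: (w : M) = 0; last by move/eqP; rewrite subr_eq0 => /eqP.
 have := h; rewrite -Zval_e => h1; have h2 : (1 - e i) *: (((w : M) - e i *: (w : M)) + e i *: (val v : M)) = 0.
  by rewrite h1 scaler0.
 move: h2; rewrite scalerBl scale1r scalerDr scalerBr !ee eqxx subrr add0r addrK. by [].
have /(g_w0 sQ)-> := w0; rewrite add0r; apply: (g_ve sQ) => //.
Qed.
End ZFacts.

Section SmMap.
Variables (M M' Q Q' : lmodType A) (m0' : M') (d' : nat).
Variables (gw : {linear kmod M -> kmod Q}) (gv : TM M * (nat -> K^o) -> Q).
Variables (gw' : {linear kmod M' -> kmod Q'}) (gv' : TM M' * (nat -> K^o) -> Q').
Hypotheses (sQ : isZ 0 0 gw gv) (sQ' : isZ m0' d' gw' gv').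
Lemma Sm_map (h : {linear M -> M'}) : exists H : {linear Q -> Q'},
 [/\ forall w, H (gw w) = gw' (h w), forall y, y \in tl M -> H (gv (y, 0)) = gv' (fT h y, 0) &
  forall q, H q = 0 -> injective h -> e i *: q = q].
have S0 v : v \in ZS C Om e x i M 0 -> v.1 \in tl M /\ v.2 = 0.
 by case: v => y l /ZSP[yt l0]; split=> //; apply/funext => k; apply: l0.
have hsh0 : hsh d' 0 = 0 :> (nat -> K^o) by apply/funext => -[|k] //=; case: ifP.
have fS v : v \in ZS C Om e x i M 0 -> ((fT h v.1, 0) : _ * _) \in ZS C Om e x i M' d'.
 by move=> /S0[vt _]; apply: tlZ; apply: fT_tl.
have [| | | | | | | | | | | |H [Hw Hv]] := glue_hom P sQ (al := gw' \o kmap h) (be := fun v => gv' (fT h v.1, 0)).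
- move=> k u v uS vS; rewrite -(g_vlin sQ') ?fS //; congr gv'.
 by apply: injective_projections; rewrite /= ?linearP // scaler0 addr0.
- move=> [y l] /ZRP[m [<- ->]] /=; apply/(g_v0 sQ'); first exact/tlZ/fT_tl/(out_tl P).
 by apply/ZRP; exists (h m); rewrite fT_out.
- by move=> w /=; rewrite linearZ (gwi P sQ').
- by move=> l w li /=; rewrite linearZ (g_we sQ').
- by move=> l w li /=; rewrite linearZ (g_wx sQ').
- by move=> l k g w v li ki /=; rewrite linearZ (g_a sQ').
- by move=> v vS; rewrite (g_ve sQ') // fS.
- by move=> [y l] vS; rewrite (g_vx sQ') ?fS //= !ZepE /= hsh0 fT_sh.
- by move=> j g w v /=; rewrite (g_ain sQ') // !ZainE /= fT_dl.
- move=> j g [y l] vl vS; rewrite (g_bout sQ') ?fS //= !ZvalE big_ord0 addr0.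
 rewrite big1 ?addr0 => [|k _]; last by rewrite rmorph0 scale0r. by rewrite fT_in -linearZ.
- exact: Zep_S.
- by move=> j g w v; rewrite ZainE; apply: tlZ; apply: (dl_tl hO P).
exists H; split=> [//|y yt|q]; first by rewrite Hv //; apply: tlZ.
have [w [v [vS ->]]] := g_dec sQ q; rewrite linearD Hw Hv // => + hI.
move=> /(g_sum0 P sQ' _ (fS _ vS))[/(g_w0 sQ') h1 _].
have /(g_w0 sQ)-> : e i *: (w : M) = w by apply: hI; rewrite linearZ.
by rewrite add0r (g_ve sQ).
Qed.
End SmMap.

Lemma gv_sum M (V0 : lmodType K) (S0 R0 : submodule V0) ep ain bout Q (gw : {linear kmod M -> kmod Q})
  (gv : V0 -> Q) (T : Type) (r : seq T) (p : pred T) (F : T -> V0) :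
 glued C Om e x a i S0 R0 ep ain bout gw gv -> (forall t, p t -> F t \in S0) -> gv (\sum_(t <- r | p t) F t) = \sum_(t <- r | p t) gv (F t).
move=> gQ FS; elim: r => [|t r IHr]; first by rewrite !big_nil (gv0 gQ).
by rewrite !big_cons; case: ifP => // pt; rewrite (gvD gQ) ?IHr // ?FS // rpred_sum.
Qed.

(** In the cokernel reflection the incoming map at [i] is the projection of [tl] onto the quotient;
    this identifies its kernel with the image of [out]. *)
Lemma Z_in M (m0 : M) d Q (gw : {linear kmod M -> kmod Q}) gv z : isZ m0 d gw gv -> z \in tl M ->
 inn Q (fun p => gw (z p)) = gv (z, 0).
move=> sQ zt; have S0 j g k m : valid i j g ->
  (iter k (sh M) (dl M j g m), 0) \in ZS C Om e x i M d.
 by move=> v; apply/tlZ/iter_sh_tl; apply: (dl_tl hO P).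
rewrite {2}(tl_decomp hO P zt) -[(_, 0)]/(inlL _ _ _) linear_sum inE_ /in_sum.
have vl j (g : 'I_(G i j)) : Om_bar Om j i -> valid i j g by move=> ij; rewrite /valid_arrow Om_barC ij /=.
rewrite (gv_sum _ sQ) => [|j ij]; last first.
 rewrite linear_sum rpred_sum // => g _; rewrite linear_sum rpred_sum // => k _. by rewrite linearZ rpredZ // S0 // vl.
apply: eq_bigr => j ij; rewrite linear_sum (gv_sum _ sQ) => [|g _]; last first.
 by rewrite linear_sum rpred_sum // => k _; rewrite linearZ rpredZ // S0 // vl.
apply: eq_bigr => g _; rewrite linear_sum (gv_sum _ sQ) => [|k _]; last first.
 by rewrite linearZ rpredZ // S0 // vl.
apply: eq_bigr => k _; rewrite linearZ (gvZ sQ) ?S0 ?vl //; congr (_ *: _).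
rewrite (g_ain sQ) ?vl // ZainE; move: (z _) => m; move: (nat_of_ord k) => {}k.
elim: k => [|k IHk]; first by rewrite expr0 scale1r.
rewrite exprS -scalerA IHk (g_vx sQ) ?S0 ?vl // ZepE; congr (gv (_, _)).
by apply/funext => -[|k'] //=; case: ifP.
Qed.

(** [out] is injective on e_i M, that is, the simple module at [i] does not occur in the socle of
    M. *)
Definition soc_free M := forall m : M, e i *: m = m -> out M m = 0 -> m = 0.

(** At [i], the kernel of the projection from [tl] to the cokernel of [out] is out(e_i M), a copy of
    e_i M. Both modules are compared inside Sp M: M by its unit, Sp (Sm M) by applying Sp to the
    counit. *)
Lemma Sp_Sm M Q (gw : {linear kmod M -> kmod Q}) gv R (gw' : {linear kmod Q -> kmod R}) gv' :
 soc_free M -> isZ 0 0 gw gv -> isSp gw' gv' -> exists h : {linear R -> M}, injective h.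
move=> sM sQ sR; have [| |c [cw cv c0]] := Z_counit _ _ sQ; rewrite ?scaler0 //.
have [S [gs [vs sS]]] := Sp_ex hC hD hO P i M.
have [u [uE u0]] := Sp_unit sS.
have uI : injective u by apply/inj_ker => m /u0[h1 h2]; apply: sM.
have [H [Hw Hv]] := Sp_map sR c sS.
have HI : injective H.
 apply/inj_ker => r; have [q [y [yk ->]]] := g_dec sR r; rewrite linearD Hw Hv //.
 move=> /(g_sum0 P sS _ (fT_kin c yk))[/(g_w0 sS) h1 /(Sp_gv_inj sS (fT_kin c yk)) h2]. have -> : y = 0.
  apply/funext => -[[j g] b]; have /kinP[yt _] := yk. have [vl|vl] := boolP (valid i j g); last by rewrite (tl_inv _ yt).
  have eiy : e i *: y (j, g, b) = y (j, g, b) by apply: c0; rewrite -fTE h2. by rewrite -(tl_e j g b yt) -eiy ee (negbTE (valid_neq hC hO vl)).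
 rewrite (gv0 sR) addr0; apply/(g_w0 sR); apply/eqP; rewrite eq_sym -subr_eq0; apply/eqP.
 have : e i *: ((q : Q) - e i *: (q : Q)) = (q : Q) - e i *: (q : Q).
  by apply: c0; rewrite linearB linearZ; apply/eqP; rewrite subr_eq0; apply/eqP/esym/h1.
 by rewrite scalerBr ee eqxx subrr => <-.
(* The kernel condition on y is transported by [Z_in] to membership in the image of [out], which
   provides the e_i-part of the preimage. *)
have imH r : exists m, u m = H r.
 have [q [y [/[dup] yk /kinP[yt y0] ->]]] := g_dec sR r. have [w [w0 wE]] : exists w : M, e i *: w = 0 /\ (q : Q) - e i *: (q : Q) = gw w.
  by apply: (g_part P sQ); rewrite scalerBr ee eqxx subrr.
 have yE : y = (fun p => gw (fT c y p)).
  apply/funext => -[[j g] b]; rewrite fTE; have [vl|vl] := boolP (valid i j g); last first.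
   by rewrite (tl_inv _ yt) // linear0 [gw _](linear0 gw).
  have [z [ze zE]] := g_partl P sQ (valid_neq hC hO vl) (tl_e j g b yt). by rewrite zE cw -ze ee eq_sym (negbTE (valid_neq hC hO vl)) subr0.
 have := y0; rewrite {1}yE (Z_in sQ (fT_tl c yt)). move=> /(g_v0 sQ (tlZ _ (fT_tl c yt)))/ZRP[m [mE _]].
 have -> : gw' q = gw' (gw w) by rewrite -wE linearB (gwi P sR) subr0. exists (w + e i *: (m : M)); rewrite linearD !uE linearD Hw Hv //.
 rewrite cw w0 subr0 (gwi P sS) add0r (out_e P) mE -(out_e P i w) w0 linear0 (gv0 sS) addr0. by [].
by have [h hE] := fact_inj uI imH; exists h => r r' E; apply: HI; rewrite -!hE E.
Qed.

(** At [i], the cokernel of ker(in) -> tl is the image of [in] inside e_i N. Both Sm (Sp N) and its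
    image in N are quotients of Sm N, and their kernels coincide. *)
Lemma Sm_Sp N Q (gw : {linear kmod N -> kmod Q}) gv R (gw' : {linear kmod Q -> kmod R}) gv' :
 isSp gw gv -> isZ 0 0 gw' gv' -> exists h : {linear R -> N}, [/\ injective h,
  forall m, e i *: m = 0 -> exists r, h r = m & forall y, y \in tl N -> exists r, h r = inn N y].
move=> sQ sR; have [|T [gt [vt sT]]] := Z_ex hC hD hO P (i := i) (m0 := 0 : N) (leq0n (D i)).
 by rewrite scaler0.
have [c [cE c0]] := Sp_unit sQ; have [H [Hw Hv _]] := Sm_map sT sR c.
have [| |k [kw kv k0]] := Z_counit _ _ sT; rewrite ?scaler0 //.
have S0 M v : v \in ZS C Om e x i M 0 -> v.1 \in tl M /\ v = (v.1, 0).
 by case: v => y l /ZSP[yt l0]; split=> //; congr pair; apply/funext => q; apply: l0.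
have cgw (m : N) : e i *: m = 0 -> c m = gw m.
 by move=> m0; rewrite cE -(out_e P i m) m0 linear0 (gv0 sQ) addr0.
have ejm j g (m : N) : valid i j g -> e j *: m = m -> e i *: m = 0.
 by move=> vl <-; rewrite ee eq_sym (negbTE (valid_neq hC hO vl)).
have xbv b z : z \in kin N -> x i ^+ b *: gv z = gv (iter b (sh N) z) /\ iter b (sh N) z \in kin N.
 move=> zk; elim: b => [|b [IH1 IH2]]; first by rewrite expr0 scale1r. rewrite exprS -scalerA IH1 (g_vx sQ) //; split=> //=.
 by have /kinP[zt z0] := IH2; apply/kinP; rewrite sh_tl // (in_sh hO P) // z0 scaler0.
have outv z : z \in kin N -> out Q (gv z) = (fun p => gw (z p)).
 move=> zk; apply/funext => -[[j g] b]; rewrite outE; have /kinP[zt _] := zk. have [vl|vl] := boolP (valid i j g); last first.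
  by rewrite (tl_inv _ zt) // linear0 (pr_a0 P) ?scale0r // validC.
 by have [-> ok] := xbv b z zk; rewrite (g_bout sQ) //= iter_sh.
have fTc z : z \in kin N -> fT c z = out Q (gv z).
 move=> zk; rewrite outv //; apply/funext => -[[j g] b]; rewrite fTE; have /kinP[zt _] := zk.
 have [vl|vl] := boolP (valid i j g); last by rewrite (tl_inv _ zt) // !linear0. by apply: cgw; apply: (ejm _ _ _ vl); apply: tl_e zt.
have Hs : surjective_fun H.
 move=> r; have [q [v [/S0[yt ->] ->]]] := g_dec sR r; move: (v.1) yt => y yt {v}.
 have [w [w0 wE]] : exists w : N, e i *: w = 0 /\ (q : Q) - e i *: (q : Q) = gw w.
  by apply: (g_part P sQ); rewrite scalerBr ee eqxx subrr.
 have /choice[z zP] : forall p : 'I_n * nat * nat, exists m : kmod N, if valid i p.1.1 p.1.2 then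
   e p.1.1 *: (m : N) = m /\ y p = gw m else m = 0.
  move=> [[j g] b] /=; have [vl|vl] := boolP (valid i j g); last by exists 0.
  by have [u [u1 u2]] := g_partl P sQ (valid_neq hC hO vl) (tl_e j g b yt); exists u.
 have zt : z \in tl N.
  apply/tlP => j g b; split=> vl; have := zP (j, g, b); rewrite /= ?vl ?(negbTE vl) //.
   by case.
  move=> [z1 z2]; have := zP (j, g, (b + f j i)%N); rewrite /= vl => -[z3 z4].
  have E : gw (z (j, g, (b + f j i)%N)) = gw (x j ^+ f i j *: (z (j, g, b) : N)).
   rewrite -z4; have := tl_shift j g b 1 yt; rewrite !muln1 => ->; rewrite z2. elim: (f i j) => [|q' IHq]; first by rewrite !expr0 !scale1r.
   by rewrite !exprS -!scalerA IHq (g_wx sQ).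
  have h1 := ejm _ _ _ vl z3. have h2 : e i *: (x j ^+ f i j *: (z (j, g, b) : N)) = 0.
   by apply: (ejm j g _ vl); rewrite scalerA (ex_comm P) -scalerA z1.
  exact (gw_inj sQ h1 h2 E).
 exists (gt w + vt (z, 0)); rewrite linearD Hw Hv // cgw //; congr (_ + gv' (_, _)).
  by rewrite -wE linearB (gwi P sR) subr0.
 apply/funext => -[[j g] b]; rewrite fTE; have := zP (j, g, b) => /=. case: ifP => [vl [z1 ->]|vl ->]; last by rewrite linear0 (tl_inv _ yt) // vl.
 by apply: cgw; apply: (ejm _ _ _ vl).
(* Both maps vanish at a [tl]-component z exactly when in(z) = 0: on one side this is the value of
   the counit, on the other z must come from [out] on the kernel of [in]. *)
have ker t : H t = 0 <-> k t = 0.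
 have [w [v [/[dup] vS /S0[zt vE] ->]]] := g_dec sT t; move: vS; rewrite {}vE.
 move: (v.1) zt => z zt {v} vS; rewrite !linearD Hw Hv // kw kv // ZvalE big_ord0 addr0. have cS : (fT c z, 0) \in ZS C Om e x i Q 0 by apply/tlZ/fT_tl.
 split=> [/(g_sum0 P sR _ cS)[/(g_w0 sR) h1 /(g_v0 sR cS)/ZRP[q [qE _]]]|h].
  have w0 : gw w = 0.
   have := h1; rewrite cE scalerDr (gwei P sQ) add0r => h2. have ok : out N w \in kin N by apply/kinP; rewrite (out_tl P) (in_out P).
   by move: h2; rewrite (g_ve sQ) // -[LHS]add0r => /addIr.
  have /(g_w0 sQ) -> := w0; rewrite subrr add0r.
  have [y yk yE] := @g_parti _ _ _ _ _ _ _ _ _ P _ _ _ _ _ _ _ _ _ _ _ sQ (e i *: (q : Q)) ltac:(by rewrite ee eqxx).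
  suff -> : z = y by have /kinP[] := yk. move: qE; rewrite -(out_e P) yE outv // => qE. apply/funext => -[[j g] b]; have /kinP[yt _] := yk.
  have [vl|vl] := boolP (valid i j g); last by rewrite (tl_inv _ yt) // (tl_inv _ zt).
  apply: (gw_inj sQ); [apply: (ejm _ _ _ vl); exact: tl_e zt | apply: (ejm _ _ _ vl); exact: tl_e yt |].
  rewrite -cgw; last by apply: (ejm _ _ _ vl); apply: tl_e zt. by rewrite -fTE -qE.
 have inz : inn N z = 0.
  have := congr1 (fun q => e i *: q) h; rewrite /= scaler0 scalerDr (in_e P) scalerBr ee eqxx subrr. by rewrite add0r.
 have w0 : e i *: (w : N) = w by apply/esym/eqP; rewrite -subr_eq0; move: h; rewrite inz addr0 => ->. apply/(g_sum0 P sR _ cS); split.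
  by rewrite -w0 linearZ (gwi P sR).
 by apply/(g_v0 sR cS)/ZRP; exists (gv z); rewrite fTc //; apply/kinP.
have [h hE] := fact_surj Hs (fun t => (ker t).1); exists h; split.
- apply/inj_ker => r; have [t <-] := Hs r; rewrite hE => /ker //.
- by move=> m m0; exists (H (gt m)); rewrite hE kw m0 subr0.
by move=> y yt; exists (H (vt (y, 0))); rewrite hE kv ?tlZ // ZvalE big_ord0 addr0.
Qed.
End Functors.

(** * Dimensions of subspaces of possibly infinite dimensional spaces *)

Section SubDim.
Variable K : fieldType.
Implicit Types V W : lmodType K.
Definition dS V (S : submodule V) := dimV (sub_mod S).

Lemma fd_sub_le V (R S : submodule V) : (forall v, v \in R -> v \in S) -> fd (sub_mod S) -> fd (sub_mod R).
move=> RS; have [g gE] := corestr (f := inclL R) (fun u => RS _ (inclL_in u)).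
by apply: (@fd_inj _ _ _ g) => u v E; apply: (@inclL_inj _ _ R); rewrite -!gE E.
Qed.

Section Map.
Variables (V W : lmodType K) (S R : submodule V) (T : submodule W) (h : V -> W).
Hypothesis hlin : forall k u v, u \in S -> v \in S -> h (k *: u + v) = k *: h u + h v.
Hypothesis hT : forall v, v \in S -> h v \in T.
Hypothesis hs : forall t, t \in T -> exists2 v, v \in S & h v = t.
Hypothesis hR : forall v, v \in R <-> v \in S /\ h v = 0.

Let maps : exists (f : {linear sub_mod R -> sub_mod S}) (g : {linear sub_mod S -> sub_mod T}),
 [/\ injective f, surjective_fun g & forall y, g y = 0 <-> exists u, f u = y].
have RS v : v \in R -> v \in S by move=> /hR[].
have [f fE] := corestr (f := inclL R) (fun u => RS _ (inclL_in u)).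
have gL : linear (fun u : sub_mod S => SubMod (hT (inclL_in u)) : sub_mod T).
 by move=> k u v; apply: val_inj; rewrite /= -hlin ?inclL_in.
exists f, (mkL gL); split.
- by move=> u v E; apply: (@inclL_inj _ _ R); rewrite -!fE E.
- move=> t; have [v vS vt] := hs (inclL_in t); exists (SubMod vS); exact: val_inj.
move=> y; split=> [/(congr1 (@inclL _ _ T)) /= y0|[u <-]].
 have /hR/inclLP[u uE] : inclL S y \in S /\ h (inclL S y) = 0 by split; rewrite ?inclL_in. by exists u; apply: (@inclL_inj _ _ S); rewrite fE.
apply: val_inj => /=; have /hR[_] := inclL_in u; rewrite -fE.
by [].
Qed.
Lemma sub_fd : fd (sub_mod R) -> fd (sub_mod T) -> fd (sub_mod S).
by have [f [g [fI gS ex]]] := maps; apply: fd_ses ex. Qed.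
Lemma sub_fd_im : fd (sub_mod S) -> fd (sub_mod T).
by have [f [g [fI gS ex]]] := maps; apply: fd_surj. Qed.
Lemma sub_dim : fd (sub_mod S) -> dS S = (dS R + dS T)%N.
by have [f [g [fI gS ex]]] := maps; apply: dim_exact ex. Qed.
End Map.

Lemma dS0 V : fd (sub_mod (zS V)) /\ dS (zS V) = 0%N.
have z (u : sub_mod (zS V)) : u = 0 by apply: val_inj; apply/zSP; exact: inclL_in u.
have f0 : fd (sub_mod (zS V)).
 by apply: (@fd_span _ _ 0 (fun _ => 0)) => u; exists (fun=> 0); rewrite big_ord0; apply: z.
by split=> //; apply/dim0P.
Qed.

Fact full_submod V : submod_closed (fun _ : V => true). by []. Qed.
Definition fullS V := Submodule (@full_submod V).
Lemma dS_full V : fd V -> fd (sub_mod (fullS V)) /\ dS (fullS V) = dimV V.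
move=> fV; have B : bijective (inclL (fullS V)).
 by apply: bijP; [exact: inclL_inj | move=> v; apply: inclLP].
by have f0 := fd_sub (fullS V) fV; split=> //; apply: dim_iso B f0.
Qed.

Section Family.
Variables (I : eqType) (W : lmodType K) (S : I -> submodule W).
(** Families supported on a finite list. The space [TM] is indexed by an infinite type, and [tl] is
    measured by restricting to such a list. *)
Fact fam_submod (s : seq I) : submod_closed (fun y : I -> W =>
 `[< forall p, if p \in s then (y p \in S p : Prop) else y p = 0 >]).
split=> [|k u v /asboolP uP /asboolP vP]; apply/asboolP => p.
 by case: ifP => // _; apply: (rpred0 (S p)).
have := uP p; have := vP p; case: ifP => _; rewrite !fctE => h1 h2; first exact: (submod_predP (S p)).2.
by rewrite h1 h2 scaler0 addr0.
Qed.
Definition famS s := Submodule (fam_submod s).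
Lemma famSP s y : y \in famS s <-> forall p, if p \in s then (y p \in S p : Prop) else y p = 0.
by split=> [/asboolP|?] //; apply/asboolP. Qed.
Lemma fam_dim s : uniq s -> (forall p, p \in s -> fd (sub_mod (S p))) ->
 fd (sub_mod (famS s)) /\ dS (famS s) = (\sum_(p <- s) dS (S p))%N.
elim: s => [_ _|p s IHs /andP[ps us] sf].
 have E : famS [::] =i zS _.
  move=> y; apply/idP/idP => [/famSP h|/zSP-> //]; last exact: rpred0. by apply/zSP/funext => p; apply: h.
 have [z1 z2] := dS0 (I -> W : lmodType K). have f0 : fd (sub_mod (famS [::])) by apply: (fd_sub_le _ z1) => v; rewrite E.
 split=> //; rewrite big_nil; apply/dim0P => // u; apply: val_inj; apply/zSP. by rewrite -E; apply: (inclL_in u).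
have [|f1 d1] := IHs us; first by move=> q qs; apply: sf; rewrite inE qs orbT.
have fp : fd (sub_mod (S p)) by apply: sf; rewrite inE eqxx.
pose h (y : I -> W) := y p.
have H1 k (u v : I -> W) : u \in famS (p :: s) -> v \in famS (p :: s) -> h (k *: u + v) = k *: h u + h v by [].
have H2 v : v \in famS (p :: s) -> h v \in S p by move=> /famSP/(_ p); rewrite inE eqxx.
have H3 t : t \in S p -> exists2 v, v \in famS (p :: s) & h v = t.
 move=> tS; exists (fun q => if q == p then t else 0); last by rewrite /h eqxx. apply/famSP => q; rewrite inE; case: eqP => [->|_] //=; case: ifP => // _.
 exact: (rpred0 (S q)).
have H4 v : v \in famS s <-> v \in famS (p :: s) /\ h v = 0.
 split=> [/famSP vs|[/famSP vs v0]].
  split; last by have := vs p; rewrite (negbTE ps). apply/famSP => q; rewrite inE; case: eqP => [->|_] /=; last exact: vs.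
  by have := vs p; rewrite (negbTE ps) => ->; apply: (rpred0 (S p)).
 apply/famSP => q; have := vs q; rewrite inE; case: eqP => [->|_] //= _. by rewrite (negbTE ps).
have f2 := sub_fd H1 H2 H3 H4 f1 fp; split=> //.
by rewrite big_cons (sub_dim H1 H2 H3 H4 f2) d1 addnC.
Qed.
End Family.
End SubDim.

(** * Dimension vectors of reflected modules; nilpotency *)

Section Dims.
Variables (K : fieldType) (n : nat) (C : 'M[int]_n) (D : 'I_n -> nat).
Variable Om : {set 'I_n * 'I_n}.
Hypotheses (hC : is_GCM C) (hD : is_symmetrizer C D) (hO : is_orientation C Om).
Notation f := (Cartan_f C).
Notation G := (Cartan_g C).
Notation valid := (valid_arrow C Om).
Variables (A : pzAlgType K) (e x : 'I_n -> A) (a : 'I_n -> 'I_n -> nat -> A).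
Hypothesis P : presentation C D Om e x a.
Implicit Types M N : lmodType A.
Notation TM := (@TM K n A).
Variable i : 'I_n.
Notation tl M := (tl C Om e x i M).
Notation out := (outL x a i).
Notation inn := (inL C Om x a i).
Notation kin := (kin C Om e x a i).
Notation ee := (ee P).
Notation isSp := (isSp C Om e x a i).
Notation isZ := (isZ C Om e x a i).

Definition eS M j : submodule (kmod M) := kerS (opL M (1 - e j)).
Lemma eSP M j m : m \in eS M j <-> e j *: (m : M) = m.
split=> [/kerSP|h]; last by apply/kerSP; rewrite /= scalerBl scale1r h subrr.
by rewrite /= scalerBl scale1r => /eqP; rewrite subr_eq0 eq_sym => /eqP.
Qed.
Definition edim M j := dS (eS M j).
Lemma fd_eS M j : fin_dim M -> fd (sub_mod (eS M j)).
by move=> /fin_dimP; apply: fd_sub. Qed.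

Lemma fin_dim_e M : (forall j, fd (sub_mod (eS M j))) -> fin_dim M.
move=> fe; have [||fF _] := @fam_dim _ _ _ (eS M) (enum 'I_n); [exact: enum_uniq | by move=> p _; apply: fe |].
have hL : linear (fun u : sub_mod (famS (eS M) (enum 'I_n)) => \sum_j (inclL _ u) j : kmod M).
 move=> k u v; rewrite scaler_sumr -big_split; apply: eq_bigr => j _. by rewrite linearP.
apply/fin_dimP; apply: (fd_surj (f := mkL hL) _ fF) => m.
have mS : (fun j => e j *: (m : M) : kmod M) \in famS (eS M) (enum 'I_n).
 by apply/famSP => p; rewrite mem_enum; apply/eSP; rewrite ee eqxx.
by exists (SubMod mS); rewrite /=; apply: (sum_e P).
Qed.

Lemma edim_iso M N j (h : {linear M -> N}) : bijective h -> fin_dim M -> edim M j = edim N j.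
move=> hB fM; have hI := bij_inj hB.
rewrite /edim (@sub_dim _ _ _ (eS M j) (zS _) (eS N j) h) ?(dS0 _).2 //.
- by move=> k u v _ _; apply: (linearP (kmap h)).
- by move=> v /eSP ve; apply/eSP; rewrite -linearZ ve.
- move=> t /eSP te; have [m mt] := bij_surj hB t; exists m => //.
 by apply/eSP; apply: hI; rewrite linearZ mt.
- move=> v; split=> [/zSP->|[_ v0]]; first by rewrite [h _]linear0 (rpred0 (eS M j)).
 by apply/zSP; apply: hI; rewrite v0 [h _]linear0.
exact: fd_eS.
Qed.

(** The free coordinates of an element of [tl]: there are g_ij f_ji = |c_ji| of them for each
    neighbour j. *)
Definition tl_idx : seq ('I_n * nat * nat) := [seq (p, b) | p <- [seq (j, g) | j <- enum 'I_n,
 g <- iota 0 (if Om_bar Om j i then G i j else 0)], b <- iota 0 (f p.1 i)].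
Lemma tl_idxP j g b : ((j, g, b) \in tl_idx) = valid i j g && (b < f j i)%N.
apply/allpairsPdep/andP => [[[j' g'] [b' [/allpairsPdep[j'' [g'' [_ gG [-> ->]]]] bf [-> -> ->]]]]|[v bf]].
 move: gG bf; rewrite !mem_iota /= !add0n; case: ifP => // ij gG bf. by rewrite /valid_arrow Om_barC ij.
have /andP[ij gG] := v; exists (j, g), b; split=> //; last by rewrite mem_iota.
apply/allpairsPdep; exists j, g; split=> //; first by rewrite mem_enum.
by rewrite mem_iota Om_barC ij.
Qed.
Lemma tl_idx_uniq : uniq tl_idx.
apply: allpairs_uniq_dep; last by move=> [p b] [q c] _ _ /= [-> ->].
 apply: allpairs_uniq_dep; [exact: enum_uniq | by move=> *; apply: iota_uniq |]. by move=> [p b] [q c] _ _ /= [-> ->].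
by move=> *; apply: iota_uniq.
Qed.
Lemma tl_dim N : fin_dim N -> fd (sub_mod (tl N)) /\
 dS (tl N) = (\sum_(j | j != i) `|C j i| * edim N j)%N.
move=> fN; pose S (p : 'I_n * nat * nat) := eS N p.1.1.
have [||f1 d1] := @fam_dim _ _ _ S tl_idx; [exact: tl_idx_uniq | by move=> p _; apply: fd_eS |].
pose h (y : TM N) : TM N := fun p => if p \in tl_idx then y p else 0.
have H1 k u v : u \in tl N -> v \in tl N -> h (k *: u + v) = k *: h u + h v.
 by move=> _ _; apply/funext => p; rewrite /h !fctE; case: ifP => // _; rewrite scaler0 addr0.
have H2 v : v \in tl N -> h v \in famS S tl_idx.
 move=> vt; apply/famSP => -[[j g] b]; rewrite /h; case: ifP => [pin|->] //. by rewrite pin; apply/(@eSP N j); exact (tl_e j g b vt).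
have H3 t : t \in famS S tl_idx -> exists2 v, v \in tl N & h v = t.
 move=> /famSP tS; exists (tl_ext C Om e x i t); first exact: (tl_ext_tl hO P).
 apply/funext => -[[j g] b]; have := tS (j, g, b); rewrite /h; case: ifP => // /[!tl_idxP] /andP[v bf]. by move=> /eSP; rewrite tl_extE.
have H4 v : v \in zS _ <-> v \in tl N /\ h v = 0.
 split=> [/zSP->|[vt v0]].
  split; first exact: (rpred0 (tl N)). by apply/funext => p; rewrite /h; case: ifP.
 apply/zSP/(tl_eq hO vt (rpred0 _)) => j g b vl bf. by have := congr1 (fun y => y (j, g, b)) v0; rewrite /h tl_idxP vl bf.
have f2 := sub_fd H1 H2 H3 H4 (dS0 _).1 f1; split=> //.
rewrite (sub_dim H1 H2 H3 H4 f2) (dS0 _).2 add0n d1 big_allpairs_dep /=.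
rewrite big_allpairs_dep /= big_enum [RHS]big_mkcond; apply: eq_bigr => j _.
rewrite (eq_bigr (fun=> f j i * edim N j)%N); last first.
 by move=> g _; rewrite (eq_bigr (fun=> edim N j)) // big_const_seq count_predT size_iota iter_addn_0 mulnC.
rewrite big_const_seq count_predT size_iota iter_addn_0 mulnC mulnA.
case: ifP => [ij|ij]; first by rewrite (Om_bar_neq hC hO ij) Cartan_fg [G j i]Cartan_gC [(f j i * _)%N]mulnC.
case: ifP => // ji; rewrite !mul0n; suff -> : C j i = 0 by [].
have [_ h1 h2] := hC; move: ij; rewrite (Om_bar_lt hO) => /negbT; rewrite -leNgt => ge.
by apply/eqP; rewrite eq_le ge (h1 _ _ ji).
Qed.

Section SpDim.
Variables (N Q : lmodType A) (gw : {linear kmod N -> kmod Q}) (gv : TM N -> Q).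
Hypotheses (sQ : isSp gw gv) (fN : fin_dim N).

Lemma gw_dim M (V0 : lmodType K) (S0 R0 : submodule V0) ep ain bout Q' (hw : {linear kmod M -> kmod Q'}) (hv : V0 -> Q') l :
 glued C Om e x a i S0 R0 ep ain bout hw hv -> l != i -> fin_dim M -> fd (sub_mod (eS Q' l)) /\ edim Q' l = edim M l.
move=> gQ li fM.
have H1 k u v : u \in eS M l -> v \in eS M l -> hw (k *: u + v) = k *: hw u + hw v by move=> _ _; apply: linearP.
have H2 v : v \in eS M l -> hw v \in eS Q' l.
 by move=> /eSP ve; apply/eSP; rewrite (g_we gQ) ve.
have H3 t : t \in eS Q' l -> exists2 v, v \in eS M l & hw v = t.
 by move=> /eSP /(g_partl P gQ li)[w [we ->]]; exists w => //; apply/eSP.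
have H4 v : v \in zS _ <-> v \in eS M l /\ hw v = 0.
 split=> [/zSP->|[/eSP ve /(g_w0 gQ) h]]; first by rewrite linear0 (rpred0 (eS M l)). by apply/zSP; rewrite -h -ve ee eq_sym (negbTE li).
have f1 := fd_eS l fM; split; first exact: sub_fd_im H1 H2 H3 H4 f1.
by rewrite /edim (sub_dim H1 H2 H3 H4 f1) (dS0 _).2.
Qed.

(** Rank-nullity for [in] on [tl]: when [in] is onto e_i N, the dimension vector undergoes a
    reflection at [i]. *)
Lemma Sp_dim : fin_dim Q /\ ((forall m, e i *: m = m -> exists2 y, y \in tl N & inn N y = m) ->
 (edim Q i + edim N i)%N = (\sum_(j | j != i) `|C j i| * edim N j)%N).
have [ft dt] := tl_dim fN.
have fk : fd (sub_mod (kin N)) by apply: fd_sub_le ft => y /kinP[].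
have H1 k u v : u \in kin N -> v \in kin N -> (gv (k *: u + v) : kmod Q) = k *: (gv u : kmod Q) + gv v.
 exact: (g_vlin sQ).
have H2 v : v \in kin N -> (gv v : kmod Q) \in eS Q i by move=> vk; apply/eSP; rewrite (g_ve sQ).
have H3 t : t \in eS Q i -> exists2 v, v \in kin N & (gv v : kmod Q) = t.
 by move=> /eSP/(g_parti P sQ)[v vk ->]; exists v.
have H4 v : v \in zS _ <-> v \in kin N /\ (gv v : kmod Q) = 0.
 split=> [/zSP->|[vk /(g_v0 sQ vk)]] //; rewrite (gv0 sQ); split=> //; exact: (rpred0 (kin N)).
have fQi := sub_fd_im H1 H2 H3 H4 fk; split.
 apply: fin_dim_e => j; have [->//|ji] := eqVneq j i. by have [] := gw_dim sQ ji fN.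
move=> inS; rewrite -dt /edim.
have -> : dS (eS Q i) = dS (kin N) by rewrite (sub_dim H1 H2 H3 H4 fk) (dS0 _).2.
apply/esym/(@sub_dim _ _ _ _ _ _ (inn N)) => //.
- by move=> k u v _ _; rewrite linearP.
- by move=> v _; apply/eSP; apply: (in_e P).
- by move=> t /eSP/inS[y yt <-]; exists y.
by move=> v; apply: kinP.
Qed.
End SpDim.

(** The part at [i] is [tl] plus d dimensions, modulo out(e_i M); when [out] is injective on e_i M
    the quotient loses exactly dim e_i M. *)
Lemma Z_dim M (m0 : M) d Q (gw : {linear kmod M -> kmod Q}) gv : isZ m0 d gw gv -> fin_dim M ->
 fin_dim Q /\ (soc_free e x a i M -> (edim Q i + edim M i)%N = (\sum_(j | j != i) `|C j i| * edim M j + d)%N).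
move=> sQ fM; have [ft dt] := tl_dim fM.
pose H : lmodType K := (nat -> K^o)%type; pose V0 : lmodType K := (TM M * H)%type.
pose ZS := ZS C Om e x i M d; pose ZR := ZR x a i M.
have fK1 : hasdim K^o 1.
 have L : linear (fun k : K^o => k%:M : 'rV[K]_1).
  by move=> k u v; apply/rowP => j; rewrite !mxE ord1 !eqxx.
 exists (mkL L); exists (fun v : 'rV_1 => v 0 0) => [k|v] /=; first by rewrite mxE eqxx. by apply/rowP => j; rewrite mxE ord1 eqxx.
have [fF dF] := dS_full (ex_intro _ _ fK1).
have [||f1 d1] := @fam_dim _ _ _ (fun _ : nat => fullS K^o) (iota 0 d) => //; first exact: iota_uniq.
have {}d1 : dS (famS (fun _ : nat => fullS K^o) (iota 0 d)) = d.
 by rewrite d1 big_const_seq count_predT size_iota iter_addn_0 dF (dimE fK1) mul1n.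
pose R : submodule V0 := kerS (sndL (TM M) H).
have RS : submod_closed (fun v : V0 => (v.1 \in tl M) && (v.2 == 0)).
 split=> [|k u v]; first by apply/andP; split; [exact: (rpred0 (tl M)) | exact: eqxx].
 rewrite /in_mem /= => /andP[u1 /eqP u2] /andP[v1 /eqP v2]; rewrite u2 v2 scaler0 addr0 eqxx andbT. exact: ((submod_predP (tl M)).2 k u.1 v.1 u1 v1).
pose R1 : submodule V0 := Submodule RS.
have R1P v : v \in R1 <-> v.1 \in tl M /\ v.2 = 0.
 split=> [/andP[h1 /eqP h2]|[h1 h2]]; first by split.
  by apply/andP; split=> //; apply/eqP.
have [fR1 dR1] : fd (sub_mod R1) /\ dS R1 = dS (tl M).
 pose h (y : TM M) : V0 := (y, 0). have H1 k u v : u \in tl M -> v \in tl M -> h (k *: u + v) = k *: h u + h v.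
  by move=> _ _; apply: injective_projections; rewrite /= ?scaler0 ?addr0.
 have H2 v : v \in tl M -> h v \in R1 by move=> vt; apply/R1P. have H3 t : t \in R1 -> exists2 v, v \in tl M & h v = t.
  by case: t => y l /R1P[/= yt ->]; exists y.
 have H4 v : v \in zS _ <-> v \in tl M /\ h v = 0.
  by split=> [/zSP->|[_ [/zSP]]] //; split=> //; apply: (rpred0 (tl M)).
 split; first exact: sub_fd_im H1 H2 H3 H4 ft. by rewrite (sub_dim H1 H2 H3 H4 ft) (dS0 _).2.
have [fZS dZS] : fd (sub_mod ZS) /\ dS ZS = (dS (tl M) + d)%N.
 pose h (v : V0) : H := v.2. have H1 k u v : u \in ZS -> v \in ZS -> h (k *: u + v) = k *: h u + h v by [].
 have H2 v : v \in ZS -> h v \in famS (fun _ : nat => fullS K^o) (iota 0 d).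
  case: v => y l /ZSP[yt l0]; apply/famSP => p; rewrite mem_iota /= add0n. by case: ltnP => // /l0.
 have H3 t : t \in famS (fun _ : nat => fullS K^o) (iota 0 d) -> exists2 v, v \in ZS & h v = t.
  move=> /famSP tF; exists (0, t) => //; apply/ZSP; split; first exact: (rpred0 (tl M)).
  by move=> k dk; have := tF k; rewrite mem_iota /= add0n ltnNge dk.
 have H4 v : v \in R1 <-> v \in ZS /\ h v = 0.
  case: v => y l; rewrite R1P; split=> [[yt l0]|[/ZSP[yt _] l0]] //; split=> //. by apply/ZSP; split=> // k _; rewrite [l]l0.
 have f2 := sub_fd H1 H2 H3 H4 fR1 f1; split=> //. by rewrite (sub_dim H1 H2 H3 H4 f2) dR1 d1.
have H1 k u v : u \in ZS -> v \in ZS -> (gv (k *: u + v) : kmod Q) = k *: (gv u : kmod Q) + gv v.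
 exact: (g_vlin sQ).
have H2 v : v \in ZS -> (gv v : kmod Q) \in eS Q i by move=> vk; apply/eSP; rewrite (g_ve sQ).
have H3 t : t \in eS Q i -> exists2 v, v \in ZS & (gv v : kmod Q) = t.
 by move=> /eSP/(g_parti P sQ)[v vk ->]; exists v.
have ZRS v : v \in ZR -> v \in ZS.
 by case: v => y l /ZRP[m [<- ->]]; apply/ZSP; rewrite (out_tl P).
have H4 v : v \in ZR <-> v \in ZS /\ (gv v : kmod Q) = 0.
 by split=> [vR|[vS /(g_v0 sQ vS)]] //; split; [exact: ZRS | apply/(g_v0 sQ) => //; apply: ZRS].
have fQi := sub_fd_im H1 H2 H3 H4 fZS; split.
 apply: fin_dim_e => j; have [->//|ji] := eqVneq j i. by have [] := gw_dim sQ ji fM.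
move=> sM; rewrite -dt -dZS (sub_dim H1 H2 H3 H4 fZS) addnC; congr (_ + _)%N.
rewrite /edim (@sub_dim _ _ _ _ (zS _) ZR (fun m => (out M m, 0) : V0)) ?(dS0 _).2 //.
- move=> k u v _ _; apply: injective_projections; rewrite /= ?linearP ?scaler0 ?addr0 //.
- by move=> v _; apply/ZRP; exists v.
- case=> y l /ZRP[m [<- ->]]; exists (e i *: (m : M)); first by apply/eSP; rewrite ee eqxx.
 by rewrite (out_e P).
- move=> v; split=> [/zSP->|[/eSP ve [o0]]]; last by apply/zSP; apply: sM.
 by rewrite linear0; split=> //; apply: (rpred0 (eS M i)).
exact: fd_eS.
Qed.

(** Every product of k loops and arrows kills m. Nilpotency has to be carried along, since finite
    dimensional modules are only shown to be nilpotent in [fin_dim_nfd]. *)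
Fixpoint kil k M (m : M) : Prop := if k is k'.+1 then
 (forall j, kil k' (x j *: m)) /\ (forall j l g, kil k' (a j l g *: m)) else m = 0.
Lemma kil0 k M : kil k (0 : M).
by elim: k => //= k IHk; split=> *; rewrite scaler0. Qed.
Lemma kil_lin k M N (h : {linear M -> N}) m : kil k m -> kil k (h m).
elim: k m => [m /= ->|k IHk m /= [h1 h2]]; first by rewrite linear0.
by split=> *; rewrite -linearZ; apply: IHk.
Qed.
Lemma kil_leq k l M (m : M) : (k <= l)%N -> kil k m -> kil l m.
elim: k l m => [l m _ /= ->|k IHk [//|l] m kl /= [h1 h2]]; first exact: kil0.
by split=> *; apply: IHk.
Qed.
Lemma kil_ext k l M N (h : {linear M -> N}) m : (forall m, h m = 0 -> kil l m) -> kil k (h m) -> kil (k + l) m.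
move=> hl; elim: k m => [m /hl//|k IHk m /= [h1 h2]].
by split=> [j|j l' g]; apply: IHk; rewrite linearZ; [apply: h1 | apply: h2].
Qed.
Definition nilp M := exists k, forall m : M, kil k m.
Lemma conc_kil M (m : M) : conc e i M -> kil (D i) m.
move=> cM; have : x i ^+ D i *: m = 0 by rewrite (pr_nil P) scale0r.
elim: (D i) m => [m|c IHc m]; first by rewrite expr0 scale1r.
rewrite exprSr -scalerA => xm; split=> [j|j l g].
 have [->|ji] := eqVneq j i; first exact: IHc. by rewrite -(pr_xe P) -scalerA -[m]cM ee (negbTE ji) scaler0; apply: kil0.
have [v|v] := boolP (valid j l g); last by rewrite (pr_a0 P) // scale0r; apply: kil0.
have [li|li] := eqVneq l i; last first.
 by rewrite -(pr_ae P) -scalerA -[m]cM ee (negbTE li) scaler0; apply: kil0.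
rewrite li validC in v *; rewrite -[_ *: m]cM -(pr_ea P) -scalerA ee eq_sym.
by rewrite (negbTE (valid_neq hC hO v)); apply: kil0.
Qed.
Lemma nilp_ses M N (h : {linear M -> N}) : nilp (sub_mod (kerS h)) -> nilp N -> nilp M.
move=> [k kk] [l ll]; exists (l + k)%N => m; apply: (kil_ext (h := h)) => // u /kerSP/inclLP[v <-].
exact: kil_lin.
Qed.
Lemma nilp_conc M : conc e i M -> nilp M.
by move=> cM; exists (D i) => m; apply: conc_kil. Qed.
Lemma nilp_surj M N (h : {linear M -> N}) : surjective_fun h -> nilp M -> nilp N.
by move=> hS [k kk]; exists k => m; have [u <-] := hS m; apply: kil_lin. Qed.
Lemma nilp_inj M N (h : {linear M -> N}) : injective h -> nilp N -> nilp M.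
move=> hI; apply: (nilp_ses (h := h)); exists 0%N => u; apply: (@inclL_inj _ _ (kerS h)); apply: hI.
by have /kerSP -> := inclL_in u; rewrite !linear0.
Qed.
Lemma nilp_ker M N (h : {linear M -> N}) : (forall m, h m = 0 -> e i *: m = m) -> nilp N -> nilp M.
move=> h0; apply: (nilp_ses (h := h)); apply: nilp_conc => u; apply: (@inclL_inj _ _ (kerS h)).
by rewrite linearZ; apply: h0; apply/kerSP; exact: (inclL_in u).
Qed.
Lemma nilp_coker M N (h : {linear M -> N}) : (forall m, e i *: m = 0 -> exists r, h r = m) -> nilp M -> nilp N.
move=> h0 nM; apply: (nilp_ses (h := projL (imS h))).
 have hk r : h r \in kerS (projL (imS h)) by apply/kerSP/projL0/imSP; exists r. have [g gE] := corestr hk; apply: (nilp_surj (h := g)) nM => u.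
 have /kerSP/projL0/imSP[r rE] := inclL_in u; exists r; apply: (@inclL_inj _ _ (kerS _)). by rewrite gE.
apply: nilp_conc => u; have [v <-] := projL_surj u; rewrite -linearZ; apply/eqP; rewrite -subr_eq0 -linearB.
apply/eqP/projL0/imSP/h0; rewrite scalerBr ee eqxx subrr //.
Qed.
End Dims.

(** * Reflection of torsion-free classes *)

Section Classes.
Variables (K : fieldType) (n : nat) (C : 'M[int]_n) (D : 'I_n -> nat).
Variable Om : {set 'I_n * 'I_n}.
Hypotheses (hC : is_GCM C) (hD : is_symmetrizer C D) (hO : is_orientation C Om).
Notation f := (Cartan_f C).
Notation G := (Cartan_g C).
Notation valid := (valid_arrow C Om).
Variables (A : pzAlgType K) (e x : 'I_n -> A) (a : 'I_n -> 'I_n -> nat -> A).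
Hypothesis P : presentation C D Om e x a.
Implicit Types M N : lmodType A.
Notation TM := (@TM K n A).
Notation tl i M := (tl C Om e x i M).
Notation out i := (outL x a i).
Notation inn i := (inL C Om x a i).
Notation ee := (ee P).
Notation isSp i := (isSp C Om e x a i).
Notation isZ i := (isZ C Om e x a i).
Notation nilp := (nilp x a).
Notation soc_free i := (soc_free e x a i).
Notation ZS := (ZS C Om e x).

Definition Sp i N : lmodType A := projT1 (cid (Sp_ex hC hD hO P i N)).
Lemma SpP i N : exists gw gv, @isSp i N (Sp i N) gw gv.
exact: (projT2 (cid (Sp_ex hC hD hO P i N))). Qed.
Fact Sm_ex0 i M : x i ^+ 0 *: (0 : M) = 0. exact: scaler0. Qed.
Definition Sm i M : lmodType A := projT1 (cid (Z_ex hC hD hO P (leq0n (D i)) (@Sm_ex0 i M))).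
Lemma SmP i M : exists gw gv, @isZ i M 0 0 (Sm i M) gw gv.
exact: (projT2 (cid (Z_ex hC hD hO P (leq0n (D i)) (@Sm_ex0 i M)))). Qed.

Definition nfd M := fin_dim M /\ nilp M.
Lemma nfd_inj M N (h : {linear M -> N}) : injective h -> nfd N -> nfd M.
by move=> hI [fN nN]; split; [exact: fin_dim_inj hI fN | exact: nilp_inj hI nN]. Qed.
Lemma nfd_ker M N (h : {linear M -> N}) : nfd (sub_mod (kerS h)) -> nfd N -> nfd M.
move=> [fK nK] [fN nN]; split; last exact: nilp_ses nK nN.
have [g gE] := corestr (f := h) (fun m => introT (imSP h _) (ex_intro _ m erefl)).
have gS : surjective_fun g.
 move=> u; have /imSP[m mE] := inclL_in u; exists m; apply: (@inclL_inj _ _ (imS h)). by rewrite gE.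
apply: (fin_dim_ses (@inclL_inj _ _ (kerS h)) gS _ fK (fin_dim_sub _ fN)) => m.
split=> [/(congr1 (inclL _))|[u <-]].
 by rewrite gE linear0 => /kerSP/inclLP.
apply: (@inclL_inj _ _ (imS h)); rewrite gE linear0; apply/kerSP; exact: inclL_in.
Qed.
Lemma zero_nfd M : zero_mod M -> nfd M.
by move=> M0; split; [apply: fin_dim0 | exists 0%N]. Qed.

(** Closure under extensions is stated with a kernel: the image of h is a submodule of N, so M is an
    extension of an object of [F] by ker h. *)
Record torf0 (F : lmodType A -> Prop) : Prop := {
 tf_nfd : forall M, F M -> nfd M; tf_zero : forall M, zero_mod M -> F M; tf_sub : forall M N (h : {linear M -> N}), injective h -> F N -> F M;
 tf_ker : forall M N (h : {linear M -> N}), F N -> F (sub_mod (kerS h)) -> F M }.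

Lemma tf_joint F (M : lmodType A) (N : nat -> lmodType A) (h : forall k, {linear M -> N k}) d :
 torf0 F -> (forall k, (k < d)%N -> F (N k)) -> (forall m, (forall k, (k < d)%N -> h k m = 0) -> m = 0) -> F M.
move=> tF; elim: d M h => [|d IHd] M h FN h0; first by apply: (tf_zero tF) => m; apply: h0.
apply: (tf_ker tF (h := h d)); first exact: FN.
apply: (IHd _ (fun k => (h k \o inclL (kerS (h d)) : {linear _ -> _}))) => [k kd|m mh].
 by apply: FN; apply: ltnW.
apply: (@inclL_inj _ _ (kerS (h d))); rewrite linear0; apply: h0 => k.
by rewrite ltnS leq_eqVlt => /orP[/eqP->|/mh//]; apply/kerSP; exact: inclL_in.
Qed.

Section Vertex.
Variable i : 'I_n.
(** The simple module at [i] belongs to [F], witnessed by an element spanning a copy of it inside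
    some object of [F]. *)
Definition has (F : lmodType A -> Prop) := exists M (m : M),
 [/\ F M, m <> 0, e i *: m = m, x i *: m = 0 & forall j l g, a j l g *: m = 0].
Definition sig (F : lmodType A -> Prop) N := nfd N /\ F (Sp i N).

Lemma soc_elt M (m : M) : m <> 0 -> exists k, x i ^+ k *: m <> 0 /\ x i *: (x i ^+ k *: m) = 0.
move=> m0; have : x i ^+ D i *: m = 0 by rewrite (pr_nil P) scale0r.
elim: (D i) => [|d IHd]; first by rewrite expr0 scale1r.
have [/IHd //|h xd] := pselect (x i ^+ d *: m = 0).
by exists d; rewrite scalerA -exprS.
Qed.

Lemma soc_free_torf F M : torf0 F -> ~ has F -> F M -> soc_free i M.
move=> tF nF FM m em om; have [//|m0] := pselect (m = 0).
have [k [u0 xu]] := soc_elt m0; case: nF; exists M, (x i ^+ k *: m).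
have eu : e i *: (x i ^+ k *: m) = x i ^+ k *: m by rewrite scalerA (ex_comm P) -scalerA em.
split=> // j l g; have [li|li] := eqVneq l i; last by rewrite -(pr_ae P) -scalerA -eu ee (negbTE li) scaler0.
by rewrite li -(outE x a i m) om.
Qed.

Lemma conc_gen M : conc e i M -> forall (m : M), (forall j l g, valid j l g -> a j l g *: m = 0) /\
 (forall j, j != i -> x j *: m = 0).
move=> cM m; split=> [j l g v|j ji]; last by rewrite -(pr_xe P) -scalerA -[m]cM ee (negbTE ji) scaler0.
have [li|li] := eqVneq l i; last by rewrite -(pr_ae P) -scalerA -[m]cM ee (negbTE li) scaler0.
rewrite li validC in v *; rewrite -[_ *: m]cM -(pr_ea P) -scalerA ee eq_sym.
by rewrite (negbTE (valid_neq hC hO v)).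
Qed.

(** Induction on the nilpotency degree of x_i: N is an extension of x_i N by the kernel of x_i, and
    that kernel is a sum of copies of the simple module at [i]. *)
Lemma conc_has G N : torf0 G -> has G -> fin_dim N -> conc e i N -> G N.
move=> tG [M [m [GM m0 em xm am]]] fN cN.
have : forall u : N, x i ^+ D i *: u = 0 by move=> u; rewrite (pr_nil P) scale0r.
elim: (D i) N fN cN => [|d IHd] N fN cN xd.
 by apply: (tf_zero tG) => u; rewrite -(xd u) expr0 scale1r.
have [|||h hE] := gen_linear P (h := opL N (x i)).
- by move=> j u /=; have [->|ji] := eqVneq j i; rewrite ?cN // -[u]cN ee (negbTE ji) scaler0 cN -(pr_ex P) -scalerA ee (negbTE ji).
- move=> j u /=; have [->//|ji] := eqVneq j i.
 by rewrite (conc_gen cN u).2 // scaler0 (conc_gen cN (x i *: u)).2.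
- by move=> j l g u v /=; rewrite (conc_gen cN u).1 // scaler0 (conc_gen cN (x i *: u)).1.
have hE' u : h u = x i *: u by rewrite hE.
have cK (S : submodule N) : conc e i (sub_mod S) by move=> u; apply: (@inclL_inj _ _ S); rewrite linearZ; apply: cN.
have GI : G (sub_mod (imS h)).
 apply: IHd; [exact: fin_dim_sub | exact: cK |] => u; apply: (@inclL_inj _ _ (imS h)). have /imSP[w wE] := inclL_in u; rewrite linearZ /= -wE hE' linear0.
 by rewrite scalerA -exprSr xd.
have [g gE] := corestr (f := h) (fun m => introT (imSP h _) (ex_intro _ m erefl)).
apply: (tf_ker tG (h := g) GI).
pose T := sub_mod (kerS g); have fT : fin_dim T by apply: fin_dim_sub.
have cT : conc e i T := cK _.
have xT (u : T) : x i *: u = 0.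
 apply: (@inclL_inj _ _ (kerS g)); have /kerSP := inclL_in u. move=> /(congr1 (inclL (imS h))); rewrite gE hE' linear0 => u0. by rewrite linearZ linear0.
have /fin_dimP[r [co coB]] := fT.
(* The coordinates of the kernel, each multiplied by m, are homomorphisms to M which are jointly
   injective. *)
have coL (k : nat) : linear (fun u : kmod T => (if insub k is Some j then (pzscal (co u 0 (j : 'I_r)) : A) *: m else 0) : kmod M).
 move=> c u v; case: insub => [j|]; last by rewrite scaler0 addr0. by rewrite linearP !mxE rmorphD rmorphM scalerDl -scalerA.
have /choice[H HE] : forall k, exists H : {linear T -> M}, forall u, H u = mkL (coL k) u.
 move=> k; apply: (gen_linear P).
 - move=> j u /=; have [->|ji] := eqVneq j i.
   by rewrite cT; case: insub => [l|]; rewrite ?scaler0 // -(pzscale_comm (co u 0 l)) em.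
  rewrite -[u]cT ee (negbTE ji) -[0 : T]/(0 : kmod T); case: insub => [l|]; rewrite ?scaler0 //.
  by rewrite linear0 mxE rmorph0 scale0r -(pzscale_comm (co _ 0 l)) -em ee (negbTE ji) scaler0.
 - move=> j u /=; have [->|ji] := eqVneq j i.
   rewrite xT -[0 : T]/(0 : kmod T); case: insub => [l|]; rewrite ?scaler0 //.
   by rewrite linear0 mxE rmorph0 scale0r -(pzscale_comm (co _ 0 l)) xm scaler0.
  rewrite (conc_gen cT u).2 // -[0 : T]/(0 : kmod T); case: insub => [l|]; rewrite ?scaler0 //.
  rewrite linear0 mxE rmorph0 scale0r -(pzscale_comm (co _ 0 l)) -em -(pr_xe P) -[(x j * e j) *: _]scalerA. by rewrite ee (negbTE ji) !scaler0.
 move=> j l g' u v /=; rewrite (conc_gen cT u).1 // -[0 : T]/(0 : kmod T); case: insub => [q|]; rewrite ?scaler0 //.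
 by rewrite linear0 mxE rmorph0 scale0r -(pzscale_comm (co _ 0 q)) am scaler0.
apply: (@tf_joint G T (fun _ => M) H r tG) => // u Hu.
apply: (bij_inj coB); rewrite linear0; apply/rowP => j; rewrite mxE.
have := Hu j (ltn_ord j); rewrite HE /= insubT /= => [|lt]; first exact: ltn_ord.
have -> : Sub (nat_of_ord j) lt = j by apply: val_inj.
move=> h0; apply/eqP; apply/negP => /negP c0; apply: m0.
have := congr1 (fun v : M => (pzscal (co u 0 j)^-1 : A) *: v) h0.
by rewrite scaler0 scalerA -rmorphM mulVf // rmorph1 scale1r.
Qed.

Lemma tf_coker G (X Y : lmodType A) (h : {linear X -> Y}) : torf0 G -> has G -> injective h ->
 (forall y, e i *: y = 0 -> exists u, h u = y) -> G X -> fin_dim Y -> G Y.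
move=> tG hG hI h0 GX fY.
apply: (tf_ker tG (h := projL (imS h))).
 apply: (conc_has tG hG); first exact: fin_dim_quot. move=> u; have [v <-] := projL_surj u; rewrite -linearZ; apply/eqP; rewrite -subr_eq0 -linearB.
 by apply/eqP/projL0/imSP/h0; rewrite scalerBr ee eqxx subrr.
have [|g gE] := fact_inj hI (g := inclL (kerS (projL (imS h)))).
 by move=> u; have /kerSP/projL0/imSP[r rE] := inclL_in u; exists r.
apply: (tf_sub tG (h := g)) GX => u v E; apply: (@inclL_inj _ _ (kerS (projL (imS h)))).
by rewrite -!gE E.
Qed.
Lemma tf_conc_ker G (X Y : lmodType A) (h : {linear X -> Y}) : torf0 G -> has G ->
 (forall u, h u = 0 -> e i *: u = u) -> G Y -> fin_dim X -> G X.
move=> tG hG h0 GY fX; apply: (tf_ker tG (h := h)) => //.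
apply: (conc_has tG hG); first exact: fin_dim_sub.
by move=> u; apply: (@inclL_inj _ _ (kerS h)); rewrite linearZ; apply/h0/kerSP/inclL_in.
Qed.

Lemma Sp_nfd N Q gw gv : @isSp i N Q gw gv -> nfd N -> nfd Q.
move=> sQ [fN nN]; split; first by have [] := Sp_dim hC hO P sQ fN.
have [c [cE _]] := Sp_unit hC hO P sQ.
apply: (nilp_coker hC hO P (i := i) (h := c)) nN => q /(g_part P sQ)[w [w0 ->]]; exists w.
by rewrite cE -(out_e P i w) w0 linear0 (gv0 sQ) addr0.
Qed.
Lemma Z_nfd M m0 d Q gw gv : e i *: m0 = m0 -> x i ^+ d *: m0 = 0 -> @isZ i M m0 d Q gw gv -> nfd M -> nfd Q.
move=> em xm sQ [fM nM]; split; first by have [] := Z_dim hC hO P sQ fM.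
have [c [_ _ c0]] := Z_counit hC hO P em xm sQ.
exact: (nilp_ker hC hO P (i := i) (h := c)) nM.
Qed.

(** The kernel reflection is left exact, so closure under submodules and extensions pulls back along
    it. *)
Lemma sig_torf F : torf0 F -> torf0 (sig F).
move=> tF; split=> [M []//|M M0|M N h hI [nN FN]|M N h [nN FN] [nK FK]].
- split; first exact: zero_nfd.
 have [gw [gv sQ]] := SpP i M; apply: (tf_zero tF); apply: (Sp_conc hC hO P sQ). by move=> m; rewrite [m]M0 scaler0.
- split; first exact: nfd_inj hI nN.
 have [gw [gv sQ]] := SpP i M; have [gw' [gv' sQ']] := SpP i N. have [H [Hw Hv]] := Sp_map hO P sQ h sQ'.
 by apply: (tf_sub tF (h := H)) FN; apply: (Sp_map_inj P sQ sQ' Hw Hv).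
split; first exact: nfd_ker nK nN.
have [gw [gv sQ]] := SpP i (sub_mod (kerS h)).
have [gw' [gv' sQ']] := SpP i M; have [gw'' [gv'' sQ'']] := SpP i N.
have [H [Hw Hv]] := Sp_map hO P sQ (inclL (kerS h)) sQ'.
have [L [Lw Lv]] := Sp_map hO P sQ' h sQ''.
have kI := @inclL_inj _ _ (kerS h).
have ex : exact_at H L.
 apply: (Sp_map_exact P sQ sQ' sQ'' Hw Hv Lw Lv kI) => y. split=> [/kerSP/inclLP//|[u <-]]; apply/kerSP; exact: inclL_in.
have HI := Sp_map_inj P sQ sQ' Hw Hv kI.
apply: (tf_ker tF (h := L)) => //.
have [|g gE] := fact_inj HI (g := inclL (kerS L)).
 by move=> u; have /kerSP/ex := inclL_in u.
apply: (tf_sub tF (h := g)) FK => u v E; apply: (@inclL_inj _ _ (kerS L)).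
by rewrite -!gE E.
Qed.

Lemma simple_ex : exists (S : lmodType A) (s : S), [/\ fin_dim S, conc e i S, s <> 0,
 forall (t : S) j, x j *: t = 0 /\ forall l g, a j l g *: t = 0 & forall j, edim e S j = (j == i)].
pose V : lmodType K := (K^o)%type.
have EL j : linear (fun v : V => if j == i then v else 0).
 by move=> k u v; case: ifP; rewrite ?scaler0 ?addr0.
have ZL : linear (fun _ : V => 0 : V) by move=> k u v; rewrite scaler0 addr0.
have it k : (0 < k)%N -> forall v : V, iter k (mkL ZL) v = 0 by case: k.
have it0 k : iter k (mkL ZL) 0 = 0 by elim: k.
have [|||||||||S [h [hB hL he hx ha]]] :=
 pr_univ P (E := fun j => mkL (EL j)) (X := fun _ => mkL ZL) (L := fun _ _ _ => mkL ZL).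
- by move=> j l v /=; case: eqP => [->|]; case: eqP => [->|] //; rewrite ?eqxx //; case: eqP.
- by move=> v; rewrite (bigD1 i) //= eqxx big1 ?addr0 // => j /negbTE->.
- by move=> j v /=; case: ifP.
- by move=> j v.
- by move=> j l g v _ /=; case: ifP.
- by move=> j l g v _.
- by move=> j v; rewrite it // (D_gt0 hD).
- by move=> j l g v vl; rewrite -[RHS]/0 -[mkL ZL v]/0 it0.
- move=> j v; rewrite big1 // => l _; rewrite big1 // => g _; rewrite big1 // => k _.
 by rewrite -[mkL ZL _]/0 it0 scaler0.
have hD0 u v : h (u + v) = h u + h v by rewrite -[u]scale1r hL rmorph1 !scale1r.
have h0 : h 0 = 0 by have := hD0 0 0; rewrite addr0 => /eqP; rewrite -subr_eq0 opprD addNKr oppr_eq0 => /eqP.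
have hS v : exists u, h u = v by have [g _ gK] := hB; exists (g v).
have hI := bij_inj hB.
have hZ k u : h (k *: u) = (pzscal k : A) *: h u by rewrite -[k *: u]addr0 hL h0 addr0.
have hLin : linear (h : V -> kmod S) by move=> k u v; apply: hL.
have d1 : hasdim V 1.
 have L : linear (fun k : V => k%:M : 'rV[K]_1).
  by move=> k u v; apply/rowP => j; rewrite !mxE ord1 !eqxx.
 exists (mkL L); exists (fun v : 'rV_1 => v 0 0) => [k|v] /=; first by rewrite mxE eqxx. by apply/rowP => j; rewrite mxE ord1 eqxx.
have dS1 : hasdim (kmod S) 1 by apply: (hasdim_iso (f := mkL hLin)).
have fS : fin_dim S by apply/fin_dimP; exists 1%N.
have cS : conc e i S by move=> s; have [u <-] := hS s; rewrite -he /= eqxx.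
exists S, (h 1); split=> //.
- by rewrite -h0 => /hI/eqP; rewrite oner_eq0.
- move=> t j; have [v <-] := hS t; split; first by rewrite -hx /= h0.
 move=> l g; have [vl|vl] := boolP (valid j l g); first by rewrite -ha //= h0. by rewrite (pr_a0 P) // scale0r.
move=> j; have fj := fd_eS e j fS; have [->|ji] := eqVneq j i.
 rewrite /edim -[RHS](dimE dS1); have B : bijective (inclL (eS e S i)).
  by apply: bijP; [exact: inclL_inj | move=> s; apply: inclLP; apply/eSP].
 exact: (dim_iso B (fd_eS e i fS)).
apply/(dim0P fj) => u; apply: (@inclL_inj _ _ (eS e S j)); rewrite linear0.
have /eSP := inclL_in u; rewrite -(cS (inclL _ u)) ee (negbTE ji) => <-.
by [].
Qed.

Lemma sig_has F : torf0 F -> has (sig F).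
move=> tF; have [S [s [fS cS s0 sx _]]] := simple_ex.
exists S, s; split=> //; [|by have [] := sx s i|by move=> j l g; have [_] := sx s j].
split; first by split=> //; apply: (nilp_conc hC hO P cS).
have [gw [gv sQ]] := SpP i S; apply: (tf_zero tF); exact: (Sp_conc hC hO P sQ).
Qed.

Lemma sig_Sm F M Q gw gv : torf0 F -> F M -> soc_free i M -> @isZ i M 0 0 Q gw gv -> sig F Q.
move=> tF FM sM sQ; split.
 by apply: (Z_nfd _ _ sQ); rewrite ?scaler0 //; apply: (tf_nfd tF).
have [gw' [gv' sR]] := SpP i Q; have [h hI] := Sp_Sm hC hD hO P sM sQ sR.
exact: (tf_sub tF (h := h)) FM.
Qed.

Lemma Sm_Z M Q gw gv m0 d R gw' gv' : @isZ i M 0 0 Q gw gv -> @isZ i M m0 d R gw' gv' ->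
 exists H : {linear Q -> R}, injective H /\ forall r, e i *: r = 0 -> exists q, H q = r.
move=> sQ sR; have [H [Hw Hv _]] := Sm_map hO P sQ sR (idfun : {linear M -> M}).
have idT (y : TM M) : fT n (idfun : {linear M -> M}) y = y by apply/funext => p; rewrite fTE.
exists H; split; last by move=> r /(g_part P sR)[w [_ ->]]; exists (gw w); rewrite Hw.
apply/inj_ker => q; have [w [v [vS ->]]] := g_dec sQ q; rewrite linearD Hw.
case: v vS => y l /[dup] vS /ZSP[yt l0]; have {}l0 : l = 0 by apply/funext => k; apply: l0.
rewrite l0 in vS *; have yS : (y, 0) \in ZS i M d by apply: tlZ.
rewrite Hv // idT => /(g_sum0 P sR _ yS)[/(g_w0 sR) w0 /(g_v0 sR yS) y0].
by apply/(g_sum0 P sQ _ vS); split; [apply/(g_w0 sQ) | apply/(g_v0 sQ vS)].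
Qed.

(** Z contains Sm M with cokernel concentrated at [i], and [sig F] contains the simple module at
    [i], hence all finite dimensional modules concentrated there. *)
Lemma sig_Z F M m0 d Q gw gv : torf0 F -> F M -> soc_free i M -> e i *: m0 = m0 -> x i ^+ d *: m0 = 0 ->
 @isZ i M m0 d Q gw gv -> sig F Q.
move=> tF FM sM em xm sQ; have [gw' [gv' sR]] := SmP i M.
have [H [HI Hs]] := Sm_Z sR sQ.
apply: (tf_coker (sig_torf tF) (sig_has tF) HI Hs); first exact: sig_Sm sR.
by have [] := Z_nfd em xm sQ (tf_nfd tF FM).
Qed.

Definition usig G M := [/\ nfd M, soc_free i M & G (Sm i M)].
(** [usig] inverts [sig], because Sp (Sm M) embeds in M for socle-free M, and Sm (Sp N) embeds in N
    with cokernel concentrated at [i]. *)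
Lemma usigP G : torf0 G -> has G -> [/\ torf0 (usig G), ~ has (usig G) & forall N, G N <-> sig (usig G) N].
move=> tG hG.
have tU : torf0 (usig G).
 split=> [M []//|M M0|M N h hI [nN sN GN]|M N h [nN sN GN] [nK sK GK]].
 - split; [exact: zero_nfd | by move=> m _ _; apply: M0 |].
  have [gw [gv sQ]] := SmP i M; have [| |c [_ _ c0]] := Z_counit hC hO P _ _ sQ; rewrite ?scaler0 //.
  apply: (tf_conc_ker tG hG (h := c)); first exact: c0.
   exact: (tf_zero tG).
  by have [] := Z_dim hC hO P sQ (fin_dim0 M0).
 - have nM := nfd_inj hI nN; split=> //.
   by move=> m em om; apply: hI; rewrite linear0; apply: sN; rewrite -?linearZ ?em // -fT_out om linear0.
  have [gw [gv sQ]] := SmP i M; have [gw' [gv' sQ']] := SmP i N. have [H [_ _ H0]] := Sm_map hO P sQ sQ' h.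
  apply: (tf_conc_ker tG hG (h := H)) => //; first by move=> q q0; apply: H0. by have [] := Z_dim hC hO P sQ nM.1.
 have nM := nfd_ker nK nN; pose k := inclL (kerS h). have hk u : h (k u) = 0 by apply/kerSP; exact: inclL_in.
 have soc m : e i *: m = m -> out i N (h m) = 0 -> exists u, k u = m.
  move=> em om; apply/inclLP/kerSP/sN => //; by rewrite -linearZ em.
 split=> //.
  move=> m em om; have [|u uE] := soc m em; first by rewrite -fT_out om linear0. rewrite -uE in em om *; rewrite (sK u) ?linear0 //.
   by apply: (@inclL_inj _ _ (kerS h)); rewrite linearZ.
  apply: (fT_inj (n := n) (@inclL_inj _ _ (kerS h))). by rewrite fT_out om linear0.
 have [gw [gv sQ]] := SmP i (sub_mod (kerS h)); have [gw' [gv' sQ']] := SmP i M. have [gw'' [gv'' sQ'']] := SmP i N.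
 have [H [Hw Hv _]] := Sm_map hO P sQ sQ' k; have [L [Lw Lv _]] := Sm_map hO P sQ' sQ'' h.
 have split_ v : v \in ZS i M 0 -> exists2 y, y \in tl i M & v = (y, 0).
  by case: v => y l /ZSP[yt l0]; exists y => //; congr pair; apply/funext => q; apply: l0.
 apply: (tf_ker tG (h := L)) => //. have LH q : L (H q) = 0.
  have [w [v [vS ->]]] : exists w v, (exists2 y, y \in tl i _ & v = (y, 0)) /\ q = gw w + gv v.
   have [w [[y l] [/ZSP[yt l0] ->]]] := g_dec sQ q; exists w, (y, l); split=> //; exists y => //. by congr pair; apply/funext => r; apply: l0.
  have [y yt ->] := vS; rewrite !linearD Hw Hv // Lw Lv ?fT_tl // [h _]hk linear0 add0r.
  have -> : fT n h (fT n k y) = 0 by apply/funext => p; rewrite !fTE hk. by rewrite -[(_, _)]/(0 : _ * _) (gv0 sQ'').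
 (* The cokernel reflection need not preserve injections. Here N has no socle at [i]: an m in M
    whose [out] comes from the kernel of h has out(h m) = 0, so h kills e_i m. *)
 have HI : injective H.
  apply/inj_ker => q; have [w [[y l] [/[dup] vS /ZSP[yt l0] ->]]] := g_dec sQ q. have {}l0 : l = 0 by apply/funext => r; apply: l0.
  rewrite {}l0 in vS *; have yS : (fT n k y, 0) \in ZS i M 0 by apply/tlZ/fT_tl.
  rewrite linearD Hw Hv // => /(g_sum0 P sQ' _ yS)[/(g_w0 sQ') w0 /(g_v0 sQ' yS)/ZRP[m [mE _]]]. apply/(g_sum0 P sQ _ vS); split.
   by apply/(g_w0 sQ); apply: (@inclL_inj _ _ (kerS h)); rewrite linearZ.
  rewrite -(out_e P) in mE; have [||u uE] := soc (e i *: (m : M)); first by rewrite ee eqxx.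
   by rewrite -fT_out mE; apply/funext => p; rewrite !fTE hk.
  apply/(g_v0 sQ vS)/ZRP; exists u; split=> //; apply: (fT_inj (n := n) (@inclL_inj _ _ (kerS h))). by rewrite fT_out uE mE.
 have [H' H'E] := corestr (f := H) (fun q => introT (kerSP L _) (LH q)). apply: (tf_coker tG hG (h := H') _ _ GK).
 - by move=> u v E; apply: HI; rewrite -!H'E E.
 - move=> r r0; have : e i *: inclL (kerS L) r = 0 by rewrite -linearZ r0 linear0.
  move=> /(g_part P sQ')[w [w0 wE]]. have : h w = 0.
   have /kerSP := inclL_in r; rewrite wE Lw => /(g_w0 sQ''). by rewrite -linearZ w0 linear0 => <-.
  move=> /kerSP/inclLP[u uE]; exists (gw u); apply: (@inclL_inj _ _ (kerS L)). by rewrite H'E Hw wE [k u]uE.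
 by apply: fin_dim_sub; have [] := Z_dim hC hO P sQ' nM.1.
split=> //.
 move=> [M [m [[_ sM _] m0 em xm am]]]; apply: m0; apply: sM => //.
 apply/funext => -[[j g] b]; rewrite outE; case: b => [|b]; first by rewrite expr0 scale1r am. by rewrite exprSr -scalerA xm !scaler0.
move=> N; have [gw [gv sQ]] := SpP i N; have [gw' [gv' sR]] := SmP i (Sp i N).
have [h [hI h0 _]] := Sm_Sp hC hD hO P sQ sR.
split=> [GN|[nN [nS sS GS]]]; last first.
 exact: (tf_coker tG hG hI h0 GS nN.1).
have nN := tf_nfd tG GN; split=> //; split; [exact: Sp_nfd sQ nN| |exact: tf_sub hI GN].
move=> q eq oq; have [v vk qE] := g_parti P sQ eq; rewrite qE in oq *.
have -> : v = 0; last exact: (gv0 sQ).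
apply/funext => -[[j g] b]; have /kinP[vt _] := vk.
have [vl|vl] := boolP (valid i j g); last by rewrite (tl_inv _ vt).
have ok : iter b (@sh K n A N) v \in kin C Om e x a i N.
 elim: b => //= b /kinP[h1 h2]; apply/kinP; rewrite sh_tl // (in_sh hO P) // h2 scaler0 //.
have xb : x i ^+ b *: gv v = gv (iter b (@sh K n A N) v).
 elim: b ok => [|b IHb] ok; first by rewrite expr0 scale1r. have ok' : iter b (@sh K n A N) v \in kin C Om e x a i N.
  elim: (b) => //= c /kinP[h1 h2]; apply/kinP; rewrite sh_tl // (in_sh hO P) // h2 scaler0 //.
 by rewrite exprS -scalerA IHb // (g_vx sQ).
have := congr1 (fun y => y (j, g, b)) oq; rewrite outE xb (g_bout sQ) //= iter_sh => h1.
have /(g_w0 sQ) := h1; rewrite -(tl_e j g b vt) ee eq_sym (negbTE (valid_neq hC hO vl)).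
by move=> <-.
Qed.

Definition perp (F : lmodType A -> Prop) N := forall M, F M -> forall (h : {linear N -> M}) m, h m = 0.

(** The torsion side of the reflection. It keeps the dimension count of [Sp_dim] valid along a word:
    having no map to the class forces [in] to be onto. *)
Lemma perp_Sp F N : torf0 F -> ~ has F -> nfd N -> perp (sig F) N -> perp F (Sp i N) /\
 (forall m : N, e i *: m = m -> exists2 y, y \in tl i N & inn i N y = m).
move=> tF nF nN pN; have [gw [gv sQ]] := SpP i N.
have inS (m : N) : e i *: m = m -> exists2 y, y \in tl i N & inn i N y = m.
 (* The elements whose e_i-part lies in the image of [in] form a submodule. The quotient is
    concentrated at [i], so it belongs to [sig F] and has to vanish. *)
 have TS : submod_closed (fun m : N => `[< exists2 y, y \in tl i N & inn i N y = e i *: m >]).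
  split=> [|b u v]; first by apply/asboolP; exists 0; rewrite ?rpred0 // linear0 scaler0. move=> uT /asboolP[z zt zv]; apply/asboolP.
  suff [y yt yb] : exists2 y, y \in tl i N & inn i N y = e i *: (b *: u).
   by exists (y + z); rewrite ?rpredD // linearD yb zv scalerDr.
  move: uT => /asboolP; move: b u {v z zt zv}. have hj j u : j != i -> exists2 y, y \in tl i N & inn i N y = e i *: (e j *: u : N).
   by move=> ji; exists 0; rewrite ?rpred0 // linear0 ee eq_sym (negbTE ji).
  elim/(pr_ind P) => [|b c IHb IHc|k b IHb|j|j b IHb|j l g b IHb] u uT.
  - by exists 0; rewrite ?rpred0 // linear0 scale0r scaler0.
  - have [y yt yb] := IHb u uT; have [z zt zc] := IHc u uT.
   by exists (y + z); rewrite ?rpredD // linearD yb zc scalerDl scalerDr.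
  - have [y yt yb] := IHb u uT; exists (k *: y); first exact: rpredZ.
   by rewrite linearZ /= yb -scalerA -pzscale_comm.
  - have [->|ji] := eqVneq j i; last exact: hj.
   by have [y yt yb] := uT; exists y; rewrite // yb ee eqxx.
  - have [y yt yb] := IHb u uT; have [->|ji] := eqVneq j i; last first.
    by rewrite -(pr_ex P) -!scalerA; apply: hj.
   exists (@sh K n A N y); first exact: sh_tl. by rewrite (in_sh hO P) // yb !scalerA (pr_xe P) mulrA (pr_ex P).
  have [v|v] := boolP (valid j l g); last first.
   by rewrite (pr_a0 P) // mul0r; exists 0; rewrite ?rpred0 // linear0 scale0r scaler0.
  have [ji|ji] := eqVneq j i; last by rewrite -(pr_ea P) -!scalerA; apply: hj.
  rewrite ji in v *; exists (dlL C Om e x i N l g (b *: u)); first exact: (dl_tl hO P). by rewrite (in_dl hO P) // !scalerA !mulrA (pr_ea P).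
 move=> em; pose T := Submodule TS. have cT : conc e i (quot_mod T).
  move=> u; have [v <-] := projL_surj u; rewrite -linearZ; apply/eqP; rewrite -subr_eq0 -linearB.
  apply/eqP/projL0/asboolP; exists 0; rewrite ?rpred0 // linear0 scalerBr ee eqxx subrr //.
 have /projL0/asboolP[y yt yE] : projL T m = 0.
  apply: (pN (quot_mod T)); apply: (conc_has (sig_torf tF) (sig_has tF)) => //. exact: fin_dim_quot nN.1.
 by exists y => //; rewrite yE em.
split=> // M FM h q.
have FI : F (sub_mod (imS h)) by apply: (tf_sub tF (h := inclL (imS h))) FM; exact: inclL_inj.
pose M' := sub_mod (imS h); have sM := soc_free_torf tF nF FI.
have [g gE] := corestr (f := h) (fun m => introT (imSP h _) (ex_intro _ m erefl)).
have [gw' [gv' sR]] := SmP i (Sp i N); have [gw'' [gv'' sR']] := SmP i M'.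
have [k [kI k0 kin]] := Sm_Sp hC hD hO P sQ sR.
(* Surjectivity of [in] makes Sm (Sp N) isomorphic to N, so a map from Sp N to M' turns under Sm
   into a map from N to Sm M', which is zero since Sm M' is in [sig F]. *)
have kS : surjective_fun k.
 move=> m; have [u uE] : exists u, k u = m - e i *: m by apply: k0; rewrite scalerBr ee eqxx subrr.
 have [|y yt yE] := inS (e i *: m); first by rewrite ee eqxx. by have [v vE] := kin y yt; exists (u + v); rewrite linearD uE vE yE subrK.
have [k' [kK k'K]] := linear_inv (bijP kI kS).
have [H [Hw Hv _]] := Sm_map hO P sR sR' g.
have H0 r : H r = 0.
 rewrite -(kK r); have := pN (Sm i M') (sig_Sm tF FI sM sR') (H \o k' : {linear _ -> _}). by move=> /(_ (k r)).
have g0 (u : Sp i N) : g u = 0.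
 have : e i *: g u = g u by have := H0 (gw' u); rewrite Hw => /(g_w0 sR'). move=> eg; apply: sM => //; apply/funext => -[[j b] c]; rewrite outE.
 have [vl|vl] := boolP (valid i j b); last by rewrite (pr_a0 P) ?scale0r // validC.
 have : forall v, e i *: g v = g v by move=> v; have := H0 (gw' v); rewrite Hw => /(g_w0 sR').
 move=> cg; have -> : a j i b *: (x i ^+ c *: g u) = g (a j i b *: (x i ^+ c *: u)) by rewrite !linearZ.
 rewrite -cg; have -> : a j i b *: (x i ^+ c *: u) = e j *: (a j i b *: (x i ^+ c *: u)).
  by rewrite [RHS]scalerA (pr_ea P).
 rewrite linearZ /= ee. by rewrite eq_sym (negbTE (valid_neq hC hO vl)).
by rewrite -gE g0 linear0.
Qed.
End Vertex.
End Classes.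

(** * Roots of Dynkin type *)

Section Reflections.
Variables (n : nat) (C : 'M[int]_n) (D : 'I_n -> nat).
Hypotheses (hC : is_GCM C) (hD : is_symmetrizer C D) (hP : is_Dynkin C D).
Notation sr := (simple_refl C).
Notation refl := (refl_word C).
Implicit Types (v w : 'cV[int]_n) (s t u : seq 'I_n).

Definition al i : 'cV[int]_n := delta_mx i 0.
Lemma alE i j : al i j 0 = (j == i)%:R. by rewrite mxE eqxx andbT. Qed.
Lemma sr_v i v : sr i *m v = v - (C *m v) i 0 *: al i.
rewrite mulmxBl mul1mx -mulmxA; congr (_ - _); apply/colP => j.
rewrite !mxE eqxx andbT (bigD1 i) //= big1 ?addr0 => [|l /negbTE li].
 by rewrite mxE eqxx andbT mulrC mxE.
by rewrite mxE li andbF mul0r.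
Qed.
Lemma Cal i j : (C *m al i) j 0 = C j i.
rewrite mxE (bigD1 i) //= big1 ?addr0 => [|l li]; first by rewrite alE eqxx mulr1.
by rewrite alE (negbTE li) mulr0.
Qed.
Lemma sr_al i : sr i *m al i = - al i.
have [h _ _] := hC; rewrite sr_v Cal h -[X in X - _]scale1r -scalerBl.
by rewrite -scaleN1r; congr (_ *: _).
Qed.
Lemma sr_sr i v : sr i *m (sr i *m v) = v.
by rewrite (sr_v i v) mulmxBr -scalemxAr sr_al sr_v scalerN opprK subrK.
Qed.
Lemma mx_ext m (M N : 'M[int]_(m, n)) : (forall v, M *m v = N *m v) -> M = N.
move=> h; apply/matrixP => i j; have := congr1 (fun v : 'cV_m => v i 0) (h (al j)).
rewrite !mxE (bigD1 j) //= big1 ?addr0 => [|l lj]; last by rewrite alE (negbTE lj) mulr0.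
rewrite (bigD1 j) //= [X in _ + X]big1 ?addr0 => [|l lj]; last by rewrite alE (negbTE lj) mulr0.
by rewrite alE eqxx !mulr1.
Qed.
Lemma sr_sq i : sr i *m sr i = 1%:M.
by apply: mx_ext => v; rewrite -mulmxA sr_sr mul1mx. Qed.
Lemma refl_cat s t : refl (s ++ t) = refl s *m refl t.
by elim: s => [|i s IHs] /=; rewrite ?mul1mx // IHs mulmxA. Qed.
Lemma refl_rcons s i : refl (rcons s i) = refl s *m sr i.
by rewrite -cats1 refl_cat /= mulmx1. Qed.
Lemma refl_rev s : refl s *m refl (rev s) = 1%:M.
elim: s => [|i s IHs]; first by rewrite /= mul1mx.
rewrite rev_cons refl_rcons /= -mulmxA (mulmxA (refl s)) IHs mul1mx; exact: sr_sq.
Qed.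
Lemma refl_revr s : refl (rev s) *m refl s = 1%:M.
by have := refl_rev (rev s); rewrite revK. Qed.
Lemma refl_inj s v w : refl s *m v = refl s *m w -> v = w.
by move=> h; rewrite -[v]mul1mx -(refl_revr s) -mulmxA h mulmxA refl_revr mul1mx. Qed.
Lemma refl_eq_rev s t : refl s = refl t -> refl (rev s) = refl (rev t).
move=> h; rewrite -[LHS]mulmx1 -(refl_rev t) -h mulmxA refl_revr mul1mx.
by [].
Qed.

Definition Bf v w : int := \sum_i (D i)%:Z * v i 0 * (C *m w) i 0.
Lemma BfDr v w w' : Bf v (w + w') = Bf v w + Bf v w'.
by rewrite -big_split; apply: eq_bigr => i _ /=; rewrite mulmxDr mxE mulrDr. Qed.
Lemma BfZr k v w : Bf v (k *: w) = k * Bf v w.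
by rewrite mulr_sumr; apply: eq_bigr => i _ /=; rewrite -scalemxAr mxE mulrCA. Qed.
Lemma BfC v w : Bf v w = Bf w v.
rewrite /Bf; under eq_bigr => i _ do rewrite mxE mulr_sumr.
rewrite exchange_big; apply: eq_bigr => j _ /=; rewrite mxE mulr_sumr; apply: eq_bigr => i _.
rewrite mulrAC [RHS]mulrAC -!mulrA; rewrite !mulrA (mulrAC _ _ (v i 0)).
by rewrite (D_sym hD i j).
Qed.
Lemma BfDl v v' w : Bf (v + v') w = Bf v w + Bf v' w.
by rewrite !(BfC _ w) BfDr. Qed.
Lemma BfZl k v w : Bf (k *: v) w = k * Bf v w.
by rewrite !(BfC _ w) BfZr. Qed.
Lemma Bf0 v : Bf v 0 = 0.
by rewrite -(scale0r (0 : 'cV[int]_n)) BfZr mul0r. Qed.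
Lemma Bf_al i v : Bf (al i) v = (D i)%:Z * (C *m v) i 0.
rewrite /Bf (bigD1 i) //= big1 ?addr0 => [|j ji]; first by rewrite alE eqxx mulr1.
by rewrite alE (negbTE ji) mulr0 mul0r.
Qed.
Lemma Bf_alal i : Bf (al i) (al i) = (D i)%:Z * 2.
by have [h _ _] := hC; rewrite Bf_al Cal h. Qed.
Lemma Bf_sr i v w : Bf (sr i *m v) (sr i *m w) = Bf v w.
rewrite !sr_v -!scaleNr BfDr !BfDl !BfZr !BfZl Bf_alal (BfC v (al i)) !Bf_al.
set p := (C *m v) i 0; set q := (C *m w) i 0; set d := (D i)%:Z.
ring.
Qed.
Lemma Bf_refl s v w : Bf (refl s *m v) (refl s *m w) = Bf v w.
by elim: s => [|i s IHs] /=; rewrite ?mul1mx // -!mulmxA Bf_sr IHs. Qed.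

Lemma Bf_pos v : v != 0 -> 0 < Bf v v.
move=> v0; have /hP h : exists i, v i 0 != 0.
 apply/existsP; rewrite -negb_forall; apply: contra v0 => /forallP h; apply/eqP/colP => i. by rewrite mxE; apply/eqP/h.
suff -> : Bf v v = Cartan_form C D (fun i => v i 0) * 2 by rewrite pmulr_lgt0.
have [c1 c2 c3] := hC.
have E : Bf v v = \sum_i (D i)%:Z * v i 0 ^+ 2 * 2 + \sum_i \sum_(j | j != i) (D i)%:Z * C i j * v i 0 * v j 0.
 rewrite -big_split; apply: eq_bigr => i _ /=; rewrite mxE (bigD1 i) //= c1 mulrDr; congr (_ + _).
  by ring.
 by rewrite mulr_sumr; apply: eq_bigr => j _; rewrite !mulrA (mulrAC _ (v i 0)).
rewrite E /Cartan_form mulrBl mulr_suml; congr (_ + _).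
pose T i j : int := (D i)%:Z * C i j * v i 0 * v j 0.
have TC i j : T i j = T j i by rewrite /T (D_sym hD i j) -!mulrA (mulrC (v i 0)).
have -> : \sum_i \sum_(j | j != i) T i j = \sum_(i < n) \sum_(j < n | (i < j)%N) T i j + \sum_(i < n) \sum_(j < n | (j < i)%N) T i j.
 rewrite -big_split; apply: eq_bigr => i _ /=; rewrite (bigID (fun j : 'I_n => (i < j)%N)) /=; congr (_ + _); apply: eq_bigl => j.
  by rewrite -val_eqE /= neq_ltn; case: ltngtP.
 by rewrite -val_eqE /= neq_ltn; case: ltngtP.
have -> : \sum_(i < n) \sum_(j < n | (j < i)%N) T i j = \sum_(i < n) \sum_(j < n | (i < j)%N) T i j.
 rewrite (exchange_big_dep xpredT) //=; apply: eq_bigr => i _. by apply: eq_bigr => j _; rewrite TC.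
set X := \sum_(i < n) _; set Y := \sum_(i < n) _; suff -> : X = - Y by ring.
rewrite -sumrN; apply: eq_bigr => i _; rewrite -sumrN; apply: eq_bigr => j ij.
have ne : i != j by rewrite -val_eqE neq_ltn ij.
by rewrite ler0_norm ?c2 // mulrN !mulNr opprK.
Qed.

Lemma refl_conj s i j : refl s *m al i = al j -> refl s *m sr i = sr j *m refl s.
move=> h; apply: mx_ext => v; rewrite -!mulmxA !sr_v mulmxBr -scalemxAr h; congr (_ - _ *: _).
have D2 : D i = D j.
 have := Bf_refl s (al i) (al i); rewrite h !Bf_alal. by lia.
have := Bf_refl s (al i) v; rewrite h !Bf_al D2 => /mulfI -> //.
by have := D_gt0 hD j; lia.
Qed.

Definition nonneg v := forall j, 0 <= v j 0.
Definition nonpos v := forall j, v j 0 <= 0.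

(** Read from its last letter, the word has a letter j where the root turns from positive to
    negative. Only the coefficient at j changes there, so the root is al_j just before, and
    conjugation moves the reflection i across the word to cancel j. *)
Lemma deletion s i : (forall u j, nonneg (refl u *m al j) \/ nonpos (refl u *m al j)) ->
 nonpos (refl (rev s) *m al i) -> exists2 t, (size t).+1 = size s & refl (i :: s) = refl t.
move=> coh; elim/last_ind: s => [|s j IHs].
 by rewrite /rev /= mul1mx => /(_ i); rewrite alE eqxx.
rewrite rev_rcons /= -mulmxA; case: (coh (rev s) i) => [ge0 le0|/IHs[t st rt] _]; last first.
 by exists (rcons t j); rewrite ?size_rcons ?st // !refl_rcons mulmxA -rt.
set be := refl (rev s) *m al i in ge0 le0.
(* A nonnegative vector that the reflection at j makes nonpositive is supported at j; as it
   generates al_i over the integers, its coefficient is 1. *)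
have bl l : l != j -> be l 0 = 0.
 move=> lj; apply/eqP; rewrite eq_le ge0 andbT; have := le0 l. by rewrite sr_v mxE [X in _ + X]mxE [X in - X]mxE alE (negbTE lj) mulr0 subr0.
have bE : be = be j 0 *: al j.
 apply/colP => l; rewrite [RHS]mxE alE. by have [->|/bl->] := eqVneq l j; rewrite ?mulr1 ?mulr0.
have b1 : be j 0 = 1.
 have : al i = be j 0 *: (refl s *m al j).
  by rewrite scalemxAr -bE /be mulmxA refl_rev mul1mx.
 move=> /(congr1 (fun v : 'cV_n => v i 0)); rewrite alE eqxx [RHS]mxE. move: (ge0 j) ((refl s *m al j) i 0) => + z; move: (be j 0) => c c0 /= cz.
 have := congr1 absz cz; rewrite abszM => /esym/eqP; rewrite muln_eq1 => /andP[/eqP h _]; lia.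
have bj : be = al j by rewrite bE b1 scale1r.
have cj := refl_conj bj; exists s; first by rewrite size_rcons.
have key : sr i *m refl s = refl s *m sr j.
 by rewrite -[LHS]mul1mx -(refl_rev s) -!mulmxA (mulmxA (refl (rev s))) cj -mulmxA refl_revr mulmx1.
by rewrite [LHS]/= refl_rcons mulmxA key -mulmxA sr_sq mulmx1.
Qed.

(** All roots u al_j have norm 2 D j. Cauchy-Schwarz against the vectors U i, which compute det S
    times a coordinate, bounds every coordinate, so positive roots form a finite set. *)
Lemma root_bound : exists B : nat, forall L : seq 'cV[int]_n, uniq L ->
 (forall v, v \in L -> nonneg v /\ exists u i, v = refl u *m al i) -> (size L <= B)%N.
pose S : 'M[int]_n := diag_mx (\row_i (D i)%:Z) *m C.
have BS v w : Bf v w = (v^T *m (S *m w)) 0 0.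
 rewrite mxE; apply: eq_bigr => i _; rewrite mxE -mulmxA mul_diag_mx !mxE. by ring.
have dS : \det S != 0.
 apply/negP => /det0P[v v0 vS]. have [h1 h2] : v^T != 0 /\ Bf v^T v^T = 0.
  rewrite BS trmxK mulmxA vS mul0mx mxE; split=> //. by apply: contra v0 => /eqP/(congr1 trmx); rewrite trmxK trmx0 => ->.
 by have := Bf_pos h1; rewrite h2.
(* The adjugate replaces the inverse of S over the integers; the factor det S is nonzero by
   positivity of the form. *)
pose U i : 'cV[int]_n := \adj S *m al i.
have BU v i : Bf v (U i) = \det S * v i 0.
 rewrite BS mulmxA /U mulmxA -(mulmxA _ S) mul_mx_adj -scalemx1 -!scalemxAr -scalemxAl mulmx1 mxE.
 congr (_ * _); rewrite mxE (bigD1 i) //= big1 ?addr0 => [|l li]; first by rewrite alE eqxx mulr1 mxE. by rewrite alE (negbTE li) mulr0.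
have CS v w : Bf v w ^+ 2 <= Bf v v * Bf w w.
 have [->|w0] := eqVneq w 0; first by rewrite !Bf0 mulr0. have := Bf_pos w0; set q := Bf w w => q0.
 have E : Bf (q *: v - Bf v w *: w) (q *: v - Bf v w *: w) = q * (Bf v v * q - Bf v w ^+ 2).
  by rewrite -scaleNr !(BfDl, BfDr, BfZl, BfZr) (BfC w v) -/q; ring.
 have : 0 <= Bf (q *: v - Bf v w *: w) (q *: v - Bf v w *: w).
  have [->|z0] := eqVneq (q *: v - Bf v w *: w) 0; last exact: ltW (Bf_pos z0). by rewrite Bf0.
 by rewrite E pmulr_rge0 // subr_ge0.
(* Summing the bounds over all i and j makes the bound uniform; |v_i| is at most the square of det S
   times v_i because these are integers and det S is nonzero. *)
pose N : nat := (\sum_i \sum_j absz (Bf (U i) (U i)) * (D j * 2))%N.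
exists #|{ffun 'I_n -> 'I_N.+1}| => L uL LP.
pose F v : {ffun 'I_n -> 'I_N.+1} := [ffun i => inord (absz (v i 0%R))].
have bd v i : v \in L -> (absz (v i 0%R) <= N)%N.
 move=> /LP[_ [u [j vE]]]; have := CS v (U i); rewrite BU {2 3}vE Bf_refl Bf_alal => h.
 have {h} h : (absz (\det S * v i 0)%R ^ 2 <= absz (Bf (U i) (U i)) * (D j * 2))%N.
  have U0 : 0 <= Bf (U i) (U i).
   have [->|z0] := eqVneq (U i) 0; last exact: ltW (Bf_pos z0). by rewrite Bf0.
  move: h U0; rewrite expr2; move: (\det S * v i 0) (Bf _ _) => p b h U0; rewrite expnS expn1. have : absz p * absz p = absz (p * p)%R by rewrite abszM.
  nia.
 have d1 : (0 < absz (\det S))%N by rewrite absz_gt0. have le2 : (absz (v i 0%R) <= absz (\det S * v i 0)%R ^ 2)%N.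
  rewrite abszM; move: (absz (\det S)) d1 (absz (v i 0)) => d d1 y; rewrite expnS expn1. have le : (y <= d * y)%N by rewrite leq_pmull.
  by case: y le => // y le; apply: leq_trans le _; rewrite leq_pmull // muln_gt0 d1.
 apply: leq_trans le2 (leq_trans h _). rewrite /N (bigD1 i) //= (bigD1 j) //= -addnA; exact: leq_addr.
have FI : {in L &, injective F}.
 move=> v w vL wL /ffunP E; apply/colP => i; have := E i; rewrite !ffunE => /(congr1 val) /=. rewrite !inordK ?ltnS ?bd // => h.
 by rewrite -[LHS]gez0_abs ?(LP _ vL).1 // -[RHS]gez0_abs ?(LP _ wL).1 // h.
rewrite -(size_map F); have /card_uniqP <- : uniq (map F L) by rewrite map_inj_in_uniq.
exact: max_card.
Qed.
End Reflections.

(** * The ideals I_w and the cyclic modules (Pi/I_w) e_l *)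

Section Words.
Variables (K : fieldType) (n : nat) (C : 'M[int]_n) (D : 'I_n -> nat).
Variable Om : {set 'I_n * 'I_n}.
Hypotheses (hC : is_GCM C) (hD : is_symmetrizer C D) (hO : is_orientation C Om).
Notation f := (Cartan_f C).
Notation valid := (valid_arrow C Om).
Variables (A : pzAlgType K) (e x : 'I_n -> A) (a : 'I_n -> 'I_n -> nat -> A).
Hypothesis P : presentation C D Om e x a.
Implicit Types M N : lmodType A.
Notation TM := (@TM K n A).
Hypothesis hP : is_Dynkin C D.
Notation tl i M := (tl C Om e x i M).
Notation out i := (outL x a i).
Notation inn i := (inL C Om x a i).
Notation ee := (ee P).
Notation isZ i := (isZ C Om e x a i).
Notation ZS := (ZS C Om e x).
Notation Sp := (Sp hC hD hO P).
Notation SpP := (SpP hC hD hO P).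

Definition Iv i : ideal A := gen_ideal [set 1 - e i]%classic.
Definition Iw (s : seq 'I_n) : ideal A := foldr (fun i J => ideal_mul (Iv i) J) (unit_ideal A) s.

Lemma mem_Iv i b c : b * (1 - e i) * c \in Iv i.
by apply/asboolP; exists [:: (b, 1 - e i, c)]; split=> [p|]; rewrite ?big_seq1 // inE => /eqP->.
Qed.
Lemma mem_Ive i b j : j != i -> b * e j \in Iv i.
move=> ji; have <- : b * (1 - e i) * e j = b * e j; last exact: mem_Iv.
by rewrite -mulrA mulrBl mul1r (pr_ee P) eq_sym (negbTE ji) subr0.
Qed.
Lemma mem_mul (I J : ideal A) b c : b \in I -> c \in J -> b * c \in ideal_mul I J.
move=> bI cJ; apply/asboolP; exists [:: (b, c)]; split=> [p|]; last by rewrite big_seq1.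
by rewrite inE => /eqP->.
Qed.
Definition killed (J : ideal A) M := forall b (m : M), b \in J -> b *: m = 0.

(** J N lies in the kernel of the unit N -> Sp N. This kernel is a submodule concentrated at [i], so
    it is killed by the ideal generated by 1 - e_i. *)
Lemma sig_killed i J N : killed J (Sp i N) -> killed (ideal_mul (Iv i) J) N.
move=> kJ b m /asboolP[t [tIJ ->]]; rewrite scaler_suml big_seq big1 // => p /tIJ[/asboolP[u [uX ->]] pJ].
rewrite -scalerA scaler_suml big_seq big1 // => q /uX ->.
have [gw [gv sQ]] := SpP i N; have [c [_ c0]] := Sp_unit hC hO P sQ.
have [|E _] := c0 (q.2 *: (p.2 *: m)); first by rewrite !linearZ_LR (kJ p.2) // scaler0.
by rewrite -!scalerA scalerBl scale1r E subrr scaler0.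
Qed.

Lemma scAo (p q : A) : p *: (q : A^o) = p * q. by []. Qed.
(** The element u presents M as (A/J) e_l. *)
Record prs (J : ideal A) l M (u : M) : Prop := {
 prs_e : e l *: u = u; prs_gen : forall m, exists b, m = b *: u; prs_ann : forall b, b *: u = 0 <-> b * e l \in J }.

Definition dta (k : nat) : nat -> K^o := fun l => (l == k)%:R.
Lemma iter_dta M d k : (k < d)%N -> iter k (Zep n M d) (0, dta 0) = (0, dta k).
elim: k => // k IHk kd; rewrite iterS IHk 1?ltnW // ZepE linear0; congr pair.
apply/funext => -[|l] //=; rewrite /dta eqSS; case: ifP => // ld; case: eqP => // lk.
by move: ld; rewrite lk kd.
Qed.

Section Step.
Variables (i l : 'I_n) (J : ideal A) (M : lmodType A) (u : M).
Hypothesis pM : prs J l u.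
(** The free summand is added only when l = i: the generator at [i] would be lost in the cokernel
    reflection, and its replacement lies over u. *)
Let m0 : M := if l == i then u else 0.
Let d : nat := if l == i then D i else 0.
Lemma step_e : e i *: m0 = m0.
by rewrite /m0; case: eqP => [<-|_]; [exact: (prs_e pM) | rewrite scaler0]. Qed.
Lemma step_x : x i ^+ d *: m0 = 0.
by rewrite /m0 /d; case: eqP => [_|_]; rewrite ?scaler0 // (pr_nil P) scale0r. Qed.
Variables (Z : lmodType A) (gw : {linear kmod M -> kmod Z}) (gv : TM M * (nat -> K^o) -> Z).
Hypothesis sZ : isZ i m0 d gw gv.

Let z0 : Z := if l == i then gv (0, dta 0) else gw u.

Let dS h : (forall k, (d <= k)%N -> h k = 0) -> ((0 : TM M, h) : _ * _) \in ZS i M d.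
by move=> h0; apply/ZSP; split=> //; apply: (rpred0 (tl i M)). Qed.
Let dtaS k : (k < d)%N -> ((0 : TM M, dta k) : _ * _) \in ZS i M d.
by move=> kd; apply: dS => p dp; rewrite /dta; case: eqP => // pk; move: kd; rewrite -pk ltnNge dp. Qed.

Let z0e : e l *: z0 = z0.
rewrite /z0; case: eqP => [li|_]; last by rewrite (g_we sZ) (prs_e pM).
rewrite li (g_ve sZ) //; apply: dtaS; rewrite /d li eqxx; exact: (D_gt0 hD).
Qed.
Let kap : exists c : {linear Z -> M}, [/\ forall w, c (gw w) = (w : M) - e i *: (w : M),
 c z0 = u & forall z, c z = 0 -> e i *: z = z].
have [c [cw cv c0]] := Z_counit hC hO P step_e step_x sZ; exists c; split=> //.
rewrite /z0; case: (altP (l =P i)) => [li|li]; last first.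
 by rewrite cw -(prs_e pM) ee eq_sym (negbTE li) subr0.
have dE : d = D i by rewrite /d li eqxx.
rewrite cv; last by apply: dtaS; rewrite dE (D_gt0 hD).
rewrite ZvalE linear0 add0r; case dd : d => [|d']; first by have := D_gt0 hD i; rewrite -dE dd.
rewrite big_ord_recl big1 ?addr0 => [|k _]; last by rewrite rmorph0 scale0r.
by rewrite rmorph1 expr0 !scale1r /m0 li eqxx.
Qed.

(* [gv (0, h)] is reached from the generator by powers of the loop at [i] *)
Let Zh h : (forall k, (d <= k)%N -> h k = 0) ->
 gv (0, h) = \sum_(k < d) (pzscal (h k : K) : A) *: (x i ^+ k *: z0).
move=> h0; case: (altP (l =P i)) => [li|li]; last first.
 have d0 : d = 0%N by rewrite /d (negbTE li). have -> : h = 0 by apply/funext => k; apply: h0; rewrite d0.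
 by rewrite -[(_, _)]/(0 : _ * _) (gv0 sZ) d0 big_ord0.
have -> : (0 : TM M, h) = \sum_(k < d) (h k : K) *: ((0, dta k) : TM M * (nat -> K^o)).
 apply: injective_projections; first by rewrite raddf_sum /= big1 // => k _; rewrite scaler0. rewrite raddf_sum /=; apply/funext => p.
 have E (T : Type) (r : seq T) (Q : pred T) (F : T -> nat -> K^o) q :
   (\sum_(t <- r | Q t) F t) q = \sum_(t <- r | Q t) F t q by elim/big_rec2: _ => // t b w _ <-.
 rewrite E; have [pd|dp] := ltnP p d.
  rewrite (bigD1 (Ordinal pd)) //= big1 ?addr0 => [|k kp]; rewrite fctE /dta.
   by rewrite eqxx [_ *: _]mulr1.
  by case: eqP => [pk|_]; [case/eqP: kp; apply: val_inj | rewrite [_ *: _]mulr0].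
 rewrite h0 // big1 // => k _; rewrite fctE /dta; case: eqP => [pk|_]; last by rewrite [_ *: _]mulr0. by move: dp; rewrite pk leqNgt ltn_ord.
rewrite (gv_sum _ sZ) => [|k _]; last by apply/rpredZ/dtaS.
apply: eq_bigr => k _; rewrite (gvZ sZ) ?dtaS //; congr (_ *: _).
have d0 : (0 < d)%N by apply: leq_ltn_trans (ltn_ord k).
rewrite /z0 li eqxx -(iter_dta M (ltn_ord k)); elim: (nat_of_ord k) => [|q IHq]; first by rewrite expr0 scale1r.
rewrite iterS exprS -scalerA -IHq (g_vx sZ) //.
by have [] := Zep_iter hO P step_x q (dtaS d0).
Qed.

Let ksplit (z : Z) (c : {linear Z -> M}) : (forall w, c (gw w) = (w : M) - e i *: (w : M)) ->
 e i *: z = 0 -> z = gw (c z).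
by move=> cw /(g_part P sZ)[w [w0 ->]]; rewrite cw w0 subr0. Qed.

Lemma step_gen z : exists b, z = b *: z0.
have [c [cw cz _]] := kap.
have TS : submod_closed (fun z : Z => `[< exists b, z = b *: z0 >]).
 split=> [|b y w /asboolP[p ->] /asboolP[q ->]]; apply/asboolP; first by exists 0; rewrite scale0r. by exists (b * p + q); rewrite scalerDl scalerA.
pose T := Submodule TS; suff : z \in T by move=> /asboolP.
have gwT w : gw w \in T.
 have [b wb] := prs_gen pM w; apply/asboolP; exists ((1 - e i) * b). have -> : gw w = gw ((w : M) - e i *: (w : M)) by rewrite linearB (gwi P sZ) subr0.
 rewrite [RHS](ksplit cw); last by rewrite scalerA mulrA mulrBr mulr1 (pr_ee P) eqxx subrr mul0r scale0r.
 by rewrite linearZ_LR cz -scalerA -wb scalerBl scale1r.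
have [w [[y h] [/[dup] vS /ZSP[yt h0] ->]]] := g_dec sZ z; apply: rpredD; first exact: gwT.
have -> : gv (y, h) = gv (y, 0) + gv (0, h).
 rewrite -(gvD sZ) ?dS ?tlZ //; congr gv. by apply: injective_projections; rewrite /= ?addr0 ?add0r.
apply: rpredD; last first.
 rewrite Zh //; apply: rpred_sum => k _; apply/asboolP. by exists (pzscal (h k) * x i ^+ k); rewrite scalerA.
rewrite -(Z_in hO P sZ yt) inE_; apply: rpred_sum => j _; apply: rpred_sum => g _; apply: rpred_sum => k _.
rewrite !scalerA; have /asboolP[b ->] := gwT (y (j, nat_of_ord g, (f j i - 1 - k)%N)).
by apply/asboolP; rewrite scalerA; eexists.
Qed.

Let mA : A^o := if l == i then e i else 0.
(** In the regular module, e_i A e_l is reached by [Zval]: an element of it that starts with an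
    arrow comes from [in], and for l = i the free summand supplies the powers of x_i. *)
Let step_ex c : exists2 v, v \in ZS i (A^o)%type d & ZvalL C Om x a i mA d v = e i * c * e l.
have eA : e i *: mA = mA by rewrite /mA; case: eqP => // _; rewrite ?scaler0 // /GRing.scale /= (pr_ee P) eqxx.
have xA : x i ^+ d *: mA = 0 by rewrite /mA /d; case: eqP => _; rewrite ?scaler0 // (pr_nil P) scale0r.
have zz w : w = 0 -> exists2 v, v \in ZS i (A^o)%type d & ZvalL C Om x a i mA d v = w.
 by move=> ->; exists 0; rewrite ?linear0 ?rpred0.
elim/(pr_ind P): c => [|b c [v vS vE] [w wS wE]|k b [v vS vE]|j|j b [v vS vE]|j q g b IHb].
- by apply: zz; rewrite mulr0 mul0r.
- by exists (v + w); rewrite ?rpredD // linearD vE wE mulrDr mulrDl.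
- exists (k *: v); first exact: rpredZ.
 by rewrite linearZ_LR vE kscaleE scAo !mulrA pzscal_central.
- rewrite (pr_ee P); have [<-|ij] := eqVneq i j; last by apply: zz; rewrite mul0r.
 rewrite (pr_ee P) eq_sym; case: (altP (l =P i)) => [li|li]; last exact: zz. have dE : d = D i by rewrite /d li eqxx. exists (0, dta 0).
  apply/ZSP; split; first exact: (rpred0 (tl i _)). by case=> // dk; have := D_gt0 hD i; rewrite -dE; case: d dk.
 rewrite ZvalE linear0 add0r; case dd : d => [|d']; first by have := D_gt0 hD i; rewrite -dE dd.
 rewrite big_ord_recl big1 ?addr0 => [|k _]; last by rewrite rmorph0 scale0r. by rewrite rmorph1 expr0 !scale1r /mA li eqxx.
- have [->|ji] := eqVneq j i; last first.
  by apply: zz; rewrite -(pr_ex P j) !mulrA (pr_ee P) eq_sym (negbTE ji) !mul0r.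
 exists (Zep n _ d v); first exact: Zep_S. by rewrite (Zval_ep hO P) // vE scAo !mulrA (pr_xe P) (pr_ex P).
have [v|v] := boolP (valid j q g); last by apply: zz; rewrite (pr_a0 P) // mul0r mulr0 mul0r.
have [ji|ji] := eqVneq j i; last first.
 by apply: zz; rewrite -(pr_ea P j) !mulrA (pr_ee P) eq_sym (negbTE ji) !mul0r.
rewrite ji in v *; exists (dlL C Om e x i (A^o)%type q g (b * e l), 0).
 by apply/tlZ/(dl_tl hO P).
rewrite ZvalE big1 ?addr0 => [|k _]; last by rewrite rmorph0 scale0r.
by rewrite (in_dl hO P) // scAo [in RHS](mulrA (e i)) (pr_ea P) mulrA.
Qed.

(** Write b' = b e_l. The counit shows b' in J, whence (1 - e_i) b' is in I_i J. The part e_i b' is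
    lifted through [Zval] in the regular module and compared with its image in Z. *)
Lemma step_ann b : b *: z0 = 0 -> b * e l \in ideal_mul (Iv i) J.
move=> bz; have [c [cw cz _]] := kap.
pose b' := b * e l; have b'z : b' *: z0 = 0 by rewrite -scalerA z0e.
have b'e : b' * e l = b' by rewrite -mulrA (pr_ee P) eqxx.
have b'J : b' \in J.
 by rewrite -b'e; apply/(prs_ann pM); rewrite -cz -linearZ b'z linear0.
rewrite -/b' -[b'](mul1r b') -(subrK (e i) 1) mulrDl; apply: rpredD.
 by apply: mem_mul => //; have := mem_Iv i 1 1; rewrite mul1r mulr1.
have [[X h] /[dup] vS /ZSP[Xt h0] vE] := step_ex b'; rewrite -mulrA b'e in vE.
have muL : linear (fun p : A^o => (p : A) *: u) by move=> k p q; rewrite scalerDl -scalerA.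
have rhoL : linear (fun p : A^o => (p : A) *: z0) by move=> k p q; rewrite scalerDl -scalerA.
pose mu := mkL muL; pose rho := mkL rhoL.
have XE : fT n rho X = (fun p => gw (fT n mu X p)).
 apply/funext => -[[j g] q]; rewrite !fTE /=; have [v|v] := boolP (valid i j g); last first.
  by rewrite (tl_inv _ Xt v) !scale0r linear0.
 have Xe : e j * X (j, g, q) = X (j, g, q) := tl_e j g q Xt. rewrite {1}(@ksplit (X (j, g, q) *: z0) c cw) ?linearZ_LR ?cz //.
 by rewrite -Xe -scalerA ee eq_sym (negbTE (valid_neq hC hO v)).
have : e i *: (b' *: z0) = gv (fT n mu X, h).
 rewrite scalerA -vE ZvalE. have -> : gv (fT n mu X, h) = gv (fT n mu X, 0) + gv (0, h).
  rewrite -(gvD sZ) ?dS ?tlZ ?fT_tl //; congr gv. by apply: injective_projections; rewrite /= ?addr0 ?add0r.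
 rewrite -(Z_in hO P sZ (fT_tl mu Xt)) -XE fT_in Zh // scalerDl; congr (_ + _).
 rewrite scaler_suml; apply: eq_bigr => k _; rewrite !scAo -!scalerA; congr (_ *: (_ *: _)); rewrite /mA; case: eqP => [li|/eqP li]; first by rewrite -li z0e.
 by move: (nat_of_ord k) (ltn_ord k) => q; rewrite /d (negbTE li).
have ok : (fT n mu X, h) \in ZS i M d by apply/ZSP; split=> //; apply: fT_tl.
(* Vanishing in Z means that the lift (X, h), applied to u, is (out m, 0). Writing m = q u and
   subtracting out(q) from X does not change in(X), since in(out q) = 0. *)
rewrite b'z scaler0 => /esym/(g_v0 sZ ok)/ZRP[m [mE hE]]; have [q qE] := prs_gen pM m.
have {}vE : inn i (A^o)%type X = e i * b'.
 rewrite -vE ZvalE hE big1 ?addr0 // => k _; by rewrite rmorph0 scale0r.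
have -> : e i * b' = inn i (A^o)%type (X - out i (A^o)%type q) * e l.
 by rewrite linearB (in_out P) subr0 vE -mulrA b'e.
rewrite inE_ /in_sum mulr_suml; apply: rpred_sum => j ij; rewrite mulr_suml; apply: rpred_sum => g _.
rewrite mulr_suml; apply: rpred_sum => k _; set Y := X - _; set p := (j, _, _).
have vl : valid i j g by rewrite /valid_arrow Om_barC ij /=.
(* After this correction the entries of Y kill u, so they lie in J after multiplication by e_l; [in]
   multiplies them by arrows a_ij = a_ij e_j, which belong to I_i. *)
have YJ : Y p * e l \in J.
 apply/(prs_ann pM). have -> : Y p *: u = fT n mu X p - out i M m p; last by rewrite mE subrr. have -> : out i M m p = (out i (A^o)%type q p : A) *: u.
  by rewrite qE -[q *: u]/(mu q) -(fT_out _ _ _ mu) fTE.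
 by rewrite fTE; exact: (scalerBl (X p : A) (out i (A^o)%type q p : A) u).
rewrite !scAo -!mulrA; apply: ideal_mull; apply: ideal_mull.
by rewrite -(pr_ae P); apply: mem_mul => //; apply/mem_Ive/(valid_neq hC hO vl).
Qed.

Lemma prs_step : killed (ideal_mul (Iv i) J) Z -> exists z : Z, prs (ideal_mul (Iv i) J) l z.
move=> kZ; exists z0; split; [exact: z0e | exact: step_gen |] => b; split; first exact: step_ann.
by move=> bJ; rewrite -z0e scalerA kZ.
Qed.
End Step.
End Words.

Lemma dchoice (I : Type) (T : I -> Type) (Q : forall i, T i -> Prop) :
 (forall i, exists y, Q i y) -> exists h : forall i, T i, forall i, Q i (h i).
by move=> h; exists (fun i => projT1 (cid (h i))) => i; exact: (projT2 (cid (h i))). Qed.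

(** * Words, roots and torsion-free classes *)

Section Legit.
Variables (K : fieldType) (n : nat) (C : 'M[int]_n) (D : 'I_n -> nat).
Variable Om : {set 'I_n * 'I_n}.
Hypotheses (hC : is_GCM C) (hD : is_symmetrizer C D) (hO : is_orientation C Om).
Notation f := (Cartan_f C).
Notation G := (Cartan_g C).
Variables (A : pzAlgType K) (e x : 'I_n -> A) (a : 'I_n -> 'I_n -> nat -> A).
Hypothesis P : presentation C D Om e x a.
Implicit Types M N : lmodType A.
Hypothesis hP : is_Dynkin C D.
Notation ee := (ee P).
Notation isZ i := (isZ C Om e x a i).
Notation Sp := (Sp hC hD hO P).
Notation SpP := (SpP hC hD hO P).
Notation nfd := (nfd x a).
Notation torf0 := (torf0 x a).
Notation has := (has e x a).
Notation sig := (sig hC hD hO P).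
Notation usig := (usig hC hD hO P).
Notation kil := (kil x a).
Notation edim := (edim e).
Notation refl := (refl_word C).
Notation Iw := (Iw e).
Notation prs := (prs e).
Notation al := (@al n).

Definition Fs (F0 : lmodType A -> Prop) (s : seq 'I_n) := foldr (fun i F => sig i F) F0 s.
(** Every letter reflects a class without the corresponding simple module, so each step can be
    undone by [usig]. The initial class is arbitrary, because the length bound is needed before the
    initial class is known to be zero. *)
Fixpoint legit (F0 : lmodType A -> Prop) (s : seq 'I_n) : Prop :=
 if s is i :: s' then legit F0 s' /\ ~ has i (Fs F0 s') else True.
Definition Z0 : lmodType A -> Prop := fun M => zero_mod M.

Lemma Fs_cat F0 s t : Fs F0 (s ++ t) = Fs (Fs F0 t) s. exact: foldr_cat. Qed.
Lemma legit_cat F0 s t : legit F0 (s ++ t) <-> legit F0 t /\ legit (Fs F0 t) s.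
elim: s => [|i s IHs] /=; first by split=> [|[]].
by rewrite IHs Fs_cat; split=> [[[]]|[? []]].
Qed.
Lemma Z0_torf : torf0 Z0.
split=> [M|M //|M N h hI N0 m|M N h N0 K0 m]; first exact: zero_nfd.
 by apply: hI; rewrite linear0; apply: N0.
have /kerSP/inclLP[u <-] : h m = 0 by apply: N0.
by rewrite (K0 u) linear0.
Qed.
Lemma Fs_torf F0 s : torf0 F0 -> torf0 (Fs F0 s).
by move=> t0; elim: s => //= i s IHs; apply: sig_torf. Qed.

(** Along the word the vector v stays proportional to a dimension vector. Dimensions reflect by the
    transpose of C; rescaling the entry at j by D j turns this into [simple_refl], because D C is
    symmetric. *)
Lemma root_chain F0 s N (v : 'cV[int]_n) c : torf0 F0 -> legit F0 s -> perp (Fs F0 s) N -> nfd N ->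
 (forall j, c%:Z * (edim N j)%:Z = (D j)%:Z * v j 0) -> nonneg (refl (rev s) *m v).
move=> t0; elim: s N v => [|i s IHs] N v /=.
 move=> _ _ _ dv j; rewrite /rev /= mul1mx. by have := dv j; have := D_gt0 hD j; nia.
move=> [ls nh] pN nN dv; rewrite rev_cons refl_rcons -mulmxA.
have [pS inS] := perp_Sp (Fs_torf s t0) nh nN pN.
have [gw [gv sQ]] := SpP i N; apply: IHs ls pS (Sp_nfd hC hO P sQ nN) _ => j.
rewrite sr_v !mxE eqxx andbT; have [->|ji] := eqVneq j i; last first.
 have [_ ->] := gw_dim P sQ ji nN.1; rewrite dv. by rewrite mulr0 subr0.
have [_ /(_ inS) dE] := Sp_dim hC hO P sQ nN.1.
have {}dE : (edim (Sp i N) i)%:Z = \sum_(j | j != i) (- C j i) * (edim N j)%:Z - (edim N i)%:Z.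
 apply/eqP; rewrite eq_sym subr_eq eq_sym -PoszD dE; apply/eqP. rewrite (big_morph Posz PoszD (erefl 0%:Z)); apply: eq_bigr => l li.
 by have [_ h _] := hC; rewrite PoszM abszE ler0_norm // h.
rewrite dE mulrBr mulr_sumr dv [in RHS](bigD1 i) //=; have [-> _ _] := hC.
have -> : \sum_(j | j != i) c%:Z * (- C j i * (edim N j)%:Z) = - ((D i)%:Z * \sum_(l | l != i) C i l * v l 0).
 rewrite mulr_sumr -sumrN; apply: eq_bigr => l li. have E := D_sym hD i l; transitivity (- C l i * (c%:Z * (edim N l)%:Z)); first by ring.
 rewrite dv; transitivity (- ((D l)%:Z * C l i) * v l 0); first by ring. by rewrite -E; ring.
by ring.
Qed.

Lemma root_nonneg F0 s i : torf0 F0 -> legit F0 s -> ~ has i (Fs F0 s) -> nonneg (refl (rev s) *m al i).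
move=> t0 ls nh; have [S [s0 [fS cS s00 sx dS]]] := simple_ex hD P i.
apply: (@root_chain F0 s S (al i) (D i)) => //.
- move=> M FM h m; have [//|hm] := pselect (h m = 0); case: nh; exists M, (h m); split=> //.
 + by rewrite -linearZ cS.
 + by rewrite -linearZ (sx m i).1 linear0. by move=> j l g; rewrite -linearZ (sx m j).2 linear0.
- by split=> //; apply: (nilp_conc hC hO P cS).
move=> j; rewrite dS alE; have [->//|_] := eqVneq j i.
by rewrite !mulr0.
Qed.

Lemma al_neq0 s i : ~ (nonneg (refl s *m al i) /\ nonpos (refl s *m al i)).
case=> h1 h2; have h0 : refl s *m al i = refl s *m 0.
 by rewrite mulmx0; apply/colP => j; rewrite [RHS]mxE; apply/eqP; rewrite eq_le h1 h2.
have := congr1 (fun v : 'cV_n => v i 0) (refl_inj hC h0); rewrite alE eqxx mxE.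
by [].
Qed.

(** The inversions of the word. *)
Fixpoint betas (s : seq 'I_n) : seq 'cV[int]_n :=
 if s is i :: s' then (refl (rev s') *m al i) :: betas s' else [::].
Lemma betasP s v : v \in betas s -> exists u j t, s = u ++ j :: t /\ v = refl (rev t) *m al j.
elim: s => //= i s IHs; rewrite inE => /orP[/eqP->|/IHs[u [j [t [-> ->]]]]].
 by exists [::], i, s.
by exists (i :: u), j, t.
Qed.
(** The inversions of a legitimate word are positive roots by [root_nonneg] and pairwise distinct,
    so their number is bounded by [root_bound]. *)
Lemma legit_bound : exists B : nat, forall F0 s, torf0 F0 -> legit F0 s -> (size s <= B)%N.
have [B BP] := root_bound hC hD hP; exists B => F0 s t0 ls.
have sb : size (betas s) = size s by elim: (s) => //= i t ->.
rewrite -sb; apply: BP.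
 elim: s ls {sb} => //= i s IHs [ls nh]; rewrite IHs // andbT. apply/negP => /betasP[u [j [t [sE]]]]; rewrite sE in ls nh *.
 (* If two inversions agree, the segment u between them sends al_i to -al_j, although u is a
    legitimate word starting from the class of j :: t and i is legitimate after it. *)
 rewrite rev_cat rev_cons refl_cat refl_rcons -!mulmxA => /(refl_inj hC) h. have {}h : refl (rev u) *m al i = - al j.
  by rewrite -(sr_sr hC j (refl (rev u) *m al i)) h (sr_al hC).
 have [/legit_cat[lt lu] hE] : legit F0 (u ++ j :: t) /\ Fs F0 (u ++ j :: t) = Fs (Fs F0 (j :: t)) u.
  by rewrite Fs_cat.
 rewrite hE in nh; have := root_nonneg (Fs_torf (j :: t) t0) lu nh j. by rewrite h mxE alE eqxx.
move=> v /betasP[u [j [t [sE ->]]]]; rewrite sE in ls; split; last by exists (rev t), j.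
by have /legit_cat[/= [lt nh] _] := ls; apply: root_nonneg lt nh.
Qed.

Lemma nilp_soc k M (m : M) : kil k m -> m <> 0 -> exists i (u : M), [/\ u <> 0, e i *: u = u,
 x i *: u = 0 & forall j l g, a j l g *: u = 0].
elim: k m => [m /= -> //|k IHk m /= [k1 k2] m0].
have [h|/existsNP[j xj]] := pselect (forall j, x j *: m = 0); last exact: IHk (k1 j) xj.
have [h2|/existsNP[j /existsNP[l /existsNP[g ag]]]] := pselect (forall j l g, a j l g *: m = 0); last first.
 exact: IHk (k2 j l g) ag.
have [i ei] : exists i, e i *: m <> 0.
 apply: contrapT => /forallNP he; apply: m0; rewrite -(sum_e P m) big1 // => l _. by apply: contrapT; apply: he.
exists i, (e i *: m); rewrite ee eqxx; split=> //.
 by rewrite scalerA (pr_xe P) h.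
move=> j l g; have [li|li] := eqVneq l i; first by rewrite -li scalerA (pr_ae P) h2.
by rewrite -(pr_ae P) -scalerA ee (negbTE li) scaler0.
Qed.

Lemma no_has F : torf0 F -> (forall i, ~ has i F) -> F = Z0.
move=> tF nF; apply/funext => M; apply/propext; split=> [FM m|]; last exact: (tf_zero tF).
apply: contrapT => m0; have [_ [k kk]] := tf_nfd tF FM.
have [i [u [u0 eu xu au]]] := nilp_soc (kk m) m0.
by apply: (nF i); exists M, u.
Qed.

Lemma sig_usig G i : torf0 G -> has i G -> G = sig i (usig i G).
by move=> tG hG; have [_ _ h] := usigP hC hD hO P tG hG; apply/funext => N; apply/propext. Qed.

(** While the class contains some simple module at i, it is [sig] of its [usig]. Each such step adds
    a letter to a legitimate word, so the bound on lengths forces an end at a class without simple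
    modules, which is zero. *)
Lemma torf_word G : torf0 G -> exists s, legit Z0 s /\ G = Fs Z0 s.
move=> tG; have [B BP] := legit_bound.
have step k : exists F0 s, [/\ torf0 F0, legit F0 s, G = Fs F0 s & size s = k \/ forall i, ~ has i F0].
 elim: k => [|k [F0 [s [t0 ls GE]]]]; first by exists G, [::]; split=> //; left.
 have [nh _|/existsNP[i /contrapT hi] [sk|/(_ i)//]] := pselect (forall i, ~ has i F0).
  by exists F0, s; split=> //; right.
 have [tU nU _] := usigP hC hD hO P t0 hi. exists (usig i F0), (rcons s i); rewrite -cats1 Fs_cat; split=> //; [|by rewrite /= -sig_usig|].
  by apply/legit_cat; rewrite /= -sig_usig.
 by left; rewrite size_cat addn1 sk.
have [F0 [s [t0 ls GE [sB|nh]]]] := step B.+1.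
 by have := BP _ _ t0 ls; rewrite sB ltnn.
by exists s; rewrite -(no_has t0 nh).
Qed.

Lemma Fs_killed s M : Fs Z0 s M -> killed (Iw s) M.
elim: s M => [M M0 b m _|i s IHs M [_ FM]]; first by rewrite [m]M0 scaler0.
by apply: (sig_killed (hC := hC) (hD := hD) (hO := hO) (P := P)); apply: IHs.
Qed.

Definition Dm : 'M[int]_n := diag_mx (\row_i (D i)%:Z).
(** The matrix identity is the link to W: the dimensions of the modules (A/I_w) e_l determine 1 -
    w. *)
Lemma Fs_prs s : legit Z0 s -> exists M : 'I_n -> lmodType A, [/\ forall l, Fs Z0 s (M l),
 forall l, exists u, @prs (Iw s) l (M l) u & (\matrix_(j, l) (edim (M l) j)%:Z) *m C = Dm *m (1%:M - refl s)].
elim: s => [_|i s IHs /= [ls nh]].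
 have Zz : zero_mod (quot_mod (lsubmod_of_ideal (unit_ideal A))).
  by move=> q; have [m <-] := projL_surj q; apply/projL0.
 exists (fun _ => quot_mod (lsubmod_of_ideal (unit_ideal A))); split=> // [l|].
  exists 0; split=> [|m|b]; first by rewrite scaler0.
   by exists 0; rewrite [m]Zz scaler0.
  by rewrite scaler0.
 rewrite subrr mulmx0; apply/matrixP => j l; rewrite mxE [RHS]mxE big1 // => k _. rewrite mxE (_ : edim _ _ = 0%N) ?mul0r //.
 have f0 := fd_eS e j (fin_dim0 Zz). by apply/(dim0P f0) => u; apply: (@inclL_inj _ _ (eS _ _ _)); rewrite linear0; apply: Zz.
have [M [FM /dchoice[u uP] dE]] := IHs ls; have tF := Fs_torf s Z0_torf.
have sM l := soc_free_torf P tF nh (FM l).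
have /dchoice[Z ZP] : forall l, exists Z : lmodType A, exists gw gv,
  @isZ i (M l) (if l == i then u l else 0) (if l == i then D i else 0%N) Z gw gv.
 by move=> l; apply: (Z_ex hC hD hO P); [by case: ifP | exact: (step_x P i l (u l))].
have FZ l : sig i (Fs Z0 s) (Z l).
 have [gw [gv sZ]] := ZP l; apply: (sig_Z hC hD hO P tF (FM l) (sM l) _ _ sZ).
  by case: (l =P i) => [<-|_]; rewrite ?scaler0 // (prs_e (uP l)).
 exact: (step_x P i l (u l)).
have kZ l : killed (Iw (i :: s)) (Z l) by exact: (@Fs_killed (i :: s) _ (FZ l)).
exists Z; split=> // [l|].
 by have [gw [gv sZ]] := ZP l; apply: (prs_step hC hD hO P (uP l) sZ (kZ l)).
pose X := \matrix_(j, l) (edim (M l) j)%:Z.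
(* [Z_dim] and [gw_dim] in matrix form: only row i changes, by reflection, and the free summand adds
   D i at the entry (i, i). *)
have -> : \matrix_(j, l) (edim (Z l) j)%:Z = X - delta_mx i i *m C^T *m X + (D i)%:Z *: delta_mx i i.
 apply/matrixP => j l; rewrite mxE; have [gw [gv sZ]] := ZP l; have fM := (tf_nfd tF (FM l)).1.
 rewrite -mulmxA !mxE (bigD1 i) //= big1 ?addr0 => [|k /negbTE ki]; last first.
  by rewrite mxE ki andbF mul0r.
 rewrite !mxE eqxx andbT; have [->|ji] := eqVneq j i; last first.
  have [_ ->] := gw_dim P sZ ji fM; rewrite mul0r subr0 andFb mulr0 addr0 //.
 have [_ /(_ (sM l)) dd] := Z_dim hC hO P sZ fM.
 have {}dd : (edim (Z l) i)%:Z = \sum_(j | j != i) (- C j i) * (edim (M l) j)%:Z + (if l == i then D i else 0%N)%:Z - (edim (M l) i)%:Z.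
  apply/eqP; rewrite eq_sym subr_eq eq_sym -PoszD dd PoszD; apply/eqP; congr (_ + _). rewrite (big_morph Posz PoszD (erefl 0%:Z)); apply: eq_bigr => k ki.
  by have [_ h _] := hC; rewrite PoszM abszE ler0_norm // h.
 rewrite dd mul1r [in RHS](bigD1 i) //= !mxE; have [-> _ _] := hC.
 have -> : \sum_(k | k != i) C^T i k * X k l = - \sum_(k | k != i) - C k i * (edim (M l) k)%:Z.
  by rewrite -sumrN; apply: eq_bigr => k _; rewrite !mxE mulNr opprK.
 by rewrite eq_sym; case: eqP => _ /=; ring.
have CD : C^T *m Dm = Dm *m C.
 by apply/matrixP => j l; rewrite mul_mx_diag mul_diag_mx !mxE mulrC (D_sym hD j l).
have ED : (D i)%:Z *: delta_mx i i = delta_mx i i *m Dm :> 'M_n.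
 by apply/matrixP => j l; rewrite mul_mx_diag !mxE; case: eqP => _; case: eqP => [->|_]; rewrite /= ?mul1r ?mulr1 ?mul0r ?mulr0.
have DE : delta_mx i i *m Dm = Dm *m delta_mx i i :> 'M_n.
 apply/matrixP => j l; rewrite mul_mx_diag mul_diag_mx !mxE. by case: eqP => [->|_]; case: eqP => [->|_]; rewrite /= ?mul1r ?mulr1 ?mul0r ?mulr0.
rewrite mulmxDl mulmxBl -(mulmxA _ X) dE ED -!(mulmxA (delta_mx i i)) (mulmxA C^T) CD.
rewrite (mulmxA (delta_mx i i)) (mulmxA (delta_mx i i) Dm) DE /= /simple_refl.
rewrite -!mulmxA -!mulmxBr -mulmxDr; congr (_ *m _).
rewrite mulmxBl mul1mx !mulmxBr !mulmx1 -!mulmxA opprB addrA addrAC.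
by rewrite addrAC subrK opprB -addrA [- refl s + _]addrC.
Qed.

(** Equal ideals give isomorphic presented modules, hence equal dimension matrices X; as X C = D (1
    - w) and D has nonzero diagonal entries, w is recovered. *)
Lemma Iw_refl s t : legit Z0 s -> legit Z0 t -> Iw s =i Iw t -> refl s = refl t.
move=> ls lt EI; have [M [FM /dchoice[u uP] dM]] := Fs_prs ls; have [N [FN /dchoice[v vP] dN]] := Fs_prs lt.
have dd l j : edim (M l) j = edim (N l) j.
 have L (V : lmodType A) (w : V) : linear (fun b : A^o => (b : A) *: w).
  by move=> k p q; rewrite scalerDl -scalerA.
 have [||h hE] := @fact_surj _ _ _ _ (mkL (L _ (u l))) (mkL (L _ (v l))).
 - by move=> m; have [b ->] := prs_gen (uP l) m; exists b.
 - by move=> b /(prs_ann (uP l)); rewrite EI => /(prs_ann (vP l)). apply: (@edim_iso _ _ _ _ _ _ _ h); last exact: (tf_nfd (Fs_torf s Z0_torf) (FM l)).1.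
 apply: bijP.
  apply/inj_ker => m; have [b ->] := prs_gen (uP l) m; rewrite -[b *: u l]/(mkL (L _ (u l)) b) hE.
  by move=> /(prs_ann (vP l)); rewrite -EI => /(prs_ann (uP l)).
 move=> m; have [b ->] := prs_gen (vP l) m; exists (b *: u l). by rewrite -[b *: u l]/(mkL (L _ (u l)) b) hE.
have : Dm *m (1%:M - refl s) = Dm *m (1%:M - refl t).
 by rewrite -dM -dN; congr (_ *m _); apply/matrixP => j l; rewrite !mxE dd.
move=> h; apply/matrixP => j l; have := congr1 (fun B : 'M_n => B j l) h.
rewrite !mul_diag_mx !mxE => /mulfI h1; apply: oppr_inj; apply: (addrI (j == l)%:R).
by apply: h1; have := D_gt0 hD j; lia.
Qed.

(** I_w is the annihilator of its class: it kills the class by [Fs_killed], and the class contains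
    modules presenting (A/I_w) e_l for every l. *)
Lemma legit_Iw_refl s t : legit Z0 s -> legit Z0 t -> Fs Z0 s = Fs Z0 t ->
 Iw s =i Iw t /\ refl s = refl t.
move=> ls lt E; have [M [FM /dchoice[u uP] _]] := Fs_prs ls; have [N [FN /dchoice[v vP] _]] := Fs_prs lt.
have sub s1 s2 (M1 : 'I_n -> lmodType A) (u1 : forall l, M1 l) : (forall l, prs (Iw s2) l (u1 l)) ->
  (forall l, Fs Z0 s2 (M1 l)) -> Fs Z0 s1 = Fs Z0 s2 -> forall b, b \in Iw s1 -> b \in Iw s2.
 move=> uP1 FM1 E1 b bs; rewrite -[b]mulr1 -(pr_e1 P) mulr_sumr; apply: rpred_sum => l _. apply/(prs_ann (uP1 l)); have F1 : Fs Z0 s1 (M1 l) by rewrite E1.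
 exact: (Fs_killed F1 _ bs).
have EI : Iw s =i Iw t.
 by move=> b; apply/idP/idP; [apply: (sub s t N v) | apply: (sub t s M u)].
by split=> //; apply: Iw_refl.
Qed.

(** The exchange property on the side of modules: the class is [sig] at i of a smaller class, and
    that class has a word of its own. *)
Lemma has_step s i : legit Z0 s -> has i (Fs Z0 s) -> exists t, [/\ legit Z0 (i :: t),
 Fs Z0 s = Fs Z0 (i :: t) & refl s = refl (i :: t)].
move=> ls hi; have tF := Fs_torf s Z0_torf; have [tU nU _] := usigP hC hD hO P tF hi.
have [t [lt UE]] := torf_word tU; exists t.
have lit : legit Z0 (i :: t) by rewrite /= -UE.
have FE : Fs Z0 s = Fs Z0 (i :: t) by rewrite /= -UE -sig_usig.
by split=> //; have [] := legit_Iw_refl ls lit FE.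
Qed.

Lemma has_nonpos s i : legit Z0 s -> has i (Fs Z0 s) -> nonpos (refl (rev s) *m al i).
move=> ls hi; have [t [lit FE rE]] := has_step ls hi => j; have [lt nt] := lit.
rewrite (refl_eq_rev hC rE) rev_cons refl_rcons -mulmxA (sr_al hC) mulmxN mxE oppr_le0.
exact: root_nonneg Z0_torf lt nt j.
Qed.

(** Which simple modules lie in the class is read off from the signs of roots, hence from w. So a
    first letter of one word can be split off from the other, and induction applies. *)
Lemma refl_Fs s t : legit Z0 s -> legit Z0 t -> refl s = refl t -> Fs Z0 s = Fs Z0 t.
have hsame u v : legit Z0 u -> legit Z0 v -> refl u = refl v -> forall i, has i (Fs Z0 u) -> has i (Fs Z0 v).
 move=> lu lv uv i hi; apply: contrapT => nv; apply: (@al_neq0 (rev u) i); split; last exact: has_nonpos.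
 by rewrite (refl_eq_rev hC uv); apply: root_nonneg Z0_torf lv nv.
elim: s t => [|i s IHs] t ls lt st.
 case: t lt st => // i t lt st; case: (@al_neq0 [::] i); split=> j; first by rewrite mul1mx alE; case: eqP.
 have h1 : has i (Fs Z0 (i :: t)) by apply/sig_has/Fs_torf/Z0_torf. by have := has_nonpos lt h1; rewrite -(refl_eq_rev hC (s := [::]) st); apply.
have h1 : has i (Fs Z0 (i :: s)) by apply/sig_has/Fs_torf/Z0_torf.
have [t' [lt' FE rE]] := has_step lt (hsame _ _ ls lt st i h1).
rewrite FE /= (IHs t'); [by []|by have [] := ls|by have [] := lt'|].
have := st; rewrite rE /= => h; rewrite -[LHS]mul1mx -[RHS]mul1mx -(sr_sq hC i) -!mulmxA.
by rewrite h.
Qed.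

Lemma word_legit s : exists2 t, legit Z0 t & refl t = refl s.
elim: s => [|i s [t lt ts]]; first by exists [::].
have [hi|nh] := pselect (has i (Fs Z0 t)); last by exists (i :: t); rewrite //= ts.
have [t' [lt' _ rE]] := has_step lt hi; exists t'; first by have [] := lt'.
by rewrite /= -ts rE /= mulmxA (sr_sq hC) mul1mx.
Qed.

(** Sign coherence of roots: u al_j is negative or positive according to whether the class of a
    legitimate word for the inverse of u contains the simple module at j. *)
Lemma root_sign u j : nonneg (refl u *m al j) \/ nonpos (refl u *m al j).
have [t lt tu] := word_legit (rev u); have := refl_eq_rev hC tu; rewrite revK => <-.
have [hi|nh] := pselect (has j (Fs Z0 t)); first by right; apply: has_nonpos.
by left; apply: root_nonneg Z0_torf lt nh.
Qed.

(** A letter whose simple module already lies in the class gives a negative root, and [deletion]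
    would then shorten the word. *)
Lemma reduced_legit s : reduced C s -> legit Z0 s.
elim: s => // i s IHs rs; have rs' : reduced C s.
 move=> t ts; have := rs (i :: t); rewrite /= ltnS; apply. by rewrite ts.
split; first exact: IHs.
move=> hi; have [t st rt] := deletion hC hD root_sign (has_nonpos (IHs rs') hi).
by have := rs t (esym rt); rewrite /= -st ltnNge leqnSn.
Qed.

(** Induction on the nilpotency degree: N is an extension of N/S by S, where S consists of the
    elements killed by all loops and arrows, and S is split off vertex by vertex. *)
Lemma has_all G : torf0 G -> (forall i, has i G) -> forall N, nfd N -> G N.
move=> tG hG; have flat (s : seq 'I_n) (T : lmodType A) : fin_dim T -> (forall m : T, kil 1 m) ->
  (forall j, j \notin s -> forall m : T, e j *: m = 0) -> G T.
 elim: s T => [|i s IHs] T fT kT eT.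
  by apply: (tf_zero tG) => m; rewrite -(sum_e P m) big1 // => j _; apply: eT.
 have xT (m : T) j : x j *: m = 0 by have [h _] := kT m; apply: h. have aT (m : T) j l g : a j l g *: m = 0 by have [_ h] := kT m; apply: h.
 have [|||h hE] := gen_linear P (h := opL T (e i)).
 - by move=> j m /=; rewrite !ee eq_sym; case: eqP => [->|].
 - by move=> j m /=; rewrite !xT scaler0.
 - by move=> j l g m v /=; rewrite !aT scaler0. have {}hE m : h m = e i *: m by rewrite hE.
 have [g gE] := corestr (f := h) (fun m => introT (imSP h _) (ex_intro _ m erefl)). apply: (tf_ker tG (h := g)).
  apply: (conc_has hC hO P tG (hG i)); first exact: fin_dim_sub.
  move=> q; apply: (@inclL_inj _ _ (imS h)); rewrite linearZ_LR; have /imSP[m <-] := inclL_in q. by rewrite hE ee eqxx.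
 apply: IHs; first exact: fin_dim_sub.
  by move=> m; split=> [j|j l g']; apply: (@inclL_inj _ _ (kerS g)); rewrite linearZ_LR ?xT ?aT linear0.
 move=> j js m; apply: (@inclL_inj _ _ (kerS g)); rewrite linearZ linear0. have [->|ji] := eqVneq j i; last by apply: eT; rewrite inE (negbTE ji).
 by have /kerSP := inclL_in m; move=> /(congr1 (inclL (imS h))); rewrite gE hE linear0.
move=> N [fN [k kk]]; elim: k N fN kk => [|k IHk] N fN kk.
 by apply: (tf_zero tG) => m; apply: kk.
have SS : submod_closed (fun m : N => `[< kil 1 m >]).
 split=> [|b u v /asboolP uS /asboolP[v1 v2]]; first by apply/asboolP; apply: kil0. apply/asboolP; suff [u1 u2] : kil 1 (b *: u).
  by split=> *; rewrite scalerDr ?u1 ?u2 ?v1 ?v2 addr0.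
 elim/(pr_ind P): b => [|b c [b1 b2] [c1 c2]|q b [b1 b2]|j|j b [b1 b2]|j l g b [b1 b2]].
 - by rewrite scale0r; apply: kil0.
 - by split=> *; rewrite scalerDl scalerDr ?b1 ?b2 ?c1 ?c2 addr0.
 - by split=> *; rewrite -scalerA -pzscale_comm ?b1 ?b2 /= scaler0.
 - have [u1 u2] := uS; split=> [l|l q g].
   have [->|lj] := eqVneq l j; first by rewrite scalerA (pr_xe P); apply: u1. by rewrite -(pr_xe P) -scalerA ee (negbTE lj) scaler0.
  have [->|lj] := eqVneq q j; first by rewrite scalerA (pr_ae P); apply: u2. by rewrite -(pr_ae P) -scalerA ee (negbTE lj) scaler0.
 - by split=> *; rewrite -scalerA b1 scaler0. by split=> *; rewrite -scalerA b2 scaler0.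
pose S := Submodule SS.
apply: (tf_ker tG (h := projL S)).
 apply: IHk; first exact: fin_dim_quot. move=> q; have [m <-] := projL_surj q; move: (kk m). elim: (k) (m) => [|k' IHk'] u ku; first by apply/projL0/asboolP.
 by have [k1 k2] := ku; split=> *; rewrite -linearZ; apply: IHk'; [apply: k1 | apply: k2].
apply: (flat (enum 'I_n)); [exact: fin_dim_sub | | by move=> j; rewrite mem_enum].
move=> m; have /kerSP/projL0/asboolP[k1 k2] := inclL_in m.
by split=> [j|j l g]; apply: (@inclL_inj _ _ (kerS (projL S))); rewrite linearZ_LR linear0; [apply: k1 | apply: k2].
Qed.

(** Letters are added as long as some simple module is missing; the length bound stops this at a
    class containing all simple modules. *)
Lemma max_word : exists2 s, legit Z0 s & forall N, nfd N -> Fs Z0 s N.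
have [B BP] := legit_bound.
have step k : exists2 s, legit Z0 s & size s = k \/ forall i, has i (Fs Z0 s).
 elim: k => [|k [s ls [sk|hs]]]; [by exists [::] => //; left| |by exists s => //; right].
 have [hs|/existsNP[i nh]] := pselect (forall i, has i (Fs Z0 s)); first by exists s => //; right. by exists (i :: s) => //; left; rewrite /= sk.
have [s ls [sB|hs]] := step B.+1; first by have := BP _ _ Z0_torf ls; rewrite sB ltnn.
by exists s => // N; apply: has_all hs N; apply: Fs_torf Z0_torf.
Qed.
End Legit.

(** * Grading, and finite dimensionality of Pi *)

Section Residual.
Variables (K : fieldType) (n : nat) (C : 'M[int]_n) (D : 'I_n -> nat).
Variable Om : {set 'I_n * 'I_n}.
Hypotheses (hC : is_GCM C) (hD : is_symmetrizer C D) (hO : is_orientation C Om).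
Notation f := (Cartan_f C).
Notation G := (Cartan_g C).
Notation valid := (valid_arrow C Om).
Variables (A : pzAlgType K) (e x : 'I_n -> A) (a : 'I_n -> 'I_n -> nat -> A).
Hypothesis P : presentation C D Om e x a.
Implicit Types M N : lmodType A.
Hypothesis hP : is_Dynkin C D.
Notation nfd := (nfd x a).
Notation torf0 := (torf0 x a).
Notation kil := (kil x a).
Notation nilp := (nilp x a).
Notation Iw := (Iw e).
Notation legit := (legit hC hD hO P).
Notation Fs := (Fs hC hD hO P).
Notation Z0 := (@Z0 K A).

Section Span.
Variable M : lmodType A.
Definition spn (r : seq M) (m : M) := exists c : nat -> K, m = \sum_(k < size r) (pzscal (c k) : A) *: r`_k.
Lemma spn0 r : spn r 0.
by exists (fun=> 0); rewrite big1 // => k _; rewrite rmorph0 scale0r. Qed.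
Lemma spnD r u v : spn r u -> spn r v -> spn r (u + v).
move=> [c ->] [d ->]; exists (fun k => c k + d k); rewrite -big_split; apply: eq_bigr => k _ /=.
by rewrite rmorphD scalerDl.
Qed.
Lemma spnZ r k u : spn r u -> spn r ((pzscal k : A) *: u).
move=> [c ->]; exists (fun j => k * c j); rewrite scaler_sumr; apply: eq_bigr => j _.
by rewrite rmorphM scalerA.
Qed.
Lemma spn_mem r m : m \in r -> spn r m.
move=> /(nthP 0)[k kr <-]; exists (fun j => (j == k)%:R).
rewrite (bigD1 (Ordinal kr)) //= big1 ?addr0 => [|j jk]; first by rewrite eqxx rmorph1 scale1r.
by case: eqP => [h|_]; [case/eqP: jk; apply: val_inj | rewrite rmorph0 scale0r].
Qed.
Lemma spn_op r (b : A) m : (forall v, v \in r -> spn r (b *: v)) -> spn r m -> spn r (b *: m).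
move=> h [c ->]; rewrite scaler_sumr; elim/big_ind: _ => [|u v|k _]; [exact: spn0 | exact: spnD |].
by rewrite -pzscale_comm; apply/spnZ/h/mem_nth.
Qed.

Definition gens (v : M) : seq M := [seq x j *: v | j <- enum 'I_n] ++
 [seq a p.1 p.2.1 p.2.2 *: v | p <- [seq (j, q) | j <- enum 'I_n, q <- [seq (l, g) | l <- enum 'I_n, g <- iota 0 (G j l)]]].
Fixpoint words (u : M) k : seq M := if k is k'.+1 then flatten [seq gens v | v <- words u k'] else [seq e j *: u | j <- enum 'I_n].
Lemma gens_x v j : x j *: v \in gens v.
by rewrite /gens mem_cat; apply/orP; left; apply/mapP; exists j; rewrite ?mem_enum. Qed.
Lemma gens_a v j l g : valid j l g -> a j l g *: v \in gens v.
move=> /andP[_ gG]; rewrite /gens mem_cat; apply/orP; right; apply/mapP; exists (j, (l, g)) => //.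
apply/allpairsPdep; exists j, (l, g); rewrite mem_enum; split=> //.
by apply/allpairsPdep; exists l, g; rewrite mem_enum mem_iota.
Qed.
Lemma kil_gens k v w : kil k.+1 v -> w \in gens v -> kil k w.
by move=> [k1 k2]; rewrite /gens mem_cat => /orP[/mapP[j _ ->]|/mapP[p _ ->]]; [apply: k1 | apply: k2].
Qed.

(** The finitely many words of length below the nilpotency degree, applied to u, span M. *)
Lemma cyclic_fd (u : M) : (forall m, exists b : A, m = b *: u) -> nilp M -> fin_dim M.
move=> gu [d kd]; pose r := flatten [seq words u k | k <- iota 0 d].
have wr k v : v \in words u k -> (k < d)%N -> v \in r.
 by move=> vk kd'; apply/flatten_mapP; exists k; rewrite ?mem_iota.
have wk k v : (k <= d)%N -> v \in words u k -> kil (d - k) v.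
 elim: k v => [|k IHk] v kd' /=; first by move=> _; rewrite subn0. move=> /flatten_mapP[w wk' vw]; apply: kil_gens vw; rewrite -subSn // subSS.
 by apply: IHk => //; apply: ltnW.
have step (b : A) : (forall v, b *: v \in gens v) -> forall v, v \in r -> spn r (b *: v).
 move=> hb v /flatten_mapP[k]; rewrite mem_iota /= add0n => kd' vk. have bk : b *: v \in words u k.+1 by apply/flatten_mapP; exists v.
 have [ld|] := ltnP k.+1 d; first exact/spn_mem/wr/ld. move=> dk; have E : k.+1 = d by apply/eqP; rewrite eqn_leq dk kd'.
 by have := wk k.+1 _ kd' bk; rewrite E subnn /= => ->; apply: spn0.
exists r => m; have [b ->] := gu m; elim/(pr_ind P): b => [|b c IHb IHc|k b IHb|j|j b IHb|j l g b IHb].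
- by rewrite scale0r; apply: spn0.
- by rewrite scalerDl; apply: spnD.
- by rewrite -scalerA; apply: spnZ.
- have [d0|d0] := posnP d; last first.
  by apply: spn_mem; apply: (wr 0%N) => //=; apply/mapP; exists j; rewrite ?mem_enum.
 by have := kd (e j *: u); rewrite d0 /= => ->; apply: spn0.
- by rewrite -scalerA; apply: spn_op IHb; apply: step => v; apply: gens_x.
rewrite -scalerA; have [v|v] := boolP (valid j l g); last by rewrite (pr_a0 P) // scale0r; apply: spn0.
by apply: spn_op IHb; apply: step => w; apply: gens_a.
Qed.
End Span.

(* The algebra is graded by 2L/c_i on the loops and 2L - L/k_ij on the arrows, where k_ij = c_i/f_ji *)
Let L : nat := (\prod_j D j)%N.
Definition wx i : nat := (2 * (L %/ D i))%N.
Definition wa i j : nat := (2 * L - L %/ Ck C D i j)%N.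
Lemma DL i : (D i %| L)%N. by rewrite /L (bigD1 i) //= dvdn_mulr. Qed.
Lemma L_gt0 : (0 < L)%N. by apply: prodn_gt0 => i; apply: (D_gt0 hD). Qed.
Lemma w_f i j : Om_bar Om i j -> (f j i * wx i = 2 * (L %/ Ck C D i j))%N.
move=> ij; rewrite /wx mulnCA; congr (_ * _)%N; have E := CkE hD hO ij.
have /dvdnP[q qE] := DL i; rewrite qE mulnK ?(D_gt0 hD) // -E mulnA mulnK ?(Ck_gt0 hD hO ij) //.
by rewrite mulnC.
Qed.
Lemma w_q i j : Om_bar Om i j -> (L %/ Ck C D i j <= L)%N. by rewrite leq_div. Qed.
(** The total degree does not depend on j or k, so the mesh relation at i is homogeneous. *)
Lemma w_mesh i j k : Om_bar Om j i -> (k < f j i)%N ->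
 (k * wx i + (wa i j + (wa j i + (f j i - 1 - k) * wx i)) = 4 * L - wx i)%N.
move=> ji kf; have ij : Om_bar Om i j by rewrite Om_barC.
have := w_f ij; have := w_q ij; rewrite /wa -(CkC hD hO ij); set q := (L %/ _)%N => qL fE.
have fk : (f j i * wx i = (k + (f j i - 1 - k)).+1 * wx i)%N.
 by congr (_ * _)%N; rewrite subnKC ?subn1 ?prednK //; case: (f j i) kf.
by move: fE; rewrite fk; move: (f j i - 1 - k)%N (wx i) => p w; nia.
Qed.
Lemma w_com i j : Om_bar Om i j -> (f j i * wx i + wa i j = wa i j + f i j * wx j)%N.
move=> ij; have ji : Om_bar Om j i by rewrite Om_barC.
by rewrite w_f // w_f // -(CkC hD hO ij) addnC.
Qed.
Lemma wx_gt0 i : (0 < wx i)%N.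
by rewrite muln_gt0 /= divn_gt0 ?(D_gt0 hD) // dvdn_leq ?L_gt0 ?DL. Qed.
Lemma wa_gt0 i j : Om_bar Om i j -> (0 < wa i j)%N.
by move=> ij; have := w_q ij; have := L_gt0; rewrite /wa; move: (L %/ _)%N => q; lia. Qed.

Let V : lmodType K := (nat -> kmod (A^o)%type)%type.
(** A-valued sequences play the role of power series over A in a central variable t; [gop b w] is
    multiplication by b t^w. *)
Fact gop_linear (b : A) (w : nat) :
 linear ((fun y m => if (w <= m)%N then b * (y (m - w)%N : A) else 0) : V -> V).
move=> k u v; apply/funext => m; rewrite -[RHS]/((pzscal k : A) * _ + _) /=; case: ifP => _; last by rewrite mulr0 addr0.
by rewrite -[(k *: u + v) _]/((pzscal k : A) * u _ + v _) mulrDr !mulrA pzscal_central.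
Qed.
Definition gop b w : {linear V -> V} := locked (mkL (gop_linear b w)).
Lemma gopE b w y m : gop b w y m = if (w <= m)%N then b * (y (m - w)%N : A) else 0.
by rewrite /gop -lock. Qed.
Lemma gop_comp b w c v y : gop b w (gop c v y) = gop (b * c) (w + v) y.
apply/funext => m; rewrite !gopE; have [wm|mw] := leqP w m; last first.
 by rewrite leqNgt (leq_trans mw) ?leq_addr.
by rewrite -leq_subRL // subnDA; case: ifP => _; rewrite ?mulrA ?mulr0.
Qed.
Lemma gop1 y : gop 1 0 y = y. by apply/funext => m; rewrite gopE mul1r subn0. Qed.
Lemma gop_iter k b w y : iter k (gop b w) y = gop (b ^+ k) (k * w) y.
elim: k => [|k IHk]; first by rewrite expr0 gop1.
by rewrite iterS IHk gop_comp exprS mulSn.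
Qed.
Lemma gop0 w y : gop 0 w y = 0.
by apply/funext => m; rewrite gopE mul0r; case: ifP. Qed.
Lemma gop_sum (T : Type) (r : seq T) (Q : pred T) (F : T -> A) w y :
 \sum_(t <- r | Q t) gop (F t) w y = gop (\sum_(t <- r | Q t) F t) w y.
elim: r => [|t r IHr]; first by rewrite !big_nil gop0.
rewrite !big_cons; case: ifP => // _; rewrite IHr; apply/funext => m.
by rewrite -[LHS]/(gop _ _ _ m + gop _ _ _ m : A) !gopE; case: ifP => _; rewrite ?addr0 ?mulrDl.
Qed.
Lemma gopZ k b w y : k *: gop b w y = gop (pzscal k * b) w y.
apply/funext => m; rewrite -[LHS]/((pzscal k : A) * gop _ _ _ m) !gopE; case: ifP => _; rewrite ?mulr0 //.
by rewrite mulrA.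
Qed.

Lemma graded_ex : exists (M : lmodType A) (h : V -> M), [/\ bijective h,
 forall k u v, h (k *: u + v) = (pzscal k : A) *: h u + h v, forall i v, h (gop (e i) 0 v) = e i *: h v, forall i v, h (gop (x i) (wx i) v) = x i *: h v
 & forall i j g v, valid i j g -> h (gop (a i j g) (wa i j) v) = a i j g *: h v].
apply: (pr_univ P (E := fun i => gop (e i) 0) (X := fun i => gop (x i) (wx i)) (L := fun i j g => gop (a i j g) (wa i j))).
- by move=> i j v; rewrite gop_comp (pr_ee P); case: eqP => _; rewrite ?gop0.
- by move=> v; rewrite gop_sum (pr_e1 P) gop1.
- by move=> i v; rewrite gop_comp (pr_ex P).
- by move=> i v; rewrite gop_comp (pr_xe P) addn0.
- by move=> i j g v _; rewrite gop_comp (pr_ea P).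
- by move=> i j g v _; rewrite gop_comp (pr_ae P) addn0.
- by move=> i v; rewrite gop_iter (pr_nil P) gop0.
- move=> i j g v vl; rewrite !gop_iter !gop_comp (pr_com P vl) w_com //.
 by have /andP[] := vl.
move=> i v; rewrite -[RHS](gop0 (4 * L - wx i) v) -(pr_mesh P i) -gop_sum; apply: eq_bigr => j ji.
rewrite -gop_sum; apply: eq_bigr => g _; rewrite -gop_sum; apply: eq_bigr => k _.
rewrite !gop_iter !gop_comp gopZ -!addnA w_mesh // /mesh_term !mulrA.
Qed.

(** In the graded module the constant series 1 generates, modulo t^d, a cyclic nilpotent and hence
    finite dimensional module. If b acts by zero on all of these, the series b 1 has no coefficients
    at all, and b is recovered by setting t = 1. *)
Lemma nfd_separate b : (forall M, nfd M -> forall m : M, b *: m = 0) -> b = 0.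
move=> kb; have [M [h [hB hL he hx ha]]] := graded_ex.
have hD0 u v : h (u + v) = h u + h v by rewrite -[u]scale1r hL rmorph1 !scale1r.
have h0 : h 0 = 0 by have := hD0 0 0; rewrite addr0 => /eqP; rewrite -subr_eq0 opprD addNKr oppr_eq0 => /eqP.
have hZ k u : h (k *: u) = (pzscal k : A) *: h u by rewrite -[k *: u]addr0 hL h0 addr0.
have hI := bij_inj hB; have hs m : exists y, h y = m by have [g _ gK] := hB; exists (g m).
pose one : V := fun m => if m == 0%N then (1 : A) else 0.
(* The series b 1 has finite support and its coefficients sum to b: this is the specialization t =
   1. *)
have [y [N [hy yN yb]]] : exists (y : V) (N : nat), [/\ h y = b *: h one, forall m, (N <= m)%N -> y m = 0 &
  \sum_(m < N) (y m : A) = b].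
 have st c w b' (y : V) (N : nat) : [/\ h y = b' *: h one, forall m, (N <= m)%N -> y m = 0 & \sum_(m < N) (y m : A) = b'] ->
   [/\ h (gop c w y) = h (gop c w y), forall m, (w + N <= m)%N -> gop c w y m = 0 & \sum_(m < w + N) (gop c w y m : A) = c * b'].
  move=> [_ yN yb]; split=> // [m wm|].
   by rewrite gopE; case: ifP => // _; rewrite yN ?mulr0 // leq_subRL // (leq_trans _ wm) ?leq_addr.
  rewrite big_split_ord /= big1 ?add0r => [|m _]; last by rewrite gopE leqNgt ltn_ord.
  rewrite -yb mulr_sumr; apply: eq_bigr => m _; rewrite gopE leq_addr addKn //.
 elim/(pr_ind P): b {kb} => [|b c [y [N [y1 y2 y3]]] [z [Q [z1 z2 z3]]]|k b [y [N [y1 y2 y3]]]|i|i b [y [N [y1 y2 y3]]]|i j g b [y [N [y1 y2 y3]]]].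
 - by exists 0, 0%N; rewrite h0 scale0r big_ord0.
 - exists (y + z), (maxn N Q); split; first by rewrite hD0 y1 z1 scalerDl.
   by move=> m; rewrite geq_max => /andP[Nm Qm]; by rewrite -[LHS]/(y m + z m) y2 // z2 // addr0.
  have ext (s : V) S T : (S <= T)%N -> (forall m, (S <= m)%N -> s m = 0) -> \sum_(m < T) (s m : A) = \sum_(m < S) (s m : A).
   move=> ST s0; rewrite -(big_mkord xpredT (s : nat -> A)) (big_cat_nat (leq0n S)) //= big_mkord.
   by rewrite [X in _ + X]big_nat_cond [X in _ + X]big1 ?addr0 // => m /andP[/andP[Sm _] _]; apply: s0.
  rewrite (eq_bigr (fun m : 'I__ => (y m : A) + z m)) // big_split /=. by rewrite (ext y N) ?leq_maxl // (ext z Q) ?leq_maxr // y3 z3.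
 - exists (k *: y), N; split; first by rewrite hZ y1 scalerA.
   by move=> m Nm; rewrite -[LHS]/((pzscal k : A) * y m) y2 // mulr0.
  by rewrite -y3 mulr_sumr.
 - exists (gop (e i) 0 one), 1%N; split; first by rewrite he.
   by case=> // m _; rewrite gopE subn0 mulr0.
  by rewrite big_ord1 gopE mulr1.
 - exists (gop (x i) (wx i) y), (wx i + N)%N; have [_ s2 s3] := st (x i) (wx i) _ _ _ (And3 y1 y2 y3).
  by rewrite hx y1 scalerA.
 have [v|v] := boolP (valid i j g); last first.
  by rewrite (pr_a0 P) // mul0r; exists 0, 0%N; rewrite h0 scale0r big_ord0.
 exists (gop (a i j g) (wa i j) y), (wa i j + N)%N; have [_ s2 s3] := st (a i j g) (wa i j) _ _ _ (And3 y1 y2 y3). by rewrite ha // y1 scalerA.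
suff y0 m : y m = 0 by rewrite -yb big1.
(* Series of order at least d form a submodule; killing its quotient shows that the coefficient of
   index m = d - 1 vanishes. *)
pose d := m.+1; pose T : pred M := fun q => `[< exists y : V, h y = q /\ forall p, (p < d)%N -> y p = 0 >].
have TS : submod_closed T.
 split=> [|c q r /asboolP qT /asboolP[z [zE z0]]]; apply/asboolP; first by exists 0.
 suff [u [uE u0]] : exists u : V, h u = c *: q /\ forall p, (p < d)%N -> u p = 0.
  exists (u + z); rewrite hD0 uE zE; split=> // p pd; by rewrite -[LHS]/(u p + z p) u0 // z0 // addr0.
 have st b' w (u : V) : (forall p, (p < d)%N -> u p = 0) -> forall p, (p < d)%N -> gop b' w u p = 0.
  by move=> u0 p pd; rewrite gopE; case: ifP => // _; rewrite u0 ?mulr0 // (leq_ltn_trans (leq_subr _ _)).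
 elim/(pr_ind P): c => [|b1 b2 [u [uE u0]] [v [vE v0]]|k b1 [u [uE u0]]|i|i b1 [u [uE u0]]|i j g b1 [u [uE u0]]].
 - by exists 0; rewrite scale0r.
 - exists (u + v); rewrite hD0 uE vE scalerDl; split=> // p pd; by rewrite -[LHS]/(u p + v p) u0 // v0 // addr0.
 - exists (k *: u); rewrite hZ uE scalerA; split=> // p pd.
  by rewrite -[LHS]/((pzscal k : A) * u p) u0 // mulr0.
 - by have [u [uE u0]] := qT; exists (gop (e i) 0 u); rewrite he uE; split=> //; apply: st.
 - by exists (gop (x i) (wx i) u); rewrite hx uE scalerA; split=> //; apply: st.
 have [v|v] := boolP (valid i j g); last by rewrite (pr_a0 P) // mul0r scale0r; exists 0.
 by exists (gop (a i j g) (wa i j) u); rewrite ha // uE scalerA; split=> //; apply: st.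
pose S := Submodule TS; pose q0 := projL S (h one).
have cL : linear (fun b : A^o => (b : A) *: q0) by move=> k p q; rewrite scalerDl -scalerA.
pose c := mkL cL; pose Cd := sub_mod (imS c).
(* All loops and arrows have positive weight, so each raises the order by at least one. *)
have kd k (z : V) : (forall p, (p < d - k)%N -> z p = 0) -> kil k (projL S (h z)).
 elim: k z => [|k IHk] z z0; first by apply/projL0/asboolP; exists z; rewrite subn0 in z0.
 have st b' w : (0 < w)%N -> forall p, (p < d - k)%N -> gop b' w z p = 0.
  move=> w0 p pd; rewrite gopE; case: ifP => // wp; rewrite z0 ?mulr0 //. by rewrite ltn_subLR // (leq_trans pd) // subnS; move: w0 pd; lia.
 split=> [j|i j g]; rewrite -linearZ; first by rewrite -hx; apply/IHk/st/wx_gt0.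
 have [v|v] := boolP (valid i j g); last by rewrite (pr_a0 P) // scale0r linear0; apply: kil0. by rewrite -ha //; apply/IHk/st/wa_gt0; have /andP[] := v.
have nC : nilp Cd.
 apply: (nilp_inj (@inclL_inj _ _ (imS c))); exists d => q; have [r <-] := projL_surj q. by have [z <-] := hs r; apply: kd => p; rewrite subnn.
have fC : fin_dim Cd.
 have q0C : q0 \in imS c by apply/imSP; exists 1; rewrite /= scale1r. have [u uE] := inclLP q0C; apply: (cyclic_fd (u := u)) nC => r.
 have /imSP[b' bE] := inclL_in r; exists b'; apply: (@inclL_inj _ _ (imS c)). by rewrite linearZ_LR uE -bE.
have q0C : q0 \in imS c by apply/imSP; exists 1; rewrite /= scale1r.
have [u uE] := inclLP q0C.
have : projL S (h y) = 0.
 by rewrite hy linearZ_LR -/q0 -uE -linearZ_LR (kb Cd) ?linear0.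
move=> /projL0/asboolP[z [zE z0]]; rewrite -(hI _ _ zE); exact: z0.
Qed.

Lemma tf_jointI F (I : eqType) (r : seq I) (M : lmodType A) (N : I -> lmodType A) (h : forall k, {linear M -> N k}) :
 torf0 F -> (forall k, F (N k)) -> (forall m, (forall k, k \in r -> h k m = 0) -> m = 0) -> F M.
move=> tF FN; elim: r M h => [|k r IHr] M h h0; first by apply: (tf_zero tF) => m; apply: h0.
apply: (tf_ker tF (h := h k)); first exact: FN.
apply: (IHr _ (fun l => (h l \o inclL (kerS (h k)) : {linear _ -> _}))) => m mh.
apply: (@inclL_inj _ _ (kerS (h k))); rewrite linear0; apply: h0 => l.
by rewrite inE => /orP[/eqP->|/mh//]; apply/kerSP; exact: inclL_in.
Qed.

Definition Uw s : lmodType A := quot_mod (lsubmod_of_ideal (Iw s)).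
Definition Upr s (b : A) : Uw s := projL (lsubmod_of_ideal (Iw s)) b.
Lemma Upr0 s b : Upr s b = 0 <-> b \in Iw s. exact: projL0. Qed.
Lemma Upr_lin s b c : Upr s (b * c) = b *: Upr s c. exact: linearZ_LR. Qed.
Lemma Upr_surj s q : exists b, q = Upr s b.
by have [b <-] := projL_surj q; exists b. Qed.
(** A/I_w embeds into the product of the modules (A/I_w) e_l, which all lie in the class. *)
Lemma Uw_Fs s : legit Z0 s -> Fs Z0 s (Uw s).
move=> ls; have [M [FM /dchoice[u uP] _]] := Fs_prs ls.
have mL l : linear (fun b : A^o => (b : A) *: u l) by move=> k p q; rewrite scalerDl -scalerA.
have /dchoice[h hE] : forall l, exists h : {linear Uw s -> M l}, forall b, h (Upr s b) = b *: u l.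
 move=> l; apply: (@fact_surj _ _ _ _ (projL (lsubmod_of_ideal (Iw s))) (mkL (mL l)) (@projL_surj _ _ _)).
 move=> b /projL0 bI /=; apply/(prs_ann (uP l)); exact: ideal_mulr.
apply: (tf_jointI (r := enum 'I_n) (h := h)) => //; first exact/Fs_torf/Z0_torf.
move=> q hq; have [b qE] := Upr_surj q; rewrite qE; apply/Upr0; rewrite -[b]mulr1 -(pr_e1 P) mulr_sumr.
apply: rpred_sum => l _; apply/(prs_ann (uP l)); rewrite -hE -qE hq // mem_enum //.
Qed.

(** The ideal of a maximal word kills every finite dimensional nilpotent module, so it is zero by
    [nfd_separate], and the regular module is the quotient A/I_w, which lies in a class of such
    modules. *)
Lemma reg_nfd : nfd (A^o)%type.
have [s ls all] := max_word hC hD hO P hP.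
have I0 b : b \in Iw s -> b = 0.
 by move=> bI; apply: nfd_separate => M nM m; apply: (Fs_killed (all M nM)).
have /tf_nfd h : torf0 (Fs Z0 s) by apply/Fs_torf/Z0_torf.
apply: (nfd_inj (h := projL (lsubmod_of_ideal (Iw s)))); last exact/h/Uw_Fs.
by apply/inj_ker => b /projL0 /I0.
Qed.
Lemma fin_dim_nfd M : fin_dim M -> nfd M.
move=> fM; split=> //; have [_ [k kk]] := reg_nfd; exists k => m.
have mL : linear (fun b : A^o => (b : A) *: m) by move=> c p q; rewrite scalerDl -scalerA.
by have := kil_lin (mkL mL) (kk 1); rewrite /= scale1r.
Qed.

Lemma tfc_torf0 F : torsion_free_class F -> torf0 F.
move=> [F1 [M0 F2] F3 F4]; split=> [M /F1/fin_dim_nfd//|M Mz|M N h|M N h FN FK].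
- have zL : linear (fun _ : M => 0 : M0) by move=> k u v; rewrite scaler0 addr0.
 by apply: (F3 _ _ (mkL zL)) F2 => u v _; rewrite [u]Mz [v]Mz.
- exact: F3.
have [g gE] := corestr (f := h) (fun m => introT (imSP h _) (ex_intro _ m erefl)).
have gS : surjective_fun g.
 move=> u; have /imSP[m mE] := inclL_in u; exists m; apply: (@inclL_inj _ _ (imS h)). by rewrite gE.
have ex : exact_at (inclL (kerS h)) g.
 move=> m; split=> [/(congr1 (inclL _))|[u <-]]; first by rewrite gE linear0 => /kerSP/inclLP.
 apply: (@inclL_inj _ _ (imS h)); rewrite gE linear0; apply/kerSP; exact: inclL_in.
have FI : F (sub_mod (imS h)) by apply: (F3 _ _ (inclL (imS h)) _ FN); apply: inclL_inj.
apply: (F4 _ _ _ (inclL (kerS h)) g) => //.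
exact: fin_dim_ses (@inclL_inj _ _ (kerS h)) gS ex (F1 _ FK) (F1 _ FI).
Qed.
Lemma torf0_tfc F : torf0 F -> torsion_free_class F.
move=> tF; split=> [M FM||M N h hI FN|M E N h g fE hI ex gS FM FN].
- by have [] := tf_nfd tF FM.
- exists (Uw [::]); apply: (tf_zero tF) => q; have [b ->] := Upr_surj q; exact/Upr0.
- exact: (tf_sub tF hI FN).
apply: (tf_ker tF (h := g)) => //; have [|k kE] := fact_inj hI (g := inclL (kerS g)).
 by move=> u; have /kerSP/ex := inclL_in u.
apply: (tf_sub tF (h := k)) FM => u v E1; apply: (@inclL_inj _ _ (kerS g)).
by rewrite -!kE E1.
Qed.
End Residual.

Lemma fd_ffun (K : fieldType) (I : finType) (V : lmodType K) : fd V -> fd {ffun I -> V}.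
move=> [d [f fB]].
have vL : linear (fun w : {ffun I -> V} => \matrix_(t < #|I|) f (w (enum_val t))).
 move=> c u v; by apply/matrixP => t k; rewrite !mxE !ffunE linearP !mxE.
apply: (fd_inj (f := mxvec \o mkL vL : {linear _ -> _})) (fd_rV _ _) => u v /(can_inj mxvecK)/row_matrixP uv.
by apply/ffunP => t; have := uv (enum_rank t); rewrite !rowK enum_rankK => /(bij_inj fB).
Qed.

(** * Averaging operators *)

Section Average.
Variable R : pzRingType.
Implicit Types u v w z : R.
(** The relative trace for truncated polynomial rings: when u^k = 0 = v^k it turns any z into a map
    intertwining v with u. *)
Definition avg k u v z := \sum_(q < k) u ^+ q * z * v ^+ (k - 1 - q).
Lemma avg_com k u v z : u ^+ k * z = z * v ^+ k -> u * avg k u v z = avg k u v z * v.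
move=> E; pose F q := u ^+ q * z * v ^+ (k - q).
have -> : u * avg k u v z = \sum_(q < k) F q.+1.
 rewrite mulr_sumr; apply: eq_bigr => q _; rewrite /F exprS !mulrA; congr (_ * _ ^+ _). by rewrite -subnDA add1n.
have -> : avg k u v z * v = \sum_(q < k) F q.
 rewrite mulr_suml; apply: eq_bigr => q _; rewrite /F -mulrA -exprSr; congr (_ * _ ^+ _). by rewrite -subnDA add1n -subSn // subSS.
have : \sum_(q < k.+1) F q = \sum_(q < k.+1) F q by [].
rewrite {1}big_ord_recl big_ord_recr /= {1}/F [F k]/F subn0 subnn expr0 mulr1 mul1r -E addrC.
by move/addrI.
Qed.
Lemma avg_comX k u v f1 f2 z : (u ^+ f1) ^+ k = 0 -> (v ^+ f2) ^+ k = 0 ->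
 u ^+ f1 * avg k (u ^+ f1) (v ^+ f2) z = avg k (u ^+ f1) (v ^+ f2) z * v ^+ f2.
by move=> u0 v0; apply: avg_com; rewrite u0 v0 mul0r mulr0. Qed.
Lemma avg_tailr k u v w z y : y * w = v * y -> avg k u w (z * y) = avg k u v z * y.
move=> E; rewrite mulr_suml; apply: eq_bigr => q _; rewrite -!mulrA; congr (_ * (_ * _)).
by elim: (k - 1 - q)%N => [|l IHl]; rewrite ?mul1r ?mulr1 // !exprSr mulrA IHl -mulrA E mulrA.
Qed.
Lemma avg_taill k u v w z y : w * y = y * u -> avg k w v (y * z) = y * avg k u v z.
move=> E; rewrite mulr_sumr; apply: eq_bigr => q _; rewrite !mulrA; congr (_ * _ * _).
by elim: (q : nat) => [|l IHl]; rewrite ?mul1r ?mulr1 // !exprS -mulrA IHl mulrA E mulrA.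
Qed.
Lemma avgD k u v y z : avg k u v (y + z) = avg k u v y + avg k u v z.
by rewrite -big_split; apply: eq_bigr => q _; rewrite mulrDr mulrDl. Qed.
Lemma sum_mul (V : nmodType) (F : nat -> V) f k :
 \sum_(q < f * k) F q = \sum_(r < f) \sum_(q < k) F (f * q + r)%N.
rewrite exchange_big; elim: k => [|k IHk]; first by rewrite muln0 !big_ord0.
by rewrite mulnSr big_split_ord big_ord_recr /= IHk.
Qed.
(** Averaging over f k powers is done in two stages, first over k powers of u^f and v^f, then over
    the f remainders. The second stage has the shape of the mesh sum. *)
Lemma avg_mul f k u v z : (0 < f)%N -> avg (f * k) u v z =
 \sum_(r < f) u ^+ r * avg k (u ^+ f) (v ^+ f) z * v ^+ (f - 1 - r).
move=> f0; rewrite /avg (sum_mul (fun q => u ^+ q * z * v ^+ (f * k - 1 - q))).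
apply: eq_bigr => r _; rewrite mulr_sumr mulr_suml; apply: eq_bigr => q _.
rewrite -!exprM !mulrA -exprD addnC -[RHS]mulrA -exprD; congr (_ * _ ^+ _).
have kE : k = (q + (k - 1 - q)).+1 by case: k q => [[]//|k] q; rewrite subn1 subnKC // -ltnS.
have fE : f = (r + (f - 1 - r)).+1 by case: f r {f0} => [[]//|f] r; rewrite subn1 subnKC // -ltnS.
move: (k - 1 - q)%N (f - 1 - r)%N kE fE => s t; move: (q : nat) (r : nat) => {}q {}r -> ->; nia.
Qed.
End Average.

(** * Trace duality between coboundaries and the mesh relation *)

Section SymMatrix.
Variables (K : fieldType) (n : nat) (C : 'M[int]_n) (D : 'I_n -> nat).
Variable Om : {set 'I_n * 'I_n}.
Hypotheses (hC : is_GCM C) (hD : is_symmetrizer C D) (hO : is_orientation C Om).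
Notation f := (Cartan_f C).
Notation G := (Cartan_g C).
Notation valid := (valid_arrow C Om).
Notation sg := (sg K Om).
Notation Ck := (Ck C D).
Variable d : nat.
Notation R := 'M[K]_d.

Lemma trC (u v : R) : \tr (u * v) = \tr (v * u). exact: mxtrace_mulC. Qed.
Lemma mZr c (u v : R) : u * (c *: v) = c *: (u * v). exact/esym/scalemxAr. Qed.
Lemma mZl c (u v : R) : (c *: u) * v = c *: (u * v). exact/esym/scalemxAl. Qed.
Lemma tr_avg k (u v z w : R) : \tr (avg k u v z * w) = \tr (z * avg k v u w).
rewrite mulr_suml mulr_sumr !raddf_sum /= (reindex_inj rev_ord_inj) /=; apply: eq_bigr => q _.
have -> : (k - 1 - (k - q.+1))%N = q by case: q => q /=; lia.
by rewrite -subnDA add1n -!mulrA [LHS]trC -!mulrA.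
Qed.
Lemma tr_nondeg (u : R) : (forall z, \tr (z * u) = 0) -> u = 0.
move=> h; apply/matrixP => i j; rewrite mxE; have := h (delta_mx j i).
rewrite /mxtrace (bigD1 j) //= big1 => [|k kj].
 rewrite addr0 !mxE (bigD1 i) //= big1 => [|l li]; first by rewrite addr0 mxE !eqxx mul1r. by rewrite mxE (negbTE li) andbF mul0r.
by rewrite !mxE big1 // => l _; rewrite mxE (negbTE kj) mul0r.
Qed.

Definition sumA (V : nmodType) (F : 'I_n -> 'I_n -> nat -> V) :=
 \sum_i \sum_(j | Om_bar Om j i) \sum_(g < G i j) F i j g.
Lemma sumA_swap (V : nmodType) (F : 'I_n -> 'I_n -> nat -> V) : sumA F = sumA (fun i j => F j i).
rewrite /sumA (exchange_big_dep xpredT) //=; apply: eq_bigr => i _.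
by under eq_bigl => j do rewrite Om_barC; apply: eq_bigr => j _; rewrite Cartan_gC.
Qed.
Lemma sumA_eq (V : nmodType) (F H : 'I_n -> 'I_n -> nat -> V) :
 (forall i j g, valid i j g -> F i j g = H i j g) -> sumA F = sumA H.
move=> FH; apply: eq_bigr => i _; apply: eq_bigr => j ji; apply: eq_bigr => g _; apply: FH.
by rewrite /valid Om_barC ji ltn_ord.
Qed.
Lemma sumAD (V : nmodType) (F H : 'I_n -> 'I_n -> nat -> V) :
 sumA (fun i j g => F i j g + H i j g) = sumA F + sumA H.
rewrite /sumA -big_split; apply: eq_bigr => i _; rewrite -big_split; apply: eq_bigr => j _.
by rewrite big_split.
Qed.
Lemma sumAN (V : zmodType) (F : 'I_n -> 'I_n -> nat -> V) :
 sumA (fun i j g => - F i j g) = - sumA F.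
rewrite /sumA -sumrN; apply: eq_bigr => i _; rewrite -sumrN; apply: eq_bigr => j _.
by rewrite sumrN.
Qed.

Variables (E X : 'I_n -> R) (B : 'I_n -> 'I_n -> nat -> R) (p : R).
Hypotheses (hEE : forall i j, E i * E j = if i == j then E j else 0) (hE1 : \sum_i E i = 1).
Hypotheses (hEX : forall i, E i * X i = X i) (hXE : forall i, X i * E i = X i).
Hypotheses (hEB : forall i j g, valid i j g -> E i * B i j g = B i j g)
 (hBE : forall i j g, valid i j g -> B i j g * E j = B i j g).
Hypothesis (hX0 : forall i, X i ^+ D i = 0).
Hypothesis hcom : forall i j g, valid i j g -> X i ^+ f j i * B i j g = B i j g * X j ^+ f i j.
Hypotheses (hpp : p * p = p) (hpE : forall i, p * E i = E i * p) (hpX : forall i, p * X i = X i * p).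
Hypothesis hpB : forall i j g, valid i j g -> p * B i j g = B i j g * p.
Implicit Types (xi th : 'I_n -> 'I_n -> nat -> R) (eta : R).

(** The derivative of the mesh relation at the point B in the direction xi; a direction satisfying
    the linear relations with [mesh xi = 0] is an extension cocycle. *)
Definition mesh xi i : R := \sum_(j | Om_bar Om j i) \sum_(g < G i j) \sum_(k < f j i)
 sg i j *: (X i ^+ k * (B i j g * xi j i g + xi i j g * B j i g) * X i ^+ (f j i - 1 - k)).
(** Makes an arbitrary family commute with x_i^(f_ji) and x_j^(f_ij), as required of arrows; k_ij is
    the common exponent at which these powers vanish. *)
Definition Avg xi i j g := avg (Ck i j) (X i ^+ f j i) (X j ^+ f i j) (xi i j g).

Lemma XfC i j : Om_bar Om i j -> (X i ^+ f j i) ^+ Ck i j = 0.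
by move=> ij; rewrite -exprM (CkE hD hO ij) hX0. Qed.
Lemma XfC' i j : Om_bar Om i j -> (X j ^+ f i j) ^+ Ck i j = 0.
by move=> ij; rewrite -exprM (CkE' hD hO ij) hX0. Qed.

(** The coboundary on averaged maps and the linearized mesh relation are adjoint for the trace form,
    up to sign. This self-duality is the source of the symmetry of Ext^1; the sign change between
    (i, j) and (j, i) turns the commutator into a sum. *)
Lemma core xi (eta : 'I_n -> R) :
 sumA (fun i j g => sg i j * \tr ((B i j g * avg (D j) (X j) (X j) (eta j) -
   avg (D i) (X i) (X i) (eta i) * B i j g) * xi j i g)) =
 - \sum_i \tr (eta i * mesh (Avg xi) i).
pose av i := avg (D i) (X i) (X i) (eta i).
rewrite (sumA_eq (H := fun i j g => - (- (sg i j * \tr (B i j g * av j * xi j i g)) +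
  sg i j * \tr (av i * B i j g * xi j i g)))); last first.
 by move=> i j g _; rewrite mulrBl raddfB /= mulrBr opprD opprK.
rewrite sumAN sumAD; congr (- _); rewrite sumAN [X in - X]sumA_swap -sumAN -sumAD.
apply: eq_bigr => i _; rewrite mulr_sumr raddf_sum /=; apply: eq_bigr => j ji.
have ij : Om_bar Om i j by rewrite Om_barC.
rewrite mulr_sumr raddf_sum /=; apply: eq_bigr => g _.
have v : valid i j g by rewrite /valid ij ltn_ord.
have v' : valid j i g by rewrite validC.
have -> : \tr (B j i g * av i * xi i j g) = \tr (av i * (xi i j g * B j i g)) by rewrite -mulrA trC -mulrA.
rewrite -(mulrA (av i)) -scaler_sumr mZr mxtraceZ (sgC K hO ji) mulNr opprK -mulrDr; congr (_ * _).
rewrite -raddfD -mulrDr /av /= tr_avg; congr (\tr (_ * _)).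
rewrite -(CkE hD hO ij) avg_mul ?(Cartan_f_gt0 hO ji) //; apply: eq_bigr => k _; congr (_ * _ * _).
rewrite addrC avgD /Avg; congr (_ + _).
 by rewrite (CkC hD hO ij); apply: avg_taill; apply: hcom.
by apply: avg_tailr; rewrite hcom.
Qed.

Lemma mesh_eq xi xi' i : (forall i j g, valid i j g -> xi i j g = xi' i j g) -> mesh xi i = mesh xi' i.
move=> h; apply: eq_bigr => j ji; apply: eq_bigr => g _; apply: eq_bigr => k _.
have v : valid i j g by rewrite /valid Om_barC ji ltn_ord.
by rewrite !h // validC.
Qed.

Lemma mesh_mul xi i u v : u * X i = X i * u -> v * X i = X i * v ->
 (forall i j g, valid i j g -> u * B i j g = B i j g * u) -> (forall i j g, valid i j g -> v * B i j g = B i j g * v) ->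
 mesh (fun i j g => u * xi i j g * v) i = u * mesh xi i * v.
move=> uX vX uB vB; rewrite /mesh mulr_sumr mulr_suml; apply: eq_bigr => j ji.
rewrite mulr_sumr mulr_suml; apply: eq_bigr => g _; rewrite mulr_sumr mulr_suml.
have v2 : valid i j g by rewrite /valid Om_barC ji ltn_ord.
have v1 : valid j i g by rewrite validC.
have uXk k : X i ^+ k * u = u * X i ^+ k by apply/esym/(commrX k (_ : GRing.comm _ _)).
have vXk k : v * X i ^+ k = X i ^+ k * v by apply: (commrX k (_ : GRing.comm _ _)).
apply: eq_bigr => k _; rewrite !(mZr, mZl); congr (_ *: _).
have -> : B i j g * (u * xi j i g * v) = u * (B i j g * xi j i g) * v by rewrite !mulrA uB.
have -> : u * xi i j g * v * B j i g = u * (xi i j g * B j i g) * v by rewrite -mulrA vB // !mulrA.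
by rewrite -mulrDl -mulrDr !mulrA uXk -!mulrA vXk.
Qed.
Lemma mesh_E xi i : mesh (fun i j g => E i * xi i j g * E j) i = E i * mesh xi i * E i.
rewrite /mesh mulr_sumr mulr_suml; apply: eq_bigr => j ji.
rewrite mulr_sumr mulr_suml; apply: eq_bigr => g _; rewrite mulr_sumr mulr_suml.
have v2 : valid i j g by rewrite /valid Om_barC ji ltn_ord.
have v1 : valid j i g by rewrite validC.
have EXk k : E i * X i ^+ k = X i ^+ k * E i.
 by apply: (commrX k (_ : GRing.comm _ _)); rewrite /GRing.comm hEX hXE.
apply: eq_bigr => k _; rewrite !(mZr, mZl); congr (_ *: _).
have -> : B i j g * (E j * xi j i g * E i) = E i * (B i j g * xi j i g) * E i by rewrite !mulrA hBE // hEB.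
have -> : E i * xi i j g * E j * B j i g = E i * (xi i j g * B j i g) * E i.
 by rewrite -[LHS]mulrA hEB // -!mulrA hBE.
by rewrite -mulrDl -mulrDr !mulrA -EXk -!mulrA EXk.
Qed.
Lemma bd_avg z (y : 'I_n -> R) i j g : valid i j g -> (forall k, E k * z = z * E k) ->
 (forall k, E k * z = avg (D k) (X k) (X k) (y k)) -> B i j g * z - z * B i j g =
 B i j g * avg (D j) (X j) (X j) (y j) - avg (D i) (X i) (X i) (y i) * B i j g.
by move=> v zE zy; rewrite -!zy mulrA hBE // zE -mulrA hEB. Qed.

Section Dual.
(** Every cocycle from the image of 1 - p to the image of p is a coboundary; the conclusion
    [dual_ext] concerns the opposite direction. *)
Hypothesis ext0 : forall th, (forall i j g, valid i j g -> [/\ E i * th i j g = th i j g, th i j g * E j = th i j g,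
  p * th i j g = th i j g, th i j g * p = 0 & X i ^+ f j i * th i j g = th i j g * X j ^+ f i j]) ->
 (forall i, mesh th i = 0) -> exists eta, [/\ forall i, E i * eta = eta * E i, forall i, X i * eta = eta * X i, p * eta = eta, eta * p = 0 &
  forall i j g, valid i j g -> th i j g = B i j g * eta - eta * B i j g].
(** Here and in [free1], every map compatible with the loops is an average: the form in which local
    freeness of one of the two modules enters. *)
Hypothesis free0 : forall i eta, E i * eta = eta -> eta * E i = eta -> p * eta = eta -> eta * p = 0 ->
 X i * eta = eta * X i -> exists eta0, eta = avg (D i) (X i) (X i) eta0.
Hypothesis free1 : forall i j g (y : R), valid i j g -> E i * y = y -> y * E j = y -> p * y = 0 -> y * p = y ->
 X i ^+ f j i * y = y * X j ^+ f i j -> exists z, y = avg (Ck i j) (X i ^+ f j i) (X j ^+ f i j) z.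
Variable xi : 'I_n -> 'I_n -> nat -> R.
Hypothesis hxi : forall i j g, valid i j g -> [/\ E i * xi i j g = xi i j g, xi i j g * E j = xi i j g,
  p * xi i j g = 0, xi i j g * p = xi i j g & X i ^+ f j i * xi i j g = xi i j g * X j ^+ f i j].
Hypothesis xi_mesh : forall i, mesh xi i = 0.

Let allowed z := [/\ forall i, E i * z = z * E i, forall i, X i * z = z * X i, p * z = 0 & z * p = z].

Let m := (\max_i \max_j G i j)%N.
Let W : lmodType K := {ffun 'I_n * 'I_n * 'I_m.+1 -> R}.
Let fam (u : 'I_n -> 'I_n -> nat -> R) : W := [ffun t : 'I_n * 'I_n * 'I_m.+1 => if valid t.1.1 t.1.2 t.2 then u t.1.1 t.1.2 t.2 else 0].
Let bd z i j g := B i j g * z - z * B i j g.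

(** By nondegeneracy of the trace form on matrices, a functional on families of matrices is a sum of
    traces against fixed matrices. *)
Lemma functional_rep (phi : {linear W -> K^o}) : exists ps : 'I_n -> 'I_n -> nat -> R,
 forall u, phi (fam u) = sumA (fun i j g => \tr (ps i j g * u i j g)).
pose single (t : 'I_n * 'I_n * 'I_m.+1) (z : R) : W := [ffun t' => if t' == t then z else 0].
exists (fun i j g => \matrix_(k, l) phi (single (i, j, inord g) (delta_mx l k))) => u.
have -> : fam u = \sum_t single t (fam u t).
 apply/ffunP => t; rewrite sum_ffunE (bigD1 t) //= [single _ _ _]ffunE eqxx big1 ?addr0 // => s st. by rewrite ffunE eq_sym (negbTE st).
rewrite linear_sum /=.
have phiE t z : phi (single t z) = \tr ((\matrix_(k, l) phi (single t (delta_mx l k))) * z).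
 have -> : single t z = \sum_k \sum_l z l k *: single t (delta_mx l k).
  apply/ffunP => s; rewrite sum_ffunE [LHS]ffunE; case: eqP => [->|st]; last first.
   rewrite big1 // => k _; rewrite sum_ffunE big1 // => l _; rewrite ffunE [single _ _ _]ffunE. by case: eqP => // _; rewrite scaler0.
  rewrite [LHS]matrix_sum_delta exchange_big; apply: eq_bigr => k _; rewrite sum_ffunE. by apply: eq_bigr => l _; rewrite ffunE [single _ _ _]ffunE eqxx.
 rewrite linear_sum /mxtrace; apply: eq_bigr => k _; rewrite linear_sum mxE; apply: eq_bigr => l _. by rewrite linearZ mxE mulrC.
rewrite (eq_bigr (fun t : 'I_n * 'I_n * 'I_m.+1 => if valid t.1.1 t.1.2 t.2 then \tr ((\matrix_(k, l) phi (single (t.1.1, t.1.2, inord t.2)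
  (delta_mx l k))) * u t.1.1 t.1.2 t.2) else 0)) => [|[[i j] g] _]; last first.
 rewrite phiE ffunE /= inord_val; case: ifP => // _; by rewrite mulr0 linear0.
rewrite -(pair_bigA _ (fun (ij : 'I_n * 'I_n) (g : 'I_m.+1) => if valid ij.1 ij.2 g then \tr ((\matrix_(k, l) phi (single (ij.1, ij.2, inord g)
  (delta_mx l k))) * u ij.1 ij.2 g) else 0)) /=.
rewrite -(pair_bigA _ (fun i j => \sum_(g < m.+1) if valid i j g then \tr ((\matrix_(k, l) phi (single (i, j, inord g)
  (delta_mx l k))) * u i j g) else 0)) /=.
apply: eq_bigr => i _; rewrite [RHS]big_mkcond; apply: eq_bigr => j _; rewrite /valid Om_barC.
case: ifP => ji /=; last by rewrite big1.
have Gm : (G i j <= m.+1)%N by apply: leqW; apply: leq_trans (leq_bigmax j) (leq_bigmax i).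
rewrite (big_ord_widen _ (fun g => \tr ((\matrix_(k, l) phi (single (i, j, inord g) (delta_mx l k))) * u i j g)) Gm).
by rewrite [RHS]big_mkcond.
Qed.

(** If xi is not a coboundary, a functional phi separates it from the coboundaries. Through the
    trace form phi becomes a family in the opposite direction, which is a cocycle, hence a
    coboundary by [ext0]; applying [core] once more gives phi(xi) = 0. *)
Lemma dual_ext : exists z, allowed z /\ forall i j g, valid i j g -> xi i j g = bd z i j g.
pose T : pred W := fun w => `[< exists z, allowed z /\ w = fam (bd z) >].
have TS : submod_closed T.
 split=> [|c u v /asboolP[z [[z1 z2 z3 z4] ->]] /asboolP[y [[y1 y2 y3 y4] ->]]]; apply/asboolP.
  exists 0; split; first by split=> *; rewrite ?mulr0 ?mul0r. by apply/ffunP => t; rewrite !ffunE /bd mulr0 mul0r subrr; case: ifP.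
 exists (c *: z + y); split.
  by split=> *; rewrite !(mulrDl, mulrDr, mZl, mZr) ?z1 ?y1 ?z2 ?y2 ?z3 ?y3 ?z4 ?y4 // scaler0 addr0.
 apply/ffunP => t; rewrite !ffunE /bd; case: ifP => _; last by rewrite scaler0 addr0. by rewrite !(mulrDl, mulrDr, mZl, mZr) scalerBr addrACA opprD.
have fW : fd W.
 by apply: fd_ffun; exists (d * d)%N, mxvec; exists vec_mx; [exact: mxvecK | exact: vec_mxK].
have [|xS] := boolP (fam xi \in Submodule TS).
 move=> /asboolP[z [za /ffunP E1]]; exists z; split=> // i j g v. have gm : (g < m.+1)%N.
  have /andP[_ gG] := v; apply: leq_trans gG _. by apply: leqW; apply: leq_trans (leq_bigmax j) (leq_bigmax i).
 by have := E1 (i, j, Ordinal gm); rewrite !ffunE /= v.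
have [phi [phi0 phi1]] := sep_functional fW xS; have [ps psE] := functional_rep phi.
exfalso; move: phi1; apply/negP; rewrite negbK.
pose q := 1 - p.
have pq : p * q = 0 by rewrite /q mulrBr mulr1 hpp subrr.
have qp : q * p = 0 by rewrite /q mulrBl mul1r hpp subrr.
have qq : q * q = q by rewrite {1}/q mulrBl pq mul1r subr0.
have qE i : q * E i = E i * q by rewrite mulrBl mulrBr hpE mul1r mulr1.
have qX i : q * X i = X i * q by rewrite mulrBl mulrBr hpX mul1r mulr1.
have qB i j g : valid i j g -> q * B i j g = B i j g * q by move=> v; rewrite mulrBl mulrBr hpB ?mul1r ?mulr1.
have qz z : p * z = 0 -> q * z = z by move=> h; rewrite mulrBl h mul1r subr0.
(* phi carried to the opposite arrows, cut down to maps between the right vertices and blocks; the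
   sign turns phi into the signed pairing of [core]. *)
pose t0 i j g := p * E i * (sg j i *: ps j i g) * E j * q.
have phiE u : (forall i j g, valid i j g -> [/\ E i * u i j g = u i j g, u i j g * E j = u i j g, p * u i j g = 0 & u i j g * p = u i j g]) ->
  phi (fam u) = sumA (fun i j g => sg i j * \tr (u i j g * t0 j i g)).
 move=> uP; rewrite psE; apply: sumA_eq => i j g v; have [u1 u2 u3 u4] := uP _ _ _ v.
 rewrite /t0 !(mZr, mZl) !mulrA u4 u2 mxtraceZ mulrA sg2 mul1r -(mulrA _ (E i)) [RHS]trC !mulrA. by rewrite -(mulrA (E i)) (qz _ u3) u1 trC.
have XD i k : X i ^+ k * p = p * X i ^+ k by apply/esym/(commrX k (_ : GRing.comm _ _))/hpX.
have XQ i k : X i ^+ k * q = q * X i ^+ k by apply/esym/(commrX k (_ : GRing.comm _ _))/qX.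
have EXk i k : X i ^+ k * E i = E i * X i ^+ k.
 by apply/esym/(commrX k (_ : GRing.comm _ _)); rewrite /GRing.comm hEX hXE.
have EE i : E i * E i = E i by rewrite hEE eqxx.
have pt i j g : p * t0 i j g = t0 i j g by rewrite /t0 !mulrA hpp.
have tq i j g : t0 i j g * q = t0 i j g by rewrite /t0 -!mulrA qq.
have Et i j g : E i * t0 i j g = t0 i j g by rewrite /t0 !mulrA -hpE -(mulrA p) EE.
have tE i j g : t0 i j g * E j = t0 i j g by rewrite /t0 -!mulrA qE (mulrA (E j)) EE.
have pA i j g : p * Avg t0 i j g = Avg t0 i j g by rewrite /Avg -(avg_taill _ _ _ (XD _ _)) ?pt.
have Aq i j g : Avg t0 i j g * q = Avg t0 i j g by rewrite /Avg -(avg_tailr _ _ _ (esym (XQ _ _))) ?tq.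
have EA i j g : E i * Avg t0 i j g = Avg t0 i j g by rewrite /Avg -(avg_taill _ _ _ (EXk _ _)) ?Et.
have AE i j g : Avg t0 i j g * E j = Avg t0 i j g by rewrite /Avg -(avg_tailr _ _ _ (esym (EXk _ _))) ?tE.
have meshA i : mesh (Avg t0) i = p * (E i * mesh (Avg t0) i * E i) * q.
 rewrite -[in RHS]mesh_E -mesh_mul //; apply: mesh_eq => k j g _. by rewrite EA AE pA Aq.
(* phi vanishes on the coboundary of every averaged endomorphism Z at i. By [core] this says that
   the mesh of Avg t0 at i is orthogonal to all matrices. *)
have mesh0 i : mesh (Avg t0) i = 0.
 apply: tr_nondeg => z; pose y k := if k == i then q * E i * z * E i * p else 0.
 pose Z := avg (D i) (X i) (X i) (y i); have yi : y i = q * E i * z * E i * p by rewrite /y eqxx. have XEi : X i * E i = E i * X i by rewrite hXE hEX.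
 have qZ : q * Z = Z by rewrite /Z -(avg_taill _ _ _ (esym (qX i))) yi !mulrA qq.
 have Zp : Z * p = Z by rewrite /Z -(avg_tailr _ _ _ (hpX i)) yi -!mulrA hpp.
 have EZ : E i * Z = Z by rewrite /Z -(avg_taill _ _ _ XEi) yi !mulrA -qE -(mulrA q (E i) (E i)) EE.
 have ZE : Z * E i = Z by rewrite /Z -(avg_tailr _ _ _ (esym XEi)) yi -!mulrA hpE (mulrA (E i) (E i)) EE.
 have XZ : X i * Z = Z * X i by rewrite /Z avg_com // hX0 mul0r mulr0. have EkZ k : E k * Z = if k == i then Z else 0.
  by rewrite -EZ mulrA hEE; case: eqP => _; rewrite ?mul0r // EZ.
 have ZEk k : Z * E k = if k == i then Z else 0.
  by rewrite -ZE -mulrA hEE eq_sym; case: eqP => [->|_]; rewrite ?mulr0 // !ZE.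
 have Za : allowed Z.
  split=> // [k|k|]; first by rewrite EkZ ZEk.
   rewrite -[in LHS](hXE k) -mulrA EkZ -[in RHS](hEX k) mulrA ZEk; by case: eqP => [->|_]; rewrite ?mulr0 ?mul0r.
  by rewrite -qZ mulrA pq mul0r.
 have /phi0 : fam (bd Z) \in Submodule TS by apply/asboolP; exists Z. have [Z1 Z2 Z3 Z4] := Za; rewrite phiE => [|k j g v]; last first.
  rewrite /bd; split; rewrite ?(mulrBr, mulrBl).
  - by congr (_ - _); [rewrite mulrA hEB | rewrite mulrA Z1 -mulrA hEB].
  - by congr (_ - _); [rewrite -mulrA -Z1 mulrA hBE | rewrite -mulrA hBE].
  - by rewrite !mulrA hpB // -(mulrA _ p) Z3 mulr0 mul0r subrr. by congr (_ - _); [rewrite -mulrA Z4 | rewrite -mulrA -hpB // mulrA Z4].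
 rewrite (sumA_eq (H := fun k j g => sg k j * \tr ((B k j g * avg (D j) (X j) (X j) (y j) -
   avg (D k) (X k) (X k) (y k) * B k j g) * t0 j k g))) => [|k j g v]; last first.
  rewrite /bd (bd_avg (y := y)) // => l; rewrite EkZ; case: eqP => [->//|/eqP li]. by rewrite /avg big1 // => r _; rewrite /y (negbTE li) mulr0 mul0r.
 rewrite core => /eqP; rewrite oppr_eq0 (bigD1 i) //= [X in _ + X]big1 => [|k ki]; last first.
  by rewrite /y (negbTE ki) mul0r linear0.
 rewrite addr0 => /eqP tr0; rewrite -tr0 yi. have ME : E i * p * mesh (Avg t0) i * (q * E i) = mesh (Avg t0) i by rewrite [RHS]meshA -hpE qE !mulrA.
 by rewrite -[in LHS]ME mulrA trC !mulrA.
have [eta [eE eX pe ep Ae]] : exists eta, [/\ forall i, E i * eta = eta * E i, forall i, X i * eta = eta * X i, p * eta = eta, eta * p = 0 &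
  forall i j g, valid i j g -> Avg t0 i j g = B i j g * eta - eta * B i j g].
 apply: ext0 => // i j g v; have /andP[ij _] := v; split=> //.
  by rewrite -Aq -mulrA qp mulr0.
 by apply: avg_comX; [exact: XfC | exact: XfC'].
have /choice[y yP] : forall k, exists y, E k * eta = avg (D k) (X k) (X k) y.
 move=> k; apply: free0; rewrite ?mulrA ?EE // ?hEX.
 - by rewrite -mulrA -eE mulrA EE.
 - by rewrite hpE -mulrA pe.
 - by rewrite -mulrA ep mulr0. by rewrite hXE eX eE -mulrA hEX.
have /choice[xi0 xi0P] : forall t : 'I_n * 'I_n * nat, exists y, valid t.1.1 t.1.2 t.2 ->
  xi t.1.1 t.1.2 t.2 = avg (Ck t.1.1 t.1.2) (X t.1.1 ^+ f t.1.2 t.1.1) (X t.1.2 ^+ f t.1.1 t.1.2) y.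
 move=> [[i j] g] /=; have [v|v] := boolP (valid i j g); last by exists 0.
 have [h1 h2 h3 h4 h5] := hxi v; have [y' yE] := free1 v h1 h2 h3 h4 h5; by exists y'.
pose x0 i j g := xi0 (i, j, g).
(* With xi = Avg x0 and Avg t0 the coboundary of averages of y, moving one averaging across the
   trace brings phi(xi) to the shape of [core], where the mesh of xi, equal to 0, appears. *)
rewrite phiE => [|i j g v]; last by have [] := hxi v.
rewrite (sumA_eq (H := fun i j g => sg i j * \tr (x0 i j g * Avg t0 j i g))) => [|i j g v]; last first.
 have /andP[ij _] := v; rewrite (xi0P (i, j, g) v) tr_avg /Avg (CkC hD hO ij) //.
rewrite sumA_swap (sumA_eq (H := fun i j g => - (sg i j * \tr ((B i j g * avg (D j) (X j) (X j) (y j) -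
   avg (D i) (X i) (X i) (y i) * B i j g) * x0 j i g)))) => [|i j g v]; last first.
 have /andP[ij _] := v; rewrite -(bd_avg v eE yP) -Ae // trC (sgC K hO ij) mulNr opprK //.
rewrite sumAN core opprK big1 // => i _; rewrite (mesh_eq (xi' := xi)) ?xi_mesh ?mulr0 ?linear0 //.
by move=> j k g v; rewrite (xi0P (j, k, g) v).
Qed.
End Dual.
End SymMatrix.

(** * Matrices acting on a coordinatized space *)

Section Operators.
Variables (K : fieldType) (V : lmodType K) (d : nat) (h : {linear V -> 'rV[K]_d}) (g : {linear 'rV[K]_d -> V}).
Hypotheses (hK : cancel h g) (gK : cancel g h).
Implicit Types u w : 'M[K]_d.
(** Coordinates are row vectors; the transpose makes [op] multiplicative instead of
    anti-multiplicative. *)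
Fact op_linear u : linear (fun v : V => g (h v *m u^T)).
by move=> k v w; rewrite linearP mulmxDl -scalemxAl linearP. Qed.
Definition op u : {linear V -> V} := locked (mkL (op_linear u)).
Lemma opE u v : op u v = g (h v *m u^T). by rewrite /op -lock. Qed.
Lemma opM u w v : op (u * w) v = op u (op w v).
by rewrite !opE gK -mulmxA -trmx_mul. Qed.
Lemma op1 v : op 1 v = v. by rewrite opE trmx1 mulmx1 hK. Qed.
Lemma op0 v : op 0 v = 0. by rewrite opE trmx0 mulmx0 linear0. Qed.
Lemma opD u w v : op (u + w) v = op u v + op w v.
by rewrite !opE linearD mulmxDr linearD. Qed.
Lemma opN u v : op (- u) v = - op u v.
by apply/eqP; rewrite -addr_eq0 -opD addNr op0. Qed.
Lemma opZ k u v : op (k *: u) v = k *: op u v.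
by rewrite !opE linearZ -scalemxAr linearZ. Qed.
Lemma op_sum (T : Type) (r : seq T) (Q : pred T) (F : T -> 'M[K]_d) v :
 op (\sum_(t <- r | Q t) F t) v = \sum_(t <- r | Q t) op (F t) v.
by apply: (big_morph (fun u => op u v)) => [u w|]; rewrite ?opD ?op0. Qed.
Lemma op_inj u w : (forall v, op u v = op w v) -> u = w.
move=> E; apply: trmx_inj; apply/row_matrixP => i; rewrite !rowE; have := E (g (delta_mx 0 i)).
by rewrite !opE gK => /(can_inj gK).
Qed.
Lemma op_surj (t : {linear V -> V}) : exists u, forall v, op u v = t v.
exists (lin1_mx (h \o (t \o g)))^T => v.
by rewrite opE trmxK mul_rV_lin1 /= !hK.
Qed.
Lemma op_iter k u v : op (u ^+ k) v = iter k (op u) v.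
by elim: k => [|k IHk]; rewrite ?op1 // exprS opM IHk. Qed.
End Operators.

(** * Symmetry of the vanishing of Ext^1 *)

Section Symmetry.
Variables (K : fieldType) (n : nat) (C : 'M[int]_n) (D : 'I_n -> nat).
Variable Om : {set 'I_n * 'I_n}.
Hypotheses (hC : is_GCM C) (hD : is_symmetrizer C D) (hO : is_orientation C Om).
Notation f := (Cartan_f C).
Notation G := (Cartan_g C).
Notation valid := (valid_arrow C Om).
Notation sg := (sg K Om).
Variables (A : pzAlgType K) (e x : 'I_n -> A) (a : 'I_n -> 'I_n -> nat -> A).
Hypothesis P : presentation C D Om e x a.
Implicit Types M N : lmodType A.

(** Ext^1(N, M) = 0: every extension with submodule M and quotient N splits. *)
Definition ext_split M N := forall (E : lmodType A) (i : {linear M -> E}) (p : {linear E -> N}),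
 injective i -> surjective_fun p -> exact_at i p -> exists s : {linear N -> E}, forall m, p (s m) = m.
(** The relative trace criterion for freeness of e_j M over K[x_j]/(x_j^(D j)): the identity of e_j
    M is the average of a K-linear map. *)
Definition free M := forall j, exists rho : {linear kmod M -> kmod M}, forall m : M,
 \sum_(q < D j) x j ^+ q *: (rho (x j ^+ (D j - 1 - q) *: m) : M) = e j *: m.

Section Extension.
Variables (M N Z : lmodType A) (i : {linear M -> Z}) (p : {linear Z -> N}).
Hypotheses (iI : injective i) (pS : surjective_fun p) (ex : exact_at i p).
Variables (d : nat) (h : {linear kmod Z -> 'rV[K]_d}) (g : {linear 'rV[K]_d -> kmod Z}).
Hypotheses (hK : cancel h g) (gK : cancel g h).
Notation R := 'M[K]_d.
Notation op := (op h g).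
Variables (E X : 'I_n -> R) (B : 'I_n -> 'I_n -> nat -> R).
Hypotheses (hE : forall j (v : Z), op (E j) v = e j *: v) (hX : forall j (v : Z), op (X j) v = x j *: v)
 (hB : forall j l b (v : Z), op (B j l b) v = a j l b *: v).
Let oM := opM gK. Let oI := op_inj gK. Let o1 := op1 hK.

Lemma hXk j k (v : Z) : op (X j ^+ k) v = x j ^+ k *: v.
by rewrite (op_iter hK gK); elim: k => [|k IHk] /=; rewrite ?scale1r // IHk hX exprS scalerA. Qed.
Lemma E_E j l : E j * E l = if j == l then E l else 0.
apply: oI => v; rewrite oM !hE scalerA (pr_ee P).
by case: eqP => _; rewrite ?hE // op0 scale0r.
Qed.
Lemma sumE : \sum_j E j = 1.
apply: oI => v; rewrite op_sum o1 -[RHS](scale1r (v : Z)) -(pr_e1 P) scaler_suml.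
by apply: eq_bigr => j _; rewrite hE.
Qed.
Lemma E_X j : E j * X j = X j. by apply: oI => v; rewrite oM hX hE scalerA (pr_ex P) -hX. Qed.
Lemma X_E j : X j * E j = X j. by apply: oI => v; rewrite oM hX hE scalerA (pr_xe P) -hX. Qed.
Lemma E_B j l b : E j * B j l b = B j l b. by apply: oI => v; rewrite oM !hB hE scalerA (pr_ea P). Qed.
Lemma B_E j l b : B j l b * E l = B j l b. by apply: oI => v; rewrite oM !hB hE scalerA (pr_ae P). Qed.
Lemma X_0 j : X j ^+ D j = 0.
by apply: oI => v; rewrite hXk (pr_nil P) op0 scale0r. Qed.
Lemma X_B j l b : valid j l b -> X j ^+ f l j * B j l b = B j l b * X l ^+ f j l.
by move=> v; apply: oI => w; rewrite !oM hXk !hB hXk !scalerA (pr_com P v). Qed.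

Definition quad (L : 'I_n -> 'I_n -> nat -> R) j : R := \sum_(l | Om_bar Om l j) \sum_(b < G j l) \sum_(k < f l j)
 sg j l *: (X j ^+ k * (L j l b * L l j b) * X j ^+ (f l j - 1 - k)).
Lemma quad0 j : quad B j = 0.
apply: oI => v; rewrite op0 -[RHS](scale0r (v : Z)) -(pr_mesh P j) scaler_suml op_sum.
apply: eq_bigr => l _; rewrite scaler_suml op_sum; apply: eq_bigr => b _; rewrite scaler_suml op_sum.
apply: eq_bigr => k _; rewrite opZ !oM !hXk !hB /mesh_term kscaleE -!scalerA.
by [].
Qed.
Lemma quadD L th j : (forall k l b, valid k l b -> th k l b * th l k b = 0) ->
 quad (fun k l b => L k l b + th k l b) j = quad L j + mesh C Om X L th j.
move=> tt; rewrite -big_split /=; apply: eq_bigr => l lj; rewrite -big_split /=; apply: eq_bigr => b _.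
rewrite -big_split /=; apply: eq_bigr => k _; rewrite -scalerDr -mulrDl -mulrDr; congr (_ *: _); congr (_ * _ * _).
have v : valid j l b by rewrite /valid Om_barC lj ltn_ord.
by rewrite mulrDl !mulrDr tt // addr0 addrA.
Qed.

Variable pi : R.
Hypotheses (pp : pi * pi = pi) (pE : forall j, pi * E j = E j * pi) (pX : forall j, pi * X j = X j * pi).
Hypotheses (ppi : forall v : Z, p (op pi v) = p v) (pii : forall m, op pi (i m : Z) = 0).
Variable q : R.
Hypothesis q_def : q = 1 - pi.
Let pq : pi * q = 0. by rewrite q_def mulrBr mulr1 pp subrr. Qed.
Let qp : q * pi = 0. by rewrite q_def mulrBl mul1r pp subrr. Qed.
Let qq : q * q = q. by rewrite {1}q_def mulrBl pq mul1r subr0. Qed.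
Let qE j : q * E j = E j * q. by rewrite q_def mulrBl mulrBr pE mul1r mulr1. Qed.
Let qX j : q * X j = X j * q. by rewrite q_def mulrBl mulrBr pX mul1r mulr1. Qed.
Let qpE : q + pi = 1. by rewrite q_def subrK. Qed.
Lemma pi_ker (v : Z) : p v = 0 -> op pi v = 0.
by move=> /ex[m <-]. Qed.
Lemma q_im (v : Z) : exists m, i m = op q v.
by apply/ex; rewrite q_def opD opN o1 linearB ppi subrr. Qed.
Lemma pBq j l b : pi * B j l b * q = 0.
apply: oI => v; rewrite !oM op0 hB; have [m <-] := q_im v.
by rewrite -linearZ_LR pii.
Qed.
(** As i(M) is a submodule, the arrows of Z are block triangular for pi: the diagonal part [Bd] is
    the action on the direct sum of M and N, and [xi] is the cocycle of the extension. *)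
Let Bd j l b := pi * B j l b * pi + q * B j l b * q.
Let xi j l b := q * B j l b * pi.
Let BE j l b : B j l b = Bd j l b + xi j l b.
rewrite -[LHS]mulr1 -[LHS]mul1r -qpE !(mulrDr, mulrDl) !mulrA pBq.
by rewrite ?addr0 ?add0r /Bd /xi [LHS]addrC addrA.
Qed.
Let Bdp j l b : pi * Bd j l b = Bd j l b * pi.
by rewrite /Bd mulrDr mulrDl !mulrA pp pq mul0r mul0r addr0 -!mulrA qp pp !mulr0 addr0. Qed.
Let sand_E (u w : R) j l b : (forall k, u * E k = E k * u) -> (forall k, w * E k = E k * w) ->
 E j * (u * B j l b * w) = u * B j l b * w /\ (u * B j l b * w) * E l = u * B j l b * w.
move=> uE wE; split; first by rewrite !mulrA -uE -(mulrA u) E_B.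
by rewrite -mulrA wE mulrA -(mulrA u) B_E.
Qed.
Let sand_X (u w : R) j l b : (forall k, u * X k = X k * u) -> (forall k, w * X k = X k * w) -> valid j l b ->
 X j ^+ f l j * (u * B j l b * w) = (u * B j l b * w) * X l ^+ f j l.
move=> uX wX v.
have uXk k : X j ^+ k * u = u * X j ^+ k by apply/esym/(commrX k (_ : GRing.comm _ _)).
have wXk k : X l ^+ k * w = w * X l ^+ k by apply/esym/(commrX k (_ : GRing.comm _ _)).
by rewrite !mulrA uXk -(mulrA u) X_B // -!mulrA wXk.
Qed.
Let Bd_E j l b : E j * Bd j l b = Bd j l b /\ Bd j l b * E l = Bd j l b.
have [h1 h2] := sand_E j l b pE pE; have [h3 h4] := sand_E j l b qE qE.
by rewrite /Bd mulrDr mulrDl h1 h2 h3 h4.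
Qed.
Let Bd_X j l b : valid j l b -> X j ^+ f l j * Bd j l b = Bd j l b * X l ^+ f j l.
by move=> v; rewrite /Bd mulrDr mulrDl !sand_X. Qed.
Let quadBd j : quad Bd j = 0.
rewrite -[RHS](_ : pi * quad B j * pi + q * quad B j * q = 0); last by rewrite quad0 !(mulr0, mul0r) addr0.
rewrite /quad !(mulr_sumr, mulr_suml) -big_split /=; apply: eq_bigr => l lj.
rewrite !(mulr_sumr, mulr_suml) -big_split /=; apply: eq_bigr => b _.
rewrite !(mulr_sumr, mulr_suml) -big_split /=; apply: eq_bigr => k _.
rewrite !(mZr, mZl) -scalerDr; congr (_ *: _).
have pXk r : pi * X j ^+ r = X j ^+ r * pi by apply: (commrX r (_ : GRing.comm _ _)).
have qXk r : q * X j ^+ r = X j ^+ r * q by apply: (commrX r (_ : GRing.comm _ _)).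
have -> : pi * (X j ^+ k * (B j l b * B l j b) * X j ^+ (f l j - 1 - k)) * pi = X j ^+ k * (pi * (B j l b * B l j b) * pi) * X j ^+ (f l j - 1 - k).
 by rewrite -!mulrA -pXk !mulrA pXk.
have -> : q * (X j ^+ k * (B j l b * B l j b) * X j ^+ (f l j - 1 - k)) * q = X j ^+ k * (q * (B j l b * B l j b) * q) * X j ^+ (f l j - 1 - k).
 by rewrite -!mulrA -qXk !mulrA qXk.
rewrite -mulrDl -mulrDr; congr (_ * _ * _).
have e1 : pi * B j l b * pi * (pi * B l j b * pi) = pi * (B j l b * B l j b) * pi.
 have -> : pi * (B j l b * B l j b) * pi = pi * B j l b * (q + pi) * (B l j b * pi) by rewrite qpE mulr1 !mulrA.
 by rewrite mulrDr pBq add0r !mulrA -(mulrA _ pi pi) pp.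
have e2 : q * B j l b * q * (q * B l j b * q) = q * (B j l b * B l j b) * q.
 have -> : q * (B j l b * B l j b) * q = q * B j l b * ((q + pi) * B l j b * q) by rewrite qpE mul1r !mulrA.
 by rewrite !mulrDl pBq addr0 !mulrA -(mulrA _ q q) qq.
rewrite /Bd mulrDl !mulrDr e1 e2 -(mulrA _ pi (q * _ * _)) -(mulrA _ q (pi * _ * _)).
by rewrite !mulrA -(mulrA _ pi q) pq mulr0 !mul0r -(mulrA _ q pi) qp mulr0 !mul0r addr0 add0r.
Qed.

Variables (sg0 : {linear kmod N -> kmod Z}) (r : {linear kmod Z -> kmod M}).
Hypotheses (sgP : forall v : Z, sg0 (p v) = op pi v) (rP : forall v : Z, i (r v) = op q v).

Lemma r_act (v : Z) (b : A) (u : R) : (forall v : Z, op u v = b *: v) -> u * q = q * u -> r (op u v) = b *: (r v : M).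
by move=> uE uq; apply: iI; rewrite linearZ_LR !rP -uE -!oM uq. Qed.
Lemma r_aB (v : Z) j l b : r (op (Bd j l b) v) = a j l b *: (r v : M).
apply: iI; rewrite linearZ_LR !rP -hB -!oM; congr (op _ v).
by rewrite /Bd mulrDr !mulrA qp qq !mul0r add0r -[RHS]mul1r -qpE mulrDl !mulrA pBq addr0.
Qed.

Hypothesis split0 : ext_split N M.
(** A cocycle [th] in the direction from M to N deforms the diagonal arrows into a module structure
    W on the same space, with submodule N and quotient M. It splits by hypothesis, and the splitting
    writes [th] as a coboundary. *)
Lemma cobound th : (forall j l b, valid j l b -> [/\ E j * th j l b = th j l b, th j l b * E l = th j l b,
  pi * th j l b = th j l b, th j l b * pi = 0 & X j ^+ f l j * th j l b = th j l b * X l ^+ f j l]) ->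
 (forall j, mesh C Om X Bd th j = 0) -> exists eta, [/\ forall j, E j * eta = eta * E j, forall j, X j * eta = eta * X j, pi * eta = eta, eta * pi = 0 &
  forall j l b, valid j l b -> th j l b = Bd j l b * eta - eta * Bd j l b].
move=> thP thm; pose L j l b := Bd j l b + th j l b.
have thq j l b : valid j l b -> th j l b * q = th j l b /\ q * th j l b = 0.
 by move=> /thP[_ _ h3 h4 _]; rewrite q_def mulrBl mulrBr h3 h4 mul1r mulr1 subr0 subrr.
have [W [k [kB kL kE kX kA]]] : exists (W : lmodType A) (k : kmod Z -> W), [/\ bijective k,
 forall c u v, k (c *: u + v) = (pzscal c : A) *: k u + k v, forall j v, k (op (E j) v) = e j *: k v, forall j v, k (op (X j) v) = x j *: k v
 & forall j l b v, valid j l b -> k (op (L j l b) v) = a j l b *: k v].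
 apply: (pr_univ P (E := fun j => op (E j)) (X := fun j => op (X j)) (L := fun j l b => op (L j l b))).
 - by move=> j l v; rewrite -oM E_E; case: eqP => // _; rewrite op0.
 - by move=> v; rewrite -op_sum sumE o1.
 - by move=> j v; rewrite -oM E_X.
 - by move=> j v; rewrite -oM X_E.
 - by move=> j l b v vl; have [h1 _ _ _ _] := thP _ _ _ vl; rewrite -oM mulrDr h1 (Bd_E _ _ _).1.
 - by move=> j l b v vl; have [_ h1 _ _ _] := thP _ _ _ vl; rewrite -oM mulrDl h1 (Bd_E _ _ _).2.
 - by move=> j v; rewrite -(op_iter hK gK) X_0 op0.
 - move=> j l b v vl; have [_ _ _ _ h1] := thP _ _ _ vl.
  by rewrite -!(op_iter hK gK) -!oM mulrDr mulrDl h1 Bd_X.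
 move=> j v; transitivity (op (quad L j) v).
  rewrite op_sum; apply: eq_bigr => l lj; rewrite op_sum; apply: eq_bigr => b _; rewrite op_sum.
  by apply: eq_bigr => c _; rewrite -!(op_iter hK gK) opZ -!oM !mulrA.
 rewrite /L quadD ?quadBd ?thm ?addr0 ?op0 // => c l b vl. have [t1 _] := thq _ _ _ vl; have /thq[_ t2] : valid l c b by rewrite validC.
 have [_ _ h3 _ _] := thP _ _ _ vl; have /thP[_ _ h4 _ _] : valid l c b by rewrite validC. by rewrite -t1 -mulrA t2 mulr0.
have kl : linear (k : kmod Z -> kmod W) by move=> c u v; exact: kL.
pose k1 := mkL kl; have [k' [kK k'K]] : exists k' : {linear kmod W -> kmod Z}, cancel k1 k' /\ cancel k' k1.
 by apply: linear_inv.
have LP v j l b : valid j l b -> r (op (L j l b) v) = a j l b *: (r v : M).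
 move=> vl; rewrite opD linearD -[RHS]addr0 r_aB; congr (_ + _); apply: iI. by rewrite rP -oM (thq _ _ _ vl).2 op0 linear0.
have [i' iE] : exists i' : {linear N -> W}, forall v, i' v = k (sg0 v).
 apply: (gen_linear P (h := k1 \o sg0 : {linear _ -> _})) => [j m|j m|j l b m vl]; have [v <-] := pS m.
 - by rewrite /= -linearZ_LR !sgP -kE -hE -!oM pE.
 - by rewrite /= -linearZ_LR !sgP -kX -hX -!oM pX. rewrite /= -linearZ_LR !sgP -kA // -hB -!oM; congr (k (op _ v)). have [_ _ _ h4 _] := thP _ _ _ vl.
 rewrite mulrDl h4 addr0 -Bdp /Bd mulrDr !mulrA pp pq !mul0r addr0. by rewrite -[LHS]mulr1 -qpE mulrDr pBq add0r.
have [p' pE'] : exists p' : {linear W -> M}, forall w, p' w = r (k' w).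
 apply: (gen_linear P (h := r \o k' : {linear _ -> _})) => [j m|j m|j l b m vl] /=; rewrite -[m]k'K -/k1.
 - by rewrite /= -kE -/(k1 _) !kK (r_act _ (hE j)) // qE.
 - by rewrite /= -kX -/(k1 _) !kK (r_act _ (hX j)) // qX. by rewrite /= -kA // -/(k1 _) !kK LP.
have k0 z : k1 z = 0 -> z = 0 by move=> kz; rewrite -(kK z) kz linear0.
have [|||s sP] := split0 (i := i') (p := p').
- apply/inj_ker => v; rewrite iE -/(k1 _) => /k0; have [z <-] := pS v.
 by rewrite sgP => z0; rewrite -ppi z0 linear0.
- move=> m; exists (k1 (i m : Z)); rewrite pE' kK; apply: iI.
 by rewrite rP q_def opD opN o1 pii subr0.
- move=> y; rewrite pE' -(k'K y); move: (k' y) => z; rewrite kK; split=> [rz|[v vE]].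
  exists (p z); rewrite iE sgP -[RHS]/(k z); congr (k _); have := rP z; rewrite rz linear0 q_def opD opN o1. by move/esym/eqP; rewrite subr_eq0 => /eqP.
 rewrite -[z]kK -vE iE -/(k1 _) kK; have [u <-] := pS v; apply: iI. by rewrite rP sgP -oM qp op0 linear0.
(* The splitting read as an operator on Z: it intertwines the diagonal arrows with the deformed ones
   and satisfies q S = q, so eta = q - S has coboundary [th]. *)
have [S SE] := op_surj hK (k' \o (mkL (kmap_linear s) \o r) : {linear kmod Z -> kmod Z}).
have rS v : r (op S v) = r v by rewrite SE /= -pE' sP.
have qS : q * S = q by apply: oI => v; rewrite oM -!rP rS.
have Sq : S * q = S.
 by apply: oI => v; rewrite oM !SE /=; congr (k' (s _)); apply: iI; rewrite !rP -oM qq.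
have k'E u (b : A) : (forall v, k (op u v) = b *: k v) -> forall w, op u (k' w) = k' (b *: w).
 by move=> kb w; rewrite -[w in RHS]k'K -[k1 _]/(k _) -kb -/(k1 _) kK.
have SEc j : E j * S = S * E j.
 by apply: oI => v; rewrite !oM !SE /= (k'E _ _ (kE j)) (r_act _ (hE j)) ?qE // linearZ_LR.
have SXc j : X j * S = S * X j.
 by apply: oI => v; rewrite !oM !SE /= (k'E _ _ (kX j)) (r_act _ (hX j)) ?qX // linearZ_LR.
have LS j l b : valid j l b -> L j l b * S = S * Bd j l b.
 move=> v; apply: oI => w; rewrite !oM !SE /= (k'E _ (a j l b)) => [|z]; last exact: kA. by rewrite r_aB linearZ_LR.
have pS' : pi * S = S - q by rewrite -[in RHS](mul1r S) -qpE mulrDl qS addrAC subrr add0r.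
exists (q - S); split=> [j|j|||j l b v].
- by rewrite mulrBr mulrBl SEc qE.
- by rewrite mulrBr mulrBl SXc qX.
- by rewrite mulrBr pq pS' sub0r opprB.
- by rewrite mulrBl qp -Sq -mulrA qp mulr0 subr0.
have := LS _ _ _ v; rewrite mulrDl => E1.
have -> : th j l b = S * Bd j l b - Bd j l b * S.
 by rewrite -E1 addrAC subrr add0r -(thq _ _ _ v).1 -mulrA qS.
rewrite mulrBr mulrBl opprB; have -> : Bd j l b * q = q * Bd j l b.
 by rewrite q_def mulrBl mulrBr Bdp mul1r mulr1.
by rewrite [RHS]addrC addrA subrK.
Qed.

(** [dual_ext] yields z whose coboundary is the cocycle xi; subtracting z from the loop-linear
    projection pi makes it commute with the arrows as well. *)
Lemma split_of_dual : (forall j eta, E j * eta = eta -> eta * E j = eta -> pi * eta = eta -> eta * pi = 0 ->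
  X j * eta = eta * X j -> exists y, eta = avg (D j) (X j) (X j) y) ->
 (forall j l b y, valid j l b -> E j * y = y -> y * E l = y -> pi * y = 0 -> y * pi = y ->
  X j ^+ f l j * y = y * X l ^+ f j l -> exists z, y = avg (Ck C D j l) (X j ^+ f l j) (X l ^+ f j l) z) ->
 exists s : {linear N -> Z}, forall m, p (s m) = m.
move=> fr0 fr1.
have xiP j l b : valid j l b -> [/\ E j * xi j l b = xi j l b, xi j l b * E l = xi j l b,
  pi * xi j l b = 0, xi j l b * pi = xi j l b & X j ^+ f l j * xi j l b = xi j l b * X l ^+ f j l].
 move=> v; have [h1 h2] := sand_E j l b qE pE; split=> //; last exact: sand_X.
  by rewrite /xi !mulrA pq !mul0r.
 by rewrite /xi -mulrA pp.
have xi_mesh j : mesh C Om X Bd xi j = 0.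
 rewrite -[RHS](quad0 j) -[LHS]add0r -(quadBd j) -quadD => [|k l b v]; last first.
  by rewrite /xi -!mulrA (mulrA pi q) pq mul0r !mulr0.
 apply: eq_bigr => l _; apply: eq_bigr => b _; apply: eq_bigr => k _; by rewrite -!BE.
have [z [[z1 z2 z3 z4] zE]] := dual_ext hD hO E_E E_X X_E (fun j l b _ => (Bd_E j l b).1)
 (fun j l b _ => (Bd_E j l b).2) X_0 Bd_X pp pE pX (fun j l b _ => Bdp j l b) cobound fr0 fr1 xiP xi_mesh.
pose psi := pi - z.
have psiB j l b : valid j l b -> B j l b * psi = psi * B j l b.
 move=> v; rewrite BE /psi; have := zE _ _ _ v; have [_ _ + + _] := xiP _ _ _ v; have := Bdp j l b. move: (Bd j l b) (xi j l b) => U Y pU pY Yp YE.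
 have Yz : Y * z = 0 by rewrite -Yp -mulrA z3 mulr0. have zY : z * Y = 0 by rewrite -z4 -mulrA pY mulr0.
 rewrite mulrDl !mulrBr mulrBl !mulrDr Yp Yz pY zY subr0 !addr0 pU. by rewrite {1}YE addrA subrK.
have psiC : exists t : {linear Z -> Z}, forall v, t v = op psi v.
 apply: (gen_linear P (h := op psi)) => [j v|j v|j l b v vl].
 - by rewrite -!hE -!oM mulrBl mulrBr pE z1.
 - by rewrite -!hX -!oM mulrBl mulrBr pX z2. by rewrite -!hB -!oM psiB.
have [t tE] := psiC.
have [s sE] : exists s : {linear N -> Z}, forall v, s (p v) = t v.
 apply: fact_surj pS _ => v /pi_ker v0; rewrite tE /psi opD opN v0 -z4 oM v0 linear0 subrr //.
exists s => m; have [v <-] := pS m; rewrite sE tE /psi opD opN linearB ppi.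
rewrite -[p (op z v)]ppi -oM z3 op0 linear0 subr0 //.
Qed.
End Extension.

Lemma avg_sum (R : pzRingType) (I : Type) (r : seq I) (F : I -> R) k u v :
 avg k u v (\sum_(t <- r) F t) = \sum_(t <- r) avg k u v (F t).
rewrite /avg exchange_big; apply: eq_bigr => q _ /=.
by rewrite mulr_sumr mulr_suml.
Qed.
Lemma avg_avg (R : pzRingType) l k (u v z : R) : (0 < l)%N ->
 avg (l * k) u v z = avg k (u ^+ l) (v ^+ l) (avg l u v z).
move=> l0; rewrite avg_mul // [avg l u v z]/avg avg_sum; apply: eq_bigr => q _.
have c w (s t : nat) : w ^+ s * w ^+ t = w ^+ t * w ^+ s :> R by rewrite -!exprD addnC.
by rewrite (avg_tailr _ _ _ (c v _ _)) (avg_taill _ _ _ (c u _ _)).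
Qed.

(** Freeness of M or N improves a K-linear splitting of the extension to one compatible with
    vertices and loops, and makes all maps through that module averages; then [split_of_dual]
    applies. *)
Lemma sym_ext M N : fin_dim M -> fin_dim N -> free M \/ free N -> ext_split N M -> ext_split M N.
move=> fM fN fr sp Z i p iI pS ex.
have /fin_dimP[d [h /linear_inv[g [hK gK]]]] := fin_dim_ses iI pS ex fM fN.
have iI' : injective (kmap i) by exact: iI.
have pi0 m : p (i m) = 0 by apply/ex; exists m.
have /choice[E hE] : forall j, exists u, forall v : Z, op h g u v = e j *: v.
 by move=> j; apply: (op_surj hK (opL Z (e j))).
have /choice[X hX] : forall j, exists u, forall v : Z, op h g u v = x j *: v.
 by move=> j; apply: (op_surj hK (opL Z (x j))).
have /choice[B0 hB0] : forall t : 'I_n * 'I_n * nat, exists u, forall v : Z, op h g u v = a t.1.1 t.1.2 t.2 *: v.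
 by move=> t; apply: (op_surj hK (opL Z (a t.1.1 t.1.2 t.2))).
pose B j l b := B0 (j, l, b); have hB j l b (v : Z) : op h g (B j l b) v = a j l b *: v by exact: hB0.
pose oM := opM gK; pose oI := op_inj gK; pose o1 := op1 hK.
pose hXk := hXk hK gK hX; pose EE := E_E gK hE; pose EX := E_X gK hE hX; pose XE := X_E gK hE hX.
have av j u (v : Z) : op h g (avg (D j) (X j) (X j) u) v =
  \sum_(k < D j) x j ^+ k *: (op h g u (x j ^+ (D j - 1 - k) *: v) : Z).
 by rewrite op_sum; apply: eq_bigr => k _; rewrite !oM !hXk.
have EE1 j : E j * E j = E j by rewrite EE eqxx.
(* Averaging over the loops at each vertex, then cutting to diagonal vertex blocks, yields an
   operator commuting with all e_j and x_j. *)
pose S (R : 'I_n -> 'M[K]_d) := \sum_j E j * avg (D j) (X j) (X j) (R j) * E j.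
have ES R j : E j * S R = E j * avg (D j) (X j) (X j) (R j) * E j.
 rewrite mulr_sumr (bigD1 j) //= big1 ?addr0 => [|l lj]; first by rewrite !mulrA EE1. by rewrite !mulrA EE eq_sym (negbTE lj) !mul0r.
have SE R j : S R * E j = E j * avg (D j) (X j) (X j) (R j) * E j.
 rewrite mulr_suml (bigD1 j) //= big1 ?addr0 => [|l lj]; first by rewrite -!mulrA EE1. by rewrite -!mulrA EE (negbTE lj) !mulr0.
have X0 j := X_0 hK gK hX j.
have SX R j : S R * X j = X j * S R.
 have aX : X j * avg (D j) (X j) (X j) (R j) = avg (D j) (X j) (X j) (R j) * X j by apply: avg_com; rewrite X0 mul0r mulr0.
 rewrite -[in LHS](EX j) mulrA SE -[in RHS](XE j) -(mulrA _ (E j) (S R)) ES. by rewrite -!mulrA EX -aX !mulrA EX XE aX -mulrA XE.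
have S_op R (v : Z) : op h g (S R) v = \sum_j e j *: (op h g (avg (D j) (X j) (X j) (R j)) (e j *: v) : Z).
 by rewrite op_sum; apply: eq_bigr => j _; rewrite !oM !hE.
have sumeZ (L : lmodType A) (v : L) : \sum_j e j *: v = v by rewrite -scaler_suml (pr_e1 P) scale1r.
have ee j (L : lmodType A) (v : L) : e j *: (e j *: v) = e j *: v by rewrite scalerA (pr_ee P) eqxx.
suff [pi [q [q_def [pp pE pX ppi pii] [fr0 fr1]]]] : exists pi q, [/\ q = 1 - pi,
  [/\ pi * pi = pi, forall j, pi * E j = E j * pi, forall j, pi * X j = X j * pi, forall v : Z, p (op h g pi v) = p v &
    forall m, op h g pi (i m : Z) = 0] &
  (forall j eta, E j * eta = eta -> eta * E j = eta -> pi * eta = eta -> eta * pi = 0 ->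
   X j * eta = eta * X j -> exists y, eta = avg (D j) (X j) (X j) y) /\
  (forall j l b y, valid j l b -> E j * y = y -> y * E l = y -> pi * y = 0 -> y * pi = y ->
   X j ^+ f l j * y = y * X l ^+ f j l -> exists z, y = avg (Ck C D j l) (X j ^+ f l j) (X l ^+ f j l) z)].
 have [sg0 sgP] : exists sg0 : {linear kmod N -> kmod Z}, forall v : Z, sg0 (kmap p v) = op h g pi v.
  by apply: (fact_surj (f := kmap p) (g := op h g pi)) => [|v /ex[m <-]].
 have [r rP] : exists r : {linear kmod Z -> kmod M}, forall v : Z, kmap i (r v) = op h g q v.
  by apply: (fact_inj (f := kmap i) (g := op h g q)) => // v; apply: (q_im ex hK ppi q_def).
 exact: (split_of_dual iI pS ex hK gK hE hX hB pp pE pX ppi pii q_def sgP rP sp fr0 fr1).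
have avf j l b u (v : valid j l b) : avg (D j) (X j) (X j) u = avg (Ck C D j l) (X j ^+ f l j) (X j ^+ f l j) (avg (f l j) (X j) (X j) u).
 have /andP[jl _] := v; rewrite -avg_avg ?(CkE hD hO jl) // (Cartan_f_gt0 hO) // Om_barC //.
have avf' j l b u (v : valid j l b) : avg (D l) (X l) (X l) u = avg (Ck C D j l) (X l ^+ f j l) (X l ^+ f j l) (avg (f j l) (X l) (X l) u).
 have /andP[jl _] := v; have v' : valid l j b by rewrite validC. rewrite (CkC hD hO jl); exact: (avf l j b u v').
case: fr => [/dchoice[rho rhoP]|/dchoice[rho rhoP]].
(* When M is free, averaging rho after a K-linear retraction r0 gives a projection q onto i(M)
   compatible with the loops. *)
- have [r0 r0P] : exists r0 : {linear kmod Z -> kmod M}, forall m, r0 (i m) = m.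
  have fK : fd (kmod M) by apply/fin_dimP. have fZ : fd (kmod Z) by exists d, h; exists g.
  have [r0 r0P] := gen_inv (kmap i) fK fZ; exists r0 => m; apply: iI; exact: r0P.
 have /choice[R RP] : forall j, exists u, forall v : Z, op h g u v = i (rho j (r0 v)).
  by move=> j; apply: (op_surj hK (kmap i \o (rho j \o r0) : {linear _ -> _})).
 pose q := S R. have avi j m : op h g (avg (D j) (X j) (X j) (R j)) (i m) = i (e j *: m).
  rewrite av -rhoP linear_sum; apply: eq_bigr => k _ /=. by rewrite RP -!linearZ_LR r0P.
 have qi m : op h g q (i m) = i m.
  rewrite S_op -[in RHS](sumeZ _ m) linear_sum; apply: eq_bigr => j _. by rewrite -linearZ_LR avi ee -linearZ_LR ee.
 have iq (v : Z) : exists m, i m = op h g q v.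
  apply/ex; rewrite S_op linear_sum big1 // => j _; rewrite linearZ_LR av linear_sum big1 ?scaler0 // => k _. by rewrite linearZ_LR RP pi0 scaler0.
 have qq : q * q = q by apply: oI => v; rewrite oM; have [m <-] := iq v; rewrite qi. have qE j : q * E j = E j * q by rewrite SE ES.
 have avq j : avg (D j) (X j) (X j) (R j) * q = E j * q.
  by apply: oI => v; rewrite !oM; have [m <-] := iq v; rewrite avi hE linearZ_LR.
 have qXk j k : X j ^+ k * q = q * X j ^+ k by apply/esym/(commrX k (_ : GRing.comm _ _))/SX. exists (1 - q), q; split; first by rewrite opprB addrC subrK.
  split=> [|j|j|v|m].
  - by rewrite mulrBl mul1r mulrBr mulr1 qq subrr subr0.
  - by rewrite mulrBl mulrBr mul1r mulr1 qE.
  - by rewrite mulrBl mulrBr mul1r mulr1 SX.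
  - by rewrite opD opN o1 linearB; have [m <-] := iq v; rewrite pi0 subr0. by rewrite opD opN o1 qi subrr.
 split=> [j eta h1 h2 h3 h4 h5|j l b y v h1 h2 h3 h4 h5].
  have hq : eta * q = eta by apply/eqP; rewrite eq_sym -subr_eq0 -{1}[eta]mulr1 -mulrBr h4.
  (* Since eta = eta q and q is an average at j, sliding eta, which commutes with x_j, under the sum
     presents eta as an average. *)
  exists (eta * R j * q); rewrite (avg_tailr _ _ _ (esym (qXk j 1%N))) (avg_taill _ _ _ h5). by rewrite -mulrA avq mulrA h2 hq.
 have hq : q * y = y by apply/eqP; rewrite eq_sym -subr_eq0 -{1}[y]mul1r -mulrBl h3.
 have E1 : q * y * X l ^+ f j l = X j ^+ f l j * (q * y) by rewrite hq h5. exists (avg (f l j) (X j) (X j) (R j) * (q * y)); rewrite (avg_tailr _ _ _ E1).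
 by rewrite -(avf j l b) // mulrA avq -mulrA hq h1.
(* When N is free, the same is done with a K-linear section s0, and pi itself is the average. *)
have [s0 s0P] : exists s0 : {linear kmod N -> kmod Z}, forall v, p (s0 v) = v.
 have fK : fd (kmod N) by apply/fin_dimP. have fZ : fd (kmod Z) by exists d, h; exists g.
 have [s0 s0P] := gen_inv (kmap p) fZ fK; exists s0 => v; have [u <-] := pS v; exact: s0P.
have /choice[R RP] : forall j, exists u, forall v : Z, op h g u v = s0 (rho j (p v)).
 by move=> j; apply: (op_surj hK (s0 \o (rho j \o kmap p) : {linear _ -> _})).
pose pi := S R.
have pav j (v : Z) : p (op h g (avg (D j) (X j) (X j) (R j)) v) = e j *: p v.
 rewrite av -rhoP linear_sum; apply: eq_bigr => k _ /=. by rewrite linearZ_LR RP s0P linearZ_LR.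
have ppi (v : Z) : p (op h g pi v) = p v.
 rewrite S_op linear_sum -[in RHS](sumeZ _ (p v)); apply: eq_bigr => j _. by rewrite linearZ_LR pav linearZ_LR !ee.
have pii m : op h g pi (i m : Z) = 0.
 rewrite S_op big1 // => j _; rewrite av big1 ?scaler0 // => k _. by rewrite RP !linearZ_LR pi0 !scaler0 !linear0 scaler0.
have pik (v w : Z) : p v = p w -> op h g pi v = op h g pi w.
 move=> vw; have /ex[m mE] : p (v - w) = 0 by rewrite linearB vw subrr. by apply/eqP; rewrite -subr_eq0 -linearB -mE pii.
have pp : pi * pi = pi by apply: oI => v; rewrite oM; apply: pik; exact: ppi.
have pE j : pi * E j = E j * pi by rewrite SE ES.
have pav' j : pi * avg (D j) (X j) (X j) (R j) = pi * E j.
 by apply: oI => v; rewrite !oM; apply: pik; rewrite pav hE linearZ_LR.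
exists pi, (1 - pi); split=> //; first by split=> // j; rewrite SX.
split=> [j eta h1 h2 h3 h4 h5|j l b y v h1 h2 h3 h4 h5].
 exists (pi * R j * eta); rewrite (avg_tailr _ _ _ (esym h5)) (avg_taill _ _ _ (esym (SX R j))). by rewrite pav' -mulrA h1 h3.
have E1 : X j ^+ f l j * (y * pi) = y * pi * X l ^+ f j l by rewrite h4 h5.
exists (y * pi * avg (f j l) (X l) (X l) (R l)); rewrite (avg_taill _ _ _ E1).
by rewrite -(avf' j l b) // -mulrA pav' mulrA h4 h2.
Qed.
End Symmetry.

(** * Local freeness of Pi/I_w *)

Section Freeness.
Variables (K : fieldType) (n : nat) (C : 'M[int]_n) (D : 'I_n -> nat).
Variable Om : {set 'I_n * 'I_n}.
Hypotheses (hC : is_GCM C) (hD : is_symmetrizer C D) (hO : is_orientation C Om).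
Notation f := (Cartan_f C).
Notation valid := (valid_arrow C Om).
Notation sg := (sg K Om).
Variables (A : pzAlgType K) (e x : 'I_n -> A) (a : 'I_n -> 'I_n -> nat -> A).
Hypothesis P : presentation C D Om e x a.
Implicit Types M N : lmodType A.
Notation TM := (@TM K n A).
Hypothesis hP : is_Dynkin C D.
Notation ee := (ee P).
Notation Iw := (Iw e).
Notation prs := (prs e).
Notation legit := (legit hC hD hO P).
Notation Fs := (Fs hC hD hO P).
Notation Z0 := (@Z0 K A).
Notation free := (free D e x).

(** Local freeness as divisibility: over K[x]/(x^D) a module is free exactly when every element
    killed by x is a multiple of x^(D-1). *)
Definition lf M := forall j (m : M), e j *: m = m -> x j *: m = 0 -> exists m', m = x j ^+ (D j - 1) *: m'.

Lemma e_xX j k M (m : M) : e j *: (x j ^+ k *: m) = x j ^+ k *: (e j *: m).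
rewrite !scalerA; congr (_ *: _); apply: (commrX k (_ : GRing.comm _ _)).
by rewrite /GRing.comm (pr_ex P) (pr_xe P).
Qed.
Lemma lf_pow M j k (m : M) : lf M -> (k <= D j)%N -> e j *: m = m -> x j ^+ k *: m = 0 ->
 exists m', e j *: m' = m' /\ m = x j ^+ (D j - k) *: m'.
move=> lM; elim: k m => [|k IHk] m kD em xm.
 by exists 0; move: xm; rewrite expr0 scale1r => ->; rewrite !scaler0.
have [m1 m1E] : exists m', x j ^+ k *: m = x j ^+ (D j - 1) *: m'.
 by apply: lM; rewrite ?e_xX ?em // scalerA -exprS.
have en : e j *: (m - x j ^+ (D j - k.+1) *: (e j *: m1)) = m - x j ^+ (D j - k.+1) *: (e j *: m1).
 by rewrite scalerBr em e_xX ee eqxx.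
have [|m2 [em2 m2E]] := IHk _ (ltnW kD) en.
 rewrite scalerBr [x j ^+ k *: (_ *: _)]scalerA -exprD (_ : (k + (D j - k.+1))%N = (D j - 1)%N); last by lia. by rewrite -e_xX -m1E e_xX em subrr.
exists (e j *: m1 + x j *: m2); split.
 by rewrite scalerDr ee eqxx; congr (_ + _); rewrite scalerA (pr_ex P).
rewrite scalerDr [x j ^+ _ *: (x j *: _)]scalerA -exprSr (_ : (D j - k.+1).+1 = (D j - k)%N); last by lia.
by rewrite -m2E addrC subrK.
Qed.

Section Step.
Variables (i : 'I_n) (M : lmodType A) (m0 : M) (d : nat) (Z : lmodType A).
Variables (gw : {linear kmod M -> kmod Z}) (gv : TM M * (nat -> K^o) -> Z).
Hypotheses (em0 : e i *: m0 = m0) (xm0 : x i ^+ d *: m0 = 0) (dE : d = 0%N \/ d = D i).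
Hypotheses (sZ : isZ C Om e x a i m0 d gw gv) (lM : lf M).
Hypothesis sM : soc_free e x a i M.
Notation tl := (tl C Om e x i).
Notation out := (outL x a i).
Notation sh := (@sh K n A).
Notation ZS := (ZS C Om e x i M d).
Notation Zep := (Zep n M d).

Lemma gv_pow k v : v \in ZS -> x i ^+ k *: gv v = gv (iter k Zep v) /\ iter k Zep v \in ZS.
move=> vS; elim: k => [|k [IH1 IH2]]; first by rewrite expr0 scale1r.
by rewrite iterS exprS -scalerA IH1 (g_vx sZ) //; split=> //; apply: Zep_S.
Qed.
(** Local freeness passes to the neighbour space. If the shift kills y, only the entries b = 0
    survive and are killed by x_j^(f_ij), so they are divisible by x_j^(D j - f_ij). *)
Lemma sh_root (y : TM M) : y \in tl M -> sh M y = 0 -> exists2 z, z \in tl M & iter (D i - 1) (sh M) z = y.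
move=> yt y0; have D0 := D_gt0 hD i.
have /choice[z zP] : forall t : 'I_n * nat, exists m, valid i t.1 t.2 -> e t.1 *: m = m /\
  y (t.1, t.2, 0%N) = x t.1 ^+ (D t.1 - f i t.1) *: m.
 move=> [j g] /=; have [v|v] := boolP (valid i j g); last by exists 0.
 have /andP[ij _] := v; have f0 : (0 < f j i)%N by apply: (Cartan_f_gt0 hO); rewrite Om_barC.
 have fD : (f i j <= D j)%N by rewrite -(CkE' hD hO ij) leq_pmulr // (Ck_gt0 hD hO ij). have [||m [em mE]] := @lf_pow M j (f i j) (y (j, g, 0%N)) lM fD.
 - exact: (tl_e _ _ _ yt).
 - have := tl_shift j g 0 1 yt; rewrite muln1 add0n muln1 => <-.
  by rewrite -(prednK f0) -shE y0.
 by exists m.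
(* The quotients are placed at b = f_ji - 1, because D i - 1 = (f_ji - 1) + f_ji (k_ij - 1), so that
   D i - 1 shifts bring them to b = 0 multiplied by x_j^(D j - f_ij). *)
pose Y : TM M := fun t => if t.2 == (f t.1.1 i - 1)%N then z t.1 else 0.
exists (tl_ext C Om e x i Y); first exact: (tl_ext_tl hO P).
apply: tl_eq => [|||l h b v lb]; try exact: hO; [apply: iter_sh_tl; exact: (tl_ext_tl hO P) | exact: yt |].
have /andP[il _] := v; have f0 : (0 < f l i)%N by apply: (Cartan_f_gt0 hO); rewrite Om_barC.
have [k0 kE] := (Ck_gt0 hD hO il, CkE hD hO il).
have tY : tl_ext C Om e x i Y \in tl M by exact: (tl_ext_tl hO P).
rewrite iter_sh; case: b lb => [|b] lb.
 have -> : (0 + (D i - 1) = (f l i - 1) + f l i * (Ck C D i l - 1))%N by rewrite -kE; nia.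
 rewrite (tl_shift _ _ _ _ tY) tl_extE ?subn1 ?prednK // /Y /= subn1 eqxx. have [ez yz] := zP (l, h) v; rewrite ez yz /=.
 by have -> : (f i l * (Ck C D i l).-1 = D l - f i l)%N by rewrite -(CkE' hD hO il) -subn1 mulnBr muln1.
have -> : (b.+1 + (D i - 1) = b + f l i * Ck C D i l)%N by rewrite kE; lia.
rewrite (tl_shift _ _ _ _ tY) (CkE' hD hO il) (pr_nil P) scale0r.
by rewrite -[in RHS]shE y0.
Qed.
(** At [i] the reflected part is the neighbour space plus a free module, modulo out(e_i M).
    Socle-freeness makes [out] injective on e_i M, and a relation out(m) in the image of the shift
    is divided by x_i inside M. *)
Lemma lf_step : lf Z.
move=> l q ql xq; have [li|li] := eqVneq l i; last first.
 have [w [we qE]] := g_partl P sZ li ql; move: xq; rewrite qE (g_wx sZ) => /(g_w0 sZ) xw. have xl : x l *: w = 0.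
  have /eqP/negbTE il : i <> l by move=> il; rewrite il eqxx in li. by rewrite -xw -(pr_ex P l) scalerA mulrA (pr_ee P) il mul0r scale0r.
 have [w' wE] := lM we xl; exists (gw w'); rewrite wE. by elim: (D l - 1)%N => [|k IHk]; rewrite ?expr0 ?scale1r // !exprS -!scalerA -(g_wx sZ) IHk.
rewrite {l}li in ql xq *; have [[y h] /[dup] vS /ZSP[yt h0] qE] := g_parti P sZ ql.
have vS' := Zep_S vS.
move: xq; rewrite qE (g_vx sZ) // ZepE => /(g_v0 sZ); rewrite -ZepE => /(_ vS').
rewrite ZepE => /ZRP[m [mE hE]].
have D0 := D_gt0 hD i.
have [m' [em' m'E]] : exists m', e i *: m' = m' /\ e i *: m = x i *: m'.
 have := @lf_pow M i (D i - 1) (e i *: m) lM (leq_subr _ _); rewrite subKn // expr1; apply.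
  by rewrite ee eqxx.
 apply: sM; first by rewrite e_xX !ee eqxx. rewrite -iter_sh_out (out_e P) mE -iterSr. by rewrite subn1 prednK // (sh_nil hD hO P).
have [z zt zE] : exists2 z, z \in tl M & iter (D i - 1) (sh M) z = y - out M m'.
 apply: sh_root; first by apply: rpredB => //; apply: (out_tl P). by rewrite linearB -mE sh_out -m'E (out_e P) subrr.
have hh k : k.+1 != d -> h k = 0.
 move=> kd; have [dk|kd'] := leqP d k; first exact: h0. have /= := congr1 (fun u : nat -> K^o => u k.+1) hE. by rewrite ltn_neqAle kd kd' /= => ->.
(* The truncated shift kills h, so h is supported at d - 1; for d = D i it is the (D i - 1)-fold
   shift of a multiple of the generator. *)
pose v : TM M * (nat -> K^o) := if d is d'.+1 then (h d') *: (0, dta K 0) else 0.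
have vZ : v \in ZS /\ iter (D i - 1) Zep v = (0, h).
 case: dE => dE'; rewrite /v.
  rewrite dE'; split; first exact: rpred0. have -> : h = 0 by apply/funext => k; apply: hh; rewrite dE'.
  by elim: (D i - 1)%N => // k IHk; rewrite iterS IHk linear0.
 case dd : d => [|d']; first by rewrite -dE' dd in D0. have dt : (0, dta K 0) \in ZS.
  by apply/ZSP; split; [exact: (rpred0 (tl M)) | case=> //; rewrite dd].
 rewrite -dd; split; first exact: (rpredZ (h d') dt). have -> k : iter k Zep (h d' *: (0, dta K 0)) = h d' *: iter k Zep (0, dta K 0).
  by elim: k => // k IHk; rewrite !iterS IHk linearZ.
 rewrite -dE' dd subn1 /= iter_dta //. apply: injective_projections; first exact: scaler0.
 apply/funext => k; rewrite -[LHS]/(h d' * (k == d')%:R); case: eqP => [->|/eqP kd]; first by rewrite mulr1. by rewrite mulr0 -[RHS]/(h k) hh // dd eqSS.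
have zS : (z, 0) \in ZS by apply/ZSP.
exists (gv ((z, 0) + v)); have uS : (z, 0) + v \in ZS by apply: rpredD => //; exact: vZ.1.
have [uE uS'] := gv_pow (D i - 1) uS; rewrite uE; apply/(gv_eq sZ vS uS').
have -> k : iter k Zep ((z, 0) + v) = iter k Zep (z, 0) + iter k Zep v.
 by elim: k => // k IHk; rewrite !iterS IHk linearD.
rewrite vZ.2; have [h' [-> [_ /(_ erefl) ->]]] : exists h', iter (D i - 1) Zep (z, 0) = (iter (D i - 1) (sh M) z, h') /\
  (forall l, (l < D i - 1)%N -> h' l = 0) /\ (0 = 0 :> (nat -> K^o) -> h' = 0) by apply: Zep_iterE.
rewrite zE; apply/ZRP; exists m'; split.
 by rewrite /= addr0 opprB addrCA subrr addr0.
by rewrite /= add0r subrr.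
Qed.
End Step.

Lemma Fs_prs_lf s : legit Z0 s -> exists M : 'I_n -> lmodType A,
 [/\ forall l, Fs Z0 s (M l), forall l, exists u, @prs (Iw s) l (M l) u & forall l, lf (M l)].
elim: s => [_|i s IHs /= [ls nh]].
 have Zz : zero_mod (quot_mod (lsubmod_of_ideal (unit_ideal A))).
  by move=> q; have [m <-] := projL_surj q; apply/projL0.
 exists (fun _ => quot_mod (lsubmod_of_ideal (unit_ideal A))); split=> // [l|l j m _ _].
  exists 0; split=> [|m|b]; first by rewrite scaler0.
   by exists 0; rewrite [m]Zz scaler0.
  by rewrite scaler0.
 by exists 0; rewrite scaler0 [m]Zz.
have [M [FM /dchoice[u uP] lM]] := IHs ls; have tF : torf0 x a (Fs Z0 s) by apply/Fs_torf/Z0_torf.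
have sM l := soc_free_torf P tF nh (FM l).
have em0 l : e i *: (if l == i then u l else 0) = (if l == i then u l else 0).
 by case: (l =P i) => [<-|_]; rewrite ?scaler0 // (prs_e (uP l)).
have xm0 l : x i ^+ (if l == i then D i else 0%N) *: (if l == i then u l else 0) = 0.
 by case: eqP => _; rewrite ?scaler0 // (pr_nil P) scale0r.
have /dchoice[Z ZP] : forall l, exists Z : lmodType A, exists gw gv,
  isZ C Om e x a i (if l == i then u l else 0) (if l == i then D i else 0%N) (Q := Z) gw gv.
 by move=> l; apply: (Z_ex hC hD hO P); [by case: ifP | exact: xm0].
have FZ l : Fs Z0 (i :: s) (Z l).
 by have [gw [gv sZ]] := ZP l; apply: (sig_Z hC hD hO P tF (FM l) (sM l) _ _ sZ).
have kZ l : killed (Iw (i :: s)) (Z l) by apply: Fs_killed (FZ l).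
exists Z; split=> // l; have [gw [gv sZ]] := ZP l; first exact: (prs_step hC hD hO P (uP l) sZ (kZ l)).
by apply: (lf_step _ sZ (lM l) (sM l)); case: (l == i); [right | left].
Qed.

(** Left local freeness of A/I_w written in terms of the ideal, obtained column by column from the
    modules (A/I_w) e_l. *)
Lemma LF s j b : legit Z0 s -> x j * b \in Iw s -> exists c, e j * b - x j ^+ (D j - 1) * c \in Iw s.
move=> ls xb; have [M [_ /dchoice[u uP] lM]] := Fs_prs_lf ls.
have /choice[c cP] : forall l, exists c, (e j * b - x j ^+ (D j - 1) * c) * e l \in Iw s.
 move=> l; have [||m mE] := lM l j ((e j * b) *: u l).
 - by rewrite -scalerA ee eqxx.
 - rewrite scalerA mulrA (pr_xe P); apply/(prs_ann (uP l)); exact: ideal_mulr. have [c cE] := prs_gen (uP l) m; exists c; apply/(prs_ann (uP l)).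
 by rewrite scalerBl mE cE scalerA subrr.
exists (\sum_l c l * e l).
have -> : e j * b - x j ^+ (D j - 1) * \sum_l c l * e l = \sum_l (e j * b - x j ^+ (D j - 1) * c l) * e l.
 under [RHS]eq_bigr => l _ do rewrite mulrBl -[(_ * c l) * _]mulrA. by rewrite sumrB -!mulr_sumr (pr_e1 P) mulr1.
by apply: rpred_sum.
Qed.

(** [rho0] projects onto the kernel of x_j and divides by x_j^(D j - 1) over K. Its average S
    commutes with x_j and is the identity on elements of e_j M killed by x_j, hence is injective on
    e_j M; composing rho0 with the inverse of S makes the average equal to e_j. *)
Lemma free_crit M : fin_dim M -> lf M -> free M.
move=> fM lM j; have fK : fd (kmod M) by apply/fin_dimP.
pose xk k : {linear kmod M -> kmod M} := opL M (x j ^+ k).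
have [s sP] := gen_inv (xk (D j - 1)%N) fK fK.
have [p [p1 p2]] := sub_proj (kerS (opL M (x j))) fK.
pose rho0 : {linear kmod M -> kmod M} := opL M (e j) \o (s \o (p \o opL M (e j))).
pose S (m : kmod M) := \sum_(q < D j) xk q (rho0 (xk (D j - 1 - q)%N m)).
have SL k u v : S (k *: u + v) = k *: S u + S v.
 by rewrite /S scaler_sumr -big_split; apply: eq_bigr => q _; rewrite !linearP.
pose SLm : {linear kmod M -> kmod M} := mkL SL.
(* S is completed by the identity on the complement of e_j M so that it can be inverted on all of
   M. *)
pose T : {linear kmod M -> kmod M} := (SLm \+ (idfun \- opL M (e j)))%R.
have TE m : T m = S m + (m - opL M (e j) m) by [].
have rhoe m : opL M (e j) (rho0 m) = rho0 m by rewrite /= ee eqxx.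
have xkS k q m : xk k (xk q m) = xk (k + q)%N m by rewrite /= scalerA exprD.
have xk0 m : xk (D j) m = 0 by rewrite /= (pr_nil P) scale0r.
have Se m : opL M (e j) (S m) = S m.
 by rewrite linear_sum; apply: eq_bigr => q _; rewrite [LHS]e_xX -/(opL M (e j) (rho0 _)) rhoe.
have eS m : S (opL M (e j) m) = S m.
 by apply: eq_bigr => q _; congr (xk q _); rewrite /rho0 /= e_xX ee eqxx -e_xX.
have Sx m : xk 1%N (S m) = S (xk 1%N m).
 pose F q := xk q (rho0 (xk (D j - q)%N m)); have D0 := D_gt0 hD j. have -> : S (xk 1%N m) = \sum_(q < D j) F q.
  by apply: eq_bigr => q _; rewrite xkS /F; congr (xk q (rho0 (xk _ m))); have := ltn_ord q; lia.
 have -> : xk 1%N (S m) = \sum_(q < D j) F q.+1.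
  rewrite linear_sum; apply: eq_bigr => q _; rewrite xkS /F add1n. by congr (xk _ (rho0 (xk _ m))); have := ltn_ord q; lia.
 have : \sum_(q < (D j).+1) F q = \sum_(q < (D j).+1) F q by []. rewrite {1}big_ord_recl big_ord_recr /= [F 0%N]/F [F (D j)]/F xk0 subn0 [xk (D j) m]xk0.
 by rewrite linear0 [xk 0%N _]linear0 add0r addr0.
have S_inj k (m : kmod M) : opL M (e j) m = m -> xk k m = 0 -> S m = 0 -> m = 0.
 elim: k m => [|k IHk] m em xm Sm; first by move: xm; rewrite /= expr0 scale1r. have xm0 : xk 1%N m = 0.
  apply: IHk; rewrite -?Sx ?Sm ?linear0 // ?xkS ?addn1 //. by rewrite [LHS]e_xX -/(opL M (e j) m) em.
 have D0 := D_gt0 hD j; move: Sm; rewrite /S -(prednK D0) big_ord_recr /= big1 => [|q _]; last first.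
  have -> : ((D j).-1.+1 - 1 - q)%N = ((D j).-1 - q.+1 + 1)%N by have := ltn_ord q; lia.
  have := xkS ((D j).-1 - q.+1)%N 1%N m; rewrite xm0 linear0 /= => <-. by rewrite scaler0 (linear0 p) (linear0 s) !scaler0.
 rewrite add0r subn1 subnn expr0 scale1r -[e j *: m]/(opL M (e j) m) em p2; last first.
  by apply/kerSP; move: xm0; rewrite /= expr1.
 have [m' mE] : exists m', (m : M) = x j ^+ (D j - 1) *: m' by apply: lM; [exact: em | move: xm0; rewrite /= expr1].
 have sE : x j ^+ (D j - 1) *: (s m : M) = m by have := sP m'; rewrite /= -mE. rewrite -e_xX -subn1 sE. by rewrite -[e j *: m]/(opL M (e j) m) em.
have T_inj : injective T.
 apply/inj_ker => m Tm; have em : opL M (e j) m = m.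
  have := congr1 (opL M (e j)) Tm; rewrite linear0 TE linearD Se linearB. have -> : opL M (e j) (opL M (e j) m) = opL M (e j) m by rewrite /= ee eqxx.
  rewrite subrr addr0 => Sm; move: Tm; rewrite TE Sm add0r. by move/eqP; rewrite subr_eq0 => /eqP.
 apply: (S_inj (D j) m em (xk0 m)). by move: Tm; rewrite TE em subrr addr0.
have [T' [TK T'K]] := linear_inv (inj_endo_bij fK T_inj).
have Tx m : T (xk 1%N m) = xk 1%N (T m).
 rewrite !TE !linearD linearN Sx. by congr (_ + (_ - _)); exact: e_xX.
have T'x k m : T' (xk k m) = xk k (T' m).
 elim: k m => [|k IHk] m; first by rewrite /= !expr0 !scale1r. by rewrite -addn1 -!xkS IHk; congr (xk k _); apply: (can_inj TK); rewrite Tx !T'K.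
exists (T' \o rho0 : {linear _ -> _}) => m.
transitivity (T' (S m)); first by rewrite linear_sum; apply: eq_bigr => q _; rewrite T'x.
apply: T_inj; rewrite T'K -[e j *: m]/(opL M (e j) m) TE eS.
have -> : opL M (e j) (opL M (e j) m) = opL M (e j) m by rewrite /= ee eqxx.
by rewrite subrr addr0.
Qed.

Lemma Uw_free s : legit Z0 s -> free (Uw e s).
move=> ls; have tF : torf0 x a (Fs Z0 s) by apply/Fs_torf/Z0_torf.
apply: free_crit; first by have [] := tf_nfd tF (Uw_Fs ls).
move=> j m; have [b ->] := Upr_surj m => em; rewrite -Upr_lin => /Upr0 xb.
have [c cP] := LF ls xb; exists (Upr e s c); rewrite -em -!Upr_lin; apply/eqP.
by rewrite -subr_eq0 -[_ - _](linearB (projL (lsubmod_of_ideal (Iw s)))); apply/eqP/Upr0.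
Qed.

(* the anti-involution of the presentation fixing e_i, x_i and exchanging a_ij and a_ji *)
Lemma anti_ex : exists phi : A -> A, [/\ forall b c, phi (b + c) = phi b + phi c,
 forall b c, phi (b * c) = phi c * phi b, forall b, phi (phi b) = b, forall i, phi (e i) = e i & forall i, phi (x i) = x i].
have rL (b : A) : linear (fun v : kmod (A^o)%type => (v : A) * b : kmod (A^o)%type).
 by move=> k u v; rewrite mulrDl -mulrA.
pose r b := mkL (rL b).
have r_iter k b v : iter k (r b) v = (v : A) * b ^+ k.
 by elim: k => [|k IHk]; rewrite ?mulr1 // iterS IHk /= -mulrA -exprSr.
have [W [h [hB hL hE hX hA]]] : exists (W : lmodType A) (h : kmod (A^o)%type -> W), [/\ bijective h,
  forall k u v, h (k *: u + v) = (pzscal k : A) *: h u + h v, forall i v, h (r (e i) v) = e i *: h v, forall i v, h (r (x i) v) = x i *: h v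
  & forall i j g v, valid i j g -> h (r (a j i g) v) = a i j g *: h v].
 apply: (pr_univ P (E := fun i => r (e i)) (X := fun i => r (x i)) (L := fun i j g => r (a j i g))).
 - move=> i j v; rewrite /= -mulrA (pr_ee P) eq_sym; case: eqP => [->//|_]; by rewrite mulr0.
 - by move=> v; rewrite -mulr_sumr (pr_e1 P) mulr1.
 - by move=> i v; rewrite /= -mulrA (pr_xe P).
 - by move=> i v; rewrite /= -mulrA (pr_ex P).
 - by move=> i j g v _; rewrite /= -mulrA (pr_ae P).
 - by move=> i j g v _; rewrite /= -mulrA (pr_ea P).
 - by move=> i v; rewrite r_iter (pr_nil P) mulr0.
 - by move=> i j g v vl; rewrite !r_iter /= -!mulrA (pr_com P) // validC.
 move=> i v; pose V : lmodType K := kmod (A^o)%type; pose ph (b : A) : V := (v : A) * b. have phD : {morph ph : b c / b + c >-> b + c} := mulrDr (v : A).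
 have ph0 : ph 0 = 0 := mulr0 (v : A). have phS (I : Type) (s : seq I) Q (F : I -> A) : \sum_(t <- s | Q t) ph (F t) = ph (\sum_(t <- s | Q t) F t).
  by elim: s => [|t s IHs]; rewrite ?big_nil ?ph0 // !big_cons; case: (Q t); rewrite ?phD IHs.
 rewrite -[RHS]ph0 -[X in ph X](pr_mesh P i) -phS; apply: eq_bigr => j _. rewrite -phS; apply: eq_bigr => g _. rewrite -phS (reindex_inj rev_ord_inj) /=.
 apply: eq_bigr => k _; rewrite !r_iter /= -[LHS]/((pzscal (sg i j) : A) * _) /mesh_term.
 have -> : (f j i - 1 - (f j i - k.+1) = k)%N by have := ltn_ord k; lia. have -> : (f j i - k.+1 = f j i - 1 - k)%N by lia.
 by rewrite /ph !mulrA pzscal_central -!mulrA.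
have hD0 u v : h (u + v) = h u + h v by rewrite -[u]scale1r hL rmorph1 !scale1r.
have h0 : h 0 = 0 by apply: (addrI (h 0)); rewrite -hD0 !addr0.
have hI := bij_inj hB; have /choice[phi phiP] : forall b, exists c : A, h c = b *: h (1 : A).
 by move=> b; have [g _ gK] := hB; exists (g (b *: h (1 : A))).
have hZ k v : h ((pzscal k : A) * v) = (pzscal k : A) *: h v by rewrite -[_ * v]addr0 -(addr0 (_ *: _)) -h0; exact: hL.
have hX' i (v : A) : h (v * x i) = x i *: h v by exact: hX.
have hA' i j g (v : A) : valid i j g -> h (v * a j i g) = a i j g *: h v by exact: hA.
have hP' b v : h ((v : A) * phi b) = b *: h v.
 elim/(pr_ind P): b v => [|b c IHb IHc|k b IHb|i|i b IHb|i j g b IHb] v.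
 - have -> : phi 0 = 0 by apply: hI; rewrite phiP h0 scale0r.
  by rewrite mulr0 h0 scale0r.
 - have -> : phi (b + c) = phi b + phi c by apply: hI; rewrite hD0 !phiP scalerDl.
  by rewrite mulrDr hD0 IHb IHc scalerDl.
 - have -> : phi (pzscal k * b) = pzscal k * phi b by apply: hI; rewrite hZ !phiP scalerA.
  by rewrite mulrA -pzscal_central -mulrA hZ IHb scalerA.
 - have -> : phi (e i) = e i by apply: hI; rewrite phiP -hE /= mul1r.
  exact: hE.
 - have -> : phi (x i * b) = phi b * x i by apply: hI; rewrite phiP hX' phiP scalerA.
  by rewrite mulrA hX' IHb scalerA.
 have [vl|vl] := boolP (valid i j g); last first.
  have -> : phi (a i j g * b) = 0 by apply: hI; rewrite phiP (pr_a0 P) // mul0r scale0r h0. by rewrite (pr_a0 P) // mul0r scale0r mulr0 h0.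
 have -> : phi (a i j g * b) = phi b * a j i g by apply: hI; rewrite phiP hA' // phiP scalerA. by rewrite mulrA hA' // IHb scalerA.
have pD b c : phi (b + c) = phi b + phi c by apply: hI; rewrite hD0 !phiP scalerDl.
have pM b c : phi (b * c) = phi c * phi b by apply: hI; rewrite hP' !phiP scalerA.
have pZ k b : phi (pzscal k * b) = pzscal k * phi b by apply: hI; rewrite hZ !phiP scalerA.
have p0 : phi 0 = 0 by apply: hI; rewrite phiP h0 scale0r.
have p1 : phi 1 = 1 by apply: hI; rewrite phiP scale1r.
have pe i : phi (e i) = e i by apply: hI; rewrite phiP -hE /= mul1r.
have px i : phi (x i) = x i by apply: hI; rewrite phiP -hX /= mul1r.
have pa i j g : phi (a i j g) = a j i g.
 have [vl|vl] := boolP (valid i j g); first by apply: hI; rewrite phiP -hA //= mul1r. have vl' : ~~ valid j i g by rewrite validC.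
 by rewrite (pr_a0 P vl) (pr_a0 P vl').
exists phi; split=> // b; elim/(pr_ind P): b => [|b c IHb IHc|k b IHb|i|i b IHb|i j g b IHb].
- by rewrite !p0.
- by rewrite !pD IHb IHc.
- by rewrite !pZ IHb.
- by rewrite !pe.
- by rewrite !pM !px IHb.
by rewrite !pM !pa IHb.
Qed.

Lemma sum_mem (I : ideal A) (T : eqType) (r : seq T) (F : T -> A) :
 (forall p, p \in r -> F p \in I) -> \sum_(p <- r) F p \in I.
by move=> h; rewrite big_seq; apply: rpred_sum. Qed.
Lemma Iw_rcons s i b : b \in Iw (rcons s i) <-> b \in ideal_mul (Iw s) (Iv e i).
elim: s b => [|j s IHs] b /=; split=> /asboolP[t [tP ->]]; apply: (sum_mem (I := ideal_mul _ _)) => p /tP[p1 p2].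
- by rewrite -[p.1 * p.2]mul1r; apply: mem_mul => //; apply: ideal_mulr.
- by rewrite -[p.1 * p.2]mulr1; apply: mem_mul => //; apply: ideal_mull.
- move: p2 => /IHs/asboolP[u [uP ->]]; rewrite mulr_sumr; apply: (sum_mem (I := ideal_mul _ _)) => r /uP[r1 r2].
 by rewrite mulrA; apply: mem_mul => //; apply: mem_mul.
move: p1 => /asboolP[u [uP ->]]; rewrite mulr_suml; apply: (sum_mem (I := ideal_mul _ _)) => r /uP[r1 r2].
by rewrite -mulrA; apply: mem_mul => //; apply/IHs/mem_mul.
Qed.

(** The right-handed form of [LF]: the anti-involution sends I_w for the word s to that for the
    reversed word, which is again reduced. *)
Lemma RF s j b : reduced C s -> b * x j \in Iw s -> exists c, b * e j - c * x j ^+ (D j - 1) \in Iw s.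
move=> rs bx; have [phi [pD pM pK pe px]] := anti_ex.
have p0 : phi 0 = 0 by apply: (addrI (phi 0)); rewrite -pD !addr0.
have pN u : phi (- u) = - phi u by apply/eqP; rewrite -addr_eq0 -pD addNr p0.
have p1 : phi 1 = 1 by rewrite -[LHS]mul1r -{1}(pK 1) -pM mul1r pK.
have pX k : phi (x j ^+ k) = x j ^+ k by elim: k => [|k IHk]; rewrite ?p1 // exprSr pM px IHk -exprS -exprSr.
have pS (T : Type) (r : seq T) (F : T -> A) : phi (\sum_(t <- r) F t) = \sum_(t <- r) phi (F t).
 exact: (big_morph phi pD p0).
have pI t u : u \in Iw t -> phi u \in Iw (rev t).
 elim: t u => [|i t IHt] u //= /asboolP[r [rP ->]]; rewrite rev_cons; apply/Iw_rcons; rewrite pS.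
 apply: (sum_mem (I := ideal_mul _ _)) => q /rP[q1 q2]; rewrite pM; apply: mem_mul; first exact: IHt.
 move: q1 => /asboolP[w [wP ->]]; rewrite pS; apply: (sum_mem (I := Iv e i)) => y /wP ->. by rewrite !pM pD pN p1 pe mulrA mem_Iv.
have rr : reduced C (rev s).
 move=> t tE; rewrite size_rev -(size_rev t); apply: rs; rewrite -[s]revK. by apply: refl_eq_rev.
have lr := reduced_legit hC hD hO P hP rr.
have /(LF lr)[c cP] : x j * phi b \in Iw (rev s) by rewrite -px -pM; exact: pI.
exists (phi c); have := pI _ _ cP; rewrite revK pD pN !pM pX pK pe //.
Qed.
End Freeness.

(** * Ext-injectivity, split extensions and descent to quotient algebras *)

Section ExtGeneric.
Variables (K : fieldType) (A : pzAlgType K).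
Implicit Types M N X Y : lmodType A.

(** Pushout: the quotient of M x Z by the pairs (f z, - i z) is an extension of Z2 by M, and a
    splitting of it yields the extension of f to Z. *)
Lemma split_ext_inj (F : lmodType A -> Prop) M : (forall N, F N -> ext_split M N) -> ext_inj F M.
move=> sp Z1 Z Z2 i p f fZ iI pS ex F2.
pose j : {linear Z1 -> (M * Z)%type} := (inlL M Z \o f) \- (inrL M Z \o i).
pose pr := projL (imS j); pose m : {linear M -> quot_mod (imS j)} := pr \o inlL M Z.
have jE z : j z = (f z, - i z) by apply: injective_projections; rewrite /= ?subr0 ?sub0r.
have prE u v z : j z = u - v -> pr u = pr v.
 by move=> E1; apply/eqP; rewrite -subr_eq0 -linearB; apply/eqP/projL0/imSP; exists z.
have [q qE] : exists q : {linear quot_mod (imS j) -> Z2}, forall v, q (pr v) = (p \o sndL M Z) v.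
 apply: (fact_surj (@projL_surj _ _ (imS j))) => v /projL0/imSP[z <-]; rewrite jE /= linearN. by rewrite (_ : p (i z) = 0) ?oppr0 //; apply/ex; exists z.
have [|||s sP] := sp Z2 F2 _ m q.
- apply/inj_ker => v /projL0/imSP[z]; rewrite jE => -[<- /eqP]; rewrite oppr_eq0 => /eqP z0.
 by rewrite (proj1 (inj_ker i) iI z z0) linear0.
- by move=> y; have [z <-] := pS y; exists (pr (inrL M Z z)); rewrite qE.
- move=> v; have [[v1 v2] <-] := projL_surj v; rewrite -/pr qE /=; split=> [/ex[z zE]|[w]].
  exists (v1 + f z); apply: (prE _ _ z). by rewrite jE; apply: injective_projections; rewrite /= ?sub0r ?zE // addrC addKr.
 move/(congr1 q); rewrite /m /= !qE /= linear0; exact: esym.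
have [r rE] : exists r : {linear quot_mod (imS j) -> M}, forall v, m (r v) = (idfun \- (s \o q)) v.
 apply: fact_inj => [|v]; last first.
  have [w wE] : exists w, pr w = v - s (q v) by apply: projL_surj. have : q (v - s (q v)) = 0 by rewrite linearB sP subrr.
  rewrite -wE qE /= => /ex[z zE]; exists (w.1 + f z); rewrite -[RHS]wE; apply: (prE _ _ z).
  by rewrite jE; apply: injective_projections; rewrite /= ?sub0r ?zE // addrC addKr.
 apply/inj_ker => v /projL0/imSP[z]; rewrite jE => -[<- /eqP]; rewrite oppr_eq0 => /eqP z0. by rewrite (proj1 (inj_ker i) iI z z0) linear0.
have mI : injective m.
 apply/inj_ker => v /projL0/imSP[z]; rewrite jE => -[<- /eqP]; rewrite oppr_eq0 => /eqP z0. by rewrite (proj1 (inj_ker i) iI z z0) linear0.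
exists (r \o (pr \o inrL M Z) : {linear _ -> _}) => z; apply: mI.
rewrite rE -[LHS]/(pr (0, i z) - s (q (pr (0, i z)))) qE -[RHS]/(pr (f z, 0)) -[(p \o _) _]/(p (i z)).
have piz : p (i z) = 0 by apply/ex; exists z.
rewrite piz (linear0 s) subr0; apply: (prE (0, i z) (f z, 0) (- z)).
by rewrite jE; apply: injective_projections; rewrite /= !linearN ?sub0r ?opprK ?subr0.
Qed.

Lemma ext_inj_split (F : lmodType A -> Prop) M N : ext_inj F M -> F N -> fin_dim M -> fin_dim N -> ext_split M N.
move=> eM FN fM fN E i p iI pS ex; have fE := fin_dim_ses iI pS ex fM fN.
have [r rE] := eM _ _ _ i p idfun fE iI pS ex FN.
have [s sE] : exists s : {linear N -> E}, forall v, s (p v) = (idfun \- (i \o r)) v.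
 by apply: (fact_surj pS) => v /ex[m <-]; rewrite /= rE subrr.
exists s => m; have [v <-] := pS m; rewrite sE /= linearB (_ : p (i _) = 0) ?subr0 //.
by apply/ex; exists (r v).
Qed.

(** For an extension E of Y by X, the coordinates X -> M extend to E by Ext-injectivity; together
    with those of Y they embed E in a power of M. *)
Lemma ext_inj_tfc M : fin_dim M -> ext_inj (Sub_class M) M -> torsion_free_class (Sub_class M).
move=> fM eM; split=> [N [fN _]//||N N' h hI [fN [k [u uI]]]|X E Y f p fE fI ex pS [fX [k [u uI]]] [fY [l [w wI]]]].
- by exists M; apply: Sub_class_self.
- by split; [apply: fin_dim_inj hI fN | exists k, (u \o h : {linear _ -> _}) => v v' /uI/hI].
have FY : Sub_class M Y by split=> //; exists l, w.
have /choice[g gE] : forall c : 'I_k, exists g : {linear E -> M}, forall x, g (f x) = (evalL M c \o u) x.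
 by move=> c; apply: (eM _ _ _ f p).
split=> //; exists (k + l)%N, (pairfL (fun c : 'I_(k + l) => match fintype.split c with inl b => g b | inr b => evalL M b \o (w \o p) end)).
apply/inj_ker => v /ffunP v0.
have /ex[z zE] : p v = 0.
 apply: wI; rewrite linear0; apply/ffunP => b; have := v0 (unsplit (inr b)). by rewrite !ffunE unsplitK.
rewrite -zE (_ : z = 0) ?linear0 //; apply: uI; rewrite linear0; apply/ffunP => b.
by have := v0 (unsplit (inl b)); rewrite !ffunE unsplitK -zE gE.
Qed.

Lemma num_leq M m m' : num_indec_summands M m -> num_indec_summands M m' -> (m <= m')%N.
move=> [X [iX Xij _]] [X' [_ _ allX]].
have /choice[f fP] : forall i, exists j, iso_mod (X i) (X' j) by move=> i; have [] := iX i; apply: allX.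
have fI : injective f.
 move=> i j E1; apply: Xij; apply: iso_trans (fP i) _; rewrite E1; exact: iso_sym.
by have := leq_card f fI; rewrite !card_ord.
Qed.

Section Descent.
Variables (I : ideal A) (M : lmodType A) (kM : forall b (m : M), b \in I -> b *: m = 0).
(** The annihilation proof is an argument of the type, so that the structure of module over the
    quotient algebra can be attached to it canonically. *)
Definition desc_of (k : forall (b : A) (m : M), b \in I -> b *: m = 0) : Type := M.
Notation desc := (desc_of kM).
HB.instance Definition _ := GRing.Zmodule.on desc.
Definition desc_scale (b : quot_alg I) (m : desc) : desc := alg_repr b *: (m : M).
Lemma desc_proj b (m : M) : desc_scale (alg_proj I b) m = b *: m.
apply/eqP; rewrite -subr_eq0 -scalerBl; apply/eqP; apply: kM.
by rewrite -alg_proj_eq alg_reprK.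
Qed.
Fact desc_scaleA b c m : desc_scale b (desc_scale c m) = desc_scale (b * c) m.
by rewrite -(alg_reprK b) -(alg_reprK c) -rmorphM !desc_proj scalerA. Qed.
Fact desc_scale1 : left_id 1 desc_scale.
by move=> m; rewrite -(rmorph1 (alg_proj I)) desc_proj scale1r. Qed.
Fact desc_scaleDr : right_distributive desc_scale +%R.
by move=> b m m'; apply: scalerDr. Qed.
Fact desc_scaleDl m : {morph desc_scale^~ m : b c / b + c}.
by move=> b c; rewrite -(alg_reprK b) -(alg_reprK c) -rmorphD !desc_proj scalerDl.
Qed.
HB.instance Definition _ := GRing.Zmodule_isLmodule.Build (quot_alg I) desc
 desc_scaleA desc_scale1 desc_scaleDr desc_scaleDl.
End Descent.

Lemma killed_lin (I : ideal A) (N : lmodType (quot_alg I)) (b : A) (m : restr_mod (alg_proj I) N) :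
 b \in I -> b *: m = 0.
move=> bI; rewrite -[LHS]/(alg_proj I b *: (m : N)); have -> : alg_proj I b = 0.
 by apply/eqP; rewrite -(raddf0 (alg_proj I)) alg_proj_eq subr0.
exact: (scale0r (m : N)).
Qed.
Lemma lift_lin (I : ideal A) (X Y : lmodType (quot_alg I))
 (h : {linear restr_mod (alg_proj I) X -> restr_mod (alg_proj I) Y}) : linear (h : X -> Y).
by move=> b u v; rewrite -(alg_reprK b); exact: (linearP h).
Qed.
Lemma restr_lin (I : ideal A) (X Y : lmodType (quot_alg I)) (h : {linear X -> Y}) :
 linear (h : restr_mod (alg_proj I) X -> restr_mod (alg_proj I) Y).
by move=> b u v; exact: (linearP h). Qed.
Lemma fin_dim_restr (I : ideal A) (X : lmodType (quot_alg I)) : fin_dim X <-> fin_dim (restr_mod (alg_proj I) X).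
by []. Qed.
End ExtGeneric.

(** * Indecomposable summands of cyclic modules *)

Section Cyclic.
Variables (K : fieldType) (n : nat) (C : 'M[int]_n) (D : 'I_n -> nat).
Variable Om : {set 'I_n * 'I_n}.
Hypotheses (hC : is_GCM C) (hD : is_symmetrizer C D) (hO : is_orientation C Om).
Notation f := (Cartan_f C).
Variables (A : pzAlgType K) (e x : 'I_n -> A) (a : 'I_n -> 'I_n -> nat -> A).
Hypothesis P : presentation C D Om e x a.
Implicit Types M N : lmodType A.
Hypothesis hP : is_Dynkin C D.
Notation ee := (ee P).
Notation kil := (kil x a).
Notation nilp := (nilp x a).

Lemma kilD k M (u v : M) : kil k u -> kil k v -> kil k (u + v).
elim: k u v => [u v /= -> ->|k IHk u v [u1 u2] [v1 v2]]; first exact: addr0.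
by split=> [j|j l g]; rewrite scalerDr; apply: IHk; [exact: u1 | exact: v1 | exact: u2 | exact: v2].
Qed.
Lemma kilZ k M c (m : M) : kil k m -> kil k ((pzscal c : A) *: m).
have cL : linear (fun u : M => (pzscal c : A) *: u) by move=> d u v; rewrite scalerDr !scalerA pzscal_central.
exact: (kil_lin (mkL cL)).
Qed.
Lemma kilS k M (m : M) : kil k m -> kil k.+1 m. exact: kil_leq. Qed.
Lemma kil_e k M i (m : M) : kil k m -> kil k (e i *: m).
case: k => [/= ->|k [k1 k2]]; first exact: scaler0.
split=> [j|j l g]; rewrite scalerA.
 rewrite -(pr_xe P j) -mulrA (pr_ee P); case: eqP => [<-|_]; first by rewrite (pr_xe P); exact: k1. by rewrite mulr0 scale0r; apply: kil0.
rewrite -(pr_ae P j l) -mulrA (pr_ee P); case: eqP => [<-|_]; first by rewrite (pr_ae P); exact: k2.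
by rewrite mulr0 scale0r; apply: kil0.
Qed.
Lemma kil_stab k M (b : A) (m : M) : kil k m -> kil k (b *: m).
move=> km; elim/(pr_ind P): b => [|b c IHb IHc|c b IHb|i|i b IHb|i j g b IHb].
- by rewrite scale0r; apply: kil0.
- by rewrite scalerDl; apply: kilD.
- by rewrite -scalerA; apply: kilZ.
- exact: kil_e.
- by rewrite -scalerA; have [k1 _] := kilS IHb; exact: k1.
by rewrite -scalerA; have [_ k1] := kilS IHb; exact: k1.
Qed.
(** Every element is a combination of vertex idempotents plus a part which strictly lowers the
    nilpotency filtration [kil]; the coefficients serve as constant terms. *)
Lemma low_ex (b : A) : exists c : 'I_n -> K, forall M k (m : M), kil k.+1 m ->
 kil k ((b - \sum_i pzscal (c i) * e i) *: m).
have z0 : \sum_i pzscal (0 : K) * e i = 0 by rewrite big1 // => i _; rewrite rmorph0 mul0r.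
elim/(pr_ind P): b => [|b1 b2 [c1 h1] [c2 h2]|k b [c h]|j|j b _|j l g b _].
- by exists (fun=> 0) => M k m _; rewrite z0 subr0 scale0r; apply: kil0.
- exists (fun i => c1 i + c2 i) => M k m km; rewrite (eq_bigr (fun i => pzscal (c1 i) * e i + pzscal (c2 i) * e i)).
  by rewrite big_split opprD addrACA scalerDl; apply: kilD; [apply: h1 | apply: h2].
 by move=> i _; rewrite rmorphD mulrDl.
- exists (fun i => k * c i) => M q m km; rewrite (eq_bigr (fun i => pzscal k * (pzscal (c i) * e i))).
  by rewrite -mulr_sumr -mulrBr -scalerA; apply/kilZ/h.
 by move=> i _; rewrite rmorphM mulrA.
- exists (fun i => (i == j)%:R) => M k m _; rewrite (bigD1 j) //= eqxx rmorph1 mul1r big1 ?addr0.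
  by rewrite subrr scale0r; apply: kil0.
 by move=> i /negbTE ->; rewrite rmorph0 mul0r.
- exists (fun=> 0) => M k m km; rewrite z0 subr0 -scalerA.
 by have [k1 _] := kil_stab b km; exact: k1.
exists (fun=> 0) => M k m km; rewrite z0 subr0 -scalerA.
by have [_ k1] := kil_stab b km; exact: k1.
Qed.
(** Each application of r lowers the nilpotency degree of t, while k is invertible; so the degree of
    t descends to 0. *)
Lemma low_fix M (t : M) (k : K) (r : A) : nilp M -> k != 0 -> (forall q (m : M), kil q.+1 m -> kil q (r *: m)) ->
 (pzscal k : A) *: t = r *: t -> t = 0.
move=> [d kd] k0 rl E1; have : kil d t by [].
elim: d {kd} => [//|d IHd] kt; apply: IHd; have := kilZ k^-1 (rl _ _ kt).
by rewrite -E1 scalerA -rmorphM mulVf // rmorph1 scale1r.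
Qed.

Section Decomp.
Variables (R : pzAlgType K) (pi : {rmorphism A -> R}) (M : lmodType R) (u : M).
Hypotheses (piS : surjective_fun pi) (fM : fin_dim M) (gu : forall m, exists b, m = b *: u).
(** The annihilator of u is a two-sided ideal, so right multiplication by e_j is a well-defined
    endomorphism of M. *)
Hypothesis two : forall b c : R, b *: u = 0 -> (b * c) *: u = 0.
Notation rs N := (restr_mod pi N).
Let S := [set j | pi (e j) *: u != 0].

Lemma rs_nilp (N : lmodType R) : nilp (rs N).
have [_ [k kk]] := reg_nfd hC hD hO P hP; exists k => m.
have mL : linear (fun b : A^o => (b : A) *: m) by move=> c p q; rewrite scalerDl -scalerA.
by have := kil_lin (mkL mL) (kk 1); rewrite /= scale1r.
Qed.
Lemma pe_pe (N : lmodType R) i j (m : N) : pi (e i) *: (pi (e j) *: m) = if i == j then pi (e j) *: m else 0.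
by rewrite scalerA -rmorphM (pr_ee P); case: eqP => // _; rewrite rmorph0 scale0r. Qed.
Lemma low_e (b : A) i j : exists (k : K) (r : A), [/\ i != j -> k = 0,
 forall (N : lmodType A) q (m : N), kil q.+1 m -> kil q (r *: m) &
 forall (N : lmodType A) (t : N), e i *: (b *: (e j *: t)) = (pzscal k : A) *: (e j *: t) + r *: t].
have [c cl] := low_ex b; pose r0 := b - \sum_i pzscal (c i) * e i.
exists (if i == j then c j else 0), (e i * r0 * e j); split=> [/negbTE->//|N q m km|N t].
 by rewrite -!scalerA; apply/kil_e/cl/kil_e.
have -> : b = \sum_i pzscal (c i) * e i + r0 by rewrite addrC subrK.
rewrite scalerDl scalerDr -!scalerA; congr (_ + _).
rewrite scaler_suml (bigD1 j) //= big1 ?addr0 => [|l lj]; last first.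
 by rewrite -scalerA ee (negbTE lj) scaler0.
rewrite -scalerA ee eqxx -pzscale_comm ee; case: eqP => // _.
by rewrite scaler0 rmorph0 scale0r.
Qed.

(** The right multiplications by the e_j split M into cyclic modules generated by the e_j u. They
    are indecomposable and pairwise non-isomorphic since e_j A e_j is scalar modulo the nilpotent
    part, and e_i A e_j is nilpotent for i different from j. *)
Lemma cyc_decomp : exists Y : {j | j \in S} -> lmodType R, [/\ forall j, indecomposable (Y j), decomp M Y &
 forall i j, iso_mod (Y i) (Y j) -> i = j].
have uL : linear (fun b : R^o => (b : R) *: u) by move=> k v w; rewrite scalerDl -scalerA.
have /dchoice[r rE] : forall j, exists r : {linear M -> M}, forall b : R, r (b *: u) = (b * pi (e j)) *: u.
 move=> j; have rL : linear (fun b : R^o => ((b : R) * pi (e j)) *: u).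
  by move=> k v w; rewrite mulrDl scalerDl -!scalerA.
 have [|v vE|h hE] := @fact_surj _ _ _ _ (mkL uL) (mkL rL).
 - by move=> m; have [b ->] := gu m; exists b.
 - exact: two. by exists h => b; exact: (hE b).
have r_gen j m : exists b : A, r j m = pi b *: (pi (e j) *: u).
 by have [b ->] := gu m; have [c cE] := piS b; exists c; rewrite rE -cE scalerA.
have r_r i j m : r i (r j m) = if i == j then r j m else 0.
 have [b ->] := gu m; rewrite !rE -mulrA -rmorphM (pr_ee P) eq_sym. by case: eqP => [->//|_]; rewrite rmorph0 mulr0 scale0r.
pose g j := pi (e j) *: u; have rg j : r j (g j) = g j by rewrite rE -rmorphM (pr_ee P) eqxx.
have rn j : j \notin S -> forall m, r j m = 0.
 by rewrite inE negbK => /eqP u0 m; have [b ->] := r_gen j m; rewrite u0 scaler0.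
pose Y j := sub_mod (imS (r j)).
have /dchoice[y yE] : forall j, exists y : Y j, inclL (imS (r j)) y = g j.
 by move=> j; apply: inclLP; apply/imSP; exists (g j).
have Yg j (m : Y j) : exists b : A, m = pi b *: y j.
 have /imSP[m' mE] := inclL_in m; have [b bE] := r_gen j m'; exists b. by apply: inclL_inj; rewrite linearZ_LR yE -mE bE.
have ey j : pi (e j) *: y j = y j by apply: inclL_inj; rewrite linearZ_LR yE pe_pe eqxx.
have y0 j : j \in S -> y j != 0.
 by rewrite inE; apply: contra => /eqP y0; rewrite -/(g j) -yE y0 linear0.
exists (fun j => Y (val j)); split=> [[j jS]||[i iS] [j jS] /=].
- split=> [Yz|X Z [f /linear_inv[f' [fK f'K]]]]; first by case/eqP: (y0 _ jS); apply: Yz.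
 (* The projection to X is given on the generator by some b. If the constant term of e_j b e_j is 0,
    the X-component of the generator is fixed by a nilpotent part and vanishes; otherwise the
    Z-component does. *)
 set p := (f (y j)).1; set q := (f (y j)).2. have [b bE] := Yg j (f' (p, 0)). have fb : pi b *: f (y j) = (p, 0) by rewrite -linearZ_LR -bE f'K.
 have bp : pi b *: p = p by have := congr1 fst fb. have bq : pi b *: q = 0 by have := congr1 snd fb.
 have eyf : pi (e j) *: f (y j) = f (y j) by rewrite -linearZ_LR ey. have ep : pi (e j) *: p = p by have := congr1 fst eyf.
 have eq : pi (e j) *: q = q by have := congr1 snd eyf. have [k [r0 [_ r0l E1]]] := low_e b j j. have gX (v : X) : p = 0 -> v = 0.
  move=> p0; have [c cE] := Yg j (f' (v, 0)). by rewrite -[v]/((v, 0 : Z).1) -(f'K (v, 0)) cE linearZ_LR -[LHS]/(pi c *: p) p0 scaler0.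
 have gZ (v : Z) : q = 0 -> v = 0.
  move=> q0; have [c cE] := Yg j (f' (0, v)). by rewrite -[v]/((0 : X, v).2) -(f'K (0, v)) cE linearZ_LR -[LHS]/(pi c *: q) q0 scaler0.
 have Ep := E1 _ (p : rs X); have Eq := E1 _ (q : rs Z). have epA : e j *: (p : rs X) = p := ep; have eqA : e j *: (q : rs Z) = q := eq.
 have bpA : b *: (p : rs X) = p := bp; have bqA : b *: (q : rs Z) = 0 := bq. move: Ep Eq; rewrite !epA !eqA bpA bqA epA scaler0 => Ep Eq.
 have [k0|k0] := eqVneq k 0.
  left=> v; apply: gX; apply: (@low_fix (rs X) p 1 r0 (rs_nilp X) (oner_neq0 _) (r0l _)). by rewrite rmorph1 scale1r [LHS]Ep k0 rmorph0 scale0r add0r.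
 right=> v; apply: gZ; apply: (@low_fix (rs Z) q k (- r0) (rs_nilp Z) k0) => [d m km|].
  by rewrite scaleNr -scaleN1r -(rmorph1 (@pzscal K A)) -rmorphN; apply/kilZ/r0l.
 by apply/eqP; rewrite scaleNr -subr_eq0 opprK -Eq.
- have rS j m : r j m \in imS (r j) by apply/imSP; exists m.
 have /dchoice[c cE] : forall j, exists c : {linear M -> Y j}, forall m, inclL (imS (r j)) (c m) = r j m.
  by move=> j; apply: corestr.
 have ri j (m : Y j) : r j (inclL (imS (r j)) m) = inclL (imS (r j)) m.
  by have /imSP[v <-] := inclL_in m; rewrite r_r eqxx.
 exists (fun j => inclL (imS (r (val j)))), (fun j => c (val j)); split=> [m|j m|i j m ij].
 - rewrite -(big_sub (mem S) (fun j => inclL (imS (r j)) (c j m))) big_mkcond /=.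
  have [b bE] := gu m; rewrite {1}bE -[b]mulr1 -(rmorph1 pi) -(pr_e1 P) rmorph_sum mulr_sumr scaler_suml.
  by apply: eq_bigr => j _; rewrite cE -rE -bE; case: ifP => // /negbT/rn->.
 - by apply: inclL_inj; rewrite cE ri. apply: inclL_inj; rewrite cE linear0 -ri r_r. by case: eqP => // /val_inj ij'; rewrite ij' eqxx in ij.
move=> [f /linear_inv[f' [fK f'K]]]; apply: val_inj => /=; apply/eqP; apply: contraT => ij.
have [b bE] := Yg j (f (y i)); have [b' bE'] := Yg i (f' (y j)).
(* For i different from j the constant term is zero, so composing the isomorphism with its inverse
   fixes the generator by a strictly lowering element. *)
have [k [r0 [k0 r0l E1]]] := low_e b i j.
case/eqP: (y0 _ iS); apply: (@low_fix (rs (Y i)) (y i) 1 (r0 * b') (rs_nilp _) (oner_neq0 _)) => [d m km|].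
 by rewrite -scalerA; apply/r0l/kil_stab.
have E2 : y i = pi r0 *: (pi b' *: y i).
 have ejA : e j *: (y j : rs (Y j)) = y j := ey j. have bA : b *: (y j : rs (Y j)) = f (y i) := esym bE. have eiA : e i *: (f (y i) : rs (Y j)) = f (y i).
  by rewrite -[LHS]/(pi (e i) *: f (y i)) -linearZ_LR ey.
 have := E1 (rs (Y j)) (y j); rewrite !ejA bA eiA k0 // rmorph0 scale0r add0r => Ef. by apply: (can_inj fK); rewrite -bE' linearZ_LR f'K [LHS]Ef.
by rewrite rmorph1 scale1r [LHS]E2 -scalerA.
Qed.
End Decomp.
End Cyclic.

(** * Pi/I_w is basic support tau^- -tilting *)

Section Final.
Variables (K : fieldType) (n : nat) (C : 'M[int]_n) (D : 'I_n -> nat).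
Variable Om : {set 'I_n * 'I_n}.
Hypotheses (hC : is_GCM C) (hD : is_symmetrizer C D) (hO : is_orientation C Om).
Notation f := (Cartan_f C).
Notation G := (Cartan_g C).
Variables (A : pzAlgType K) (e x : 'I_n -> A) (a : 'I_n -> 'I_n -> nat -> A).
Hypothesis P : presentation C D Om e x a.
Implicit Types M N : lmodType A.
Hypothesis hP : is_Dynkin C D.
Notation Iw := (Iw e).
Notation legit := (legit hC hD hO P).
Notation Fs := (Fs hC hD hO P).
Notation Z0 := (@Z0 K A).
Notation U s := (Uw e s).
Notation refl := (refl_word C).
Notation torf0 := (torf0 x a).
Notation one s := (Upr e s 1).

Lemma tFs s : torf0 (Fs Z0 s). exact/Fs_torf/Z0_torf. Qed.
Lemma UprE s b : Upr e s b = b *: one s. by rewrite -Upr_lin mulr1. Qed.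
Lemma U_fd s : legit Z0 s -> fin_dim (U s).
by move=> ls; have [] := tf_nfd (tFs s) (Uw_Fs ls). Qed.
Lemma U_kill s b (m : U s) : b \in Iw s -> b *: m = 0.
by move=> bI; have [c ->] := Upr_surj m; rewrite -Upr_lin; apply/Upr0/ideal_mulr. Qed.
Lemma U_ann s b : (forall m : U s, b *: m = 0) -> b \in Iw s.
by move=> h; apply/Upr0; rewrite UprE. Qed.
Lemma U_map s N (v : N) : (forall b, b \in Iw s -> b *: v = 0) -> exists h : {linear U s -> N}, forall b, h (Upr e s b) = b *: v.
move=> kv; have vL : linear (fun b : A^o => (b : A) *: v) by move=> k p q; rewrite scalerDl -scalerA.
apply: (@fact_surj _ _ _ _ (projL (lsubmod_of_ideal (Iw s))) (mkL vL) (@projL_surj _ _ _)).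
by move=> b /projL0/kv.
Qed.
Lemma Sub_sub F M N : torf0 F -> F M -> Sub_class M N -> F N.
move=> tF FM [_ [k [u uI]]]; apply: (tf_jointI (r := enum 'I_k) (N := fun=> M) (h := fun c => evalL M c \o u : {linear N -> M}) tF) => // m h.
apply: uI; rewrite linear0; apply/ffunP => c; have := h c; rewrite mem_enum ffunE; exact.
Qed.
(** An extension of A/I_w by an object of the class lies in the class, so I_w kills it, and a
    preimage of 1 defines the section. *)
Lemma U_proj s N : legit Z0 s -> Fs Z0 s N -> ext_split N (U s).
move=> ls FN E i p iI pS ex; have fN := (tf_nfd (tFs s) FN).1.
have [_ _ _ F4] := torf0_tfc e (tFs s).
have FE := F4 _ _ _ i p (fin_dim_ses iI pS ex fN (U_fd ls)) iI ex pS FN (Uw_Fs ls).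
have [v vE] := pS (one s); have [t tE] := U_map (s := s) (fun b bI => Fs_killed FE v bI).
by exists t => m; have [b ->] := Upr_surj m; rewrite tE linearZ_LR vE -UprE.
Qed.
(** Relative projectivity turns into relative injectivity by [sym_ext], as A/I_w is locally free. *)
Lemma U_inj s : legit Z0 s -> ext_inj (Fs Z0 s) (U s).
move=> ls; apply: split_ext_inj => N FN; have fN := (tf_nfd (tFs s) FN).1.
apply: (sym_ext hD hO P (U_fd ls) fN); last exact: U_proj.
by left; exact: (Uw_free ls).
Qed.
Lemma Fs_Iw s t : legit Z0 s -> Fs Z0 t (U s) -> forall b, b \in Iw t -> b \in Iw s.
by move=> ls Ft b bt; apply: U_ann => m; exact: (Fs_killed Ft). Qed.
Lemma Iw_Fs s t : legit Z0 s -> legit Z0 t -> Fs Z0 t (U s) -> Fs Z0 s (U t) -> Iw s =i Iw t.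
by move=> ls lt ts st b; apply/idP/idP; apply: Fs_Iw. Qed.
Lemma ext_inj_sub (F G : lmodType A -> Prop) M : (forall N, G N -> F N) -> ext_inj F M -> ext_inj G M.
by move=> GF eM Z1 Z Z2 i p f fZ iI pS ex G2; apply: (eM _ _ _ i p) => //; apply: GF. Qed.
Lemma tfc_word F : torsion_free_class F -> exists s, legit Z0 s /\ F = Fs Z0 s.
by move=> /(tfc_torf0 hC hD hO P hP)/(torf_word hC hD hO P hP). Qed.
(** Sub(A/I_w) is itself a torsion-free class, so it comes from a word t. The two cyclic modules lie
    in each other's classes, so the ideals agree, hence the elements of W, hence the classes. *)
Lemma Sub_U s : legit Z0 s -> Sub_class (U s) = Fs Z0 s.
move=> ls; have sub N : Sub_class (U s) N -> Fs Z0 s N by apply: Sub_sub (tFs s) (Uw_Fs ls).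
have [t [lt tE]] := tfc_word (ext_inj_tfc (U_fd ls) (ext_inj_sub sub (U_inj ls))).
have G1 : Fs Z0 s (U t) by apply: sub; rewrite tE; exact: Uw_Fs.
have G2 : Fs Z0 t (U s) by rewrite -tE; apply: Sub_class_self; apply: U_fd.
by rewrite tE; apply: (refl_Fs hP lt ls); apply: (Iw_refl lt ls); exact: (Iw_Fs lt ls G1 G2).
Qed.

Lemma fin_dim_conv (R : pzAlgType K) : fin_dim (R^o)%type -> fin_dim ((R^c)^o)%type.
move=> [b bP]; exists b => y; have [c E1] := bP y; exists c; rewrite [LHS]E1; apply: eq_bigr => i _.
exact: (pzscal_central (c i) (b`_i : R)).
Qed.
Lemma quot_fd (I : ideal A) : fin_dim ((quot_alg I)^o)%type.
apply/fin_dim_restr; have [fA _] := reg_nfd hC hD hO P hP.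
have pL : linear (alg_proj I : A^o -> restr_mod (alg_proj I) ((quot_alg I)^o)%type).
 by move=> b u v; rewrite rmorphD rmorphM.
by apply: (fin_dim_surj (f := mkL pL)) fA => y; exists (alg_repr y); apply: alg_reprK.
Qed.
Lemma alg_proj0 (I : ideal A) b : alg_proj I b = 0 <-> b \in I.
rewrite -(raddf0 (alg_proj I)); split; first by move/eqP; rewrite alg_proj_eq subr0.
by move=> bI; apply/eqP; rewrite alg_proj_eq subr0.
Qed.
Lemma proj_surj (I : ideal A) : surjective_fun (alg_proj I).
by move=> y; exists (alg_repr y); apply: alg_reprK. Qed.
Lemma gen_kill (e0 : A) M : (forall m : M, e0 *: m = 0) -> forall b (m : M), b \in gen_ideal [set e0]%classic -> b *: m = 0.
move=> k0 b m /asboolP[r [rP ->]]; rewrite scaler_suml big_seq big1 // => q /rP ->.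
by rewrite -!scalerA k0 scaler0.
Qed.
Lemma gen_in (e0 : A) : e0 \in gen_ideal [set e0]%classic.
by apply/asboolP; exists [:: (1, e0, 1)]; split=> [p|]; rewrite ?big_seq1 ?mul1r ?mulr1 // inE => /eqP->. Qed.
Lemma ext_inj_iso F M N : iso_mod M N -> ext_inj F M -> ext_inj F N.
move=> [j /linear_inv[j' [jK j'K]]] eM Z1 Z Z2 i p f fZ iI pS ex F2.
have [g gE] := eM _ _ _ i p (j' \o f : {linear _ -> _}) fZ iI pS ex F2.
by exists (j \o g : {linear _ -> _}) => z; rewrite /= gE /= j'K.
Qed.
Lemma U_two s : forall b c : A, b *: one s = 0 -> (b * c) *: one s = 0.
by move=> b c; rewrite -!UprE => /Upr0 bI; apply/Upr0/ideal_mulr. Qed.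
Lemma U_gen s (m : U s) : exists b, m = b *: one s.
by have [b ->] := Upr_surj m; exists b; rewrite UprE. Qed.
Lemma id_surj : surjective_fun (idfun : A -> A). by move=> b; exists b. Qed.
Lemma eU s j : (e j *: one s != 0) = (e j \notin Iw s).
by congr (~~ _); rewrite -UprE; apply/eqP/idP => /Upr0. Qed.

Lemma U_tilt s : legit Z0 s -> basic_support_tau_inv_tilting (U s).
move=> ls; have fU := U_fd ls; split.
 have [Y [iY dY nY]] := cyc_decomp hC hD hO P hP id_surj (@U_gen s) (@U_two s). exact: decomp_basic fU dY iY nY.
(* The support idempotent: the sum of the e_j lying in I_w, which are the ones acting by zero on
   A/I_w. *)
pose e0 := \sum_(j | e j \in Iw s) e j.
have ee0 j : e j * e0 = if e j \in Iw s then e j else 0.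
 rewrite mulr_sumr; case: ifP => ej.
  rewrite (bigD1 j) //= (pr_ee P) eqxx big1 ?addr0 // => l /andP[_ /negbTE lj]. by rewrite (pr_ee P) eq_sym lj.
 rewrite big1 // => l el; rewrite (pr_ee P); case: eqP => // jl; by rewrite jl el in ej.
exists e0; split; first by rewrite {1}/e0 mulr_suml; apply: eq_bigr => j ej; rewrite ee0 ej.
set I := gen_ideal _; have kU : forall b (m : U s), b \in I -> b *: m = 0.
 apply: gen_kill => m; rewrite scaler_suml big1 // => j ej; exact: U_kill.
have IeI j : e j \in I <-> e j \in Iw s.
 split=> [eI|eI]; first by apply: U_ann => m; apply: kU. by have := ee0 j; rewrite eI => <-; apply: ideal_mull; apply: gen_in.
pose N : lmodType (quot_alg I) := desc_of kU.
have jL : linear (id : U s -> restr_mod (alg_proj I) N).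
 by move=> b u v; congr (_ + _); exact/esym/(desc_proj kU).
have UN : iso_mod (U s) (restr_mod (alg_proj I) N) by exists (mkL jL); exists id.
have fN : fin_dim N by apply/fin_dim_restr; apply: iso_fin_dim UN fU.
have oE b : alg_proj I b *: (one s : N) = (b *: one s : U s) by apply: (desc_proj kU).
exists N; split=> //; split=> //.
 apply: (Sub_ext_inj_rigid (fin_dim_conv (quot_fd I))) => // Z1 Z Z2 i p f fZ iI pS ex S2. have eN := ext_inj_iso UN (U_inj ls).
 have FN : Fs Z0 s (restr_mod (alg_proj I) N).
  by have [j jB] := iso_sym UN; apply: (tf_sub (tFs s) (bij_inj jB)); apply: Uw_Fs.
 have F2 : Fs Z0 s (restr_mod (alg_proj I) Z2).
  apply: (Sub_sub (tFs s) FN); have [fZ2 [k [u uI]]] := S2; split; first exact/fin_dim_restr.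
  have uL : linear (u : restr_mod (alg_proj I) Z2 -> {ffun 'I_k -> restr_mod (alg_proj I) N}).
   move=> b v w; apply/ffunP => c; have := congr1 (fun q : {ffun 'I_k -> N} => q c) (linearP u (alg_proj I b) v w). by rewrite !ffunE.
  by exists k, (mkL uL).
 have [g gE] := eN _ _ _ (mkL (restr_lin i)) (mkL (restr_lin p)) (mkL (restr_lin f)) ((fin_dim_restr _).1 fZ) iI pS ex F2. by exists (mkL (lift_lin g)).
have gN (m : N) : exists b, m = b *: (one s : N).
 by have [b bE] := U_gen (m : U s); exists (alg_proj I b); rewrite oE.
have tN (b c : quot_alg I) : b *: (one s : N) = 0 -> (b * c) *: (one s : N) = 0.
 rewrite -(alg_reprK b) -(alg_reprK c) -rmorphM !oE; exact: U_two.
have gB (m : ((quot_alg I)^o)%type) : exists b : quot_alg I, m = b *: (1 : ((quot_alg I)^o)%type) by exists m; rewrite -[RHS]/(m * 1) mulr1.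
have tB (b c : quot_alg I) : b *: (1 : ((quot_alg I)^o)%type) = 0 -> (b * c) *: (1 : ((quot_alg I)^o)%type) = 0.
 by rewrite -[b *: _]/(b * 1) mulr1 => ->; rewrite mul0r scale0r.
have [Y [iY dY nY]] := cyc_decomp hC hD hO P hP (@proj_surj I) gN tN.
have [V [iV dV nV]] := cyc_decomp hC hD hO P hP (@proj_surj I) gB tB.
eexists; split; first exact: (decomp_num fN dY iY nY).
(* The indecomposable summands of A/I_w and of the quotient by e0 are indexed by the same vertices,
   since e_j lies in the ideal of e0 exactly when it lies in I_w. *)
have -> : #|{: {j | j \in [set j | alg_proj I (e j) *: (one s : N) != 0]}}| =
  #|{: {j | j \in [set j | alg_proj I (e j) *: (1 : ((quot_alg I)^o)%type) != 0]}}|.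
 have mE j : alg_proj I (e j) *: (1 : ((quot_alg I)^o)%type) = alg_proj I (e j) by exact: mulr1.
 rewrite !card_sig; apply: eq_card => j; rewrite !inE oE eU mE. congr (~~ _); apply/idP/eqP => [/IeI/alg_proj0//|/alg_proj0/IeI //].
exact: decomp_num (quot_fd I) dV iV nV.
Qed.

Lemma ex_reduced t : exists s, reduced C s /\ refl s = refl t.
have ex : exists k, `[< exists s, refl s = refl t /\ size s = k >] by exists (size t); apply/asboolP; exists t.
have [k /asboolP[s [sE sk]] kmin] := ex_minnP ex; exists s; split=> // u uE.
by rewrite sk; apply: kmin; apply/asboolP; exists u; rewrite uE.
Qed.
Lemma torf_reduced F : torsion_free_class F -> exists s, reduced C s /\ F = Fs Z0 s.
move=> /tfc_word[t [lt ->]]; have [s [rs sE]] := ex_reduced t; exists s; split=> //.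
exact: (refl_Fs hP lt (reduced_legit hC hD hO P hP rs) (esym sE)).
Qed.

Lemma RF_pow s j k b : reduced C s -> (k <= D j)%N -> b * x j ^+ k \in Iw s ->
 exists c, b * e j - c * x j ^+ (D j - k) \in Iw s.
move=> rs; have ex r : e j * x j ^+ r = x j ^+ r * e j.
 by apply: (commrX r (_ : GRing.comm _ _)); rewrite /GRing.comm (pr_ex P) (pr_xe P).
have eje : e j * e j = e j by rewrite (pr_ee P) eqxx.
elim: k b => [|k IHk] b kD bx.
 by exists 0; rewrite mul0r subr0; apply: ideal_mulr; rewrite expr0 mulr1 in bx.
rewrite exprSr mulrA in bx; have [d dI] := RF hC hD hO P hP rs bx.
have [|c cI] := IHk (b * e j - d * x j ^+ (D j - k.+1) * e j) (ltnW kD).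
 have -> : (b * e j - d * x j ^+ (D j - k.+1) * e j) * x j ^+ k = (b * x j ^+ k * e j - d * x j ^+ (D j - 1)) * e j.
  rewrite !mulrBl -!mulrA ex eje (mulrA (x j ^+ (D j - _))) -exprD; congr (_ - _ * (_ ^+ _ * _)); lia.
 exact: ideal_mulr.
exists (d * e j + c * x j); move: cI; rewrite mulrBl -!mulrA eje.
rewrite mulrDl -!mulrA -exprS ex (_ : (D j - k.+1).+1 = (D j - k)%N); last by lia.
by rewrite opprD addrA.
Qed.

(** To divide an m killed by x_j, extend the map U y -> M, y |-> m, to U, where y = e_j x_j^(D j -
    1); the value at e_j is the quotient. Right local freeness of U identifies U y as a kernel whose
    cokernel lies in the class. *)
Lemma inj_lf s M : reduced C s -> Fs Z0 s M -> ext_inj (Fs Z0 s) M -> lf D e x M.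
move=> rs FM eM j m em xm; have ls := reduced_legit hC hD hO P hP rs.
have D0 := D_gt0 hD j.
pose I := lsubmod_of_ideal (Iw s).
have [h1 h1E] := U_map (s := s) (v := Upr e s (x j)) (fun b bI => U_kill (Upr e s (x j)) bI).
have [h2 h2E] := U_map (s := s) (v := Upr e s (1 - e j)) (fun b bI => U_kill (Upr e s (1 - e j)) bI).
(* Right multiplication by x_j and by 1 - e_j. The image lies in U x U, hence in the class, and by
   [RF] the kernel is U y. *)
have [rho rhoE] : exists rho : {linear U s -> (U s * U s)%type},
 forall b, rho (Upr e s b) = (Upr e s (b * x j), Upr e s (b * (1 - e j))). exists ((inlL _ _ \o h1) \+ (inrL _ _ \o h2)) => b.
 by apply: injective_projections; rewrite /= ?addr0 ?add0r ?h1E ?h2E -Upr_lin.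
have [p pE] := corestr (f := rho) (fun v => introT (imSP rho _) (ex_intro _ v erefl)).
have F2 : Fs Z0 s (sub_mod (imS rho)).
 apply: (tf_sub (tFs s) (@inclL_inj _ _ (imS rho))).
 apply: (tf_jointI (r := [:: true; false]) (N := fun=> U s) (h := fun c : bool => if c then fstL (U s) (U s) else sndL (U s) (U s)) (tFs s)).
  by move=> _; apply: Uw_Fs.
 move=> v v0; apply: injective_projections; first by apply: (v0 true). exact: (v0 false).
pose y := e j * x j ^+ (D j - 1).
have ex r : e j * x j ^+ r = x j ^+ r * e j.
 by apply: (commrX r (_ : GRing.comm _ _)); rewrite /GRing.comm (pr_ex P) (pr_xe P).
have eje : e j * e j = e j by rewrite (pr_ee P) eqxx.
have D1 : (D j - 1).+1 = D j by lia.
have yx : y * x j = 0 by rewrite /y -mulrA -exprSr D1 (pr_nil P) mulr0.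
have ye : y * (1 - e j) = 0 by rewrite mulrBr mulr1 /y ex -mulrA eje subrr.
have wL : linear (fun b : A^o => Upr e s ((b : A) * y)).
 by move=> k u v; rewrite mulrDl -mulrA; exact: (linearP (projL I)).
have U0 : Upr e s 0 = 0 by apply/Upr0; apply: rpred0.
have w0 b : mkL wL b \in kerS rho.
 by apply/kerSP; rewrite rhoE -(mulrA (b : A) y (x j)) -(mulrA (b : A) y (1 - e j)) yx ye !mulr0 U0.
have [w wE] := corestr w0.
have wS : surjective_fun w.
 move=> v; have /kerSP := inclL_in v; have [b bE] := Upr_surj (inclL (kerS rho) v); rewrite bE rhoE => -[/Upr0 b1 /Upr0 b2].
 have [d dI] := RF hC hD hO P hP rs b1; exists d; apply: (@inclL_inj _ _ (kerS rho)); rewrite wE bE.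
 apply/eqP; rewrite -subr_eq0 -[_ - _](linearB (projL I)); apply/eqP/Upr0.
 have -> : (d * y : A) - b = - ((b * e j - d * x j ^+ (D j - 1)) * e j + b * (1 - e j)).
  by rewrite mulrBl mulrBr mulr1 -!mulrA eje /y ex [in RHS]addrC addrA subrK opprB.
 by rewrite rpredN; apply: rpredD => //; apply: ideal_mulr.
have kM b : b \in Iw s -> b *: m = 0 by apply: (Fs_killed FM).
have mL : linear (fun b : A^o => (b : A) *: m) by move=> k u v; rewrite scalerDl -scalerA.
(* Well defined: if b y is in I_w, then by [RF_pow] the element b e_j is in A x_j + I_w, and x_j m =
   0. *)
have [f0 f0E] : exists f0 : {linear sub_mod (kerS rho) -> M}, forall b : A, f0 (w b) = b *: m.
 apply: (fact_surj (f := w) (g := mkL mL) wS) => b wb. have /Upr0 byI : Upr e s ((b : A) * y) = 0 by have := wE b; rewrite wb linear0.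
 have [|d] := RF_pow (k := (D j - 1)%N) (b := (b : A) * e j) rs (leq_subr _ _); first by rewrite -mulrA.
 rewrite -mulrA eje subKn // expr1 => /kM; rewrite scalerBl -!scalerA em xm scaler0 subr0; exact.
have ex_p : exact_at (inclL (kerS rho)) p.
 move=> v; split=> [pv|[u <-]].
  have vK : v \in kerS rho by apply/kerSP; rewrite -pE pv linear0. by have [u uE] := inclLP vK; exists u.
 by apply: (@inclL_inj _ _ (imS rho)); rewrite pE linear0; apply/kerSP; apply: inclL_in.
have pS : surjective_fun p.
 by move=> v; have /imSP[u uE] := inclL_in v; exists u; apply: (@inclL_inj _ _ (imS rho)); rewrite pE.
have [g gE] := eM _ _ _ (inclL (kerS rho)) p f0 (U_fd ls) (@inclL_inj _ _ (kerS rho)) pS ex_p F2.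
exists (g (Upr e s (e j))); have := gE (w 1); rewrite f0E scale1r wE /= mul1r => <-.
by rewrite -linearZ_LR -Upr_lin /y ex.
Qed.

(** Cover M by a power of U. The kernel K of this cover lies in the class, so extensions of K by M
    split by Ext-injectivity; M is locally free, so [sym_ext] splits the cover. *)
Lemma retract_U s M : reduced C s -> Fs Z0 s M -> ext_inj (Fs Z0 s) M -> exists k, retract M {ffun 'I_k -> U s}.
move=> rs FM eM; have ls := reduced_legit hC hD hO P hP rs; have fM := (tf_nfd (tFs s) FM).1.
have frM := free_crit hD P fM (inj_lf rs FM eM).
have [b bP] := fM.
have /choice[h hE] : forall c : 'I_(size b), exists h : {linear U s -> M}, forall q, h (Upr e s q) = q *: b`_c.
 by move=> c; apply: U_map => q qI; apply: (Fs_killed FM).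
have [p pS] : exists p : {linear {ffun 'I_(size b) -> U s} -> M}, surjective_fun p.
 exists (sumfL h) => m; have [c ->] := bP m; exists [ffun i : 'I_(size b) => Upr e s (pzscal (c i))]. by apply: eq_bigr => i _; rewrite ffunE hE.
have FU : Fs Z0 s {ffun 'I_(size b) -> U s}.
 apply: (tf_jointI (r := enum 'I_(size b)) (N := fun=> U s) (h := fun c => evalL (U s) c) (tFs s)) => [_|v v0].
  exact: Uw_Fs.
 by apply/ffunP => c; rewrite ffunE; apply: (v0 c); rewrite mem_enum.
have FK : Fs Z0 s (sub_mod (kerS p)) by apply: (tf_sub (tFs s) (@inclL_inj _ _ (kerS p))).
have fK := (tf_nfd (tFs s) FK).1.
have sp : ext_split (sub_mod (kerS p)) M.
 apply: (sym_ext hD hO P fK fM); first by right; exact: frM. exact: (ext_inj_split eM FK fM fK).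
have [|||t tE] := sp _ (inclL (kerS p)) p.
- exact: inclL_inj.
- exact: pS.
- move=> v; split=> [pv|[u <-]]; last by apply/kerSP; apply: inclL_in.
 have vK : v \in kerS p by apply/kerSP; exact: pv. by have [u uE] := inclLP vK; exists u.
by exists (size b), t, p.
Qed.

End Final.

(** * Every support tau^- -tilting module is some Pi/I_w; the bijections *)

Section Final2.
Variables (K : fieldType) (n : nat) (C : 'M[int]_n) (D : 'I_n -> nat).
Variable Om : {set 'I_n * 'I_n}.
Hypotheses (hC : is_GCM C) (hD : is_symmetrizer C D) (hO : is_orientation C Om).
Variables (A : pzAlgType K) (e x : 'I_n -> A) (a : 'I_n -> 'I_n -> nat -> A).
Hypothesis P : presentation C D Om e x a.
Implicit Types M N : lmodType A.
Hypothesis hP : is_Dynkin C D.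
Notation Iw := (Iw e).
Notation legit := (legit hC hD hO P).
Notation Fs := (Fs hC hD hO P).
Notation Z0 := (@Z0 K A).
Notation U s := (Uw e s).
Notation refl := (refl_word C).
Notation one s := (Upr e s 1).

Lemma restr_iso (I : ideal A) (X Y : lmodType (quot_alg I)) :
 iso_mod (restr_mod (alg_proj I) X) (restr_mod (alg_proj I) Y) -> iso_mod X Y.
by move=> [h hB]; exists (mkL (lift_lin h)). Qed.
Lemma iso_restr (I : ideal A) (X Y : lmodType (quot_alg I)) :
 iso_mod X Y -> iso_mod (restr_mod (alg_proj I) X) (restr_mod (alg_proj I) Y).
by move=> [h hB]; exists (mkL (restr_lin h)). Qed.
Lemma desc_iso (I : ideal A) M (kM : forall (b : A) (m : M), b \in I -> b *: m = 0) :
 iso_mod M (restr_mod (alg_proj I) (desc_of kM)).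
have jL : linear (id : M -> restr_mod (alg_proj I) (desc_of kM)).
 by move=> b u v; congr (_ + _); exact/esym/(desc_proj kM).
by exists (mkL jL); exists id.
Qed.
Lemma restr_retract (I : ideal A) (X Y : lmodType (quot_alg I)) :
 retract X Y <-> retract (restr_mod (alg_proj I) X) (restr_mod (alg_proj I) Y).
split=> [[i [p ip]]|[i [p ip]]]; first by exists (mkL (restr_lin i)), (mkL (restr_lin p)).
by exists (mkL (lift_lin i)), (mkL (lift_lin p)).
Qed.
Lemma retract_kill (I : ideal A) M N : retract N M -> (forall (b : A) (m : M), b \in I -> b *: m = 0) ->
 forall (b : A) (m : N), b \in I -> b *: m = 0.
by move=> [i [p ip]] kM b m bI; apply: (can_inj ip); rewrite linear0 linearZ_LR kM. Qed.
Lemma restr_indec (I : ideal A) (X : lmodType (quot_alg I)) :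
 indecomposable X <-> indecomposable (restr_mod (alg_proj I) X).
split=> [[X0 iX]|[X0 iX]]; split=> // V W VW; last first.
 apply: (iX (restr_mod (alg_proj I) V) (restr_mod (alg_proj I) W)); have [h hB] := VW.
 have hL : linear (h : restr_mod (alg_proj I) X -> (restr_mod (alg_proj I) V * restr_mod (alg_proj I) W)%type).
  by move=> b u v; exact: (linearP h).
 by exists (mkL hL).
have kX := @killed_lin K A I X.
have rV : retract V (restr_mod (alg_proj I) X).
 by apply: retract_trans (iso_retract (iso_sym VW)); exists (inlL V W), (fstL V W).
have rW : retract W (restr_mod (alg_proj I) X).
 by apply: retract_trans (iso_retract (iso_sym VW)); exists (inrL V W), (sndL V W).
pose V' := desc_of (retract_kill rV kX); pose W' := desc_of (retract_kill rW kX).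
have [h hB] := VW.
have hL : linear (h : X -> (V' * W')%type).
 move=> b u v; rewrite -(alg_reprK b); have E1 := linearP h (alg_repr b) u v; rewrite [LHS]E1.
 by apply: injective_projections => /=; congr (_ + _); exact/esym/desc_proj.
exact: (iX V' W' (ex_intro _ (mkL hL) hB)).
Qed.
Lemma num_restr (I : ideal A) (X : lmodType (quot_alg I)) m : num_indec_summands X m ->
 num_indec_summands (restr_mod (alg_proj I) X) m.
move=> [Y [iY nY aY]]; exists (fun i => restr_mod (alg_proj I) (Y i)); split=> [i|i j /restr_iso/nY//|V iV /summand_retract rV].
 have [iYi sYi] := iY i; split; first exact/restr_indec. by apply: retract_iso; apply/restr_retract; apply: summand_retract.
have kV := retract_kill rV (@killed_lin K A I X); have VE := desc_iso kV.
have [||i iE] := aY (desc_of kV).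
- by apply/restr_indec; apply: indec_iso VE iV.
- apply: retract_iso; apply/restr_retract; apply: retract_trans rV; apply: iso_retract; exact: iso_sym.
by exists i; apply: iso_trans VE _; apply: iso_restr.
Qed.
Lemma decomp_reindex M (J L : finType) (Y : J -> lmodType A) (g : L -> J) : bijective g ->
 decomp M Y -> decomp M (fun l => Y (g l)).
move=> gB [i [p [s pi pi0]]]; exists (fun l => i (g l)), (fun l => p (g l)); split=> // [m|k l m kl].
 by rewrite [LHS]s (reindex g) //; apply: onW_bij.
by apply: pi0; rewrite (inj_eq (bij_inj gB)).
Qed.

Lemma basic_iso M N : iso_mod M N -> basic M -> basic N.
move=> MN bM X iX /summand_retract rX; apply: (bM X iX); apply: retract_iso.
by apply: retract_trans rX _; apply/iso_retract/iso_sym.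
Qed.

(** An extension over A of modules over the quotient by e0 is again a module over that quotient, so
    Ext-injectivity there splits it. *)
Lemma restr_split (I : ideal A) (e0 : A) (N : lmodType (quot_alg I)) X : e0 * e0 = e0 -> I = gen_ideal [set e0]%classic ->
 fin_dim N -> Sub_ext_inj N -> Sub_class (restr_mod (alg_proj I) N) X -> ext_split (restr_mod (alg_proj I) N) X.
move=> ee0 IE fN sN [fX [k [u uI]]] E i p iI pS ex.
have fE := fin_dim_ses iI pS ex ((fin_dim_restr N).1 fN) fX.
have kN := @killed_lin K A I N.
have kX b (v : X) : b \in I -> b *: v = 0.
 by move=> bI; apply: uI; rewrite linearZ_LR linear0; apply/ffunP => c; rewrite !ffunE kN.
have eI : e0 \in I by rewrite IE; apply: gen_in.
(* e0 v lies in the submodule because e0 kills X, and e0 kills the submodule; so e0 v = e0 (e0 v) =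
   0. *)
have kE : forall b (v : E), b \in I -> b *: v = 0.
 rewrite IE; apply: gen_kill => v; have /ex[m mE] : p (e0 *: v) = 0 by rewrite linearZ_LR kX. by rewrite -ee0 -scalerA -mE -linearZ_LR kN // linear0.
have iL : linear (i : N -> desc_of kE).
 move=> b v w; rewrite -(alg_reprK b); have E1 := linearP i (alg_repr b) v w; rewrite [LHS]E1. by congr (_ + _); exact/esym/desc_proj.
have dE b (v : E) : alg_proj I b *: (v : desc_of kE) = (b *: v : E) := desc_proj kE b v.
have pL : linear (p : desc_of kE -> desc_of kX).
 move=> b v w; rewrite -(alg_reprK b); have E1 := linearP p (alg_repr b) v w. by rewrite dE [LHS]E1; congr (_ + _); exact/esym/desc_proj.
have dX b (v : X) : alg_proj I b *: (v : desc_of kX) = (b *: v : X) := desc_proj kX b v.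
have uL : linear (u : desc_of kX -> {ffun 'I_k -> N}).
 move=> b v w; rewrite -(alg_reprK b) dX. have E1 := linearP u (alg_repr b) v w; rewrite [LHS]E1. by apply/ffunP => c; rewrite !ffunE.
have S2 : Sub_class N (desc_of kX).
 split; first by apply/fin_dim_restr; apply: iso_fin_dim (desc_iso kX) fX. by exists k, (mkL uL).
have fE' : fin_dim (desc_of kE) by apply/fin_dim_restr; apply: iso_fin_dim (desc_iso kE) fE.
have [g gE] := sN _ _ _ (mkL iL) (mkL pL) idfun fE' iI pS ex S2.
have gL : linear (g : E -> restr_mod (alg_proj I) N).
 move=> b v w; have := linearP g (alg_proj I b) v w. by rewrite dE.
pose r := mkL gL; have ri m : r (i m) = m by exact: gE.
have [s sE] : exists s : {linear X -> E}, forall v, s (p v) = (idfun \- (i \o r)) v.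
 by apply: (fact_surj pS) => v /ex[m <-]; rewrite -[LHS]/(i m - i (r (i m))) ri subrr.
exists s => m; have [v <-] := pS m; rewrite sE -[X in p X]/(v - i (r v)) linearB (_ : p (i _) = 0) ?subr0 //.
by apply/ex; exists (r v).
Qed.

(** Sub M is the class of a reduced word s, and M is a retract of a power of U, so its
    indecomposable summands are among those of U. The count demanded by tau^- -tilting leaves none
    of them out. *)
Lemma tilt_U M : basic_support_tau_inv_tilting M -> exists2 s, reduced C s & iso_mod (U s) M.
move=> [bM [e0 [ee0 [N [[fN rN [m [nN nB]]] MN]]]]]; set I := gen_ideal _ in N fN rN nN nB MN.
have sN := rigid_Sub_ext_inj (fin_dim_conv (quot_fd hC hD hO P hP I)) fN rN.
pose M' := restr_mod (alg_proj I) N; have fM : fin_dim M' := (fin_dim_restr N).1 fN.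
have eM : ext_inj (Sub_class M') M' by apply: split_ext_inj => X; apply: (restr_split ee0 erefl fN sN).
have [s [rs FE]] := torf_reduced hC hD hO P hP (ext_inj_tfc fM eM); exists s => //.
have ls := reduced_legit hC hD hO P hP rs; have fU := U_fd ls.
have FM : Fs Z0 s M' by rewrite -FE; apply: Sub_class_self.
rewrite FE in eM; have [k rM] := retract_U hP rs FM eM.
have [Y [iY dY nY]] := cyc_decomp hC hD hO P hP (@id_surj K A) (@U_gen K n A e s) (@U_two K n A e s).
have [T [Z [iZ dZ nZ cT]]] := basic_num fM (basic_iso MN bM) (num_restr nN).
have dk : decomp {ffun 'I_k -> U s} (fun _ : 'I_k => U s).
 exists (fun c => singL (U s) c), (fun c => evalL (U s) c); split=> [v|c v|c c' v cc'].
 - exact: ffun_sum.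
 - by rewrite /= ffunE eqxx. by rewrite /= ffunE (negbTE cc').
(* Exchange is applied twice: in the power, to place the summand inside a single copy of U, and then
   among the indecomposable summands of U. *)
have /choice[g gE] : forall t, exists j, iso_mod (Z t) (Y j).
 move=> t; have rZ := retract_trans (decomp_retract t dZ) rM. have fZ := decomp_fin_dim dZ fM t; have [b0 [c0 bc]] := rZ; have [i [p [sm _ _]]] := dk.
 have bc' : bijective (c0 \o b0) by exists id => v /=; rewrite bc. have [j [h hK h'K]] := krull_schmidt (iZ t) fZ bc' sm.
 apply: (krull_schmidt_iso (iZ t) fZ _ dY iY). pose q0 : {linear Z t -> Z t} := c0 \o (i j \o (p j \o b0)). have q0h : cancel q0 h by exact: hK.
 have hq0 : cancel h q0 by exact: h'K. have [h0 [h0K _]] := linear_inv (Bijective q0h hq0).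
 by exists (p j \o b0 : {linear _ -> _}), (h0 \o (c0 \o i j) : {linear _ -> _}) => v; exact: h0K.
have gI : injective g.
 by move=> t t' E1; apply: nZ; apply: iso_trans (gE t) _; rewrite E1; apply: iso_sym.
have gB : bijective g.
 apply: inj_card_bij gI _; rewrite cT card_sig.
 have gen (v : ((quot_alg I)^o)%type) : exists b : quot_alg I, v = b *: (1 : ((quot_alg I)^o)%type) by exists v; rewrite -[RHS]/(v * 1) mulr1.
 have two (b c : quot_alg I) : b *: (1 : ((quot_alg I)^o)%type) = 0 -> (b * c) *: (1 : ((quot_alg I)^o)%type) = 0.
  by rewrite -[b *: _]/(b * 1) mulr1 => ->; rewrite mul0r scale0r.
 have [V [iV dV nV]] := cyc_decomp hC hD hO P hP (@proj_surj K A I) gen two. apply: leq_trans (num_leq (decomp_num (quot_fd hC hD hO P hP I) dV iV nV) nB).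
 (* A vertex idempotent in the support ideal kills M, hence kills U, which embeds in a power of M;
    so U has at most as many summands as the quotient algebra. *)
 rewrite card_sig; apply: subset_leq_card; apply/fintype.subsetP => j.
 have mE : alg_proj I (e j) *: (1 : ((quot_alg I)^o)%type) = alg_proj I (e j) by exact: mulr1. rewrite !inE mE => ej; apply: contra ej => /eqP/alg_proj0 eI.
 apply/eqP; have : Sub_class M' (U s) by rewrite FE; apply: Uw_Fs. move=> [_ [l [w wI]]]; apply: wI; rewrite linearZ_LR linear0; apply/ffunP => c.
 by rewrite !ffunE (killed_lin _ eI).
apply: iso_trans (iso_sym MN); apply: (decomp_iso (decomp_reindex gB dY) dZ) => t; exact/iso_sym/gE.
Qed.

Lemma reduced_exprP w : Weyl_group C w -> reduced C (reduced_expr C w) /\ refl (reduced_expr C w) = w.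
move=> [t <-]; have [s [rs sE]] := ex_reduced C t; rewrite /reduced_expr.
by case: xgetP => [u _ [h1 h2]|/(_ s)]; [| case].
Qed.
Lemma reduced_Iw s t : reduced C s -> reduced C t -> refl s = refl t -> Iw s =i Iw t.
move=> rs rt st; have ls := reduced_legit hC hD hO P hP rs; have lt := reduced_legit hC hD hO P hP rt.
by have [] := legit_Iw_refl ls lt (refl_Fs hP ls lt st).
Qed.
Lemma Iw_iso s t : Iw s =i Iw t -> iso_mod (U s) (U t).
move=> st; have [h hE] := U_map (s := s) (v := one t) (fun b bI => U_kill (one t) (etrans (esym (st b)) bI)).
have [g gE] := U_map (s := t) (v := one s) (fun b bI => U_kill (one s) (etrans (st b) bI)).
exists h, g => v; have [b ->] := Upr_surj v; first by rewrite hE -UprE gE -UprE.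
by rewrite gE -UprE hE -UprE.
Qed.

Theorem Weyl_bijections : [/\ forall s t, reduced C s -> reduced C t -> refl s = refl t -> Iw s =i Iw t,
 bij_onto_classes (@iso_mod K A) (Weyl_group C) (@basic_support_tau_inv_tilting K A) (fun w => U (reduced_expr C w))
 & bij_onto_classes (@same_class K A) (Weyl_group C) (@torsion_free_class K A) (fun w => Sub_class (U (reduced_expr C w)))].
Proof.
have rl s : reduced C s -> legit Z0 s by apply: reduced_legit.
have SU s : reduced C s -> Sub_class (U s) = Fs Z0 s by move=> /rl ls; exact: (Sub_U hP ls).
split; first exact: reduced_Iw.
 split=> [w /reduced_exprP[rw _]|v w /reduced_exprP[rv vE] /reduced_exprP[rw wE] [h hB]|M /tilt_U[s rs sM]].
 - exact: (U_tilt hP (rl _ rw)).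
 - rewrite -vE -wE; apply: (Iw_refl (rl _ rv) (rl _ rw)) => b.
  have [h' hK h'K] := hB; have [g gE] := linear_inv hB. apply/idP/idP => bI; apply: U_ann => m.
   by have [g1 g2] := gE; rewrite -[m]g2 -linearZ_LR U_kill // linear0.
  by have [g1 g2] := gE; rewrite -[m]g1 -linearZ_LR U_kill // linear0.
 exists (refl s); first by exists s. have [|rw wE] := @reduced_exprP (refl s); first by exists s. by apply: iso_trans sM; apply: Iw_iso; apply: reduced_Iw.
split=> [w /reduced_exprP[rw _]|v w /reduced_exprP[rv vE] /reduced_exprP[rw wE] vw|F /(torf_reduced hC hD hO P hP)[s [rs ->]]].
- by rewrite SU //; apply: (torf0_tfc e); exact: (tFs hC hD hO P).
- rewrite -vE -wE; apply: (Iw_refl (rl _ rv) (rl _ rw)); move: vw; rewrite !SU // => vw.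
 by apply: (Iw_Fs (rl _ rv) (rl _ rw)); [apply: (vw _).1 | apply: (vw _).2]; apply: Uw_Fs; apply: rl.
exists (refl s); first by exists s.
have [|rw wE] := @reduced_exprP (refl s); first by exists s.
by rewrite SU // (refl_Fs hP (rl _ rw) (rl _ rs) wE).
Qed.
End Final2.

Theorem theorem1p2 (K : fieldType) (n : nat) (C : 'M[int]_n)
    (D : 'I_n -> nat) (Om : {set 'I_n * 'I_n}) :
  is_GCM C -> is_symmetrizer C D -> is_Dynkin C D -> is_orientation C Om ->
  [/\ forall s t : seq 'I_n, reduced C s -> reduced C t ->
        refl_word C s = refl_word C t ->
        pp_ideal_word K C D Om s =i pp_ideal_word K C D Om t,
      bij_onto_classes (@iso_mod K (preproj K C D Om))
        (Weyl_group C) (@basic_support_tau_inv_tilting K (preproj K C D Om))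
        (pp_mod K C D Om)
    & bij_onto_classes (@same_class K (preproj K C D Om))
        (Weyl_group C) (@torsion_free_class K (preproj K C D Om))
        (fun w => Sub_class (pp_mod K C D Om w))].
Proof.
move=> hC hD hP hO.
(* [pp_ideal_word] and [pp_mod] are convertible to [Iw] and [Uw] for the idempotents [pp_idem]. *)
exact: (Weyl_bijections hC hD hO (pp_presentation K C D Om) hP).
Qed.
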